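(* Let the observations be Gaussian, $X_1,\dots,X_n$ i.i.d. $\mathcal N_p(\mu,\Sigma)$ with $\Sigma_{ii}>0$ for all $i$, and consider the threshold estimator $\hat\rho^\ast=\hat\rho^\ast_\alpha$ with $\alpha>0$, $\alpha\ne\frac{2\sqrt2}{3}$. Then $\hat\rho^\ast$ is minimax rate optimal under the squared Frobenius norm over all permissible sets $\mathcal G_{\mathrm{w},q}(c_{n,p})$ if and only if $\alpha>\frac{2\sqrt2}{3}$. Hence, for $\alpha>\frac{2\sqrt2}{3}$ and an arbitrary permissible set $\mathcal G_{\mathrm{w},q}(c_{n,p})$ one has $$\sup_{\rho\in\mathcal G_{\mathrm{w},q}(c_{n,p})}\frac1p\,\mathbb E\|\hat\rho^\ast-\rho\|_F^2\le C_{\alpha,\eta_u}\,c_{n,p}\Big(\frac{\log p}{n}\Big)^{1-\frac q2},$$ where the constant $C_{\alpha,\eta_u}>0$ depends on $\alpha$ and $\eta_u$. Moreover, for $\alpha<\frac23$ there is no permissible set $\mathcal G_{\mathrm{w},q}(c_{n,p})$ such that $\hat\rho^\ast$ attains the minimax rate over $\mathcal G_{\mathrm{w},q}(c_{n,p})$ (under the squared Frobenius norm).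
   Context: Sparsity classes: for $x\in\mathbb R^{d}$ let $|x_{[1]}|\ge\dots\ge|x_{[d]}|$ be the ordered absolute values of its entries. For $0\le q<1$, $c>0$ the weak $\ell_q$-ball $B_{\mathrm{w},q}(c)$ is the set of $x$ with $|x_{[i]}|^q\le c\,i^{-1}$ for all $i$ (for $q=0$ with $0^0=0$, i.e. at most $c$ nonzero entries). $\mathcal G_{\mathrm{w},q}(c)$ is the set of symmetric $A=(a_{ij})\in\mathbb R^{p\times p}$ with $a_{jj}=1$ for all $j$ and $A_i\in B_{\mathrm{w},q}(c)$ for all $i$, where $A_i\in\mathbb R^{p-1}$ is the $i$-th row of $A$ without the diagonal entry. Permissible sets: $p=p_n$ and $c_{n,p}$ are sequences indexed by $n\ge2$ and $0\le q<1$ is fixed. The set (sequence of sets) $\mathcal G_{\mathrm{w},q}(c_{n,p})$ is permissible if $c_{n,p}>0$ (a positive integer if $q=0$) and there are constants $M>0$, $m>0$, $\eta_l>1$, $\eta_u>1$ with, for all $n$, $m(\frac{\log p}{n})^{q/2}\le c_{n,p}\le M n^{(1-q)/2}(\log p)^{-(3-q)/2}$ and $n^{\eta_l}<p<n^{\eta_u}$. The quantities $q,M,m,\eta_l$ are regarded as fixed when dependence of constants is stated; constants do not depend on $n,p,c_{n,p}$. Estimator: $\hat\tau_{ij}=\frac1{n(n-1)}\sum_{k\ne l}\operatorname{sign}(X_{ik}-X_{il})\operatorname{sign}(X_{jk}-X_{jl})$, where $X_k=(X_{1k},\dots,X_{pk})^T$ and $\operatorname{sign}x=\mathbf 1(x>0)-\mathbf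 1(x<0)$. $\hat\rho^\ast_\alpha$ has diagonal entries $1$ and off-diagonal entries $\sin(\frac\pi2\hat\tau_{ij})\,\mathbf 1\big(|\hat\tau_{ij}|>\alpha\sqrt{\log p/n}\big)$. $\|A\|_F^2=\sum_{i,j}A_{ij}^2$; $\rho$ is the correlation matrix of $X_1$. Suprema over $\rho\in\mathcal G_{\mathrm{w},q}(c_{n,p})$ are over all Gaussian distributions $\mathcal N_p(\mu,\Sigma)$, $\Sigma_{ii}>0$, whose correlation matrix lies in $\mathcal G_{\mathrm{w},q}(c_{n,p})$. An estimator attains the minimax rate (is minimax rate optimal) over a permissible set under the squared Frobenius norm if there is a constant $K$ such that for all $n$ its maximal risk $\sup_\rho\frac1p\mathbb E\|\hat\rho-\rho\|_F^2$ is at most $K$ times the infimum of the maximal risk over all estimators, equivalently at most of the order of $c_{n,p}(\frac{\log p}{n})^{1-q/2}$. *)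

(* Defs.v *)
From HB Require Import structures.
From mathcomp Require Import all_boot all_order all_algebra.
From mathcomp Require Import all_classical all_reals all_analysis.

Set Implicit Arguments.
Unset Strict Implicit.
Unset Printing Implicit Defensive.

Import Order.TTheory GRing.Theory Num.Theory.
Import numFieldNormedType.Exports.

Local Open Scope classical_set_scope.
Local Open Scope ring_scope.

(* x ^ q for x >= 0 with the convention 0 ^ 0 = 0, whereas 0 `^ 0 = 1. *)
Definition pow00 (R : realType) (x q : R) : R :=
  if x == 0 then 0 else x `^ q.

(* |x_[1]| >= ... >= |x_[d]|, indexed from 0. *)
Definition ordered_abs (R : realType) (d : nat) (x : 'rV[R]_d) : seq R :=
  sort >=%R [seq `|x 0 j| | j <- enum 'I_d].

Definition weak_ball (R : realType) (d : nat) (q c : R) : set 'rV[R]_d :=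
  [set x | forall i : nat, (i < d)%N ->
     pow00 (ordered_abs x)`_i q <= c * (i.+1%:R)^-1].

Definition sparse_class (R : realType) (p : nat) (q c : R) : set 'M[R]_p :=
  [set A | [/\ A^T = A, forall j, A j j = 1 &
     forall i, @weak_ball R p.-1 q c (row i (col' i A))]].

Definition permissible_with (R : realType) (q M m eta_l eta_u : R)
    (p : nat -> nat) (c : nat -> R) : Prop :=
  [/\ 0 < M, 0 < m, 1 < eta_l, 1 < eta_u &
   forall n : nat, (2 <= n)%N ->
     let logp := ln (p n)%:R in
     [/\ 0 < c n /\ (q = 0 -> exists k : nat, c n = k%:R),
         m * (logp / n%:R) `^ (q / 2) <= c n,
         c n <= M * n%:R `^ ((1 - q) / 2) * logp `^ (- ((3 - q) / 2)),
         n%:R `^ eta_l < (p n)%:R &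
         (p n)%:R < n%:R `^ eta_u]].

Definition permissible (R : realType) (q : R) (p : nat -> nat) (c : nat -> R)
    : Prop :=
  exists M m eta_l eta_u : R, permissible_with q M m eta_l eta_u p c.

(* The sample space (R^p)^n with its product Borel sigma-algebra; the entry
   X_ik of the data is tnth (tnth x k) i. *)
Definition sample (R : realType) (n p : nat) :=
  n.-tuple (p.-tuple (measurableTypeR R)).

(* N(m, v), where v is the variance; normal_prob takes the standard deviation
   and is not the Dirac mass when the latter is 0. *)
Definition normal_law (R : realType) (m v : R) (A : set (measurableTypeR R))
    : \bar R :=
  if v == 0 then dirac m A else normal_prob m (Num.sqrt v) A.

(* P is N_p(mu, Sigma): every linear form t has law N(t mu, t Sigma t^T). *)
Definition multinormal (R : realType) (p : nat) (mu : 'cV[R]_p)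
    (Sigma : 'M[R]_p) (P : probability (p.-tuple (measurableTypeR R)) R)
    : Prop :=
  [/\ Sigma^T = Sigma,
      forall t : 'rV[R]_p, 0 <= (t *m Sigma *m t^T) 0 0 &
      forall (t : 'rV[R]_p) (A : set (measurableTypeR R)), measurable A ->
        P [set x | A (\sum_i t 0 i * tnth x i)]
        = normal_law ((t *m mu) 0 0) ((t *m Sigma *m t^T) 0 0) A].

(* Q is the joint law of X_1, ..., X_n i.i.d. N_p(mu, Sigma). *)
Definition gaussian_sample (R : realType) (n p : nat) (mu : 'cV[R]_p)
    (Sigma : 'M[R]_p) (Q : probability (sample R n p) R) : Prop :=
  exists P : probability (p.-tuple (measurableTypeR R)) R,
    multinormal mu Sigma P /\
    forall B : 'I_n -> set (p.-tuple (measurableTypeR R)),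
      (forall k, measurable (B k)) ->
      Q [set x | forall k, B k (tnth x k)] = (\prod_k P (B k))%E.

Definition corrmx (R : realType) (p : nat) (Sigma : 'M[R]_p) : 'M[R]_p :=
  \matrix_(i, j) (Sigma i j / (Num.sqrt (Sigma i i) * Num.sqrt (Sigma j j))).

Definition estimator (R : realType) (n p : nat) := sample R n p -> 'M[R]_p.

Definition measurable_estimator (R : realType) (n p : nat)
    (f : estimator R n p) : Prop :=
  forall i j, measurable_fun [set: sample R n p]
    (fun x => f x i j : measurableTypeR R).

Definition frobenius2 (R : realType) (p : nat) (A : 'M[R]_p) : R :=
  \sum_i \sum_j (A i j) ^+ 2.

Definition risk (R : realType) (n p : nat) (Q : probability (sample R n p) R)
    (rho : 'M[R]_p) (f : estimator R n p) : \bar R :=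
  ((p%:R^-1)%:E * 'E_Q[fun x => frobenius2 (f x - rho)])%E.

Definition max_risk (R : realType) (n p : nat) (q c : R) (f : estimator R n p)
    : \bar R :=
  ereal_sup [set r | exists (mu : 'cV[R]_p) (Sigma : 'M[R]_p)
                            (Q : probability (sample R n p) R),
    [/\ gaussian_sample mu Sigma Q, forall i, 0 < Sigma i i,
        sparse_class q c (corrmx Sigma) & r = risk Q (corrmx Sigma) f]].

Definition minimax_risk (R : realType) (n p : nat) (q c : R) : \bar R :=
  ereal_inf [set max_risk q c f |
             f in [set f : estimator R n p | measurable_estimator f]].

Definition attains_minimax_rate (R : realType) (q : R) (p : nat -> nat)
    (c : nat -> R) (f : forall n, estimator R n (p n)) : Prop :=
  exists2 K : R, 0 < K & forall n : nat, (2 <= n)%N ->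
    (max_risk q (c n) (f n) <= K%:E * minimax_risk n (p n) q (c n))%E.

Definition kendall_tau (R : realType) (n p : nat) (x : sample R n p)
    (i j : 'I_p) : R :=
  let X (i : 'I_p) (k : 'I_n) : R := tnth (tnth x k) i in
  ((n * n.-1)%N%:R)^-1 *
  \sum_(k < n) \sum_(l < n | l != k)
    Num.sg (X i k - X i l) * Num.sg (X j k - X j l).

Definition threshold_estimator (R : realType) (alpha : R) (n p : nat)
    : estimator R n p :=
  fun x => \matrix_(i, j)
    if i == j then 1
    else sin (pi / 2 * kendall_tau x i j) *
         (`|kendall_tau x i j| > alpha * Num.sqrt (ln p%:R / n%:R))%R%:R.

(* Main.v *)
Require Import Defs.
From HB Require Import structures.
From mathcomp Require Import all_boot all_order all_algebra.
From mathcomp Require Import all_classical all_reals all_analysis.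
From mathcomp Require Import measurable_realfun.
From mathcomp Require Import perm lra ring.

Set Implicit Arguments.
Unset Strict Implicit.
Unset Printing Implicit Defensive.

Import Order.TTheory GRing.Theory Num.Theory.
Import numFieldNormedType.Exports.

Local Open Scope classical_set_scope.
Local Open Scope ring_scope.

(** Throughout, [l] is [sqrt (ln p / n)].

    Where the critical constant comes from. By the Cramer-Wold device and the
    invariance of signs, the law of Kendall's tau of two coordinates depends on
    their correlation [sin psi] only ([kendall_law]). Its mean is
    [2 psi / pi] (Sheppard's formula, [sgn_corrE]), so the sine transform turns
    it into an estimate of the correlation. For small [psi] its variance is
    close to [4 / (9 n)], because the projection of the sign kernel on one
    observation has variance 1/9 ([ustat_indep_var]). At independence the event
    [tau > alpha l] therefore has probability [p ^ (- 9 alpha ^ 2 / 8)], up to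
    an arbitrarily small change of the exponent. The upper bound
    ([kendall_tail]) splits the U-statistic into means over independent blocks
    and uses exponential moments; the lower bound ([kendall_lower_tail]) tilts
    the law along the projection of the kernel and compares relative entropies.
    The exponent [9 alpha ^ 2 / 8] is 1 exactly at [alpha = 2 sqrt 2 / 3].

    Above the critical constant. A false exceedance costs about [l ^ 2] and is
    rarer than [1 / p], so the [p] entries of a row together contribute a term
    of order [l ^ 2]. All other errors are of order [min (rho ^ 2) (l ^ 2)] per
    entry ([entry_risk]), and the sum of these over a weak ball is of order
    [c l ^ (2 - q)] ([weak_ball_sum]). This is [threshold_upper].

    Below the critical constant. At the identity matrix every exceedance is
    false, so the risk per row is at least of order [l ^ 2 p ^ (1 - kappa)] for all
    [kappa > 9 alpha ^ 2 / 8] ([max_risk_ge_identity]). The rate is attained by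
    a larger threshold, so rate optimality would bound [p ^ (1 - kappa)] by a
    multiple of [c l ^ (- q)] ([attains_bound]). This fails for the least sparsity
    allowed ([suboptimal_subcritical]); it fails in every permissible set when
    [alpha < 2 / 3], since then [kappa < 1 / 2] while [c l ^ (- q)] is at most
    of order [sqrt n] and [p > n] ([suboptimal_lt23]).

    The rate is minimax. That the estimator is optimal above the critical
    constant also needs a lower bound for all estimators ([minimax_lower]).
    To a graph on the coordinates with degrees at most [K] one attaches the
    correlation matrix with entry [d] at the edges, where [d] is a small
    multiple of [l] and [K] is of order [c d ^ (- q)]. The laws with and
    without one given edge differ by a likelihood ratio with second moment at
    most [(1 - 4 d ^ 2) ^ (- n)], a small power of [p]. Hence, under a random
    graph whose edges have prior odds [z] of order [K / p], every edge costs an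
    estimator at least [z d ^ 2 / 4] ([two_point_risk]). Since such a graph has
    of the order of [K p] edges on average ([mean_edges]), some graph forces a
    risk of order [K d ^ 2], that is [c l ^ (2 - q)] ([hard_graph]). *)

(** * Expectations of bounded measurable functions *)

Section bounded_measurable.
Context d (T : measurableType d) (R : realType).
Implicit Types f g : T -> R.

(** Signs, clipped losses, truncated likelihood ratios and exponentials of
    bounded statistics all belong to this class. On it the
    expectation is linear, monotone and satisfies Fubini without integrability
    conditions to carry along. *)
Definition bounded_measurable f :=
  measurable_fun [set: T] f /\ exists M : R, forall x, `|f x| <= M.

Lemma bmf_cst (r : R) : bounded_measurable (fun=> r).
Proof. by split; [exact: measurable_cst|exists `|r|]. Qed.

Lemma bmfD f g : bounded_measurable f -> bounded_measurable g ->
  bounded_measurable (fun x => f x + g x).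
Proof.
move=> [mf [M fM]] [mg [N gN]]; split; first exact: measurable_funD.
by exists (M + N) => x; rewrite (le_trans (ler_normD _ _))// lerD.
Qed.

Lemma bmfN f : bounded_measurable f -> bounded_measurable (fun x => - f x).
Proof.
move=> [mf [M fM]]; split; first exact: measurableT_comp.
by exists M => x; rewrite normrN.
Qed.

Lemma bmfB f g : bounded_measurable f -> bounded_measurable g ->
  bounded_measurable (fun x => f x - g x).
Proof. by move=> bf bg; apply: bmfD => //; exact: bmfN. Qed.

Lemma bmfM f g : bounded_measurable f -> bounded_measurable g ->
  bounded_measurable (fun x => f x * g x).
Proof.
move=> [mf [M fM]] [mg [N gN]]; split; first exact: measurable_funM.
by exists (M * N) => x; rewrite normrM ler_pM.
Qed.

Lemma bmfZ (r : R) f : bounded_measurable f ->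
  bounded_measurable (fun x => r * f x).
Proof. by move=> bf; apply: bmfM => //; exact: bmf_cst. Qed.

Lemma bmfX n f : bounded_measurable f -> bounded_measurable (fun x => f x ^+ n).
Proof.
move=> bf; elim: n => [|n IH].
  by under eq_fun do rewrite expr0; exact: bmf_cst.
by under eq_fun do rewrite exprS; exact: bmfM.
Qed.

Lemma bmf_norm f : bounded_measurable f -> bounded_measurable (fun x => `|f x|).
Proof.
move=> [mf [M fM]]; split; first exact: measurableT_comp.
by exists M => x; rewrite normr_id.
Qed.

Lemma bmf_sum I (r : seq I) (P : pred I) (F : I -> T -> R) :
  (forall i, P i -> bounded_measurable (F i)) ->
  bounded_measurable (fun x => \sum_(i <- r | P i) F i x).
Proof.
move=> bF; elim: r => [|i r IH].
  by under eq_fun do rewrite big_nil; exact: bmf_cst.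
under eq_fun do rewrite big_cons.
by case: (boolP (P i)) => // Pi; apply: bmfD => //; exact: bF.
Qed.

Lemma bmf_prod I (r : seq I) (P : pred I) (F : I -> T -> R) :
  (forall i, P i -> bounded_measurable (F i)) ->
  bounded_measurable (fun x => \prod_(i <- r | P i) F i x).
Proof.
move=> bF; elim: r => [|i r IH].
  by under eq_fun do rewrite big_nil; exact: bmf_cst.
under eq_fun do rewrite big_cons.
by case: (boolP (P i)) => // Pi; apply: bmfM => //; exact: bF.
Qed.

Lemma bmf_expR f : bounded_measurable f ->
  bounded_measurable (fun x => expR (f x)).
Proof.
move=> [mf [M fM]]; split; first exact: measurableT_comp.
exists (expR M) => x; rewrite ger0_norm ?expR_ge0// ler_expR.
by rewrite (le_trans (ler_norm _)).
Qed.

Lemma bmf_sin f : measurable_fun setT f ->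
  bounded_measurable (fun x => sin (f x)).
Proof.
move=> mf; split.
  by apply: measurableT_comp => //; apply: continuous_measurable_fun; exact: continuous_sin.
by exists 1 => x; rewrite ler_norml sin_geN1 sin_le1.
Qed.

Lemma bmf_cos f : measurable_fun setT f ->
  bounded_measurable (fun x => cos (f x)).
Proof.
move=> mf; split.
  by apply: measurableT_comp => //; apply: continuous_measurable_fun; exact: continuous_cos.
by exists 1 => x; rewrite ler_norml cos_geN1 cos_le1.
Qed.

Lemma sgrE (x : R) : Num.sg x = (0 < x)%R%:R - (x < 0)%R%:R.
Proof. by case: sgrP => _ /=; lra. Qed.

Lemma bmf_bool (b : T -> bool) : measurable_fun setT b ->
  bounded_measurable (fun x => (b x)%:R).
Proof.
move=> mb; split.
  rewrite (_ : (fun x => _) = (fun b : bool => b%:R) \o b)//.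
  by apply: measurableT_comp.
by exists 1 => x; case: (b x); rewrite ?normr1 ?normr0.
Qed.

Lemma bmf_sg f : measurable_fun setT f ->
  bounded_measurable (fun x => Num.sg (f x)).
Proof.
move=> mf; under eq_fun do rewrite sgrE.
by apply: bmfB; apply: bmf_bool; exact: measurable_fun_ltr.
Qed.

Lemma bmf_indic (A : set T) : measurable A ->
  bounded_measurable (\1_A : T -> R).
Proof.
move=> mA; split; first exact: measurable_indic.
by exists 1 => x; rewrite indicE; case: (x \in A); rewrite ?normr1 ?normr0.
Qed.

Lemma bmf_integrable (P : probability T R) f : bounded_measurable f ->
  P.-integrable setT (EFin \o f).
Proof.
move=> [mf [M fM]]; apply: measurable_bounded_integrable => //.
  by rewrite [X in (X < _)%E]probability_setT ltry.
exists `|M|; split; first exact: normr_real.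
move=> N MN x _ /=; apply: le_trans (fM x) _.
exact: le_trans (ler_norm _) (ltW MN).
Qed.

End bounded_measurable.

Lemma bmf_comp d d' (T : measurableType d) (U : measurableType d')
    (R : realType) (phi : T -> U) (f : U -> R) :
  measurable_fun setT phi -> bounded_measurable f ->
  bounded_measurable (fun x => f (phi x)).
Proof.
move=> mphi [mf [M fM]]; split; first exact: measurableT_comp.
by exists M => x; exact: fM.
Qed.

Section expectation.
Context d (T : measurableType d) (R : realType) (P : probability T R).
Implicit Types f g : T -> R.
Local Notation bmf := (@bounded_measurable d T R).

Lemma Rint_cst (r : R) : \int[P]_x r = r.
Proof. by rewrite Rintegral_cst// [X in fine X]probability_setT mulr1. Qed.

Lemma RintD f g : bmf f -> bmf g ->
  \int[P]_x (f x + g x) = \int[P]_x f x + \int[P]_x g x.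
Proof. by move=> bf bg; rewrite RintegralD//; exact: bmf_integrable. Qed.

Lemma RintB f g : bmf f -> bmf g ->
  \int[P]_x (f x - g x) = \int[P]_x f x - \int[P]_x g x.
Proof. by move=> bf bg; rewrite RintegralB//; exact: bmf_integrable. Qed.

Lemma RintZ (r : R) f : bmf f -> \int[P]_x (r * f x) = r * \int[P]_x f x.
Proof. by move=> bf; rewrite RintegralZl//; exact: bmf_integrable. Qed.

Lemma RintZr (r : R) f : bmf f -> \int[P]_x (f x * r) = (\int[P]_x f x) * r.
Proof. by move=> bf; rewrite RintegralZr//; exact: bmf_integrable. Qed.

Lemma Rint_sum I (r : seq I) (Q : pred I) (F : I -> T -> R) :
  (forall i, Q i -> bmf (F i)) ->
  \int[P]_x (\sum_(i <- r | Q i) F i x) = \sum_(i <- r | Q i) \int[P]_x F i x.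
Proof.
move=> bF; elim: r => [|i r IH].
  by under eq_Rintegral do rewrite big_nil; rewrite big_nil Rint_cst.
under eq_Rintegral do rewrite big_cons.
rewrite big_cons; case: (boolP (Q i)) => // Pi; rewrite RintD ?IH//.
  exact: bF.
exact: bmf_sum.
Qed.

Lemma Rint_le f g : bmf f -> bmf g -> (forall x, f x <= g x) ->
  \int[P]_x f x <= \int[P]_x g x.
Proof. by move=> bf bg fg; apply: le_Rintegral => //; exact: bmf_integrable. Qed.

Lemma Rint_ge0 f : (forall x, 0 <= f x) -> 0 <= \int[P]_x f x.
Proof. by move=> f0; exact: Rintegral_ge0. Qed.

Lemma EFin_Rint f : bmf f -> (\int[P]_x (f x)%:E)%E = (\int[P]_x f x)%:E.
Proof.
move=> bf; rewrite /Rintegral fineK//.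
by apply: integrable_fin_num => //; exact: bmf_integrable.
Qed.

Lemma Rint_norm_le f : bmf f -> `|\int[P]_x f x| <= \int[P]_x `|f x|.
Proof. by move=> bf; apply: le_normr_Rintegral => //; exact: bmf_integrable. Qed.

Lemma Rint_indic A : measurable A -> (\int[P]_x (\1_A x : R))%:E = P A.
Proof.
move=> mA; rewrite -EFin_Rint; last exact: bmf_indic.
by rewrite integral_indic// setIT.
Qed.

Lemma Rint_cvg (F : nat -> T -> R) f (M : R) :
  (forall k, measurable_fun setT (F k)) -> measurable_fun setT f ->
  (forall k x, `|F k x| <= M) -> (forall x, F ^~ x @ \oo --> f x) ->
  (\int[P]_x F k x) @[k --> \oo] --> \int[P]_x f x.
Proof.
move=> mF mf FM Ff.
have bF k : bmf (F k) by split => //; exists M.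
have bf : bmf f.
  split=> //; exists M => x.
  have : (`|F k x| @[k --> \oo] --> `|f x|) by apply: cvg_norm; exact: Ff.
  by move/cvgr_to_le; apply; near do exact: FM.
have := @dominated_convergence _ _ _ P setT measurableT (fun k x => (F k x)%:E)
  (EFin \o f) (cst M%:E).
case.
- by move=> k; exact/measurable_EFinP.
- exact/measurable_EFinP.
- by apply: aeW => x _; apply: cvg_EFin; [near=> k|exact: Ff].
- by have := bmf_integrable P (bmf_cst T M).
- by apply: aeW => x k _; rewrite lee_fin.
move=> _ _ + ; under eq_fun do rewrite EFin_Rint//.
rewrite EFin_Rint// => /fine_cvgP[_].
by apply: cvg_trans; apply: near_eq_cvg; near do by [].
Unshelve. all: by end_near. Qed.

End expectation.

Lemma Rint_push d d' (T : measurableType d) (U : measurableType d')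
    (R : realType) (P : probability T R) (Q : probability U R)
    (phi : T -> U) (f : U -> R) :
  measurable_fun setT phi ->
  (forall A, measurable A -> Q A = P (phi @^-1` A)) ->
  bounded_measurable f ->
  \int[Q]_x f x = \int[P]_x f (phi x).
Proof.
move=> mphi QP bf.
rewrite /Rintegral; congr fine.
have := @integral_pushforward _ _ T U R phi mphi P setT (EFin \o f).
rewrite preimage_setT => <-//; last 2 first.
- by apply/measurable_EFinP; case: bf.
- by apply: bmf_integrable (bmf_comp mphi bf).
apply: eq_measure_integral => A mA _; exact: QP.
Qed.

Section fubini.
Context d d' (T : measurableType d) (U : measurableType d') (R : realType).
Variables (P : probability T R) (Q : probability U R).
Variable f : T * U -> R.
Hypothesis bf : bounded_measurable f.

Local Notation PQ := ((P \x Q)%E : probability (T * U)%type R).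

Lemma bmf_pairl x : bounded_measurable (fun y => f (x, y)).
Proof. by apply: bmf_comp bf; exact: pair1_measurable. Qed.

Lemma bmf_pairr y : bounded_measurable (fun x => f (x, y)).
Proof. by apply: bmf_comp bf; exact: pair2_measurable. Qed.

Lemma bmf_fubini1 : bounded_measurable (fun x => \int[Q]_y f (x, y)).
Proof.
have iPQ := bmf_integrable PQ bf.
split.
  have := measurable_fubini_F iPQ.
  rewrite /fubini_F => mF; apply/measurable_EFinP.
  apply: eq_measurable_fun mF => x _ /=.
  by rewrite EFin_Rint//; exact: bmf_pairl.
case: bf => mf [M fM]; exists M => x.
apply: le_trans (Rint_norm_le Q (bmf_pairl x)) _.
rewrite -[leRHS](Rint_cst Q M); apply: Rint_le.
- exact: bmf_norm (bmf_pairl x).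
- exact: bmf_cst.
- by move=> y; exact: fM.
Qed.

Lemma Rint_fubini1 : \int[PQ]_z f z = \int[P]_x \int[Q]_y f (x, y).
Proof.
have iPQ := bmf_integrable PQ bf.
rewrite {1}/Rintegral -(integral12_prod_meas1 iPQ) /fubini_F; congr fine.
by apply: eq_integral => x _; rewrite /= EFin_Rint//; exact: bmf_pairl.
Qed.

Lemma Rint_fubini2 : \int[PQ]_z f z = \int[Q]_y \int[P]_x f (x, y).
Proof.
have iPQ := bmf_integrable PQ bf.
rewrite {1}/Rintegral -(integral21_prod_meas1 iPQ) /fubini_G; congr fine.
by apply: eq_integral => x _; rewrite /= EFin_Rint//; exact: bmf_pairr.
Qed.

End fubini.

(** * Independent samples *)

Section iid.
Context d (T : measurableType d) (R : realType).
Implicit Types (P : probability T R).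

Definition box n (B : 'I_n -> set T) : set (n.-tuple T) :=
  [set x | forall k, B k (tnth x k)].

Lemma measurable_box n (B : 'I_n -> set T) :
  (forall k, measurable (B k)) -> measurable (box B).
Proof.
move=> mB.
have -> : box B = \bigcap_(k in [set: 'I_n]) ((@tnth _ T ^~ k) @^-1` B k).
  by apply/seteqP; split => x /= h k => [_|]; exact: h.
apply: fin_bigcap_measurable => // k _.
by rewrite -[X in measurable X]setTI; apply: measurable_tnth.
Qed.

(** The preimage of a set under one coordinate is a box whose other sides are
    the whole space. *)
Lemma box_generates n : @measurable _ (n.-tuple T) =
  <<s [set X | exists2 B : 'I_n -> set T, (forall k, measurable (B k)) & X = box B] >>.
Proof.
apply/seteqP; split; last first.
  apply: smallest_sub; first exact: sigma_algebra_measurable.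
  by move=> _ [B mB ->]; exact: measurable_box.
apply: smallest_sub; first exact: smallest_sigma_algebra.
move=> X; rewrite -bigcup_seq/= => -[i _] [A mA <-]; rewrite setTI.
apply: sub_sigma_algebra => /=.
exists (fun k => if k == i then A else setT).
  by move=> k; case: ifP.
apply/seteqP; split => x /=.
  by move=> Ax k; case: eqP => // ->.
by move/(_ i); rewrite eqxx.
Qed.

(** Boxes are stable under intersection, so they determine a finite measure. *)
Lemma tuple_measure_unique n (Q Q' : {measure set (n.-tuple T) -> \bar R}) :
  (Q setT < +oo)%E ->
  (forall B : 'I_n -> set T, (forall k, measurable (B k)) ->
     Q (box B) = Q' (box B)) ->
  forall A, measurable A -> Q A = Q' A.
Proof.
move=> Qoo QQ'; apply: (measure_unique _ (fun=> setT) (box_generates n)) => //.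
- move=> _ _ [B mB ->] [C mC ->] /=.
  exists (fun k => B k `&` C k); first by move=> k; exact: measurableI.
  apply/seteqP; split => x /=; first by move=> [Bx Cx] k; split.
  by move=> h; split => k; case: (h k).
- move=> _; exists (fun=> setT) => //.
  by apply/seteqP; split.
- by rewrite bigcup_const//; exists 0%N.
- by move=> _ [B mB ->]; exact: QQ'.
Qed.

Definition iid n P (Q : probability (n.-tuple T) R) :=
  forall B : 'I_n -> set T, (forall k, measurable (B k)) ->
    Q (box B) = (\prod_k P (B k))%E.

Lemma iid_unique n P (Q Q' : probability (n.-tuple T) R) :
  iid P Q -> iid P Q' -> forall A, measurable A -> Q A = Q' A.
Proof.
move=> iQ iQ'; apply: tuple_measure_unique.
  by rewrite [X in (X < _)%E]probability_setT ltry.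
by move=> B mB; rewrite [LHS]iQ// [RHS]iQ'.
Qed.

Lemma iid_Rint_eq n P (Q : probability (n.-tuple T) R) d' (U : measurableType d')
    (S : probability U R) (phi : U -> n.-tuple T) (f : n.-tuple T -> R) :
  iid P Q -> measurable_fun setT phi ->
  (forall B : 'I_n -> set T, (forall k, measurable (B k)) ->
    S [set u | forall k, B k (tnth (phi u) k)] = (\prod_k P (B k))%E) ->
  bounded_measurable f -> \int[Q]_x f x = \int[S]_u f (phi u).
Proof.
move=> iQ mphi iS bf.
pose mphiM : {mfun U >-> n.-tuple T} := HB.pack phi (isMeasurableFun.Build _ _ _ _ _ mphi).
apply: Rint_push bf => // A mA.
have := @iid_unique n P Q (distribution S mphiM) iQ.
by apply.
Qed.

Definition cons_pair n (z : T * n.-tuple T) : n.+1.-tuple T :=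
  [the n.+1.-tuple T of z.1 :: z.2].

Lemma measurable_cons_pair n : measurable_fun setT (@cons_pair n).
Proof. by apply: measurable_cons. Qed.

HB.instance Definition _ n :=
  isMeasurableFun.Build _ _ _ _ (@cons_pair n) (@measurable_cons_pair n).

Fixpoint power_prob P n : probability (n.-tuple T) R :=
  if n is n'.+1 then
    distribution ((P \x power_prob P n')%E : probability (T * n'.-tuple T)%type R)
      (@cons_pair n' : {mfun _ >-> _})
  else dirac [tuple].

Lemma iid_power P n : iid P (power_prob P n).
Proof.
elim: n => [|n IH] B mB.
  rewrite big_ord0 /= diracE mem_set//.
  by move=> [].
rewrite /= /distribution /pushforward big_ord_recl/=.
have -> : @cons_pair n @^-1` box B =
    B ord0 `*` box (fun k => B (lift ord0 k)).
  apply/seteqP; split => -[x y] /=.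
    by move=> h; split; [have := h ord0|move=> k; have := h (lift ord0 k); rewrite tnthS].
  move=> [h0 h] k; case: (unliftP ord0 k) => [j|] ->//.
  by rewrite tnthS.
rewrite product_measure1E//; last by apply: measurable_box.
by rewrite -IH.
Qed.

Section merging.
Variables (n : nat) (P : probability T R) (Q : probability (n.-tuple T) R).
Hypothesis iQ : iid P Q.
Implicit Types (S : pred 'I_n) (f g : n.-tuple T -> R).

(** Independence is used through resampling: if [x] and [y] are independent
    samples, then so is the sample that takes the coordinates in [S] from [x]
    and the others from [y]. Fubini then separates functions of disjoint sets
    of coordinates. *)
Definition merge S (x y : n.-tuple T) : n.-tuple T :=
  [tuple if S k then tnth x k else tnth y k | k < n].

Lemma tnth_merge S x y k :
  tnth (merge S x y) k = if S k then tnth x k else tnth y k.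
Proof. by rewrite tnth_mktuple. Qed.

Lemma measurable_merge S :
  measurable_fun setT (fun z : n.-tuple T * n.-tuple T => merge S z.1 z.2).
Proof.
apply/measurable_fun_tnthP => k.
rewrite (_ : _ \o _ = if S k then (fun z => tnth z.1 k) else (fun z => tnth z.2 k)).
  by case: (S k); [exact: (measurableT_comp (measurable_tnth k) measurable_fst)|
    exact: (measurableT_comp (measurable_tnth k) measurable_snd)].
by apply/funext => z /=; rewrite tnth_merge; case: (S k).
Qed.

Lemma Rint_merge S f : bounded_measurable f ->
  \int[Q]_x f x = \int[Q]_x \int[Q]_y f (merge S x y).
Proof.
move=> bf.
rewrite -(@Rint_fubini1 _ _ _ _ _ Q Q (fun z => f (merge S z.1 z.2))); last first.
  by apply: bmf_comp bf; exact: measurable_merge.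
apply: (iid_Rint_eq (S := (Q \x Q)%E) iQ (measurable_merge S)) => //.
move=> B mB.
have -> : [set u : n.-tuple T * n.-tuple T |
     forall k, B k (tnth (merge S u.1 u.2) k)] =
   box (fun k => if S k then B k else setT) `*`
   box (fun k => if S k then setT else B k).
  apply/seteqP; split => -[x y] /=.
    by move=> h; split => k; have := h k; rewrite tnth_merge; case: (S k).
  move=> [h1 h2] k; rewrite tnth_merge.
  by have := h1 k; have := h2 k; case: (S k).
rewrite [LHS]product_measure1E; last 2 first.
- by apply: measurable_box => k; case: (S k).
- by apply: measurable_box => k; case: (S k).
transitivity ((\prod_k P (if S k then B k else setT)) *
    (\prod_k P (if S k then setT else B k)))%E.
  by congr (_ * _)%E; apply: iQ => k; case: (S k).
rewrite -big_split/=; apply: eq_bigr => k _.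
by case: (S k); [rewrite -[RHS]mule1|rewrite -[RHS]mul1e]; congr (_ * _)%E;
  exact: probability_setT.
Qed.

Lemma Rint_indep S f g : bounded_measurable f -> bounded_measurable g ->
  (forall x y, f (merge S x y) = f x) ->
  (forall x y, g (merge S x y) = g y) ->
  \int[Q]_x (f x * g x) = (\int[Q]_x f x) * \int[Q]_x g x.
Proof.
move=> bf bg fS gS; rewrite (Rint_merge S); last exact: bmfM.
under eq_Rintegral => x _.
  under eq_Rintegral do rewrite fS gS.
  rewrite RintZ//; over.
by rewrite RintZr.
Qed.

Lemma Rint_coord k (h : T -> R) : bounded_measurable h ->
  \int[Q]_x h (tnth x k) = \int[P]_t h t.
Proof.
move=> bh; symmetry.
apply: Rint_push => //; first exact: measurable_tnth.
move=> A mA.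
have -> : (fun x : n.-tuple T => tnth x k) @^-1` A =
    box (fun j => if j == k then A else setT).
  apply/seteqP; split => x /=; last by move/(_ k); rewrite eqxx.
  by move=> Ax j; case: eqP => // ->.
rewrite [RHS]iQ; last by move=> j; case: ifP.
rewrite (bigD1 k)//= eqxx big1 ?mule1// => j /negPf ->.
by rewrite [LHS]probability_setT.
Qed.

Definition set_coord (x : n.-tuple T) k (t : T) : n.-tuple T :=
  [tuple if j == k then t else tnth x j | j < n].

Lemma tnth_set_coord x k t j :
  tnth (set_coord x k t) j = if j == k then t else tnth x j.
Proof. by rewrite tnth_mktuple. Qed.

Lemma measurable_set_coord k :
  measurable_fun setT (fun z : n.-tuple T * T => set_coord z.1 k z.2).
Proof.
apply/measurable_fun_tnthP => j.
rewrite (_ : _ \o _ = if j == k then (fun z => z.2) else (fun z => tnth z.1 j)).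
  by case: (j == k); [exact: measurable_snd|
    exact: (measurableT_comp (measurable_tnth j) measurable_fst)].
by apply/funext => z /=; rewrite tnth_set_coord; case: (j == k).
Qed.

Lemma Rint_set_coord k f : bounded_measurable f ->
  \int[Q]_x f x = \int[Q]_x \int[P]_t f (set_coord x k t).
Proof.
move=> bf; rewrite (Rint_merge (predC1 k))//.
apply: eq_Rintegral => x _.
rewrite -(@Rint_coord k (fun t => f (set_coord x k t))); last first.
  apply: bmf_comp bf.
  have := measurableT_comp (measurable_set_coord k) (@pair1_measurable _ _ _ _ x).
  exact.
apply: eq_Rintegral => y _; congr (f _); apply: eq_from_tnth => j.
by rewrite tnth_merge tnth_set_coord /=; case: eqP => // ->.
Qed.

Lemma Rint_reindex (s : 'I_n -> 'I_n) f : injective s -> bounded_measurable f ->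
  \int[Q]_x f [tuple tnth x (s k) | k < n] = \int[Q]_x f x.
Proof.
move=> sI bf; symmetry; apply: (iid_Rint_eq iQ) => //.
  apply/measurable_fun_tnthP => k.
  rewrite (_ : _ \o _ = fun x => tnth x (s k)); first exact: measurable_tnth.
  by apply/funext => x /=; rewrite tnth_mktuple.
move=> B mB.
have [s' sK s'K] := injF_bij sI.
have -> : [set u : n.-tuple T | forall k, B k (tnth [tuple tnth u (s j)  | j < n] k)] =
    box (B \o s').
  apply/seteqP; split => x /= h k.
    by have := h (s' k); rewrite tnth_mktuple s'K.
  by rewrite tnth_mktuple; have := h (s k); rewrite /= sK.
rewrite [LHS]iQ; last by move=> k; exact: mB.
rewrite (reindex s) /=; last by apply: onW_bij; exists s'.
by apply: eq_bigr => k _; rewrite sK.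
Qed.

End merging.

Lemma Rint_prod_coord n (P : probability T R) (Q : probability (n.-tuple T) R)
    (F : 'I_n -> T -> R) : iid P Q ->
  (forall k, bounded_measurable (F k)) ->
  \int[Q]_x (\prod_k F k (tnth x k)) = \prod_k \int[P]_t F k t.
Proof.
move=> iQ bF.
have bFx k : bounded_measurable (fun x : n.-tuple T => F k (tnth x k)).
  by apply: bmf_comp (bF k); exact: measurable_tnth.
suff H (r : seq 'I_n) : uniq r ->
    \int[Q]_x (\prod_(k <- r) F k (tnth x k)) = \prod_(k <- r) \int[P]_t F k t.
  by apply: H; exact: index_enum_uniq.
elim: r => [|k r IH] /=.
  by under eq_Rintegral do rewrite big_nil; rewrite big_nil Rint_cst.
move=> /andP[kr ur]; under eq_Rintegral do rewrite big_cons.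
rewrite big_cons (@Rint_indep n P Q iQ (pred1 k))//.
- by rewrite (Rint_coord iQ)// IH.
- by apply: bmf_prod => j _; exact: bFx.
- by move=> x y; rewrite tnth_merge /= eqxx.
- move=> x y; apply: eq_big_seq => j jr; rewrite tnth_merge /=.
  by case: eqP => // jk; rewrite -jk jr in kr.
Qed.

End iid.

(** * The Cramer-Wold device in the plane *)

Section steep_polynomials.
Variable R : realType.
Implicit Types r : R.

Lemma cvg_mulrn_expr (x : R) : 0 <= x < 1 -> (k%:R * x ^+ k) @[k --> \oo] --> (0 : R).
Proof.
move=> /andP[x0 x1].
pose y : R := (1 + x) / 2.
have y0 : 0 < y by rewrite /y; lra.
have y1 : y < 1 by rewrite /y; lra.
have xy : x <= y ^+ 2 by rewrite /y; nra.
pose h := y^-1 - 1.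
have h0 : 0 < h by rewrite subr_gt0 invf_gt1.
have hk k : k%:R * y ^+ k <= h^-1.
  rewrite -ler_pdivlMr ?exprn_gt0// -ler_pdivrMl ?invr_gt0 ?h0// invrK.
  rewrite -exprVn (_ : y^-1 = 1 + h); last by rewrite /h; lra.
  have : forall k, 1 + k%:R * h <= (1 + h) ^+ k.
    elim=> [|j IH]; first by rewrite mul0r addr0 expr0.
    rewrite exprS -natr1; apply: le_trans (ler_wpM2l _ IH); last lra.
    have : 0 <= j%:R :> R by [].
    nra.
  by move/(_ k); nra.
apply: (@squeeze_cvgr _ _ _ _ (cst 0) (fun k => h^-1 * y ^+ k)).
- near=> k; rewrite /= mulr_ge0 ?exprn_ge0//=.
  have : x ^+ k <= y ^+ k * y ^+ k.
    by rewrite -exprMn -expr2 lerXn2r// nnegrE ?sqr_ge0.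
  move=> H; apply: le_trans (ler_wpM2l (ler0n _ k) H) _.
  by rewrite mulrA ler_wpM2r// exprn_ge0// ltW.
- exact: cvg_cst.
- rewrite -[X in _ --> X](mulr0 h^-1); apply: cvgM; first exact: cvg_cst.
  by apply: cvg_expr; rewrite ger0_norm ?ltW.
Unshelve. all: by end_near. Qed.

(** A polynomial in [r] that approaches the indicator of [r < 1/2]: the
    exponent [k * 2 ^ k] makes [k * 2 ^ k * r ^ k] tend to 0 below 1/2 and stay
    above [k] from 1/2 on. *)
Definition steep k r := (1 - r ^+ k) ^+ (k * 2 ^ k).

Lemma steep_ge0 k r : 0 <= r <= 1 -> 0 <= steep k r.
Proof. by move=> /andP[r0 r1]; rewrite exprn_ge0// subr_ge0 exprn_ile1. Qed.

Lemma steep_le1 k r : 0 <= r <= 1 -> steep k r <= 1.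
Proof.
move=> /andP[r0 r1]; rewrite exprn_ile1 ?subr_ge0 ?exprn_ile1//.
by rewrite gerBl exprn_ge0.
Qed.

Lemma bernoulli_ge (x : R) n : 0 <= x <= 1 -> 1 - n%:R * x <= (1 - x) ^+ n.
Proof.
move=> /andP[x0 x1]; elim: n => [|n IH]; first by rewrite mul0r subr0 expr0.
rewrite exprS; apply: le_trans (ler_wpM2l _ IH); last lra.
have : 0 <= n%:R :> R by [].
rewrite -natr1; nra.
Qed.

Lemma cvg_steep r : 0 <= r <= 1 ->
  steep k r @[k --> \oo] --> ((r < 2^-1)%R%:R : R).
Proof.
move=> r01; have /andP[r0 r1] := r01.
have [rh|rh] := ltP.
  apply: (@squeeze_cvgr _ _ _ _ (fun k => 1 - k%:R * (2 * r) ^+ k) (cst 1)).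
  - near=> k; rewrite steep_le1// andbT.
    have := @bernoulli_ge (r ^+ k) (k * 2 ^ k).
    rewrite exprn_ge0// exprn_ile1// => /(_ isT); apply: le_trans.
    by rewrite natrM natrX exprMn mulrA.
  - rewrite -[X in _ --> X]subr0; apply: cvgB; first exact: cvg_cst.
    apply: cvg_mulrn_expr; lra.
  - exact: cvg_cst.
apply: (@squeeze_cvgr _ _ _ _ (cst 0) (fun k => expR (-1) ^+ k)).
- near=> k; rewrite steep_ge0//=.
  have rk1 : r ^+ k <= 1 by rewrite exprn_ile1.
  apply: le_trans (_ : expR (- r ^+ k) ^+ (k * 2 ^ k) <= _).
    rewrite lerXn2r ?nnegrE ?expR_ge0 ?subr_ge0//.
    exact: expR_ge1Dx.
  rewrite -!expRM_natl ler_expR natrM natrX !mulrN mulr1 lerN2.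
  rewrite -mulrA -exprMn ler_peMr// exprn_ege1//; lra.
- exact: cvg_cst.
- by apply: cvg_expr; rewrite ger0_norm ?expR_ge0// expRN invf_lt1 ?expR_gt0// expR_gt1.
Unshelve. all: by end_near. Qed.

End steep_polynomials.

Section cramer_wold.
Variable R : realType.
Local Notation RR := (measurableTypeR R * measurableTypeR R)%type.
Variables mu nu : probability RR R.
Hypothesis munu : forall (a b : R) (A : set (measurableTypeR R)), measurable A ->
  mu [set z | A (a * z.1 + b * z.2)] = nu [set z | A (a * z.1 + b * z.2)].
Implicit Type F : RR -> R.

Definition linform (a b : R) (z : RR) : R := a * z.1 + b * z.2.

Lemma measurable_linform a b : measurable_fun setT (linform a b).
Proof.
apply: measurable_funD; apply: measurable_funM => //.
Qed.

(** The test functions [cos (l + c)], with [l] a linear form, are controlled by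
    the laws of linear forms alone. Asking for equal expectations of [F] times
    every test function, instead of [F] alone, makes the class stable under
    multiplication by test functions. *)
Definition cw_good F := bounded_measurable F /\ forall a b c,
  \int[mu]_z (F z * cos (linform a b z + c)) =
  \int[nu]_z (F z * cos (linform a b z + c)).

Lemma bmf_coslin a b c : bounded_measurable (fun z => cos (linform a b z + c)).
Proof. by apply: bmf_cos; apply: measurable_funD => //; exact: measurable_linform. Qed.

Lemma cw_good1 : cw_good (cst 1).
Proof.
split=> [|a b c]; first exact: bmf_cst.
have mL : @measurable_fun _ _ RR (measurableTypeR R) setT (linform a b).
  exact: measurable_linform.
pose L : {mfun RR >-> measurableTypeR R} :=
  HB.pack (linform a b : RR -> measurableTypeR R) (isMeasurableFun.Build _ _ _ _ _ mL).
have bc : @bounded_measurable _ (measurableTypeR R) R (fun t => cos (t + c)).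
  by apply: bmf_cos; apply: measurable_funD.
under eq_Rintegral do rewrite mul1r.
under [RHS]eq_Rintegral do rewrite mul1r.
transitivity (\int[distribution nu L]_t cos (t + c)); last first.
  exact: (Rint_push mL).
symmetry; apply: (Rint_push mL) => // A mA.
by rewrite munu.
Qed.

Lemma cw_goodD F G : cw_good F -> cw_good G -> cw_good (fun z => F z + G z).
Proof.
move=> [bF gF] [bG gG]; split=> [|a b c]; first exact: bmfD.
under eq_Rintegral do rewrite mulrDl.
under [RHS]eq_Rintegral do rewrite mulrDl.
rewrite !RintD ?gF ?gG//; apply: bmfM => //; exact: bmf_coslin.
Qed.

Lemma cw_goodZ r F : cw_good F -> cw_good (fun z => r * F z).
Proof.
move=> [bF gF]; split=> [|a b c]; first exact: bmfZ.
under eq_Rintegral do rewrite -mulrA.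
under [RHS]eq_Rintegral do rewrite -mulrA.
rewrite !RintZ ?gF//; apply: bmfM => //; exact: bmf_coslin.
Qed.

(** A product of two cosines is half the sum of two cosines. *)
Lemma cw_goodM F a b c : cw_good F -> cw_good (fun z => F z * cos (linform a b z + c)).
Proof.
move=> [bF gF]; split=> [|a' b' c']; first by apply: bmfM => //; exact: bmf_coslin.
have E z : F z * cos (linform a b z + c) * cos (linform a' b' z + c') =
   2^-1 * (F z * cos (linform (a + a') (b + b') z + (c + c')) +
           F z * cos (linform (a - a') (b - b') z + (c - c'))).
  rewrite (_ : linform (a + a') (b + b') z + (c + c') =
    (linform a b z + c) + (linform a' b' z + c')); last by rewrite /linform; ring.
  rewrite (_ : linform (a - a') (b - b') z + (c - c') =
    (linform a b z + c) - (linform a' b' z + c')); last by rewrite /linform; ring.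
  set x := (_ + c : R); set y := (_ + c' : R).
  by rewrite cosD cosB; field.
under eq_Rintegral do rewrite E.
under [RHS]eq_Rintegral do rewrite E.
have bFc a0 b0 c0 : bounded_measurable (fun z => F z * cos (linform a0 b0 z + c0)).
  by apply: bmfM => //; exact: bmf_coslin.
rewrite !RintZ ?RintD ?gF//; exact: bmfD.
Qed.

Lemma cw_good_cvg (F : nat -> RR -> R) (G : RR -> R) (M : R) : (forall k, cw_good (F k)) ->
  (forall k z, `|F k z| <= M) -> measurable_fun setT G ->
  (forall z, F ^~ z @ \oo --> G z) -> cw_good G.
Proof.
move=> gF FM mG FG.
have bG : bounded_measurable G.
  split=> //; exists M => x.
  have : (`|F k x| @[k --> \oo] --> `|G x|) by apply: cvg_norm; exact: FG.
  by move/cvgr_to_le; apply; near do exact: FM.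
split=> // a b c.
have [mc [_ _]] := bmf_coslin a b c.
have H (P : probability RR R) :
  \int[P]_z (F k z * cos (linform a b z + c)) @[k --> \oo] -->
  \int[P]_z (G z * cos (linform a b z + c)).
  apply: (@Rint_cvg _ _ _ P _ _ M).
  - by move=> k; apply: measurable_funM => //; case: (gF k) => -[].
  - exact: measurable_funM.
  - move=> k z; rewrite normrM -[M]mulr1 ler_pM//.
    by rewrite ler_norml cos_geN1 cos_le1.
  - by move=> z; apply: cvgM; [exact: FG|exact: cvg_cst].
have E : (fun k => \int[nu]_z (F k z * cos (linform a b z + c))) =
    (fun k => \int[mu]_z (F k z * cos (linform a b z + c))).
  by apply/funext => k; rewrite (gF k).2.
by have := H nu; rewrite E; apply: cvg_unique (H mu).
Unshelve. all: by end_near. Qed.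

Lemma cw_good_steep F a b c k : cw_good F ->
  cw_good (fun z => F z * steep k (cos (linform a b z + c) ^+ 2)).
Proof.
move=> gF; rewrite /steep; elim: (k * 2 ^ k)%N => [|m IH].
  by under eq_fun do rewrite expr0 mulr1.
under eq_fun do rewrite exprS mulrCA mulrBl mul1r.
apply: cw_goodD => //.
rewrite (_ : (fun z => - _) = fun z => -1 *
   ((F z * (1 - cos (linform a b z + c) ^+ 2 ^+ k) ^+ m) *
   cos (linform a b z + c) ^+ (2 * k))); last first.
  by apply/funext => z; rewrite exprM; ring.
apply: cw_goodZ; elim: (2 * k)%N => [|j IHj].
  by under eq_fun do rewrite expr0 mulr1.
under eq_fun do rewrite (exprSr _ j) mulrA.
exact: cw_goodM.
Qed.

Lemma cos2_lt_half (t : R) : (cos (t / 2 + pi / 4) ^+ 2 < 2^-1) = (0 < sin t).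
Proof.
have -> : sin t = - cos (pi / 2 + t).
  by rewrite cosD cos_pihalf sin_pihalf; ring.
have -> : pi / 2 + t = (t / 2 + pi / 4) *+ 2 by rewrite -mulr_natr; field.
rewrite cos_mulr2n -mulr_natr; apply/idP/idP => h; lra.
Qed.

(** The square wave [0 < sin (l - t)] says that [cos ^ 2] of a shifted half
    angle is below 1/2, hence it is a limit of [steep] polynomials in cosines. *)
Lemma cw_good_sin F a b s t : cw_good F ->
  cw_good (fun z => F z * (0 < sin (s * (linform a b z - t)))%R%:R).
Proof.
move=> gF; have [[mF [M FM]] _] := gF.
apply: (@cw_good_cvg (fun k z => F z * steep k (cos (linform (s * a / 2) (s * b / 2) z +
    (- s * t / 2 + pi / 4)) ^+ 2)) _ M).
- by move=> k; exact: cw_good_steep.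
- move=> k z; rewrite normrM -[M]mulr1 ler_pM//.
  have c01 : 0 <= cos (linform (s * a / 2) (s * b / 2) z + (- s * t / 2 + pi / 4)) ^+ 2 <= 1.
    rewrite sqr_ge0/= -[leRHS](cos2Dsin2 (linform (s * a / 2) (s * b / 2) z + (- s * t / 2 + pi / 4))).
    by rewrite lerDl sqr_ge0.
  by rewrite ger0_norm ?steep_ge0 ?steep_le1.
- apply: measurable_funM => //; apply: (bmf_bool R _).1.
  apply: measurable_fun_ltr => //.
  apply: (bmf_sin _).1; apply: measurable_funM => //.
  by apply: measurable_funD => //; exact: measurable_linform.
- move=> z; apply: cvgM; first exact: cvg_cst.
  rewrite -cos2_lt_half.
  rewrite (_ : s * (linform a b z - t) / 2 + pi / 4 =
    linform (s * a / 2) (s * b / 2) z + (- s * t / 2 + pi / 4)); last first.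
    by rewrite /linform; field.
  apply: cvg_steep; rewrite sqr_ge0/=.
  rewrite -[leRHS](cos2Dsin2 (linform (s * a / 2) (s * b / 2) z + (- s * t / 2 + pi / 4))).
  by rewrite lerDl sqr_ge0.
Qed.

(** A half plane is the limit of square waves whose period grows. *)
Lemma cw_good_ray F a b t : cw_good F ->
  cw_good (fun z => F z * (t < linform a b z)%R%:R).
Proof.
move=> gF; have [[mF [M FM]] _] := gF.
apply: (@cw_good_cvg (fun k z => F z * (0 < sin (k.+1%:R^-1 * (linform a b z - t)))%R%:R) _ M).
- by move=> k; exact: cw_good_sin.
- move=> k z; rewrite normrM -[M]mulr1 ler_pM//.
  by case: (_ < _)%R; rewrite ?normr0 ?normr1.
- apply: measurable_funM => //; apply: (bmf_bool R _).1.
  by apply: measurable_fun_ltr => //; exact: measurable_linform.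
move=> z; apply: cvgM; first exact: cvg_cst.
apply: cvg_near_cst; near=> k.
rewrite -(subr_gt0 t); set u : R := _ - t.
have ku : `|k.+1%:R^-1 * u| < pi.
  rewrite normrM ger0_norm ?invr_ge0// mulrC ltr_pdivrMr// -ltr_pdivrMl ?pi_gt0//.
  rewrite mulrC; apply: (@lt_trans _ _ k%:R); last by rewrite ltr_nat.
  by near: k; exact: nbhs_infty_gtr.
move: ku; rewrite ltr_norml => /andP[ku1 ku2].
congr (nat_of_bool _)%:R; case: (ltrgtP 0 u) => hu.
- by rewrite sin_gt0_pi// mulr_gt0 ?invr_gt0.
- apply/negbTE; rewrite -leNgt -oppr_ge0 -sinN sin_ge0_pi//.
  by rewrite -mulrN mulr_ge0 ?invr_ge0 ?oppr_ge0 ?(ltW hu)//= mulrN ltW// ltrNl.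
- by rewrite -hu mulr0 sin0 ltxx.
Unshelve. all: by end_near. Qed.

Lemma ray_rect_eq (a b : R) :
  mu (`]a, +oo[ `*` `]b, +oo[) = nu (`]a, +oo[ `*` `]b, +oo[).
Proof.
have mA : measurable (`]a, +oo[ `*` `]b, +oo[ : set RR).
  by apply: measurableX => //; exact: measurable_itv.
rewrite -!(Rint_indic _ mA); congr EFin.
have [_ /(_ 0 0 0)] := cw_good_ray 0 1 b (cw_good_ray 1 0 a cw_good1).
have E z : (\1_(`]a, +oo[ `*` `]b, +oo[) z : R) =
  cst 1 z * (a < linform 1 0 z)%R%:R * (b < linform 0 1 z)%R%:R *
    cos (linform 0 0 z + 0).
  have -> : linform 1 0 z = z.1 by rewrite /linform mul1r mul0r addr0.
  have -> : linform 0 1 z = z.2 by rewrite /linform mul1r mul0r add0r.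
  have -> : linform 0 0 z = 0 by rewrite /linform !mul0r addr0.
  rewrite addr0 cos0 mulr1 /= mul1r indicE.
  rewrite -natrM mulnb; congr (nat_of_bool _)%:R.
  apply/idP/andP.
    by move=> /set_mem[] /=; rewrite !in_itv/= !andbT.
  by move=> [? ?]; apply: mem_set; split => /=; rewrite in_itv/= andbT.
by under eq_Rintegral do rewrite -E; under [RHS]eq_Rintegral do rewrite -E.
Qed.

Lemma measurable_ray_rects : @measurable _ RR =
  <<s [set X | exists a b : R, X = `]a, +oo[ `*` `]b, +oo[] >>.
Proof.
apply/seteqP; split; last first.
  apply: smallest_sub; first exact: sigma_algebra_measurable.
  by move=> _ [a [b ->]]; apply: measurableX => //; exact: measurable_itv.
set G := [set X | _].
have sG : sigma_algebra setT <<s G >> by exact: smallest_sigma_algebra.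
have ray_cover : \bigcup_k `](- k%:R : R), +oo[%classic = setT.
  apply/seteqP; split => // x _; exists (Num.bound `|x|) => //=.
  rewrite in_itv/= andbT ltrNl (le_lt_trans (ler_norm _))// normrN.
  exact: archi_boundP.
have sub1 (A : set (measurableTypeR R)) : measurable A -> <<s G >> (fst @^-1` A).
  rewrite [measurable](RGenOInfty.measurableE R).
  move=> /(_ (image_set_system setT fst <<s G >>)); rewrite /image_set_system /= setTI.
  apply; split; first exact: sigma_algebra_image.
  move=> _ [a ->] /=; rewrite setTI.
  have -> : (fst @^-1` `]a, +oo[ : set RR) = \bigcup_k (`]a, +oo[ `*` `](- k%:R), +oo[).
    by rewrite -setX_bigcupr ray_cover; apply/seteqP; split => -[x y] // [].
  apply: sigma_algebra_bigcup => // k; apply: sub_sigma_algebra.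
  by exists a, (- k%:R).
have sub2 (A : set (measurableTypeR R)) : measurable A -> <<s G >> (snd @^-1` A).
  rewrite [measurable](RGenOInfty.measurableE R).
  move=> /(_ (image_set_system setT snd <<s G >>)); rewrite /image_set_system /= setTI.
  apply; split; first exact: sigma_algebra_image.
  move=> _ [a ->] /=; rewrite setTI.
  have -> : (snd @^-1` `]a, +oo[ : set RR) = \bigcup_k (`](- k%:R), +oo[ `*` `]a, +oo[).
    by rewrite -setX_bigcupl ray_cover; apply/seteqP; split => -[x y] // [].
  apply: sigma_algebra_bigcup => // k; apply: sub_sigma_algebra.
  by exists (- k%:R), a.
rewrite measurable_prod_measurableType; apply: smallest_sub => //.
move=> _ [A mA [B mB <-]].
rewrite (_ : A `*` B = fst @^-1` A `&` snd @^-1` B)//.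
by apply: (@measurableI _ (g_sigma_algebraType G)); [exact: sub1|exact: sub2].
Qed.

(** The class [cw_good] contains the constants, is stable under multiplication
    by cosines of linear forms and under bounded limits; it therefore contains
    the indicators of half planes and of quadrants, and quadrants generate the
    Borel sets. No inversion of characteristic functions is involved. *)
Lemma cramer_wold2 A : measurable A -> mu A = nu A.
Proof.
apply: (@measure_unique _ R RR _ (fun k => `](- k%:R : R), +oo[ `*` `](- k%:R), +oo[)
  measurable_ray_rects) => //.
- move=> _ _ [a [b ->]] [a' [b' ->]]; rewrite -setXI.
  exists (Num.max a a'), (Num.max b b'); congr (_ `*` _).
    by apply/seteqP; split => x /=; rewrite !in_itv/= !andbT gt_max => /andP.
  by apply/seteqP; split => x /=; rewrite !in_itv/= !andbT gt_max => /andP.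
- by move=> k; exists (- k%:R), (- k%:R).
- apply/seteqP; split => // -[x y] _.
  exists (maxn (Num.bound `|x|) (Num.bound `|y|)) => //=.
  rewrite !in_itv/= !andbT; split; rewrite ltrNl.
    rewrite (le_lt_trans (ler_norm _))// normrN.
    have /lt_le_trans := archi_boundP (normr_ge0 x); apply.
    by rewrite ler_nat leq_maxl.
  rewrite (le_lt_trans (ler_norm _))// normrN.
  have /lt_le_trans := archi_boundP (normr_ge0 y); apply.
  by rewrite ler_nat leq_maxr.
- by move=> _ [a [b ->]]; exact: ray_rect_eq.
- move=> k; apply: le_lt_trans (probability_le1 mu _) (ltry 1).
  by apply: measurableX => //; exact: measurable_itv.
Qed.

End cramer_wold.

(** * Linear forms in Gaussian variables *)

Section density.
Local Open Scope ereal_scope.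
Context d (T : measurableType d) (R : realType).
Variables (mu nu : {measure set T -> \bar R}) (h : T -> R).
Hypotheses (mh : measurable_fun setT h) (h0 : forall x, (0 <= h x)%R).
Hypothesis nuE : forall A, measurable A -> nu A = \int[mu]_(x in A) (h x)%:E.

Import HBNNSimple.

Let density_nnsfun (f : {nnsfun T >-> R}) :
  \int[nu]_x (f x)%:E = \int[mu]_x ((f x)%:E * (h x)%:E).
Proof.
under [LHS]eq_integral do rewrite fimfunE -fsumEFin//.
rewrite [LHS]ge0_integral_fsum//; last 2 first.
  - by move=> r; exact/measurable_EFinP/measurableT_comp.
  - by move=> n x _; rewrite EFinM nnfun_muleindic_ge0.
under [RHS]eq_integral.
  move=> x xD; rewrite fimfunE -fsumEFin// muleC ge0_mule_fsumr; last first.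
    by move=> r; rewrite EFinM nnfun_muleindic_ge0.
  over.
rewrite [RHS]ge0_integral_fsum//; last 2 first.
  - move=> r; apply: emeasurable_funM; first exact/measurable_EFinP.
    by apply/measurable_EFinP; apply/measurableT_comp.
  - by move=> r x _; rewrite mule_ge0 ?lee_fin// -lee_fin EFinM nnfun_muleindic_ge0.
apply: eq_fsbigr => r _.
under eq_integral do rewrite EFinM.
rewrite integralZl_indic_nnsfun//= integral_indic// setIT nuE//.
transitivity (\int[mu]_x (r%:E * (\1_(f @^-1` [set r]) x * h x)%:E)); last first.
  by apply: eq_integral => x _; rewrite -!EFinM; congr EFin; ring.
have [r0|r0] := leP 0%R r.
  rewrite ge0_integralZl//; last 2 first.
  - apply/measurable_EFinP; apply: measurable_funM => //.
  - by move=> x _; rewrite lee_fin mulr_ge0.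
  congr (_ * _); rewrite integral_mkcond; apply: eq_integral => x _.
  by rewrite patchE indicE; case: (x \in _); rewrite ?mul1r ?mul0r.
rewrite preimage_nnfun0// integral_set0 mule0.
by rewrite integral0_eq// => x _; rewrite indic0 mul0r mule0.
Qed.

(** Simple functions first, then monotone convergence. *)
Lemma ge0_integral_density (f : T -> \bar R) : measurable_fun setT f ->
  (forall x, 0 <= f x) -> \int[nu]_x f x = \int[mu]_x (f x * (h x)%:E).
Proof.
move=> mf f0; pose f_ := nnsfun_approx measurableT mf.
transitivity (limn (fun n => \int[nu]_x (f_ n x)%:E)).
  rewrite -monotone_convergence//=.
  - apply: eq_integral => x /[!inE] xD; apply/esym/cvg_lim => //=.
    by apply: cvg_nnsfun_approx.
  - by move=> n; apply: measurableT_comp => //; exact: measurable_funTS.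
  - by move=> n x _; rewrite lee_fin.
  - by move=> x _ a b ab; rewrite lee_fin//; exact/lefP/nd_nnsfun_approx.
transitivity (limn (fun n => \int[mu]_x ((f_ n x)%:E * (h x)%:E))).
  by congr (limn _); apply/funext => n; exact: density_nnsfun.
rewrite -monotone_convergence//=.
- apply: eq_integral => x /[!inE] xD; apply/cvg_lim => //.
  by apply: cvgeZr => //; apply: cvg_nnsfun_approx.
- by move=> n; apply: emeasurable_funM; exact/measurable_EFinP.
- by move=> n x _; rewrite mule_ge0 ?lee_fin.
- move=> x _ a b ab; rewrite lee_pmul ?lee_fin//.
  by exact/lefP/nd_nnsfun_approx.
Qed.

End density.

Section normal_facts.
Variable R : realType.
Notation leb := (@lebesgue_measure R).
Notation RT := (measurableTypeR R).
Implicit Types (f : RT -> \bar R) (m s : R).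

Lemma normal_integral m s f : measurable_fun setT f -> (forall x, 0 <= f x)%E ->
  (\int[normal_prob m s]_x f x = \int[leb]_x (f x * (normal_pdf m s x)%:E))%E.
Proof.
move=> mf f0; apply: ge0_integral_density => //.
  exact: measurable_normal_pdf.
by move=> x; exact: normal_pdf_ge0.
Qed.

Definition affine m s (x : RT) : RT := m + s * x.

Lemma measurable_affine m s : measurable_fun setT (affine m s).
Proof. by apply: measurable_funD => //; apply: measurable_funM. Qed.

HB.instance Definition _ m s :=
  isMeasurableFun.Build _ _ _ _ (affine m s) (measurable_affine m s).

Lemma lebesgue_affine m s f : s != 0 -> measurable_fun setT f ->
  (forall x, 0 <= f x)%E ->
  (\int[leb]_x f x = `|s|%:E * \int[leb]_x f (affine m s x))%E.
Proof.
move=> s0 mf f0.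
have s_gt0 : 0 < `|s| by rewrite normr_gt0.
pose k := NngNum (ltW s_gt0).
have E A : measurable A -> leb A = mscale k (pushforward leb (affine m s)) A.
  apply: lebesgue_measure_unique => _ [[a b]] _ <-.
  symmetry; transitivity (k%:num%:E * leb (affine m s @^-1` `]a, b]%classic))%E => //=.
  have [sp|sn|/eqP] := ltgtP 0 s; last by rewrite eq_sym (negPf s0).
    rewrite [X in (_ * leb X)%E](_ : _ =
        `](a - m) / s, (b - m) / s]%classic); last first.
      apply/seteqP; split => x /=; rewrite !in_itv/= /affine;
        by rewrite ltr_pdivrMr// ler_pdivlMr// ltrBlDl lerBrDl mulrC.
    rewrite !lebesgue_measure_itv/= !lte_fin ltr_pM2r ?invr_gt0// ltrD2r.
    case: ifPn => ab; last by rewrite mule0.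
    by rewrite (gtr0_norm sp) -EFinB -EFinM; congr EFin; field.
  rewrite [X in (_ * leb X)%E](_ : _ =
      `[(b - m) / s, (a - m) / s[%classic); last first.
    apply/seteqP; split => x /=; rewrite !in_itv/= /affine;
      by rewrite ltr_ndivlMr// ler_ndivrMr// ltrBlDl lerBrDl mulrC andbC.
  rewrite !lebesgue_measure_itv/= !lte_fin ltr_nM2r ?invr_lt0// ltrD2r.
  case: ifPn => ab; last by rewrite mule0.
  by rewrite (ltr0_norm sn) -EFinB -EFinM; congr EFin; field.
rewrite (eq_measure_integral (mscale k (pushforward leb (affine m s)))); last first.
  by move=> A mA _; exact: E.
rewrite ge0_integral_mscale//; congr (_ * _)%E.
by rewrite ge0_integral_pushforward.
Qed.

(** The standard normal law, sealed so that unification never unfolds it into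
    an integral against the Lebesgue measure. *)
Fact gauss_subproof : {P : probability RT R | P = normal_prob (0 : R) 1 :> probability RT R}.
Proof. by exists (normal_prob (0 : R) 1 : probability RT R). Qed.

Definition gauss : probability RT R := sval gauss_subproof.

Lemma gaussE : gauss = normal_prob (0 : R) 1 :> probability RT R.
Proof. by rewrite /gauss; case: gauss_subproof. Qed.

Lemma normal_affine m s f : s != 0 -> measurable_fun setT f ->
  (forall x, 0 <= f x)%E ->
  (\int[normal_prob m s]_x f x = \int[gauss]_x f (affine m s x))%E.
Proof.
move=> s0 mf f0; rewrite gaussE.
have mfa : measurable_fun setT (f \o affine m s).
  by apply: measurableT_comp => //; exact: measurable_affine.
transitivity (\int[leb]_x (f x * (normal_pdf m s x)%:E))%E.
  exact: normal_integral.
transitivity (\int[leb]_x (f (affine m s x) * (normal_pdf 0 1 x)%:E))%E; last first.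
  by symmetry; apply: (normal_integral 0 1 mfa) => x; exact: f0.
rewrite (@lebesgue_affine m s)//; last 2 first.
- apply: emeasurable_funM => //; apply/measurable_EFinP.
  exact: measurable_normal_pdf.
- by move=> x; rewrite mule_ge0 ?lee_fin ?normal_pdf_ge0.
rewrite -ge0_integralZl//; last 2 first.
- apply: emeasurable_funM => //; apply/measurable_EFinP.
  apply: measurableT_comp; first exact: measurable_normal_pdf.
  exact: measurable_affine.
- by move=> x _; rewrite mule_ge0 ?lee_fin ?normal_pdf_ge0.
apply: eq_integral => x _; rewrite muleCA; congr (_ * _)%E.
rewrite -EFinM; congr EFin.
rewrite !normal_pdfE ?oner_neq0// /normal_peak /normal_fun /affine.
rewrite (_ : m + s * x - m = s * x); last by ring.
rewrite subr0 expr1n -mulr_natr (sqrtrM _ (_ : 0 <= _ ^+ 2 * pi)); last first.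
  by rewrite mulr_ge0 ?sqr_ge0 ?pi_ge0.
rewrite -(mulr_natr (1 * pi)) (sqrtrM _ (_ : 0 <= 1 * pi)); last first.
  by rewrite mulr_ge0 ?pi_ge0.
rewrite (sqrtrM _ (sqr_ge0 s)) mul1r sqrtr_sqr mulrA; congr (_ * expR _).
  rewrite !invfM !mulrA divff ?normr_eq0// mul1r//.
by field.
Qed.

(** Bayes' formula for a normal mean: prior times likelihood is marginal times
    posterior. Integrating the posterior out yields the convolution of two
    normal laws. *)
Lemma normal_pdf_conv m s1 s2 x y : s1 != 0 -> s2 != 0 ->
  normal_pdf x s2 y * normal_pdf m s1 x =
  normal_pdf m (Num.sqrt (s1 ^+ 2 + s2 ^+ 2)) y *
  normal_pdf ((s2 ^+ 2 * m + s1 ^+ 2 * y) / (s1 ^+ 2 + s2 ^+ 2))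
    (s1 * s2 / Num.sqrt (s1 ^+ 2 + s2 ^+ 2)) x.
Proof.
move=> s10 s20.
have s1p : 0 < s1 ^+ 2 by rewrite exprn_even_gt0.
have s2p : 0 < s2 ^+ 2 by rewrite exprn_even_gt0.
have Sp : 0 < s1 ^+ 2 + s2 ^+ 2 by rewrite addr_gt0.
set S := Num.sqrt _.
have S0 : 0 < S by rewrite sqrtr_gt0.
have S2 : S ^+ 2 = s1 ^+ 2 + s2 ^+ 2 by rewrite sqr_sqrtr// ltW.
have Sn : S != 0 by rewrite lt0r_neq0.
have ns : s1 * s2 / S != 0 by rewrite !mulf_neq0 ?invr_eq0.
rewrite !normal_pdfE//.
rewrite /normal_peak /normal_fun mulrACA [RHS]mulrACA -!expRD; congr (_ * expR _).
  rewrite -!invfM; congr (_^-1).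
  have pos (t : R) : 0 <= t ^+ 2 * pi *+ 2.
    by rewrite mulrn_wge0// mulr_ge0 ?pi_ge0 ?sqr_ge0.
  rewrite -(sqrtrM _ (pos s2)) -(sqrtrM _ (pos S)).
  congr Num.sqrt; rewrite expr_div_n exprMn S2; field.
  exact: lt0r_neq0.
rewrite expr_div_n exprMn S2; field.
by rewrite s10 s20 lt0r_neq0.
Qed.

Lemma measurable_normal_pdf2 s :
  measurable_fun setT (fun z : RT * RT => normal_pdf z.1 s z.2).
Proof.
have [->|s0] := eqVneq s 0.
  rewrite (_ : (fun z => _) = (fun z : RT * RT => (normal_pdf 0 0 z.2 : R))).
    by apply: measurableT_comp => //; exact: measurable_normal_pdf.
  by apply/funext => z; rewrite /normal_pdf eqxx.
under eq_fun do rewrite normal_pdfE//.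
apply: measurable_funM => //; apply: measurableT_comp => //.
apply: measurable_funM => //; apply: measurableT_comp => //.
apply: measurable_funX; apply: measurable_funB => //.
Qed.

Lemma measurable_normal_kernel b f : measurable_fun setT f ->
  (forall x, 0 <= f x)%E ->
  measurable_fun setT (fun x : RT => \int[normal_prob x b]_y f y)%E.
Proof.
move=> mf f0; pose F1 (z : RT * RT) := (f z.2 * (normal_pdf z.1 b z.2)%:E)%E.
have -> : (fun x : RT => \int[normal_prob x b]_y f y)%E = fubini_F leb F1.
  by apply/funext => x; rewrite normal_integral.
  apply: (@measurable_fun_fubini_tonelli_F _ _ _ _ R leb).
    apply: emeasurable_funM; first by apply: measurableT_comp.
    by apply/measurable_EFinP; exact: measurable_normal_pdf2.
  by move=> z; rewrite mule_ge0// lee_fin normal_pdf_ge0.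
Qed.

Lemma normal_conv m s1 s2 f : s1 != 0 -> s2 != 0 -> measurable_fun setT f ->
  (forall x, 0 <= f x)%E ->
  (\int[normal_prob m s1]_x \int[normal_prob x s2]_y f y =
   \int[normal_prob m (Num.sqrt (s1 ^+ 2 + s2 ^+ 2))]_y f y)%E.
Proof.
move=> s10 s20 mf f0.
pose F (z : RT * RT) := (f z.2 * (normal_pdf z.1 s2 z.2 * normal_pdf m s1 z.1)%:E)%E.
have mF : measurable_fun setT F.
  apply: emeasurable_funM; first by apply: measurableT_comp.
  apply/measurable_EFinP; apply: measurable_funM.
    exact: measurable_normal_pdf2.
  by apply: measurableT_comp => //; exact: measurable_normal_pdf.
have F0 z : (0 <= F z)%E.
  by rewrite mule_ge0// lee_fin mulr_ge0 ?normal_pdf_ge0.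
have inner x : (\int[normal_prob x s2]_y f y * (normal_pdf m s1 x)%:E =
    \int[leb]_y F (x, y))%E.
  rewrite normal_integral// -ge0_integralZr//; last 3 first.
  - apply: emeasurable_funM => //; apply/measurable_EFinP.
    exact: measurable_normal_pdf.
  - by move=> y _; rewrite mule_ge0 ?lee_fin ?normal_pdf_ge0.
  - by rewrite lee_fin normal_pdf_ge0.
  by apply: eq_integral => y _; rewrite /F /= EFinM muleA.
transitivity (\int[leb]_x \int[leb]_y F (x, y))%E.
  have fub : measurable_fun setT (fun x => \int[leb]_y F (x, y))%E.
    exact: (@measurable_fun_fubini_tonelli_F _ _ _ _ R leb _ mF F0).
  rewrite normal_integral.
  - by apply: eq_integral => x _; rewrite inner.
  - exact: measurable_normal_kernel.
  - by move=> x; apply: integral_ge0.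
rewrite (@fubini_tonelli _ _ _ _ R leb leb F mF F0) normal_integral//.
apply: eq_integral => y _; rewrite /fubini_G.
transitivity (\int[leb]_x ((f y * (normal_pdf m (Num.sqrt (s1 ^+ 2 + s2 ^+ 2)) y)%:E) *
  (normal_pdf ((s2 ^+ 2 * m + s1 ^+ 2 * y) / (s1 ^+ 2 + s2 ^+ 2))
    (s1 * s2 / Num.sqrt (s1 ^+ 2 + s2 ^+ 2)) x)%:E))%E.
  by apply: eq_integral => x _; rewrite /F/= normal_pdf_conv// EFinM muleA.
rewrite ge0_integralZl//.
- by rewrite integral_normal_pdf mule1.
- by apply/measurable_EFinP; exact: measurable_normal_pdf.
- by move=> x _; rewrite lee_fin normal_pdf_ge0.
- by rewrite mule_ge0// lee_fin normal_pdf_ge0.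
Qed.

Lemma normal_pdf_norm m s : normal_pdf m `|s| = normal_pdf m s.
Proof.
by apply/funext => x; rewrite /normal_pdf normr_eq0 /normal_peak /normal_fun real_normK ?num_real.
Qed.

Local Notation N01 := gauss.

Lemma ge0_normal_lin1 m a f : measurable_fun setT f -> (forall x, 0 <= f x)%E ->
  (\int[N01]_u f (m + a * u)%R = \int[N01]_u f (m + `|a| * u)%R)%E.
Proof.
move=> mf f0; have [->|a0] := eqVneq a 0; first by rewrite normr0.
have a0' : `|a| != 0 by rewrite normr_eq0.
rewrite -(normal_affine m a0 mf f0) -(normal_affine m a0' mf f0).
rewrite (normal_integral m a mf f0) [RHS](normal_integral m `|a| mf f0).
by rewrite normal_pdf_norm.
Qed.

Lemma ge0_normal_lin2 m a b f : measurable_fun setT f -> (forall x, 0 <= f x)%E ->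
  (\int[N01]_u \int[N01]_v f (m + a * u + b * v)%R =
   \int[N01]_w f (m + Num.sqrt (a ^+ 2 + b ^+ 2) * w)%R)%E.
Proof.
move=> mf f0.
have mfa k s : measurable_fun setT (fun x => f (k + s * x)%R).
  by apply: (measurableT_comp mf); exact: measurable_affine.
have [->|a0] := eqVneq a 0.
  under eq_integral do under eq_integral do rewrite mul0r addr0.
  rewrite integral_cst//= [X in (_ * X)%E]probability_setT mule1.
  by rewrite expr0n/= add0r sqrtr_sqr; exact: ge0_normal_lin1.
have [->|b0] := eqVneq b 0.
  rewrite expr0n/= addr0 sqrtr_sqr -ge0_normal_lin1//.
  apply: eq_integral => u _.
  under eq_integral do rewrite mul0r addr0.
  by rewrite integral_cst//= [X in (_ * X)%E]probability_setT mule1.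
have inner u : (\int[N01]_v f (m + a * u + b * v)%R =
    \int[normal_prob (affine m a u) b]_y f y)%E.
  by rewrite (normal_affine _ b0).
under eq_integral do rewrite inner.
have mg := measurable_normal_kernel b mf f0.
rewrite -(normal_affine m a0 mg); last by move=> x; exact: integral_ge0.
rewrite normal_conv// normal_affine//.
by rewrite lt0r_neq0// sqrtr_gt0 addr_gt0// exprn_even_gt0.
Qed.

(** As an affine image of the standard normal law, a normal law with variance 0
    needs no separate treatment. *)
Lemma normal_lawE m v (A : set RT) : 0 <= v -> measurable A ->
  normal_law m v A = N01 [set w | A (m + Num.sqrt v * w)].
Proof.
move=> v0 mA; rewrite /normal_law; case: eqVneq => [->|vn].
  rewrite sqrtr0; under eq_set do rewrite mul0r addr0.
  rewrite diracE; case: (pselect (A m)) => Am.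
    rewrite mem_set//= (_ : [set _ | _] = setT) ?probability_setT//.
    by apply/seteqP; split.
  rewrite memNset//= (_ : [set _ | _] = set0) ?measure0//.
  by apply/seteqP; split.
have s0 : Num.sqrt v != 0 by rewrite sqrtr_eq0 -ltNge lt_def vn.
have mpre : measurable [set w : RT | A (m + Num.sqrt v * w)].
  by have := measurable_affine m (Num.sqrt v) measurableT mA; rewrite setTI.
transitivity (\int[normal_prob m (Num.sqrt v)]_x (\1_A x)%:E)%E.
  by rewrite integral_indic// setIT.
have mi : measurable_fun setT (fun x : RT => (\1_A x : R)%:E).
  by apply/measurable_EFinP; exact: measurable_indic.
rewrite (normal_affine m s0 mi); last by move=> x; rewrite lee_fin.
by rewrite -[LHS]/(\int[N01]_x (\1_[set w | A (m + Num.sqrt v * w)] x)%:E)%E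
  integral_indic// setIT.
Qed.

Lemma Rint_normal_lin2 m a b (g : RT -> R) : bounded_measurable g ->
  \int[N01]_u \int[N01]_v g (m + a * u + b * v) =
  \int[N01]_w g (m + Num.sqrt (a ^+ 2 + b ^+ 2) * w).
Proof.
move=> bg; have [mg [M gM]] := bg.
have H (h : RT -> R) : bounded_measurable h -> (forall x, 0 <= h x) ->
    \int[N01]_u \int[N01]_v h (m + a * u + b * v) =
    \int[N01]_w h (m + Num.sqrt (a ^+ 2 + b ^+ 2) * w).
  move=> bh h0; have [mh _] := bh.
  have := @ge0_normal_lin2 m a b (EFin \o h).
  move=> /(_ _ _)/(congr1 fine) E.
  rewrite {1}/Rintegral; rewrite [RHS]/Rintegral -E; last 2 first.
  - exact/measurable_EFinP.
  - by move=> x; rewrite lee_fin.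
  congr fine; apply: eq_integral => u _.
  rewrite -EFin_Rint//; apply: bmf_comp bh.
  exact: (measurable_affine (m + a * u) b).
have bM c : bounded_measurable (fun x : RT => g (m + c * x) + M).
  apply: bmfD; last exact: bmf_cst.
  by apply: bmf_comp bg; exact: (measurable_affine m c).
have bMg : bounded_measurable (fun x : RT => g x + M).
  by apply: bmfD => //; exact: bmf_cst.
have := H _ bMg.
have gM0 x : 0 <= g x + M by have := gM x; rewrite ler_norml; lra.
move=> /(_ gM0).
rewrite RintD; last 2 first.
- by apply: bmf_comp bg; exact: (measurable_affine m).
- exact: bmf_cst.
rewrite Rint_cst => E; apply: (addIr M); rewrite -E.
have b2 : bounded_measurable (fun z : RT * RT => g (m + a * z.1 + b * z.2)).
  apply: bmf_comp bg; apply: measurable_funD; first apply: measurable_funD => //.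
    by apply: measurable_funM.
  by apply: measurable_funM.
rewrite -[X in _ + X](Rint_cst N01) -RintD; last 2 first.
- exact: (bmf_fubini1 N01 N01 b2).
- exact: bmf_cst.
apply: eq_Rintegral => u _.
rewrite RintD; last 2 first.
- exact: (bmf_pairl b2).
- exact: bmf_cst.
by rewrite Rint_cst.
Qed.

(** Coordinates are added one at a time, each time merging two independent
    normal variables into one. *)
Lemma Rint_linform n (nu : probability (n.-tuple RT) R) (c : 'I_n -> R) m (g : RT -> R) :
  iid N01 nu -> bounded_measurable g ->
  \int[nu]_w g (m + \sum_l c l * tnth w l) =
  \int[N01]_w g (m + Num.sqrt (\sum_l c l ^+ 2) * w).
Proof.
move=> inu.
suff H (r : seq 'I_n) : uniq r -> forall g : RT -> R, bounded_measurable g ->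
    \int[nu]_w g (m + \sum_(l <- r) c l * tnth w l) =
    \int[N01]_w g (m + Num.sqrt (\sum_(l <- r) c l ^+ 2) * w).
  by move=> bg; apply: H => //; exact: index_enum_uniq.
elim: r => [_ {}g bg|k r IH /= /andP[kr ur] {}g bg].
  under eq_Rintegral do rewrite big_nil addr0.
  rewrite Rint_cst big_nil sqrtr0.
  by under eq_Rintegral do rewrite mul0r addr0; rewrite Rint_cst.
have mS : measurable_fun setT (fun w : n.-tuple RT =>
    m + \sum_(l <- (k :: r)) c l * tnth w l : R).
  apply: measurable_funD => //; apply: measurable_sum => l.
  by apply: measurable_funM => //; exact: measurable_tnth.
rewrite (Rint_set_coord inu k); last by apply: bmf_comp bg; exact: mS.
have b2 : bounded_measurable (fun z : RT * RT => g (z.1 + c k * z.2)).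
  by apply: bmf_comp bg; apply: measurable_funD => //; apply: measurable_funM.
rewrite big_cons.
transitivity (\int[nu]_w \int[N01]_t g (m + \sum_(l <- r) c l * tnth w l + c k * t)).
  apply: eq_Rintegral => w _; apply: eq_Rintegral => t _; congr g.
  rewrite big_cons tnth_set_coord eqxx [c k * t + _]addrC addrA; congr (_ + _ + _).
  apply: eq_big_seq => l lr; rewrite tnth_set_coord.
  by case: eqP => // lk; rewrite -lk lr in kr.
rewrite (IH ur (fun x => \int[N01]_t g (x + c k * t))); last exact: (bmf_fubini1 N01 N01 b2).
rewrite Rint_normal_lin2// sqr_sqrtr; last by apply: sumr_ge0 => l _; exact: sqr_ge0.
by rewrite addrC.
Qed.

End normal_facts.

(** * The law of two coordinates of a Gaussian vector *)

Lemma measurable_map_tnth d (T : measurableType d) d' (U : measurableType d') n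
    (phi : T -> U) : measurable_fun setT phi ->
  measurable_fun setT (fun x : n.-tuple T => [tuple phi (tnth x k) | k < n]).
Proof.
move=> mphi; apply/measurable_fun_tnthP => k.
rewrite (_ : _ \o _ = fun x => phi (tnth x k)).
  exact: (measurableT_comp mphi (measurable_tnth k)).
by apply/funext => x /=; rewrite tnth_mktuple.
Qed.

(** Both sides are the expectation of [f] under independent copies of the
    common law of [phi] and [psi]. *)
Lemma iid_transfer d (T : measurableType d) d' (T' : measurableType d')
    d'' (U : measurableType d'') (R : realType) n
    (P : probability T R) (Q : probability (n.-tuple T) R)
    (P' : probability T' R) (Q' : probability (n.-tuple T') R)
    (phi : T -> U) (psi : T' -> U) (f : n.-tuple U -> R) :
  iid P Q -> iid P' Q' -> measurable_fun setT phi -> measurable_fun setT psi ->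
  (forall A, measurable A -> P (phi @^-1` A) = P' (psi @^-1` A)) ->
  bounded_measurable f ->
  \int[Q]_x f [tuple phi (tnth x k) | k < n] =
  \int[Q']_x f [tuple psi (tnth x k) | k < n].
Proof.
move=> iQ iQ' mphi mpsi PP' bf.
pose phiM : {mfun T >-> U} := HB.pack phi (isMeasurableFun.Build _ _ _ _ _ mphi).
pose psiM : {mfun T' >-> U} := HB.pack psi (isMeasurableFun.Build _ _ _ _ _ mpsi).
pose S := power_prob (distribution P phiM : probability U R) n.
have iS : iid (distribution P phiM : probability U R) S by exact: iid_power.
transitivity (\int[S]_x f x).
  have := iid_Rint_eq (S := Q) iS (@measurable_map_tnth _ _ _ _ n _ mphi) _ bf.
  move=> H; symmetry; apply: H => B mB.
  rewrite -(iQ (fun k => phi @^-1` B k)); last first.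
    by move=> k; rewrite -[X in measurable X]setTI; exact: (mphi measurableT _ (mB k)).
  congr (Q _); apply/seteqP; split => x /= h k; have := h k; rewrite tnth_mktuple//.
have := iid_Rint_eq (S := Q') iS (@measurable_map_tnth _ _ _ _ n _ mpsi) _ bf.
apply => B mB.
transitivity (\prod_k P' (psi @^-1` B k))%E; last first.
  by apply: eq_bigr => k _; symmetry; exact: PP'.
rewrite -(iQ' (fun k => psi @^-1` B k)); last first.
  by move=> k; rewrite -[X in measurable X]setTI; exact: (mpsi measurableT _ (mB k)).
congr (Q' _); apply/seteqP; split => x /= h k; have := h k; rewrite tnth_mktuple//.
Qed.

Section gaussian_pair.
Variable R : realType.
Local Notation RT := (measurableTypeR R).
Local Notation RR := (RT * RT)%type.

Definition gauss2 : probability RR R := (gauss R \x gauss R)%E.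

(** Turns a standard Gaussian pair into one with means [m1], [m2], standard
    deviations [s1], [s2] and correlation [r]. *)
Definition corr_map (m1 s1 m2 s2 r : R) (z : RR) : RR :=
  (m1 + s1 * z.1, m2 + s2 * (r * z.1 + Num.sqrt (1 - r ^+ 2) * z.2)).

Lemma measurable_corr_map m1 s1 m2 s2 r : measurable_fun setT (corr_map m1 s1 m2 s2 r).
Proof.
apply/measurable_fun_pairP; split.
  by apply: measurable_funD => //; apply: measurable_funM.
apply: measurable_funD => //; apply: measurable_funM => //.
by apply: measurable_funD => //; apply: measurable_funM.
Qed.

Variables (p : nat) (mu : 'cV[R]_p) (Sigma : 'M[R]_p) (P : probability (p.-tuple RT) R).
Hypothesis mP : multinormal mu Sigma P.
Hypothesis S0 : forall i, 0 < Sigma i i.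

Let comb (i j : 'I_p) (a b : R) : 'rV[R]_p := a *: delta_mx 0 i + b *: delta_mx 0 j.

Let comb_quad i j a b : (comb i j a b *m Sigma *m (comb i j a b)^T) 0 0 =
  a ^+ 2 * Sigma i i + a * b * Sigma i j * 2 + b ^+ 2 * Sigma j j.
Proof.
have [sym _ _] := mP.
have Sji : Sigma j i = Sigma i j by rewrite -[in LHS]sym mxE.
have E (v : 'rV[R]_p) k : (v *m (delta_mx 0 k : 'rV[R]_p)^T) 0 0 = v 0 k.
  by rewrite trmx_delta -colE mxE.
rewrite /comb linearD/= !linearZ/= mulmxDr -!scalemxAr.
rewrite mxE [X in X + _]mxE [X in _ + X]mxE !E.
rewrite !mulmxDl -!scalemxAl -!rowE !mxE Sji; ring.
Qed.

Let comb_mean i j a b : (comb i j a b *m mu) 0 0 = a * mu i 0 + b * mu j 0.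
Proof.
rewrite /comb mulmxDl -!scalemxAl -!rowE mxE.
by congr (_ + _); rewrite mxE [in LHS]mxE.
Qed.

Let comb_form i j a b (x : p.-tuple RT) :
  \sum_k comb i j a b 0 k * tnth x k = a * tnth x i + b * tnth x j :> R.
Proof.
have E c k : \sum_l (c *: delta_mx 0 k : 'rV[R]_p) 0 l * tnth x l = c * tnth x k :> R.
  rewrite (bigD1 k)//= !mxE !eqxx mulr1 big1 ?addr0// => l lk.
  by rewrite !mxE (negPf lk) andbF mulr0 mul0r.
rewrite -!E -big_split/=; apply: eq_bigr => k _.
by rewrite [X in X * _]mxE mulrDl.
Qed.

(** Cauchy-Schwarz: the quadratic form of [Sigma] is nonnegative at the vector
    with entries [Sigma i j] and [- Sigma i i] at positions [i] and [j]. *)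
Lemma corr_sqr_le1 i j : corrmx Sigma i j ^+ 2 <= 1.
Proof.
have [sym psd _] := mP.
have Si := S0 i; have Sj := S0 j.
rewrite mxE expr_div_n exprMn (sqr_sqrtr (ltW Si)) (sqr_sqrtr (ltW Sj)).
rewrite ler_pdivrMr ?mulr_gt0// mul1r.
have := psd (comb i j (Sigma i j) (- Sigma i i)).
rewrite comb_quad => H.
have : 0 <= Sigma i i * (Sigma i i * Sigma j j - Sigma i j ^+ 2) by nra.
by rewrite pmulr_rge0// subr_ge0.
Qed.

(** By the Cramer-Wold device it suffices to compare linear forms in the two
    coordinates; these are linear forms in the whole vector, so both sides are
    normal with the same mean and variance. *)
Lemma pair_law i j (A : set RR) : measurable A ->
  P [set x | A (tnth x i, tnth x j)] =
  gauss2 [set z | A (corr_map (mu i 0) (Num.sqrt (Sigma i i))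
                     (mu j 0) (Num.sqrt (Sigma j j)) (corrmx Sigma i j) z)].
Proof.
move=> mA; have [sym psd law] := mP.
set phi := corr_map _ _ _ _ _.
have mphi : measurable_fun setT phi := measurable_corr_map _ _ _ _ _.
have mpr : measurable_fun setT (fun x : p.-tuple RT => (tnth x i, tnth x j)).
  by apply/measurable_fun_pairP; split; exact: measurable_tnth.
pose phiM : {mfun RR >-> RR} := HB.pack phi (isMeasurableFun.Build _ _ _ _ _ mphi).
pose prM : {mfun p.-tuple RT >-> RR} :=
  HB.pack (fun x : p.-tuple RT => (tnth x i, tnth x j)) (isMeasurableFun.Build _ _ _ _ _ mpr).
apply: (@cramer_wold2 R (distribution P prM) (distribution gauss2 phiM)) mA => a b B mB.
rewrite /distribution /pushforward /=.
transitivity (P [set x | B (\sum_k comb i j a b 0 k * tnth x k)]).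
  by congr (P _); apply/seteqP; split => x /=; rewrite comb_form.
rewrite law// comb_mean comb_quad normal_lawE//; last by rewrite -comb_quad.
rewrite -(Rint_indic (gauss R)); last first.
  by have := measurable_affine (a * mu i 0 + b * mu j 0) (Num.sqrt (a ^+ 2 * Sigma i i
   + a * b * Sigma i j * 2 + b ^+ 2 * Sigma j j)) measurableT mB; rewrite setTI.
have mpre : measurable [set z : RR | B (a * (phi z).1 + b * (phi z).2)].
  have := measurableT_comp (measurable_linform a b) mphi measurableT mB.
  by rewrite setTI.
rewrite -(Rint_indic gauss2)//; congr EFin.
rewrite Rint_fubini1; last exact: bmf_indic.
set si := Num.sqrt (Sigma i i); set sj := Num.sqrt (Sigma j j); set r := corrmx Sigma i j.
set s := Num.sqrt (1 - r ^+ 2).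
have := @Rint_normal_lin2 R (a * mu i 0 + b * mu j 0) (a * si + b * sj * r) (b * sj * s) (\1_B) (bmf_indic R mB).
have -> : (a * si + b * sj * r) ^+ 2 + (b * sj * s) ^+ 2 =
   a ^+ 2 * Sigma i i + a * b * Sigma i j * 2 + b ^+ 2 * Sigma j j.
  have si2 : si ^+ 2 = Sigma i i by rewrite sqr_sqrtr// ltW.
  have sj2 : sj ^+ 2 = Sigma j j by rewrite sqr_sqrtr// ltW.
  have s2 : s ^+ 2 = 1 - r ^+ 2 by rewrite sqr_sqrtr// subr_ge0 corr_sqr_le1.
  have rE : si * sj * r = Sigma i j.
    rewrite /r mxE -/si -/sj mulrC divfK//.
    by rewrite mulf_neq0// gt_eqF// sqrtr_gt0.
  rewrite -si2 -sj2 -rE.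
  have -> : (b * sj * s) ^+ 2 = b ^+ 2 * sj ^+ 2 * s ^+ 2 by ring.
  by rewrite s2; ring.
move=> <-.
apply: eq_Rintegral => u _; apply: eq_Rintegral => v _.
rewrite -[RHS]/(\1_B (a * (phi (u, v)).1 + b * (phi (u, v)).2)).
congr (\1_B _).
have : a * mu i 0 + b * mu j 0 + (a * si + b * sj * r) * (u : R) + b * sj * s * (v : R) =
  a * (mu i 0 + si * (u : R)) + b * (mu j 0 + sj * (r * (u : R) + s * (v : R))) by ring.
exact.
Qed.

End gaussian_pair.

(** * U-statistics of order two *)

Section elementary.
Variable R : realType.
Implicit Types (x t a b : R).

(** The mean value theorem, in the form that yields inequalities between
    elementary functions from the sign of a derivative. *)
Lemma le_of_deriv (f g : R -> R) a b : a <= b ->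
  (forall x, a <= x <= b -> is_derive x 1 f (g x)) ->
  (forall x, a <= x <= b -> 0 <= g x) -> f a <= f b.
Proof.
rewrite le_eqVlt => /predU1P[->//|ab] df g0.
have [c cab E] : exists2 c, c \in `]a, b[%R & f b - f a = g c * (b - a).
  apply: MVT => //.
    by move=> x; rewrite in_itv/= => /andP[ax xb]; apply: df; rewrite !ltW.
  apply: derivable_within_continuous => x; rewrite in_itv/= => xab.
  by apply: (@ex_derive _ _ _ _ _ _ _ (df x xab)).
move: cab; rewrite in_itv/= => /andP[ac cb].
by rewrite -subr_ge0 E mulr_ge0 ?subr_ge0 ?g0 ?ltW.
Qed.

Lemma expR_le_quad x : expR x <= 1 + x + x ^+ 2 / 2 * expR `|x|.
Proof.
have [x0|x0] := leP 0 x.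
  rewrite ger0_norm//.
  have := @le_of_deriv (fun x => 1 + x + x ^+ 2 / 2 * expR x - expR x)
    (fun x => 1 + x * expR x + x ^+ 2 / 2 * expR x - expR x) 0 x x0.
  rewrite expR0 expr0n/= !mul0r !addr0 subrr => H.
  rewrite -subr_ge0; apply: H => [y _|y /andP[y0 _]].
    by apply: is_derive_eq; rewrite /GRing.scale/=; field.
  have := expR_ge1Dx (- y); have ey := expR_gt0 y.
  have : expR y * expR (- y) = 1 by rewrite -expRD subrr expR0.
  nra.
rewrite ltr0_norm//.
have := @le_of_deriv (fun x => expR x - 1 - x - x ^+ 2 / 2) (fun x => expR x - 1 - x) x 0 (ltW x0).
rewrite expR0 expr0n/= => H.
have e1 : 1 <= expR (- x) by rewrite -expR0 ler_expR oppr_ge0 ltW.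
have : expR x - 1 - x - x ^+ 2 / 2 <= 0.
  apply: le_trans (H _ _) _; last by rewrite mul0r; lra.
    by move=> y _; apply: is_derive_eq; rewrite /GRing.scale/=; field.
  by move=> y _; have := expR_ge1Dx y; lra.
have : 0 <= x ^+ 2 / 2 by rewrite divr_ge0 ?sqr_ge0.
nra.
Qed.

Lemma ln1p_le_cubic x : -1 < x -> ln (1 + x) <= x - x ^+ 2 / 2 + x ^+ 3 / 3.
Proof.
move=> x1.
pose F := fun x : R => x - x ^+ 2 / 2 + x ^+ 3 / 3 - ln (1 + x).
pose G := fun x : R => x ^+ 3 / (1 + x).
have dF (y : R) : -1 < y -> is_derive y 1 F (G y).
  move=> y1; have y0 : 0 < 1 + y by lra.
  have := is_derive1_ln y0 => dln.
  apply: is_derive_eq; rewrite /GRing.scale/= /G; field; lra.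
have F0 : F 0 = 0 by rewrite /F addr0 ln1; field.
rewrite -subr_ge0 -/(F x) -F0.
have [x0|x0] := leP 0 x.
  apply: (le_of_deriv (f := F) (g := G) x0) => y /andP[y0 yx].
    by apply: dF; lra.
  by rewrite divr_ge0 ?exprn_ge0//; lra.
rewrite -lerN2; apply: (@le_of_deriv (fun x => - F x) (fun x => - G x)); first exact: ltW.
  by move=> y /andP[xy y0]; have := dF y (lt_le_trans x1 xy) => dFy; apply: is_deriveN.
move=> y /andP[xy y0]; rewrite -mulNr divr_ge0//; last lra.
rewrite oppr_ge0 exprS mulr_le0_ge0 ?sqr_ge0//.
Qed.

End elementary.

Section selections.
Context d (T : measurableType d).

Definition sel n m (e : 'I_m -> 'I_n) (x : n.-tuple T) : m.-tuple T :=
  [tuple tnth x (e k) | k < m].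

Lemma tnth_sel n m (e : 'I_m -> 'I_n) x k : tnth (sel e x) k = tnth x (e k).
Proof. by rewrite tnth_mktuple. Qed.

Lemma measurable_sel n m (e : 'I_m -> 'I_n) : measurable_fun setT (sel e).
Proof.
apply/measurable_fun_tnthP => k.
rewrite (_ : _ \o _ = fun x => tnth x (e k)); first exact: measurable_tnth.
by apply/funext => x /=; rewrite tnth_sel.
Qed.

End selections.

Lemma sum_offdiag (R : realType) n (a : R) :
  \sum_(k < n) \sum_(l < n | l != k) a = (n * n.-1)%:R * a.
Proof.
transitivity (\sum_(k < n) a *+ n.-1).
  apply: eq_bigr => k _; rewrite sumr_const; congr (_ *+ _).
  by have := cardC1 k; rewrite card_ord.
by rewrite sumr_const card_ord -mulrnA mulr_natl mulnC.
Qed.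

Lemma perm_two n (a a' b b' : 'I_n) : a != a' -> b != b' ->
  exists s : 'S_n, s b = a /\ s b' = a'.
Proof.
move=> aa bb; pose t := tperm b a.
exists (t * tperm (t b') a')%g; rewrite !permM; split; last by rewrite tpermL.
rewrite tpermL tpermD//; last by rewrite eq_sym.
by apply: contraNneq bb => tb; rewrite -(inj_eq (@perm_inj _ t)) tb tpermL.
Qed.

Section jensen.
Variable R : realType.

Lemma mean_cst (I : finType) (c : R) : (0 < #|I|)%N ->
  #|I|%:R^-1 * \sum_(i : I) c = c.
Proof. by move=> I0; rewrite sumr_const -[c *+ _]mulr_natl mulKf// pnatr_eq0 -lt0n. Qed.

Lemma mean_cst_ord N (c : R) : (0 < N)%N -> N%:R^-1 * \sum_(i < N) c = c.
Proof.
by move=> N0; have := @mean_cst 'I_N c; rewrite card_ord; apply.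
Qed.

(** Jensen's inequality, from the tangent to the exponential at the mean. *)
Lemma expR_mean_le (I : finType) (F : I -> R) : (0 < #|I|)%N ->
  expR (#|I|%:R^-1 * \sum_i F i) <= #|I|%:R^-1 * \sum_i expR (F i).
Proof.
move=> I0; have n0 : #|I|%:R != 0 :> R by rewrite pnatr_eq0 -lt0n.
set m := _ * \sum_i F i.
rewrite -ler_pdivrMl ?invr_gt0 ?ltr0n// invrK.
have : \sum_i expR m * (1 + (F i - m)) <= \sum_i expR (F i).
  apply: ler_sum => i _.
  rewrite -[F i in leRHS](subrK m) [X in _ <= expR X]addrC expRD ler_pM2l ?expR_gt0//.
  exact: expR_ge1Dx.
rewrite -mulr_sumr big_split/= sumr_const big_split/= sumr_const -mulr_natl mulr1.
suff -> : \sum_i F i + - m *+ #|I| = 0 by rewrite addr0 mulrC.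
by rewrite mulNrn -mulr_natl /m mulVKf// subrr.
Qed.

Lemma sqr_mean_le (I : finType) (F : I -> R) : (0 < #|I|)%N ->
  (#|I|%:R^-1 * \sum_i F i) ^+ 2 <= #|I|%:R^-1 * \sum_i (F i) ^+ 2.
Proof.
move=> I0; have n0 : #|I|%:R != 0 :> R by rewrite pnatr_eq0 -lt0n.
set m := _ * \sum_i F i.
rewrite -ler_pdivrMl ?invr_gt0 ?ltr0n// invrK.
have : \sum_i (m ^+ 2 + 2 * m * (F i - m)) <= \sum_i (F i) ^+ 2.
  by apply: ler_sum => i _; have := sqr_ge0 (F i - m); nra.
rewrite big_split/= sumr_const -mulr_sumr big_split/= sumr_const.
suff -> : \sum_i F i + - m *+ #|I| = 0 by rewrite mulr0 addr0 mulr_natl.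
by rewrite mulNrn -mulr_natl /m mulVKf// subrr.
Qed.

End jensen.

Section ustatistics.
Context d (T : measurableType d) (R : realType).
Variable h : T -> T -> R.

Definition ustat n (x : n.-tuple T) : R :=
  ((n * n.-1)%N%:R)^-1 * \sum_(k < n) \sum_(l < n | l != k) h (tnth x k) (tnth x l).

(** Averaged over all relabellings, every ordered pair of distinct indices is
    equally likely. *)
Lemma ustat_perm_pair n (x : n.-tuple T) (a a' : 'I_n) : a != a' ->
  #|'S_n|%:R^-1 * \sum_(s : 'S_n) h (tnth x (s a)) (tnth x (s a')) = ustat x.
Proof.
move=> aa.
have n0 : (0 < n * n.-1)%N.
  by case: n x a a' aa => [? [] //|[|n]//] x a a'; rewrite (ord1 a) (ord1 a') eqxx.
have S0 : (0 < #|'S_n|)%N by apply/card_gt0P; exists (1%g : 'S_n).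
set M := \sum_(s : 'S_n) _.
have MM k l : l != k -> \sum_(s : 'S_n) h (tnth x (s k)) (tnth x (s l)) = M.
  move=> lk; have [s [sb sb']] := @perm_two n a a' k l aa (contra_neq (@esym _ _ _) lk).
  rewrite /M (reindex_inj (mulgI s)) /=.
  by apply: eq_bigr => t _; rewrite !permM sb sb'.
have E : \sum_(k < n) \sum_(l < n | l != k) M = #|'S_n|%:R *
    \sum_(k < n) \sum_(l < n | l != k) h (tnth x k) (tnth x l).
  transitivity (\sum_(s : 'S_n) \sum_(k < n) \sum_(l < n | l != k)
      h (tnth x (s k)) (tnth x (s l))).
    rewrite [RHS]exchange_big/=; apply: eq_bigr => k _.
    rewrite [RHS]exchange_big/=; apply: eq_bigr => l lk.
    by rewrite MM.
  rewrite mulr_natl -sumr_const; apply: eq_bigr => s _.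
  rewrite [RHS](reindex_inj (@perm_inj _ s)); apply: eq_bigr => k _.
  rewrite [RHS](reindex_inj (@perm_inj _ s)); apply: eq_bigl => l.
  by rewrite (inj_eq (@perm_inj _ s)).
rewrite sum_offdiag in E.
rewrite /ustat; apply: (mulfI (x := (n * n.-1)%:R)); first by rewrite pnatr_eq0 -lt0n.
rewrite mulVKf ?pnatr_eq0 -?lt0n// mulrCA E mulKf// pnatr_eq0 -lt0n//.
Qed.

(** Hoeffding's decomposition. On disjoint blocks the inner mean is a mean of
    independent variables, and the outer mean over relabellings is harmless
    for convex functions such as the square and the exponential. *)
Lemma ustat_perm_blocks n N b (e : 'I_N -> 'I_b -> 'I_n) (x : n.-tuple T) :
  (0 < N)%N -> (1 < b)%N -> (forall j, injective (e j)) ->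
  ustat x = #|'S_n|%:R^-1 * \sum_(s : 'S_n)
    (N%:R^-1 * \sum_(j < N) ustat (sel (e j) (sel s x))).
Proof.
move=> N0 b1 eI.
have b0 : (0 < b * b.-1)%N by case: b b1 {e eI} => [|[|b]].
rewrite -mulr_sumr mulrCA exchange_big/= mulr_sumr.
transitivity (N%:R^-1 * \sum_(j < N) ustat x).
  by rewrite mean_cst_ord.
congr (_ * _); apply: eq_bigr => j _.
rewrite [in RHS]/ustat -mulr_sumr mulrCA exchange_big/= mulr_sumr.
transitivity (((b * b.-1)%N%:R)^-1 * \sum_(k < b) \sum_(l < b | l != k) ustat x).
  by rewrite sum_offdiag mulKf// pnatr_eq0 -lt0n.
congr (_ * _); apply: eq_bigr => k _.
rewrite exchange_big/= mulr_sumr; apply: eq_bigr => l lk.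
rewrite -(@ustat_perm_pair n x (e j k) (e j l)); last by rewrite (inj_eq (eI j)) eq_sym.
by congr (_ * _); apply: eq_bigr => s _; rewrite !tnth_sel.
Qed.

Hypothesis bh : bounded_measurable (fun z : T * T => h z.1 z.2).

Lemma bmf_kernel n (k l : 'I_n) :
  bounded_measurable (fun x : n.-tuple T => h (tnth x k) (tnth x l)).
Proof.
apply: (@bmf_comp _ _ _ _ _ (fun x : n.-tuple T => (tnth x k, tnth x l)) _ _ bh).
by apply/measurable_fun_pairP; split; exact: measurable_tnth.
Qed.

Lemma bmf_ustat n : bounded_measurable (@ustat n).
Proof.
by apply: bmfZ; apply: bmf_sum => k _; apply: bmf_sum => l _; exact: bmf_kernel.
Qed.

Hypothesis h1 : forall t t', `|h t t'| <= 1.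

Lemma ustat_norm_le1 n (x : n.-tuple T) : `|ustat x| <= 1.
Proof.
have [n0|n0] := posnP (n * n.-1).
  by rewrite /ustat n0 invr0 mul0r normr0.
rewrite /ustat normrM ger0_norm ?invr_ge0//.
rewrite -ler_pdivlMl ?invr_gt0 ?ltr0n// invrK.
rewrite -sum_offdiag (le_trans (ler_norm_sum _ _ _))//; apply: ler_sum => k _.
by rewrite (le_trans (ler_norm_sum _ _ _))//; apply: ler_sum => l _.
Qed.

Variables (P : probability T R).

Definition kernel_mean := \int[P]_t \int[P]_t' h t t'.
Local Notation theta := kernel_mean.

Section sample.
Variables (n : nat) (Q : probability (n.-tuple T) R).
Hypothesis iQ : iid P Q.

Lemma Rint_pair (k l : 'I_n) (F : T * T -> R) : k != l -> bounded_measurable F ->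
  \int[Q]_x F (tnth x k, tnth x l) = \int[P]_t \int[P]_t' F (t, t').
Proof.
move=> kl bF.
rewrite (Rint_set_coord iQ l); last first.
  apply: bmf_comp bF.
  by apply/measurable_fun_pairP; split; exact: measurable_tnth.
rewrite -(Rint_coord iQ k (bmf_fubini1 P P bF)).
apply: eq_Rintegral => x _; apply: eq_Rintegral => t _.
by rewrite !tnth_set_coord eqxx (negPf kl).
Qed.

Lemma Rint_ustat_sel m (e : 'I_m -> 'I_n) : (1 < m)%N -> injective e ->
  \int[Q]_x ustat (sel e x) = theta.
Proof.
move=> m1 eI.
have m0 : (0 < m * m.-1)%N by case: m m1 {e eI} => [|[|m]].
have bk (k l : 'I_m) : bounded_measurable
    (fun x : n.-tuple T => h (tnth (sel e x) k) (tnth (sel e x) l)).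
  by apply: (bmf_comp (@measurable_sel _ _ _ _ e) (bmf_kernel k l)).
rewrite /ustat RintZ; last by apply: bmf_sum => k _; apply: bmf_sum => l _; exact: bk.
rewrite Rint_sum; last by move=> k _; apply: bmf_sum => l _; exact: bk.
transitivity ((m * m.-1)%:R^-1 * \sum_(k < m) \sum_(l < m | l != k) theta); last first.
  by rewrite sum_offdiag mulKf// pnatr_eq0 -lt0n.
congr (_ * _); apply: eq_bigr => k _.
rewrite Rint_sum; last by move=> l _; exact: bk.
apply: eq_bigr => l lk.
under eq_Rintegral do rewrite !tnth_sel.
by apply: (Rint_pair _ bh); rewrite (inj_eq eI) eq_sym.
Qed.

Lemma kernel_mean_norm_le1 : (1 < n)%N -> `|theta| <= 1.
Proof.
move=> n1; rewrite -(@Rint_ustat_sel n id n1 (fun _ _ => id)).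
have bu : bounded_measurable (fun x : n.-tuple T => ustat (sel id x)).
  by apply: (bmf_comp (@measurable_sel _ _ _ _ id) (@bmf_ustat n)).
apply: le_trans (Rint_norm_le Q bu) _.
rewrite -(Rint_cst Q 1); apply: Rint_le; [exact: bmf_norm|exact: bmf_cst|].
by move=> x; exact: ustat_norm_le1.
Qed.

Section blocks.
Variables (N b : nat) (e : 'I_N -> 'I_b -> 'I_n).
Hypotheses (N0 : (0 < N)%N) (b1 : (1 < b)%N) (eI : forall j, injective (e j)).
Hypothesis edisj : forall j j' l l', e j l = e j' l' -> j = j'.

Lemma bmf_block j : bounded_measurable (fun x : n.-tuple T => ustat (sel (e j) x)).
Proof. by apply: (bmf_comp (@measurable_sel _ _ _ _ (e j)) (@bmf_ustat b)). Qed.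

Lemma sel_merge_in j (S : pred 'I_n) (x y : n.-tuple T) :
  (forall l, S (e j l)) -> sel (e j) (merge S x y) = sel (e j) x.
Proof. by move=> eS; apply: eq_from_tnth => l; rewrite !tnth_sel tnth_merge eS. Qed.

Lemma sel_merge_out j (S : pred 'I_n) (x y : n.-tuple T) :
  (forall l, ~~ S (e j l)) -> sel (e j) (merge S x y) = sel (e j) y.
Proof.
by move=> eS; apply: eq_from_tnth => l; rewrite !tnth_sel tnth_merge (negPf (eS l)).
Qed.

Let blk j : pred 'I_n := fun k => k \in codom (e j).

Let blk_in j l : blk j (e j l).
Proof. exact: codom_f. Qed.

Let blk_out j j' l : j' != j -> ~~ blk j (e j' l).
Proof. by move=> jj; apply/negP => /codomP[l' /edisj E]; rewrite E eqxx in jj. Qed.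

Lemma Rint_prod_blocks (F : 'I_N -> b.-tuple T -> R) :
  (forall j, bounded_measurable (F j)) ->
  \int[Q]_x (\prod_j F j (sel (e j) x)) = \prod_j \int[Q]_x F j (sel (e j) x).
Proof.
move=> bF.
have bFx k : bounded_measurable (fun x : n.-tuple T => F k (sel (e k) x)).
  by apply: bmf_comp (bF k); exact: measurable_sel.
suff H (r : seq 'I_N) : uniq r ->
    \int[Q]_x (\prod_(k <- r) F k (sel (e k) x)) = \prod_(k <- r) \int[Q]_x F k (sel (e k) x).
  by apply: H; exact: index_enum_uniq.
elim: r => [|k r IH] /=.
  by under eq_Rintegral do rewrite big_nil; rewrite big_nil Rint_cst.
move=> /andP[kr ur]; under eq_Rintegral do rewrite big_cons.
rewrite big_cons (Rint_indep iQ (S := blk k))//.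
- by rewrite IH.
- by apply: bmf_prod => j _; exact: bFx.
- by move=> x y; rewrite sel_merge_in//; exact: blk_in.
- move=> x y; apply: eq_big_seq => j jr; rewrite sel_merge_out// => l.
  by apply: blk_out; apply: contraNneq kr => <-.
Qed.

Lemma Rint_block_cross j j' : j != j' ->
  \int[Q]_x ((ustat (sel (e j) x) - theta) * (ustat (sel (e j') x) - theta)) = 0.
Proof.
move=> jj.
have bB k : bounded_measurable (fun x : n.-tuple T => ustat (sel (e k) x) - theta).
  by apply: bmfB; [exact: bmf_block|exact: bmf_cst].
rewrite (Rint_indep iQ (S := blk j))//.
- rewrite RintB; [|exact: bmf_block|exact: bmf_cst].
  by rewrite Rint_ustat_sel// Rint_cst subrr mul0r.
- by move=> x y; rewrite sel_merge_in//; exact: blk_in.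
- by move=> x y; rewrite sel_merge_out// => l; apply: blk_out; rewrite eq_sym.
Qed.

Variable sigma2 : R.
Hypothesis var_block : forall j, \int[Q]_x (ustat (sel (e j) x) - theta) ^+ 2 <= sigma2.

(** A second-order Taylor expansion: the linear term has mean zero. *)
Lemma block_mgf j (t : R) :
  \int[Q]_x expR (t * (ustat (sel (e j) x) - theta)) <=
  expR (t ^+ 2 / 2 * expR (2 * `|t|) * sigma2).
Proof.
have n1 : (1 < n)%N.
  by have := leq_card _ (@eI j); rewrite !card_ord; exact: leq_trans.
set Y := fun x : n.-tuple T => ustat (sel (e j) x) - theta.
have bY : bounded_measurable Y.
  by apply: bmfB; [exact: bmf_block|exact: bmf_cst].
have Y2 x : `|Y x| <= 2.
  rewrite (le_trans (ler_normB _ _))//.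
  by have := ustat_norm_le1 (sel (e j) x); have := kernel_mean_norm_le1 n1; lra.
apply: le_trans (_ : \int[Q]_x (1 + t * Y x + t ^+ 2 / 2 * expR (2 * `|t|) * Y x ^+ 2) <= _).
  apply: Rint_le.
  - by apply: bmf_expR; exact: bmfZ.
  - apply: bmfD; last by apply: bmfZ; exact: bmfX.
    by apply: bmfD; [exact: bmf_cst|exact: bmfZ].
  - move=> x; apply: le_trans (expR_le_quad _) _; rewrite lerD2l.
    rewrite [leRHS](_ : _ = (t * Y x) ^+ 2 / 2 * expR (2 * `|t|)); last by ring.
    rewrite ler_wpM2l ?divr_ge0 ?sqr_ge0// ler_expR normrM mulrC ler_wpM2r//.
    exact: Y2.
rewrite RintD; last 2 first.
- by apply: bmfD; [exact: bmf_cst|exact: bmfZ].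
- by apply: bmfZ; exact: bmfX.
rewrite RintD; [|exact: bmf_cst|exact: bmfZ].
rewrite !RintZ//; last exact: bmfX.
rewrite Rint_cst /Y RintB; [|exact: bmf_block|exact: bmf_cst].
rewrite Rint_ustat_sel// Rint_cst subrr mulr0 addr0.
apply: le_trans (expR_ge1Dx _) _; rewrite ler_expR.
rewrite ler_wpM2l// mulr_ge0 ?expR_ge0// divr_ge0 ?sqr_ge0//.
Qed.

(** Jensen's inequality over the relabellings and independence of the blocks:
    the U-statistic is at least as concentrated as the mean of [N] independent
    block statistics. *)
Lemma ustat_mgf (t : R) :
  \int[Q]_x expR (t * (ustat x - theta)) <=
  expR (t ^+ 2 / 2 * expR (2 * `|t| / N%:R) * sigma2 / N%:R).
Proof.
have S0 : (0 < #|'S_n|)%N by apply/card_gt0P; exists (1%g : 'S_n).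
pose G (x : n.-tuple T) := \prod_(j < N) expR (t / N%:R * (ustat (sel (e j) x) - theta)).
have bG : bounded_measurable G.
  apply: bmf_prod => j _; apply: bmf_expR; apply: bmfZ.
  by apply: bmfB; [exact: bmf_block|exact: bmf_cst].
have NN : N%:R != 0 :> R by rewrite pnatr_eq0 -lt0n.
apply: le_trans (_ : \int[Q]_x (#|'S_n|%:R^-1 * \sum_(s : 'S_n) G (sel s x)) <= _).
  apply: Rint_le.
  - apply: bmf_expR; apply: bmfZ; apply: bmfB; [exact: bmf_ustat|exact: bmf_cst].
  - apply: bmfZ; apply: bmf_sum => s _.
    by apply: (bmf_comp (@measurable_sel _ _ _ _ s) bG).
  move=> x; rewrite (ustat_perm_blocks x N0 b1 eI).
  have -> : t * (#|'S_n|%:R^-1 * \sum_(s : 'S_n) (N%:R^-1 * \sum_(j < N)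
      ustat (sel (e j) (sel s x))) - theta) =
    #|'S_n|%:R^-1 * \sum_(s : 'S_n) (\sum_(j < N)
      t / N%:R * (ustat (sel (e j) (sel s x)) - theta)).
    transitivity (#|'S_n|%:R^-1 * \sum_(s : 'S_n) (t * (N%:R^-1 * (\sum_(j < N)
      ustat (sel (e j) (sel s x))) - theta))); last first.
      congr (_ * _); apply: eq_bigr => s _.
      rewrite -[RHS]mulr_sumr big_split/= sumr_const card_ord -[(- theta) *+ _]mulr_natl.
      by field.
    rewrite -[in RHS]mulr_sumr [RHS]mulrCA; congr (_ * _).
    by rewrite big_split/= mulrDr (mean_cst (- theta)).
  apply: le_trans (expR_mean_le _ S0) _.
  rewrite ler_wpM2l ?invr_ge0//; apply: ler_sum => s _.
  by rewrite expR_sum.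
rewrite RintZ; last first.
  apply: bmf_sum => s _; by apply: (bmf_comp (@measurable_sel _ _ _ _ s) bG).
rewrite Rint_sum; last first.
  move=> s _; by apply: (bmf_comp (@measurable_sel _ _ _ _ s) bG).
rewrite (eq_bigr (fun=> \int[Q]_x G x)); last first.
  by move=> s _; apply: (Rint_reindex iQ (@perm_inj _ s) bG).
rewrite mean_cst//.
rewrite /G (Rint_prod_blocks (F := fun j y => expR (t / N%:R * (ustat y - theta)))); last first.
  move=> j; apply: bmf_expR; apply: bmfZ; apply: bmfB; [exact: bmf_ustat|exact: bmf_cst].
apply: le_trans (_ : \prod_(j < N) expR ((t / N%:R) ^+ 2 / 2 * expR (2 * `|t / N%:R|) * sigma2) <= _).
  apply: ler_prod => j _; rewrite block_mgf andbT.
  by apply: Rint_ge0 => x; exact: expR_ge0.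
rewrite -expR_sum sumr_const card_ord ler_expR -[_ *+ N]mulr_natl normrM.
rewrite [`|N%:R^-1|]ger0_norm ?invr_ge0// [2 * (_ / _)]mulrA mulrA.
by rewrite le_eqVlt; apply/orP; left; apply/eqP; field.
Qed.

Lemma ustat_var : \int[Q]_x (ustat x - theta) ^+ 2 <= sigma2 / N%:R.
Proof.
have S0 : (0 < #|'S_n|)%N by apply/card_gt0P; exists (1%g : 'S_n).
pose Y j (x : n.-tuple T) := ustat (sel (e j) x) - theta.
have bY j : bounded_measurable (Y j).
  by apply: bmfB; [exact: bmf_block|exact: bmf_cst].
pose G (x : n.-tuple T) := (N%:R^-1 * \sum_(j < N) Y j x) ^+ 2.
have bG : bounded_measurable G.
  by apply: bmfX; apply: bmfZ; apply: bmf_sum.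
have NN : N%:R != 0 :> R by rewrite pnatr_eq0 -lt0n.
apply: le_trans (_ : \int[Q]_x (#|'S_n|%:R^-1 * \sum_(s : 'S_n) G (sel s x)) <= _).
  apply: Rint_le.
  - by apply: bmfX; apply: bmfB; [exact: bmf_ustat|exact: bmf_cst].
  - apply: bmfZ; apply: bmf_sum => s _.
    by apply: (bmf_comp (@measurable_sel _ _ _ _ s) bG).
  move=> x; rewrite (ustat_perm_blocks x N0 b1 eI).
  apply: le_trans (sqr_mean_le _ S0); rewrite le_eqVlt; apply/orP; left; apply/eqP.
  congr (_ ^+ 2).
  transitivity (#|'S_n|%:R^-1 * \sum_(s : 'S_n) (N%:R^-1 * (\sum_(j < N)
      ustat (sel (e j) (sel s x))) - theta)).
    by rewrite big_split/= mulrDr (mean_cst (- theta)).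
  congr (_ * _); apply: eq_bigr => s _.
  by rewrite /Y big_split/= mulrDr mean_cst_ord.
rewrite RintZ; last first.
  apply: bmf_sum => s _; by apply: (bmf_comp (@measurable_sel _ _ _ _ s) bG).
rewrite Rint_sum; last first.
  move=> s _; by apply: (bmf_comp (@measurable_sel _ _ _ _ s) bG).
rewrite (eq_bigr (fun=> \int[Q]_x G x)); last first.
  by move=> s _; apply: (Rint_reindex iQ (@perm_inj _ s) bG).
rewrite mean_cst//.
have E x : G x = N%:R^-1 ^+ 2 * \sum_(j < N) \sum_(j' < N) (Y j x * Y j' x).
  rewrite /G exprMn; congr (_ * _); rewrite expr2 mulr_suml.
  by apply: eq_bigr => j _; rewrite mulr_sumr.
under eq_Rintegral do rewrite E.
rewrite RintZ; last by apply: bmf_sum => j _; apply: bmf_sum => j' _; exact: bmfM.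
rewrite Rint_sum; last by move=> j _; apply: bmf_sum => j' _; exact: bmfM.
have -> : \sum_(j < N) \int[Q]_x (\sum_(j' < N) (Y j x * Y j' x)) =
    \sum_(j < N) \int[Q]_x Y j x ^+ 2.
  apply: eq_bigr => j _; rewrite Rint_sum; last by move=> j' _; exact: bmfM.
  by rewrite (bigD1 j)//= big1 ?addr0// => j' jj; rewrite Rint_block_cross// eq_sym.
apply: le_trans (_ : N%:R^-1 ^+ 2 * \sum_(j < N) sigma2 <= _).
  by rewrite ler_wpM2l ?sqr_ge0//; apply: ler_sum => j _; exact: var_block.
by rewrite expr2 -mulrA mean_cst_ord// mulrC.
Qed.

End blocks.

End sample.

End ustatistics.

(** * Sheppard's formula for the correlation of two signs *)

Lemma Rint_1B d (T : measurableType d) (R : realType) (P : probability T R) (f : T -> R) :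
  bounded_measurable f -> \int[P]_x (1 - f x) = 1 - \int[P]_x f x.
Proof. by move=> bf; rewrite RintB ?Rint_cst//; exact: bmf_cst. Qed.

Section pair_laws.
Variable R : realType.
Local Notation RT := (measurableTypeR R).
Local Notation RR := (RT * RT)%type.
Local Notation N := (gauss R).
Local Notation N2 := (gauss2 R).

Lemma Rint_pair_eq d (T : measurableType d) d' (T' : measurableType d')
    (P : probability T R) (P' : probability T' R) (X Y : T -> R) (X' Y' : T' -> R)
    (F : RR -> R) :
  measurable_fun setT X -> measurable_fun setT Y ->
  measurable_fun setT X' -> measurable_fun setT Y' ->
  (forall (a b : R) (g : RT -> R), bounded_measurable g ->
    \int[P]_x g (a * X x + b * Y x) = \int[P']_x g (a * X' x + b * Y' x)) ->
  bounded_measurable F ->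
  \int[P]_x F (X x, Y x) = \int[P']_x F (X' x, Y' x).
Proof.
move=> mX mY mX' mY' H bF.
have mXY : @measurable_fun _ _ T RR setT (fun x => (X x, Y x)).
  by apply/measurable_fun_pairP; split.
have mXY' : @measurable_fun _ _ T' RR setT (fun x => (X' x, Y' x)).
  by apply/measurable_fun_pairP; split.
pose M : {mfun T >-> RR} := HB.pack (fun x => (X x, Y x) : RR) (isMeasurableFun.Build _ _ _ _ _ mXY).
pose M' : {mfun T' >-> RR} := HB.pack (fun x => (X' x, Y' x) : RR) (isMeasurableFun.Build _ _ _ _ _ mXY').
transitivity (\int[distribution P M]_z F z); first by symmetry; exact: (Rint_push mXY).
apply: (Rint_push mXY') => // A mA.
apply: (@cramer_wold2 R (distribution P M) (distribution P' M')) mA => a b B mB.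
rewrite /distribution /pushforward /=.
have mp d0 (T0 : measurableType d0) (X0 Y0 : T0 -> R) : measurable_fun setT X0 -> measurable_fun setT Y0 ->
    measurable [set x | B (a * X0 x + b * Y0 x)].
  move=> mX0 mY0.
  have m0 : @measurable_fun _ _ T0 RT setT (fun x => a * X0 x + b * Y0 x).
    by apply: measurable_funD; apply: measurable_funM.
  by have := m0 measurableT B mB; rewrite setTI.
transitivity (P [set x | B (a * X x + b * Y x)]) => //.
transitivity (P' [set x | B (a * X' x + b * Y' x)]) => //.
rewrite -(Rint_indic P (mp _ _ _ _ mX mY)) -(Rint_indic P' (mp _ _ _ _ mX' mY')).
by congr EFin; exact: (H a b (\1_B) (bmf_indic R mB)).
Qed.

Lemma bmf_lin2 (m a b : R) (g : RT -> R) : bounded_measurable g ->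
  bounded_measurable (fun z : RR => g (m + a * z.1 + b * z.2)).
Proof.
move=> bg; apply: bmf_comp bg.
by apply: measurable_funD; [apply: measurable_funD => //|]; apply: measurable_funM.
Qed.

Lemma Rint_gauss2_lin (m a b : R) (g : RT -> R) : bounded_measurable g ->
  \int[N2]_z g (m + a * z.1 + b * z.2) =
  \int[N]_w g (m + Num.sqrt (a ^+ 2 + b ^+ 2) * w).
Proof.
move=> bg; rewrite -Rint_normal_lin2//.
by rewrite (Rint_fubini1 N N (bmf_lin2 m a b bg)).
Qed.

Lemma Rint_gauss2_lin0 (a b : R) (g : RT -> R) : bounded_measurable g ->
  \int[N2]_z g (a * z.1 + b * z.2) =
  \int[N]_w g (Num.sqrt (a ^+ 2 + b ^+ 2) * w).
Proof.
move=> bg; have := Rint_gauss2_lin 0 a b bg.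
under eq_Rintegral do rewrite add0r.
by under [RHS]eq_Rintegral do rewrite add0r.
Qed.

(** Any combination of two linear forms in a standard Gaussian pair is normal
    with a variance read off their Gram matrix, so the Gram matrix determines
    the joint law. *)
Lemma Rint_gauss2_gram (a1 b1 c1 d1 a2 b2 c2 d2 : R) (F : RR -> R) :
  a1 ^+ 2 + b1 ^+ 2 = a2 ^+ 2 + b2 ^+ 2 ->
  c1 ^+ 2 + d1 ^+ 2 = c2 ^+ 2 + d2 ^+ 2 ->
  a1 * c1 + b1 * d1 = a2 * c2 + b2 * d2 -> bounded_measurable F ->
  \int[N2]_z F (a1 * z.1 + b1 * z.2, c1 * z.1 + d1 * z.2) =
  \int[N2]_z F (a2 * z.1 + b2 * z.2, c2 * z.1 + d2 * z.2).
Proof.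
move=> E1 E2 E3 bF.
apply: (@Rint_pair_eq _ _ _ _ N2 N2 (fun z => a1 * z.1 + b1 * z.2)
  (fun z => c1 * z.1 + d1 * z.2) (fun z => a2 * z.1 + b2 * z.2)
  (fun z => c2 * z.1 + d2 * z.2)) => //;
  try exact: measurable_linform.
move=> a b g bg.
transitivity (\int[N2]_z g ((a * a1 + b * c1) * z.1 + (a * b1 + b * d1) * z.2)).
  apply: eq_Rintegral => z _; congr g.
  have : a * (a1 * (z.1 : R) + b1 * (z.2 : R)) + b * (c1 * (z.1 : R) + d1 * (z.2 : R)) =
    (a * a1 + b * c1) * (z.1 : R) + (a * b1 + b * d1) * (z.2 : R) by ring.
  exact.
transitivity (\int[N2]_z g ((a * a2 + b * c2) * z.1 + (a * b2 + b * d2) * z.2)); last first.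
  apply: eq_Rintegral => z _; congr g.
  have : (a * a2 + b * c2) * (z.1 : R) + (a * b2 + b * d2) * (z.2 : R) =
   a * (a2 * (z.1 : R) + b2 * (z.2 : R)) + b * (c2 * (z.1 : R) + d2 * (z.2 : R)) by ring.
  exact.
rewrite !Rint_gauss2_lin0//.
suff -> : (a * a1 + b * c1) ^+ 2 + (a * b1 + b * d1) ^+ 2 =
   (a * a2 + b * c2) ^+ 2 + (a * b2 + b * d2) ^+ 2 by [].
transitivity (a ^+ 2 * (a1 ^+ 2 + b1 ^+ 2) + b ^+ 2 * (c1 ^+ 2 + d1 ^+ 2)
   + 2 * a * b * (a1 * c1 + b1 * d1)); first by ring.
by rewrite E1 E2 E3; ring.
Qed.

Lemma Rint_gauss2_diff (F : RR -> R) : bounded_measurable F ->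
  \int[N2]_z \int[N2]_z' F (z.1 - z'.1, z.2 - z'.2) =
  \int[N2]_z F (Num.sqrt 2 * z.1, Num.sqrt 2 * z.2).
Proof.
move=> bF.
have mD : @measurable_fun _ _ (RR * RR)%type RR setT
    (fun w => (w.1.1 - w.2.1, w.1.2 - w.2.2)).
  apply/measurable_fun_pairP; split.
    by apply: measurable_funB; apply: measurableT_comp => //.
  by apply: measurable_funB; apply: measurableT_comp => //.
rewrite -(Rint_fubini1 N2 N2 (bmf_comp mD bF)).
have [m1 m2] := (measurable_fun_pairP _).1 mD.
apply: (@Rint_pair_eq _ _ _ _ (N2 \x N2)%E N2 (fun w => w.1.1 - w.2.1)
  (fun w => w.1.2 - w.2.2) (fun z => Num.sqrt 2 * z.1) (fun z => Num.sqrt 2 * z.2)) => //.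
- by apply: measurable_funM.
- by apply: measurable_funM.
move=> a b g bg.
pose G (w : RR * RR) := g (a * (w.1.1 - w.2.1) + b * (w.1.2 - w.2.2)).
have bG : bounded_measurable G.
  apply: (@bmf_comp _ _ (RR * RR)%type RT R (fun w : RR * RR => a * (w.1.1 - w.2.1) + b * (w.1.2 - w.2.2)) g _ bg).
  by apply: measurable_funD; apply: measurable_funM.
rewrite (Rint_fubini1 N2 N2 bG).
set c := Num.sqrt (a ^+ 2 + b ^+ 2).
have c2 : c ^+ 2 = a ^+ 2 + b ^+ 2 by rewrite sqr_sqrtr// addr_ge0 ?sqr_ge0.
have bK : bounded_measurable (fun x : RT => \int[N]_w g (x + c * w)).
  have b2 : bounded_measurable (fun z : RR => g (z.1 + c * z.2)).
    by apply: bmf_comp bg; apply: measurable_funD => //; apply: measurable_funM.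
  exact: (bmf_fubini1 N N b2).
transitivity (\int[N2]_z \int[N]_w g (a * z.1 + b * z.2 + c * w)).
  apply: eq_Rintegral => z _.
  transitivity (\int[N2]_z' g (a * z.1 + b * z.2 + (- a) * z'.1 + (- b) * z'.2)).
    apply: eq_Rintegral => z' _; rewrite /G; congr g.
    have : a * ((z.1 : R) - (z'.1 : R)) + b * ((z.2 : R) - (z'.2 : R)) =
     a * (z.1 : R) + b * (z.2 : R) + - a * (z'.1 : R) + - b * (z'.2 : R) by ring.
    exact.
  by rewrite Rint_gauss2_lin// !sqrrN.
rewrite (Rint_gauss2_lin0 a b bK).
transitivity (\int[N]_u \int[N]_w g (0 + c * u + c * w)).
  by under [RHS]eq_Rintegral do under eq_Rintegral do rewrite add0r.
rewrite Rint_normal_lin2//.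
transitivity (\int[N2]_z g ((a * Num.sqrt 2) * z.1 + (b * Num.sqrt 2) * z.2)); last first.
  apply: eq_Rintegral => z _; congr g.
  have : (a * Num.sqrt 2) * (z.1 : R) + (b * Num.sqrt 2) * (z.2 : R) =
    a * (Num.sqrt 2 * (z.1 : R)) + b * (Num.sqrt 2 * (z.2 : R)) by ring.
  exact.
rewrite Rint_gauss2_lin0//; apply: eq_Rintegral => w _; rewrite add0r.
have s2 : Num.sqrt 2 ^+ 2 = 2 :> R by rewrite sqr_sqrtr.
by rewrite c2 !exprMn s2; congr (g (Num.sqrt _ * w)); ring.
Qed.

Lemma gauss_set1 (x : R) : N [set x] = 0%E.
Proof.
rewrite gaussE.
have := @normal_prob_dominates R 0 1.
move/null_content_dominatesP; apply => //; exact: lebesgue_measure_set1.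
Qed.

Lemma bmf_sgrX2 d (T : measurableType d) (f : T -> R) : measurable_fun setT f ->
  bounded_measurable (fun x => 1 - Num.sg (f x) ^+ 2).
Proof. by move=> mf; apply: bmfB; [exact: bmf_cst|apply: bmfX; exact: bmf_sg]. Qed.

Lemma gauss_sgr0 (a : R) : a != 0 -> \int[N]_w (1 - Num.sg (a * w) ^+ 2) = 0.
Proof.
move=> a0.
transitivity (\int[N]_w (\1_[set (0 : R)] w : R)).
  apply: eq_Rintegral => w _; rewrite sgrM exprMn !sqr_sg a0 mul1r indicE.
  have [w0|w0] := eqVneq (w : R) 0; first by rewrite mem_set//= subr0.
  by rewrite memNset/= ?subrr// => /eqP; rewrite (negPf w0).
have := Rint_indic N (measurable_set1 (0 : R)).
by rewrite gauss_set1 => -[].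
Qed.

(** The correlation between the signs of two standard normal variables whose
    correlation is [cos t]. *)
Definition sgn_corr (t : R) :=
  \int[N2]_z (Num.sg z.1 * Num.sg (cos t * z.1 + sin t * z.2)).

Let dir t (z : RR) : R := cos t * z.1 + sin t * z.2.

Let measurable_dir t : measurable_fun setT (dir t).
Proof. exact: measurable_linform. Qed.

Let bmf_dir s t : bounded_measurable (fun z => Num.sg (dir s z) * Num.sg (dir t z)).
Proof. by apply: bmfM; apply: bmf_sg; exact: measurable_dir. Qed.

Let bmf_sgsg : @bounded_measurable _ RR R (fun z => Num.sg (z.1 : R) * Num.sg (z.2 : R)).
Proof. by apply: bmfM; apply: bmf_sg. Qed.

Let sgn_corr_dir s t : \int[N2]_z (Num.sg (dir s z) * Num.sg (dir t z)) = sgn_corr (t - s).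
Proof.
transitivity (\int[N2]_z (fun z : RR => Num.sg (z.1 : R) * Num.sg (z.2 : R))
   (1 * z.1 + 0 * z.2, cos (t - s) * z.1 + sin (t - s) * z.2)); last first.
  by apply: eq_Rintegral => z _ /=; rewrite mul1r mul0r addr0.
rewrite -(@Rint_gauss2_gram (cos s) (sin s) (cos t) (sin t) _ _ _ _
  (fun z : RR => Num.sg (z.1 : R) * Num.sg (z.2 : R)))//.
- by rewrite cos2Dsin2; ring.
- by rewrite !cos2Dsin2.
- by rewrite cosB; ring.
Qed.

Let dir_null t : \int[N2]_z (1 - Num.sg (dir t z) ^+ 2) = 0.
Proof.
rewrite (@Rint_gauss2_lin0 (cos t) (sin t) (fun x => 1 - Num.sg (x : R) ^+ 2)).
  by rewrite cos2Dsin2 sqrtr1; exact: gauss_sgr0 (oner_neq0 _).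
exact: bmf_sgrX2.
Qed.

(** Between [x] and [z] the sign changes as often as between [x] and [y] plus
    between [y] and [z]; the right-hand side is 0 unless a variable vanishes. *)
Let sgn_between (x y z a b : R) : 0 < a -> 0 < b -> y = a * x + b * z ->
  let p := Num.sg x in let q := Num.sg y in let r := Num.sg z in
  `|(1 - p * r) - ((1 - p * q) + (1 - q * r))| <=
  3 * ((1 - p ^+ 2) + (1 - q ^+ 2) + (1 - r ^+ 2)).
Proof.
move=> a0 b0 E /=.
case: (sgrP x) => hx; case: (sgrP y) => hy; case: (sgrP z) => hz;
  rewrite ?mulr0 ?mul0r ?mulr1 ?mul1r ?mulrN ?mulNr ?expr0n ?expr1n ?sqrrN ?expr1n/= ?mulr1 ?mul1r ler_norml; try lra; exfalso; nra.
Qed.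

Let anti t := 1 - sgn_corr t.

(** The direction at angle [a] is a positive combination of those at angles 0
    and [a + b], so sign changes add up almost surely. *)
Let antiD a b : 0 < a -> 0 < b -> a + b < pi -> anti (a + b) = anti a + anti b.
Proof.
move=> a0 b0 ab.
have sa : 0 < sin a by apply: sin_gt0_pi; rewrite ?a0//=; lra.
have sb : 0 < sin b by apply: sin_gt0_pi; rewrite ?b0//=; lra.
have sab : 0 < sin (a + b) by apply: sin_gt0_pi; rewrite ?addr_gt0.
pose p z := Num.sg (dir 0 z); pose q z := Num.sg (dir a z); pose r z := Num.sg (dir (a + b) z).
have bp := bmf_dir 0 (a + b); have bq := bmf_dir 0 a; have br := bmf_dir a (a + b).
have E : \int[N2]_z ((1 - p z * r z) - ((1 - p z * q z) + (1 - q z * r z))) =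
  anti (a + b) - (anti a + anti b).
  have b1 f : bounded_measurable f -> @bounded_measurable _ RR R (fun z => 1 - f z).
    by move=> bf; apply: bmfB => //; exact: bmf_cst.
  rewrite (RintB N2 (b1 _ bp) (bmfD (b1 _ bq) (b1 _ br))).
  rewrite (RintD N2 (b1 _ bq) (b1 _ br)).
  rewrite !Rint_1B// !sgn_corr_dir !subr0.
  by rewrite (_ : a + b - a = b)//; ring.
suff : `|anti (a + b) - (anti a + anti b)| <= 0.
  by rewrite normr_le0 subr_eq0 => /eqP.
rewrite -E; apply: le_trans (Rint_norm_le _ _) _.
  apply: bmfB; first by apply: bmfB => //; exact: bmf_cst.
  by apply: bmfD; apply: bmfB => //; exact: bmf_cst.
have bn t : bounded_measurable (fun z => 1 - Num.sg (dir t z) ^+ 2).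
  by apply: bmf_sgrX2; exact: measurable_dir.
apply: le_trans (_ : \int[N2]_z (3 * ((1 - p z ^+ 2) + (1 - q z ^+ 2) + (1 - r z ^+ 2))) <= _).
  apply: Rint_le.
  - apply: bmf_norm; apply: bmfB; first by apply: bmfB => //; exact: bmf_cst.
    by apply: bmfD; apply: bmfB => //; exact: bmf_cst.
  - by apply: bmfZ; apply: bmfD; [apply: bmfD|]; exact: bn.
  move=> z; apply: (@sgn_between _ _ _ (sin b / sin (a + b)) (sin a / sin (a + b))).
  - by rewrite divr_gt0.
  - by rewrite divr_gt0.
  rewrite /dir cos0 sin0 mul1r mul0r addr0.
  rewrite [RHS](_ : _ = ((sin b + sin a * cos (a + b)) * z.1 + sin a * sin (a + b) * z.2) / sin (a + b)); last by field; exact: lt0r_neq0.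
  rewrite (_ : sin b + sin a * cos (a + b) = cos a * sin (a + b)).
    by field; exact: lt0r_neq0.
  have s2 : sin a ^+ 2 = 1 - cos a ^+ 2 by rewrite sin2cos2.
  rewrite cosD sinD.
  transitivity (cos a * (sin a * cos b) + (1 - sin a ^+ 2) * sin b); first by ring.
  by rewrite s2; ring.
rewrite RintZ; last by apply: bmfD; [apply: bmfD|]; exact: bn.
rewrite RintD; [|by apply: bmfD; exact: bn|exact: bn].
by rewrite RintD; [|exact: bn|exact: bn]; rewrite !dir_null !addr0 mulr0.
Qed.

Let sgn_corr0 : sgn_corr 0 = 1.
Proof.
have := dir_null 0.
rewrite RintB; [|exact: bmf_cst|by apply: bmfX; apply: bmf_sg; exact: measurable_dir].
rewrite Rint_cst => /eqP; rewrite subr_eq0 => /eqP ->.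
by apply: eq_Rintegral => z _; rewrite /dir cos0 sin0 mul1r mul0r addr0 expr2.
Qed.

Let anti_ge0 t : 0 <= anti t.
Proof.
rewrite subr_ge0 -(Rint_cst N2 1); apply: Rint_le.
- have := bmf_dir 0 t; under eq_fun do rewrite {1}/dir cos0 sin0 mul1r mul0r addr0.
  exact.
- exact: bmf_cst.
move=> z; case: sgrP => _; case: sgrP => _; rewrite ?mul0r ?mulr0 ?mul1r ?mulr1 ?mulrNN ?mulr1; lra.
Qed.

Let gauss_sg0 : \int[N]_w Num.sg (w : R) = 0.
Proof.
have bs : @bounded_measurable _ RT R (fun w => Num.sg (w : R)) by exact: bmf_sg.
have := Rint_normal_lin2 0 0 (-1) bs.
rewrite expr0n/= add0r sqrrN expr1n sqrtr1.
under eq_Rintegral do under eq_Rintegral do rewrite mul0r !add0r mulN1r sgrN.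
rewrite Rint_cst; under [RHS]eq_Rintegral do rewrite add0r mul1r.
under eq_Rintegral do rewrite -mulN1r.
by rewrite RintZ// mulN1r => H; lra.
Qed.

Let anti_pihalf : anti (pi / 2) = 1.
Proof.
rewrite /anti /sgn_corr cos_pihalf sin_pihalf.
under eq_Rintegral do rewrite mul0r add0r mul1r.
rewrite (Rint_fubini1 N N bmf_sgsg) /=.
transitivity (1 - \int[N]_x (0 : R)); last by rewrite Rint_cst subr0.
congr (_ - _); apply: eq_Rintegral => x _.
by rewrite RintZ ?gauss_sg0 ?mulr0//; exact: bmf_sg.
Qed.

Let anti_mul k d : 0 < d -> k.+1%:R * d < pi -> anti (k.+1%:R * d) = k.+1%:R * anti d.
Proof.
move=> d0; elim: k => [|k IH kd]; first by rewrite !mul1r.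
have E : k.+2%:R * d = k.+1%:R * d + d by rewrite -(natr1 k.+1) mulrDl mul1r.
rewrite E antiD//; last by rewrite -E.
  rewrite IH; first by rewrite -(natr1 k.+1) mulrDl mul1r.
  by apply: lt_trans kd; rewrite E ltrDl.
by rewrite mulr_gt0.
Qed.

(** Sheppard's formula, without computing a density: [anti] is additive and
    nonnegative with value 1 at a right angle, hence it is linear, as
    comparison with the multiples of a small fraction of the right angle
    shows. *)
Lemma sgn_corrE (t : R) : 0 <= t <= pi -> sgn_corr t = 1 - 2 * t / pi.
Proof.
have pi0 := @pi_gt0 R.
move=> /andP[]; rewrite le_eqVlt => /predU1P[<- _|t0].
  by rewrite sgn_corr0 mulr0 mul0r subr0.
rewrite le_eqVlt => /predU1P[->|tpi].
  rewrite mulfK ?lt0r_neq0// /sgn_corr cospi sinpi.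
  transitivity (\int[N2]_z (-1 * (Num.sg z.1 * Num.sg (cos 0 * z.1 + sin 0 * z.2)))).
    apply: eq_Rintegral => z _; rewrite cos0 sin0 !mul0r !addr0 !sgrM sgrN1 sgr1; ring.
  have b0 := bmf_dir 0 0; rewrite RintZ; last first.
    by move: b0; under eq_fun do rewrite {1}/dir cos0 sin0 mul1r mul0r addr0.
  rewrite -/(sgn_corr 0) sgn_corr0; ring.
suff : forall n, `|anti t - 2 * t / pi| <= n.+1%:R^-1.
  move=> H; suff : `|anti t - 2 * t / pi| <= 0.
    by rewrite normr_le0 subr_eq0 /anti => /eqP; lra.
  rewrite leNgt; apply/negP => /[dup] e0; rewrite -invr_gt0 => _.
  have [n _ Hn] := near_infty_natSinv_lt (PosNum e0).
  have := Hn n (leqnn n); rewrite /= ltNge => /negP; apply; exact: H.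
move=> n; pose d : R := pi / 2 / n.+1%:R.
have d0 : 0 < d by rewrite !divr_gt0.
have dn : n.+1%:R * d = pi / 2 by rewrite mulrC divfK.
have fd : anti d = n.+1%:R^-1.
  have : anti (n.+1%:R * d) = n.+1%:R * anti d by apply: anti_mul => //; rewrite dn; lra.
  rewrite dn anti_pihalf => E; apply: (mulfI (x := n.+1%:R)) => //.
  by rewrite -E divff.
have n0 : 0 < n.+1%:R :> R by [].
have t2 : 2 * t / pi = t / d / n.+1%:R.
  by rewrite -[RHS]mulrA -invfM [d * _]mulrC dn invf_div mulrA [t * 2]mulrC.
pose k := Num.truncn (t / d).
have /andP[k1 k2] : k%:R <= t / d < k.+1%:R.
  by apply: truncn_itv; rewrite divr_ge0 ?ltW.
have rest (x : R) : 0 <= x -> x < d -> anti x <= anti d.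
  rewrite le_eqVlt => /predU1P[<- _|x0 xd]; first by rewrite /anti sgn_corr0 subrr anti_ge0.
  have dpi : d < pi.
    have : d <= n.+1%:R * d by rewrite ler_peMl ?ler1n ?ltW.
    by rewrite dn; move: pi0; lra.
  rewrite -(subrK x d) [d - x + x]addrC antiD ?subr_gt0 ?lerDl ?anti_ge0//.
  by rewrite addrC subrK.
have [lb ub] : k%:R / n.+1%:R <= anti t /\ anti t <= k.+1%:R / n.+1%:R.
  have t_kd : k%:R * d <= t by rewrite -ler_pdivlMr.
  have kd_t : t < k.+1%:R * d by rewrite -ltr_pdivrMr.
  have kd : anti (k%:R * d) = k%:R / n.+1%:R.
    case: k t_kd {k1 k2 kd_t} => [|k] t_kd; first by rewrite !mul0r /anti sgn_corr0 subrr.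
    by rewrite anti_mul// ?fd//; exact: le_lt_trans tpi.
  have [E|tkd] := eqVneq t (k%:R * d).
    by rewrite E kd lexx; split => //; rewrite ler_pM2r ?invr_gt0// ler_nat.
  have y0 : 0 < t - k%:R * d by rewrite subr_gt0 lt_neqAle eq_sym tkd.
  have yd : t - k%:R * d < d.
    by move: kd_t; rewrite -(natr1 k) mulrDl mul1r; lra.
  have := rest _ (ltW y0) yd; rewrite fd => H.
  have := anti_ge0 (t - k%:R * d).
  have E : anti t = k%:R / n.+1%:R + anti (t - k%:R * d).
    case: k kd y0 {k1 k2 t_kd kd_t tkd yd H} => [|k] kd y0.
      by rewrite !mul0r subr0 add0r.
    rewrite -{1}(subrK (k.+1%:R * d) t) [_ - _ + _]addrC antiD//.
    - by rewrite kd.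
    - by rewrite mulr_gt0.
    - by rewrite addrC subrK.
  by rewrite E -(natr1 k) mulrDl mul1r => h; split; rewrite ?lerDl ?lerD2l.
have : k%:R / n.+1%:R <= 2 * t / pi by rewrite t2 ler_pM2r ?invr_gt0.
have : 2 * t / pi <= k.+1%:R / n.+1%:R by rewrite t2 ler_pM2r ?invr_gt0// ltW.
move: lb ub; rewrite -(natr1 k) mulrDl mul1r ler_norml.
move: (n.+1%:R^-1 : R) (anti t) (2 * t / pi) (k%:R / n.+1%:R) => A B C D h1 h2 h3 h4; apply/andP; split; lra.
Qed.

End pair_laws.

(** * The mean and the variance of Kendall's tau *)

Section select_law.
Context d (T : measurableType d) (R : realType).

(** Coordinates outside the range of [e] integrate to 1. *)
Lemma Rint_sel n m (P : probability T R) (Q : probability (n.-tuple T) R)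
    (Q' : probability (m.-tuple T) R) (e : 'I_m -> 'I_n) (f : m.-tuple T -> R) :
  iid P Q -> iid P Q' -> injective e -> bounded_measurable f ->
  \int[Q]_x f (sel e x) = \int[Q']_x f x.
Proof.
move=> iQ iQ' eI bf; symmetry.
have := iid_Rint_eq (S := Q) iQ' (@measurable_sel _ _ _ _ e) _ bf.
apply => B mB.
pose B' j := if [pick k | e k == j] is Some k then B k else setT.
have B'e k : B' (e k) = B k.
  by rewrite /B'; case: pickP => [l /eqP /eI ->//|/(_ k)]; rewrite eqxx.
have -> : [set u | forall k, B k (tnth (sel e u) k)] = box B'.
  apply/seteqP; split => x /= h.
    move=> j; rewrite /B'; case: pickP => [k /eqP <-|//].
    by have := h k; rewrite tnth_sel.
  by move=> k; have := h (e k); rewrite tnth_sel B'e.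
rewrite iQ; last by move=> j; rewrite /B'; case: pickP.
rewrite (bigID (mem [set e k | k in [set: 'I_m]]%SET)) /= [X in (_ * X)%E]big1; last first.
  move=> j /imsetP jn; rewrite /B'; case: pickP => [k /eqP ejk|_]; last exact: probability_setT.
  by exfalso; apply: jn; exists k; rewrite ?inE.
rewrite mule1 big_imset/=; last by move=> k l _ _; exact: eI.
by apply: eq_big => k; rewrite ?inE// B'e.
Qed.

End select_law.

Section kendall.
Variable R : realType.
Local Notation RT := (measurableTypeR R).
Local Notation RR := (RT * RT)%type.
Local Notation N := (gauss R).
Local Notation N2 := (gauss2 R).

(** The sign kernel of Kendall's tau for a pair of correlation [sin psi],
    expressed through a standard Gaussian pair. The angle is the natural
    parameter: the mean of the kernel is linear in it. *)
Definition kern (psi : R) (z z' : RR) : R :=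
  Num.sg (z.1 - z'.1) *
  Num.sg (sin psi * (z.1 - z'.1) + cos psi * (z.2 - z'.2)).

Let diff (w : RR * RR) : RR := (w.1.1 - w.2.1, w.1.2 - w.2.2).

Let measurable_diff : measurable_fun setT diff.
Proof.
apply/measurable_fun_pairP; split.
  by apply: measurable_funB; apply: measurableT_comp => //.
by apply: measurable_funB; apply: measurableT_comp => //.
Qed.

Let bmf_sgs (a b c d : R) :
  bounded_measurable (fun z : RR => Num.sg (linform a b z) * Num.sg (linform c d z)).
Proof. by apply: bmfM; apply: bmf_sg; exact: measurable_linform. Qed.

Lemma bmf_kern psi : bounded_measurable (fun w : RR * RR => kern psi w.1 w.2).
Proof.
have := bmf_comp measurable_diff (bmf_sgs 1 0 (sin psi) (cos psi)).
rewrite /linform; under eq_fun do rewrite /= mul1r mul0r addr0.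
exact.
Qed.

Lemma kern_norm_le1 psi z z' : `|kern psi z z'| <= 1.
Proof.
rewrite normrM !normr_sg.
by case: (_ != 0); case: (_ != 0); rewrite ?mulr1 ?mulr0 ?mul0r.
Qed.

Lemma sg_sqrt2 (x : R) : Num.sg (Num.sqrt 2 * x) = Num.sg x.
Proof. by rewrite sgrM gtr0_sg ?mul1r// sqrtr_gt0. Qed.

(** The difference of two independent pairs is [sqrt 2] times a pair, which
    signs do not see; the two linear forms left make an angle of
    [pi / 2 - psi]. *)
Lemma kern_mean psi : `|psi| <= pi / 2 -> kernel_mean (kern psi) N2 = 2 * psi / pi.
Proof.
have pi0 := @pi_gt0 R.
rewrite ler_norml => psi2.
have bF := bmf_sgs 1 0 (sin psi) (cos psi).
transitivity (\int[N2]_z \int[N2]_z' (fun z : RR => Num.sg (linform 1 0 z) *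
    Num.sg (linform (sin psi) (cos psi) z)) (z.1 - z'.1, z.2 - z'.2)).
  apply: eq_Rintegral => z _; apply: eq_Rintegral => z' _.
  by rewrite /kern /linform /= mul1r mul0r addr0.
rewrite (Rint_gauss2_diff bF).
transitivity (sgn_corr (pi / 2 - psi)).
  apply: eq_Rintegral => z _; rewrite cosB sinB cos_pihalf sin_pihalf /linform/=.
  rewrite mul0r addr0 !mul0r !mul1r add0r subr0 sg_sqrt2; congr (_ * _).
  have E (u v : R) : Num.sqrt 2 * (sin psi * u + cos psi * v) =
    sin psi * (Num.sqrt 2 * u) + cos psi * (Num.sqrt 2 * v) by ring.
  by rewrite -[RHS]sg_sqrt2 E.
rewrite sgn_corrE; last by apply/andP; split; lra.
clear psi2; move: (pi : R) pi0 => P P0; field; exact: lt0r_neq0.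
Qed.

(** The kernels differ only where the signs of two directions at angle [psi]
    differ, and Sheppard's formula gives the probability of that event. *)
Lemma kern_close psi : `|psi| <= pi / 2 ->
  \int[N2]_z \int[N2]_z' `|kern psi z z' - kern 0 z z'| <= 2 * `|psi| / pi.
Proof.
have pi0 := @pi_gt0 R.
move=> psi2.
pose F (z : RR) := Num.sg (linform 0 1 z) * Num.sg (linform (sin psi) (cos psi) z).
have bF : bounded_measurable F := bmf_sgs _ _ _ _.
have bF1 : bounded_measurable (fun z => 1 - F z) by apply: bmfB => //; exact: bmf_cst.
have bD : bounded_measurable (fun w : RR * RR => 1 - F (diff w)).
  exact: (bmf_comp measurable_diff bF1).
have bK : bounded_measurable (fun w : RR * RR => `|kern psi w.1 w.2 - kern 0 w.1 w.2|).
  by apply: bmf_norm; apply: bmfB; exact: bmf_kern.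
apply: le_trans (_ : \int[N2]_z \int[N2]_z' (1 - F (z.1 - z'.1, z.2 - z'.2)) <= _).
  apply: Rint_le; [exact: (bmf_fubini1 N2 N2 bK)|exact: (bmf_fubini1 N2 N2 bD)|].
  move=> z; apply: Rint_le; [exact: (bmf_pairl bK)|exact: (bmf_pairl bD)|].
  move=> z'; rewrite /kern /F /linform /= -mulrBr normrM normr_sg sin0 cos0 !mul0r !mul1r !add0r.
  set x := z.2 - z'.2 : R; set y := (sin psi * _ + _ : R).
  apply: le_trans (_ : `|Num.sg y - Num.sg x| <= _).
    by rewrite -[leRHS]mul1r ler_wpM2r//; case: (_ != 0).
  by case: (sgrP x) => _; case: (sgrP y) => _; rewrite ?mulr0 ?mul0r ?mulr1 ?mul1r ?mulrN ?mulNr ?mulr1 ler_norml; lra.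
rewrite (Rint_gauss2_diff bF1).
have bF2 : bounded_measurable (fun z : RR => F (Num.sqrt 2 * z.1, Num.sqrt 2 * z.2)).
  apply: bmf_comp bF; apply/measurable_fun_pairP; split; exact: measurable_funM.
rewrite (Rint_1B N2 bF2).
have -> : \int[N2]_x F (Num.sqrt 2 * x.1, Num.sqrt 2 * x.2) = sgn_corr `|psi|.
  pose G (z : RR) := Num.sg (z.1 : R) * Num.sg (z.2 : R).
  have bG : bounded_measurable G.
    by have := bmf_sgs 1 0 0 1; rewrite /linform /G;
      under eq_fun do rewrite !mul1r !mul0r addr0 add0r.
  transitivity (\int[N2]_z G (0 * z.1 + 1 * z.2, sin psi * z.1 + cos psi * z.2)).
    apply: eq_Rintegral => z _; rewrite /F /G /linform/=.
    have E (a b u v : R) : a * (Num.sqrt 2 * u) + b * (Num.sqrt 2 * v) =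
      Num.sqrt 2 * (a * u + b * v) by ring.
    by rewrite !E !sg_sqrt2.
  rewrite (@Rint_gauss2_gram R 0 1 (sin psi) (cos psi) 1 0 (cos `|psi|) (sin `|psi|) G)//.
  - by apply: eq_Rintegral => z _; rewrite /G /= mul1r mul0r addr0.
  - by ring.
  - by rewrite cos2Dsin2 addrC cos2Dsin2.
  - have -> : cos `|psi| = cos psi by case: (ger0P psi) => // _; rewrite cosN.
    by ring.
rewrite sgn_corrE; first by rewrite subKr.
by rewrite normr_ge0/=; lra.
Qed.

(** With [F] the standard normal distribution function this is [2 F - 1], which
    is uniform on [[-1, 1]]. At independence the first Hoeffding projection of
    the sign kernel is the product of two copies, see [kern0_proj]. *)
Definition Hproj (x : RT) : R := \int[N]_t Num.sg (x - t : R).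

Let bmf_sgB : bounded_measurable (fun z : RR => Num.sg (z.1 - z.2 : R)).
Proof. by apply: bmf_sg; exact: measurable_funB. Qed.

Lemma bmf_Hproj : bounded_measurable Hproj.
Proof. exact: (bmf_fubini1 N N bmf_sgB). Qed.

Lemma Hproj_norm_le1 x : `|Hproj x| <= 1.
Proof.
apply: le_trans (Rint_norm_le N (bmf_pairl bmf_sgB x)) _.
rewrite -[leRHS](Rint_cst N 1); apply: Rint_le.
- by apply: bmf_norm; exact: (bmf_pairl bmf_sgB x).
- exact: bmf_cst.
- by move=> t /=; rewrite normr_sg; case: (_ != 0).
Qed.

Lemma Hproj_mean : \int[N]_x Hproj x = 0.
Proof.
have E : \int[N]_x Hproj x = - \int[N]_x Hproj x.
  transitivity (\int[N]_y \int[N]_x Num.sg (x - y : R)).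
    by have := Rint_fubini2 N N bmf_sgB; rewrite (Rint_fubini1 N N bmf_sgB).
  rewrite -[RHS]mulN1r -RintZ; last exact: bmf_Hproj.
  apply: eq_Rintegral => y _; rewrite -RintZ; last exact: (bmf_pairl bmf_sgB y).
  by apply: eq_Rintegral => x _; rewrite /= mulN1r -sgrN opprB.
by move: E; lra.
Qed.

Let sg3 (n : nat) (Q : probability (n.-tuple RT) R) (i j k : 'I_n) : iid N Q ->
  j != i -> k != i -> k != j ->
  \int[Q]_x (Num.sg (tnth x i - tnth x j : R) * Num.sg (tnth x i - tnth x k : R)) =
  \int[N]_x Hproj x ^+ 2.
Proof.
move=> iQ ji ki kj.
have bs (a b : 'I_n) : bounded_measurable (fun x : n.-tuple RT => Num.sg (tnth x a - tnth x b : R)).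
  by apply: bmf_sg; apply: measurable_funB; exact: measurable_tnth.
rewrite (Rint_set_coord iQ k); last exact: bmfM.
transitivity (\int[Q]_x (Num.sg (tnth x i - tnth x j : R) * Hproj (tnth x i))).
  apply: eq_Rintegral => x _; rewrite /Hproj -RintZ; last exact: (bmf_pairl bmf_sgB).
  apply: eq_Rintegral => t _; rewrite !tnth_set_coord eqxx.
  by rewrite [i == k]eq_sym (negPf ki) [j == k]eq_sym (negPf kj).
have bH : bounded_measurable (fun x : n.-tuple RT => Hproj (tnth x i)).
  by apply: bmf_comp bmf_Hproj; exact: measurable_tnth.
rewrite (Rint_set_coord iQ j); last exact: bmfM.
transitivity (\int[Q]_x (Hproj (tnth x i) ^+ 2)).
  apply: eq_Rintegral => x _; rewrite expr2 {1}/Hproj -RintZr; last exact: (bmf_pairl bmf_sgB).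
  apply: eq_Rintegral => t _; rewrite !tnth_set_coord eqxx.
  by rewrite [i == j]eq_sym (negPf ji).
by apply: (Rint_coord iQ i); apply: bmfX; exact: bmf_Hproj.
Qed.

(** Among three distinct numbers, the product of the signs of the differences
    to the other two is -1 at the middle one and 1 at the extreme ones. *)
Let sgn_three (a b c : R) :
  `|(Num.sg (a - b) * Num.sg (a - c) + Num.sg (b - a) * Num.sg (b - c) +
     Num.sg (c - a) * Num.sg (c - b)) - 1| <=
  3 * ((1 - Num.sg (a - b) ^+ 2) + (1 - Num.sg (a - c) ^+ 2) + (1 - Num.sg (b - c) ^+ 2)).
Proof.
rewrite -[b - a]opprB -[c - a]opprB -[c - b]opprB !sgrN.
case: (sgrP (a - b)) => h1; case: (sgrP (a - c)) => h2; case: (sgrP (b - c)) => h3;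
  rewrite ?oppr0 ?opprK ?mulr0 ?mul0r ?mulr1 ?mul1r ?mulrN ?mulNr ?expr0n ?expr1n ?sqrrN ?expr1n/= ?mulr1 ?mul1r ?oppr0 ?opprK ler_norml; lra.
Qed.

(** For three independent copies the sum of the products of [sgn_three] is
    almost surely 1, and by symmetry each product has mean
    [\int Hproj ^+ 2]. *)
Lemma Hproj_var : \int[N]_x Hproj x ^+ 2 = 3^-1.
Proof.
pose Q := power_prob N 3; have iQ : iid N Q by exact: iid_power.
pose i0 : 'I_3 := @Ordinal 3 0 isT; pose i1 : 'I_3 := @Ordinal 3 1 isT; pose i2 : 'I_3 := @Ordinal 3 2 isT.
pose s (a b : 'I_3) (x : 3.-tuple RT) := Num.sg (tnth x a - tnth x b : R).
have bs a b : bounded_measurable (s a b).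
  by apply: bmf_sg; apply: measurable_funB; exact: measurable_tnth.
have null a b : a != b -> \int[Q]_x (1 - s a b x ^+ 2) = 0.
  move=> ab.
  have bF : bounded_measurable (fun z : RR => 1 - Num.sg (z.1 - z.2 : R) ^+ 2).
    by apply: bmf_sgrX2; apply: measurable_funB.
  rewrite (Rint_pair iQ ab bF).
  have b1 : bounded_measurable (fun x : RT => 1 - Num.sg (x : R) ^+ 2) by exact: bmf_sgrX2.
  have := Rint_normal_lin2 0 1 (-1) b1.
  under eq_Rintegral do under eq_Rintegral do rewrite add0r mul1r mulN1r.
  move=> ->; under eq_Rintegral do rewrite add0r.
  by apply: gauss_sgr0; rewrite sqrtr_eq0 -ltNge sqrrN expr1n; lra.
have bX a b c : bounded_measurable (fun x => s a b x * s a c x) by exact: bmfM.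
have bn a b : bounded_measurable (fun x => 1 - s a b x ^+ 2).
  by apply: bmfB; [exact: bmf_cst|exact: bmfX].
have bS : bounded_measurable (fun x => s i0 i1 x * s i0 i2 x + s i1 i0 x * s i1 i2 x +
    s i2 i0 x * s i2 i1 x) by apply: bmfD; [apply: bmfD|]; exact: bX.
set v := \int[N]_x _.
have E : \int[Q]_x ((s i0 i1 x * s i0 i2 x + s i1 i0 x * s i1 i2 x +
    s i2 i0 x * s i2 i1 x) - 1) = 3 * v - 1.
  rewrite RintB//; last exact: bmf_cst.
  rewrite RintD//; last exact: bmfD.
  rewrite RintD// (Rint_cst Q (1 : R)).
  by rewrite (sg3 (i := i0) (j := i1) (k := i2) iQ)// (sg3 (i := i1) (j := i0) (k := i2) iQ)//
    (sg3 (i := i2) (j := i0) (k := i1) iQ)// -/v; ring.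
have : `|3 * v - 1| <= 0.
  rewrite -E; apply: le_trans (Rint_norm_le _ _) _; first by apply: bmfB => //; exact: bmf_cst.
  apply: le_trans (_ : \int[Q]_x (3 * ((1 - s i0 i1 x ^+ 2) + (1 - s i0 i2 x ^+ 2) + (1 - s i1 i2 x ^+ 2))) <= _).
    apply: Rint_le.
    - by apply: bmf_norm; apply: bmfB => //; exact: bmf_cst.
    - by apply: bmfZ; apply: bmfD; [apply: bmfD|]; exact: bn.
    - by move=> x; exact: sgn_three.
  rewrite RintZ; last by apply: bmfD; [apply: bmfD|]; exact: bn.
  rewrite RintD; [|by apply: bmfD; exact: bn|exact: bn].
  by rewrite RintD; [|exact: bn|exact: bn]; rewrite !null// !addr0 mulr0.
by rewrite normr_le0 subr_eq0 => /eqP h; lra.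
Qed.

Lemma kern0E (z z' : RR) :
  kern 0 z z' = Num.sg (z.1 - z'.1 : R) * Num.sg (z.2 - z'.2 : R).
Proof. by rewrite /kern sin0 cos0 mul0r add0r mul1r. Qed.

Lemma kern_sym psi z z' : kern psi z' z = kern psi z z'.
Proof.
rewrite /kern -(opprB z.1 z'.1) -(opprB z.2 z'.2) !mulrN -opprD !sgrN.
by rewrite mulrNN.
Qed.

Lemma kern0_proj z : \int[N2]_z' kern 0 z z' = Hproj z.1 * Hproj z.2.
Proof.
have bF : bounded_measurable (fun z' : RR => Num.sg (z.1 - z'.1 : R) * Num.sg (z.2 - z'.2 : R)).
  by apply: bmfM; apply: bmf_sg; apply: measurable_funB.
under eq_Rintegral do rewrite kern0E.
rewrite (Rint_fubini1 N N bF) /=.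
rewrite /Hproj -RintZr; last exact: (bmf_pairl bmf_sgB).
by apply: eq_Rintegral => u _; rewrite RintZ//; exact: (bmf_pairl bmf_sgB).
Qed.

Lemma Rint_gauss2_prod (f g : RT -> R) : bounded_measurable f -> bounded_measurable g ->
  \int[N2]_z (f z.1 * g z.2) = (\int[N]_u f u) * \int[N]_v g v.
Proof.
move=> bf bg.
have bF : bounded_measurable (fun z : RR => f z.1 * g z.2).
  by apply: bmfM; [exact: bmf_comp bf|exact: bmf_comp bg].
rewrite (Rint_fubini1 N N bF) /= -RintZr//.
by apply: eq_Rintegral => u _; rewrite RintZ.
Qed.

Lemma bmf_Hprod : bounded_measurable (fun z : RR => Hproj z.1 * Hproj z.2).
Proof. by apply: bmfM; [exact: bmf_comp bmf_Hproj|exact: bmf_comp bmf_Hproj]. Qed.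

Lemma Hprod_mean : \int[N2]_z (Hproj z.1 * Hproj z.2) = 0.
Proof. by rewrite Rint_gauss2_prod ?Hproj_mean ?mul0r//; exact: bmf_Hproj. Qed.

Lemma Hprod_var : \int[N2]_z (Hproj z.1 * Hproj z.2) ^+ 2 = 9^-1.
Proof.
under eq_Rintegral do rewrite exprMn.
rewrite (@Rint_gauss2_prod (fun x => Hproj x ^+ 2) (fun x => Hproj x ^+ 2)).
- by rewrite Hproj_var; field.
- by apply: bmfX; exact: bmf_Hproj.
- by apply: bmfX; exact: bmf_Hproj.
Qed.

Section indep_sample.
Variables (n : nat) (Q : probability (n.-tuple RR) R).
Hypothesis iQ : iid N2 Q.

Let K (k l : 'I_n) (x : n.-tuple RR) := kern 0 (tnth x k) (tnth x l).

Let bK k l : bounded_measurable (K k l).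
Proof. exact: (bmf_kernel (bmf_kern 0)). Qed.

Let bH m : bounded_measurable (fun x : n.-tuple RR => Hproj (tnth x m).1 * Hproj (tnth x m).2).
Proof. by apply: (bmf_comp (measurable_tnth m) bmf_Hprod). Qed.

Let bKz z : bounded_measurable (fun z' => kern 0 z z').
Proof. exact: (bmf_pairl (bmf_kern 0)). Qed.

(** Conditioning the kernel on one of its arguments leaves a product of two
    copies of [Hproj], whose variance is 1/9. *)
Lemma kern0_H (k l m : 'I_n) : l != k ->
  \int[Q]_x (K k l x * (Hproj (tnth x m).1 * Hproj (tnth x m).2)) =
  ((m == k) + (m == l))%N%:R / 9.
Proof.
have main k' l' : l' != k' ->
  \int[Q]_x (K k' l' x * (Hproj (tnth x k').1 * Hproj (tnth x k').2)) = 9^-1.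
  move=> lk'; rewrite (Rint_set_coord iQ l'); last exact: bmfM.
  transitivity (\int[Q]_x (Hproj (tnth x k').1 * Hproj (tnth x k').2) ^+ 2).
    apply: eq_Rintegral => x _.
    transitivity ((\int[N2]_t kern 0 (tnth x k') t) *
      (Hproj (tnth x k').1 * Hproj (tnth x k').2)); last by rewrite kern0_proj expr2.
    rewrite -RintZr; last exact: bKz.
    apply: eq_Rintegral => t _; rewrite /K !tnth_set_coord eqxx.
    by rewrite [k' == l']eq_sym (negPf lk').
  by rewrite (Rint_coord iQ k' (bmfX 2 bmf_Hprod)) Hprod_var.
move=> lk; have [->|mk] := eqVneq m k.
  by rewrite eq_sym (negPf lk) main// mul1r.
have [ml|ml] := eqVneq m l.
  rewrite mul1r -(main l k); last by rewrite eq_sym.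
  by apply: eq_Rintegral => x _; rewrite ml /K kern_sym.
rewrite mul0r (Rint_set_coord iQ m); last exact: bmfM.
transitivity (\int[Q]_x (0 : R)); last by rewrite Rint_cst.
apply: eq_Rintegral => x _; rewrite -[RHS](mulr0 (K k l x)) -[X in _ * X]Hprod_mean.
rewrite -RintZ; last exact: bmf_Hprod.
apply: eq_Rintegral => t _; rewrite /K !tnth_set_coord eqxx.
by rewrite [k == m]eq_sym (negPf mk) [l == m]eq_sym (negPf ml).
Qed.

(** Kernels at disjoint pairs are uncorrelated, kernels that share one index
    are correlated through the projection, and the second summand pays for
    pairs with the same two indices. *)
Let cov_le (k l k' l' : 'I_n) : l != k -> l' != k' ->
  \int[Q]_x (K k l x * K k' l' x) <=
  ((k' == k) + (k' == l) + (l' == k) + (l' == l))%N%:R / 9 +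
  ((k' == k) && (l' == l) + (k' == l) && (l' == k))%N%:R.
Proof.
move=> lk lk'.
have red (k1 l1 : 'I_n) : l1 != k1 -> l1 != k -> l1 != l ->
    \int[Q]_x (K k l x * K k1 l1 x) = ((k1 == k) + (k1 == l))%N%:R / 9.
  move=> l1k1 l1k l1l; rewrite (Rint_set_coord iQ l1); last exact: bmfM.
  rewrite -(kern0_H k1 lk); apply: eq_Rintegral => x _.
  transitivity (K k l x * \int[N2]_t kern 0 (tnth x k1) t); last by rewrite kern0_proj.
  rewrite -RintZ; last exact: bKz.
  apply: eq_Rintegral => t _.
  rewrite /K !tnth_set_coord eqxx [k == l1]eq_sym (negPf l1k) [l == l1]eq_sym (negPf l1l).
  by rewrite [k1 == l1]eq_sym (negPf l1k1).
have [l'k|l'k] := eqVneq l' k; last have [l'l|l'l] := eqVneq l' l.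
- have [k'k|k'k] := eqVneq k' k; first by rewrite l'k k'k eqxx in lk'.
  have [k'l|k'l] := eqVneq k' l.
    apply: le_trans (_ : 1 <= _); last by rewrite /= ler_wpDl// divr_ge0.
    rewrite -(Rint_cst Q 1); apply: Rint_le; [exact: bmfM|exact: bmf_cst|].
    move=> x; apply: le_trans (ler_norm _) _; rewrite normrM.
    by rewrite mulr_ile1// kern_norm_le1.
  rewrite l'k [k == l]eq_sym (negPf lk) /= addr0.
  rewrite (_ : \int[Q]_x _ = \int[Q]_x (K k l x * K l' k' x)).
    by rewrite red// ?l'k ?eqxx// [k == l]eq_sym (negPf lk).
  by apply: eq_Rintegral => x _; rewrite /K [kern 0 (tnth x k') _]kern_sym l'k.
- have [k'l|k'l] := eqVneq k' l; first by rewrite l'l k'l eqxx in lk'.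
  have [k'k|k'k] := eqVneq k' k.
    apply: le_trans (_ : 1 <= _); last by rewrite /= ler_wpDl// divr_ge0.
    rewrite -(Rint_cst Q 1); apply: Rint_le; [exact: bmfM|exact: bmf_cst|].
    move=> x; apply: le_trans (ler_norm _) _; rewrite normrM.
    by rewrite mulr_ile1// kern_norm_le1.
  rewrite /= addr0.
  rewrite (_ : \int[Q]_x _ = \int[Q]_x (K k l x * K l' k' x)).
    by rewrite red// ?l'l ?eqxx ?(negPf lk)// -l'l eq_sym.
  by apply: eq_Rintegral => x _; rewrite /K [kern 0 (tnth x k') _]kern_sym.
- by rewrite red// !andbF !addn0 addr0.
Qed.

(** The leading constant 4/9 is what fixes the threshold of the theorem:
    [(2 sqrt 2 / 3) ^ 2] is twice 4/9. *)
Lemma ustat_indep_var : (1 < n)%N ->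
  \int[Q]_x (ustat (kern 0) x) ^+ 2 <= 4 / (9 * n%:R) + 2 / (n * n.-1)%N%:R.
Proof.
move=> n1.
have n0 : (0 < n * n.-1)%N by case: n n1 => [|[|m]].
have nn0 : (n * n.-1)%N%:R != 0 :> R by rewrite pnatr_eq0 -lt0n.
pose S x := \sum_(k < n) \sum_(l < n | l != k) K k l x.
have bS1 k : bounded_measurable (fun x => \sum_(l < n | l != k) K k l x).
  by apply: bmf_sum => l _.
have bS : bounded_measurable S by apply: bmf_sum => k _.
have E x : (ustat (kern 0) x) ^+ 2 = ((n * n.-1)%N%:R)^-1 ^+ 2 *
    \sum_(k < n) \sum_(l < n | l != k) \sum_(k' < n) \sum_(l' < n | l' != k')
      K k l x * K k' l' x.
  rewrite /ustat exprMn; congr (_ * _); transitivity (S x * S x); first by rewrite expr2.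
  rewrite /S mulr_suml.
  apply: eq_bigr => k _; rewrite mulr_suml; apply: eq_bigr => l _.
  by rewrite mulr_sumr; apply: eq_bigr => k' _; rewrite mulr_sumr.
under eq_Rintegral do rewrite E.
have b4 k l k' : bounded_measurable (fun x => \sum_(l' < n | l' != k') K k l x * K k' l' x).
  by apply: bmf_sum => l' _; exact: bmfM.
have b3 k l : bounded_measurable (fun x => \sum_(k' < n) \sum_(l' < n | l' != k') K k l x * K k' l' x).
  by apply: bmf_sum => k' _.
have b2 k : bounded_measurable (fun x => \sum_(l < n | l != k) \sum_(k' < n) \sum_(l' < n | l' != k') K k l x * K k' l' x).
  by apply: bmf_sum => l _.
rewrite RintZ; last by apply: bmf_sum => k _.
rewrite Rint_sum//.
apply: le_trans (_ : ((n * n.-1)%N%:R)^-1 ^+ 2 * \sum_(k < n) \sum_(l < n | l != k)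
   (4 * n.-1%:R / 9 + 2) <= _).
  rewrite ler_wpM2l ?sqr_ge0//; apply: ler_sum => k _.
  rewrite Rint_sum//; apply: ler_sum => l lk.
  rewrite Rint_sum//.
  apply: le_trans (_ : \sum_(k' < n) \sum_(l' < n | l' != k')
    (((k' == k)%:R + (k' == l)%:R + (l' == k)%:R + (l' == l)%:R) / 9 +
      ((k' == k)%:R * (l' == l)%:R + (k' == l)%:R * (l' == k)%:R)) <= _).
    apply: ler_sum => k' _; rewrite Rint_sum; last by move=> l' _; exact: bmfM.
    apply: ler_sum => l' lk'; apply: le_trans (cov_le lk lk') _.
    by rewrite !natrD -!mulnb !natrM.
  have one (a b : 'I_n) : b != a -> \sum_(k' < n | k' != a) (k' == b)%:R = 1 :> R.
    move=> ba; rewrite (bigD1 b)//= eqxx big1 ?addr0// => i /andP[_ /negPf ->]//.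
  have oneT (b : 'I_n) : \sum_(k' < n) (k' == b)%:R = 1 :> R.
    by rewrite (bigD1 b)//= eqxx big1 ?addr0// => i /negPf ->.
  have cst (c : R) (k' : 'I_n) : \sum_(l' < n | l' != k') c = n.-1%:R * c.
    rewrite sumr_const -[c *+ _]mulr_natl; congr (_%:R * _).
    by have := cardC1 k'; rewrite card_ord.
  have col (a : 'I_n) : \sum_(k' < n) \sum_(l' < n | l' != k') (k' == a)%:R = n.-1%:R :> R.
    under eq_bigr do rewrite cst.
    by rewrite -mulr_sumr oneT mulr1.
  have row (a : 'I_n) : \sum_(k' < n) \sum_(l' < n | l' != k') (l' == a)%:R = n.-1%:R :> R.
    rewrite -(col a) (exchange_big_dep predT)//=.
    by apply: eq_bigr => j _; apply: eq_bigl => i; rewrite eq_sym.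
  have pt (a b : 'I_n) : b != a -> \sum_(k' < n) \sum_(l' < n | l' != k') (k' == a)%:R * (l' == b)%:R = 1 :> R.
    move=> ba; under eq_bigr do rewrite -mulr_sumr.
    rewrite (bigD1 a)//= eqxx mul1r one// big1 ?addr0// => i /negPf ->; rewrite mul0r//.
  have splt : \sum_(k' < n) \sum_(l' < n | l' != k')
    (((k' == k)%:R + (k' == l)%:R + (l' == k)%:R + (l' == l)%:R) / 9 +
      ((k' == k)%:R * (l' == l)%:R + (k' == l)%:R * (l' == k)%:R)) =
    (n.-1%:R + n.-1%:R + n.-1%:R + n.-1%:R) / 9 + (1 + 1) :> R.
    under eq_bigr do rewrite big_split/= -mulr_suml.
    rewrite big_split/= -mulr_suml; congr (_ / 9 + _).
      under eq_bigr do rewrite !big_split/=.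
      by rewrite !big_split/= !col !row.
    under eq_bigr do rewrite !big_split/=.
    by rewrite !big_split/= !pt// eq_sym.
  by rewrite splt; lra.
rewrite sum_offdiag expr2 -!mulrA mulKf// le_eqVlt; apply/orP; left; apply/eqP.
have p0 : n.-1%:R != 0 :> R by rewrite pnatr_eq0; case: n n1 => [|[|m]].
have q0 : n%:R != 0 :> R by rewrite pnatr_eq0 -lt0n; exact: ltnW.
by rewrite natrM; field; rewrite p0 q0.
Qed.

End indep_sample.

Section kendall_sample.
Variables (n : nat) (Q : probability (n.-tuple RR) R) (psi : R).
Hypotheses (iQ : iid N2 Q) (psi2 : `|psi| <= pi / 2).

Lemma ustat_kern_close : (1 < n)%N ->
  \int[Q]_x `|ustat (kern psi) x - ustat (kern 0) x| <= 2 * `|psi| / pi.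
Proof.
move=> n1.
have n0 : (0 < n * n.-1)%N by case: n n1 => [|[|m]].
pose D (k l : 'I_n) (x : n.-tuple RR) := `|kern psi (tnth x k) (tnth x l) - kern 0 (tnth x k) (tnth x l)|.
have bF : bounded_measurable (fun w : RR * RR => `|kern psi w.1 w.2 - kern 0 w.1 w.2|).
  by apply: bmf_norm; apply: bmfB; exact: bmf_kern.
have bD k l : bounded_measurable (D k l).
  by apply: bmf_norm; apply: bmfB; exact: (bmf_kernel (bmf_kern _)).
have bDs k : bounded_measurable (fun x => \sum_(l < n | l != k) D k l x) by apply: bmf_sum.
apply: le_trans (_ : \int[Q]_x ((n * n.-1)%N%:R^-1 * \sum_(k < n) \sum_(l < n | l != k) D k l x) <= _).
  apply: Rint_le.
  - by apply: bmf_norm; apply: bmfB; exact: (bmf_ustat (bmf_kern _)).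
  - by apply: bmfZ; apply: bmf_sum.
  move=> x; rewrite /ustat -mulrBr normrM ger0_norm ?invr_ge0//.
  rewrite ler_wpM2l ?invr_ge0// -sumrB.
  apply: le_trans (ler_norm_sum _ _ _) _; apply: ler_sum => k _.
  by rewrite -sumrB; apply: le_trans (ler_norm_sum _ _ _) _.
rewrite RintZ; last by apply: bmf_sum.
rewrite Rint_sum// -ler_pdivlMl ?invr_gt0 ?ltr0n// invrK -sum_offdiag.
apply: ler_sum => k _; rewrite Rint_sum//; apply: ler_sum => l lk.
rewrite /D (Rint_pair iQ (F := fun w : RR * RR => `|kern psi w.1 w.2 - kern 0 w.1 w.2|))//.
  exact: kern_close.
by rewrite eq_sym.
Qed.

(** The variance is at most the second moment about 0, and the second moments
    for [psi] and for 0 are close since both statistics are bounded by 1. *)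
Lemma ustat_kern_var : (1 < n)%N ->
  \int[Q]_x (ustat (kern psi) x - 2 * psi / pi) ^+ 2 <=
  4 / (9 * n%:R) + 2 / (n * n.-1)%N%:R + 4 * `|psi| / pi.
Proof.
move=> n1.
have bU p : bounded_measurable (fun x : n.-tuple RR => ustat (kern p) x).
  exact: (bmf_ustat (bmf_kern _)).
have U1 p x : `|@ustat _ _ R (kern p) n x| <= 1 by apply: ustat_norm_le1 => z z'; exact: kern_norm_le1.
have m : \int[Q]_x ustat (kern psi) x = 2 * psi / pi.
  rewrite -(kern_mean psi2) -(Rint_ustat_sel (bmf_kern psi) iQ n1 (fun _ _ => id) (e := id)).
  by apply: eq_Rintegral => x _; congr (ustat _ _); apply: eq_from_tnth => k; rewrite tnth_sel.
apply: le_trans (_ : \int[Q]_x (ustat (kern psi) x) ^+ 2 <= _).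
  set c := 2 * psi / pi in m *.
  rewrite (_ : \int[Q]_x (ustat (kern psi) x - c) ^+ 2 =
     \int[Q]_x (ustat (kern psi) x) ^+ 2 - c ^+ 2); first by rewrite gerBl sqr_ge0.
  transitivity (\int[Q]_x ((ustat (kern psi) x) ^+ 2 - (2 * c * ustat (kern psi) x - c ^+ 2))).
    by apply: eq_Rintegral => x _; ring.
  have bc : bounded_measurable (fun x => 2 * c * @ustat _ _ R (kern psi) n x) by exact: bmfZ.
  rewrite RintB; [|exact: bmfX|by apply: bmfB => //; exact: bmf_cst].
  rewrite RintB//; last exact: bmf_cst.
  by rewrite RintZ// m Rint_cst; ring.
apply: le_trans (_ : \int[Q]_x ((ustat (kern 0) x) ^+ 2 + 2 * `|ustat (kern psi) x - ustat (kern 0) x|) <= _).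
  apply: Rint_le.
  - exact: bmfX.
  - by apply: bmfD; [exact: bmfX|apply: bmfZ; apply: bmf_norm; exact: bmfB].
  move=> x; set u := ustat _ _; set v := ustat _ _.
  have : u ^+ 2 - v ^+ 2 <= 2 * `|u - v|.
    rewrite subr_sqr mulrC; apply: le_trans (ler_norm _) _; rewrite normrM ler_wpM2r//.
    by apply: le_trans (ler_normD _ _) _; have := U1 psi x; have := U1 0 x; rewrite -/u -/v; lra.
  lra.
rewrite RintD; [|exact: bmfX|by apply: bmfZ; apply: bmf_norm; exact: bmfB].
rewrite RintZ; last by apply: bmf_norm; exact: bmfB.
have := ustat_indep_var iQ n1; have := ustat_kern_close n1.
rewrite -!mulrA; move: (`|psi| / pi) => w; lra.
Qed.

End kendall_sample.

(** Kendall's tau is invariant under shifts and positive rescalings of each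
    coordinate, so only the correlation of the two coordinates matters. *)
Lemma kendall_law (n p : nat) (mu : 'cV[R]_p) (Sigma : 'M[R]_p)
    (Q : probability (sample R n p) R) (G : probability (n.-tuple RR) R)
    (i j : 'I_p) (psi : R) (f : R -> R) :
  gaussian_sample mu Sigma Q -> (forall i, 0 < Sigma i i) -> iid N2 G ->
  corrmx Sigma i j = sin psi -> 0 <= cos psi -> bounded_measurable f ->
  \int[Q]_x f (kendall_tau x i j) = \int[G]_x f (ustat (kern psi) x).
Proof.
move=> [P [mP iQ]] S0 iG rho cpsi bf.
pose raw (z z' : RR) := Num.sg (z.1 - z'.1 : R) * Num.sg (z.2 - z'.2 : R).
have braw : bounded_measurable (fun w : RR * RR => raw w.1 w.2).
  by have := bmf_kern 0; under eq_fun do rewrite kern0E.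
pose phi (x : p.-tuple RT) : RR := (tnth x i, tnth x j).
pose cm := corr_map (mu i 0) (Num.sqrt (Sigma i i)) (mu j 0) (Num.sqrt (Sigma j j)) (corrmx Sigma i j).
have mphi : measurable_fun setT phi.
  by apply/measurable_fun_pairP; split; exact: measurable_tnth.
have bfu : bounded_measurable (fun y : n.-tuple RR => f (ustat raw y)).
  by apply: bmf_comp bf; case: (bmf_ustat braw n).
have := iid_transfer iQ iG mphi (measurable_corr_map _ _ _ _ _ : measurable_fun setT cm)
  (pair_law mP S0 i j) bfu.
rewrite (_ : \int[Q]_x _ = \int[Q]_x f (kendall_tau x i j)); last first.
  apply: eq_Rintegral => x _; congr f; rewrite /ustat /kendall_tau; congr (_ * _).
  by apply: eq_bigr => k _; apply: eq_bigr => l _; rewrite !tnth_mktuple.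
move=> ->; apply: eq_Rintegral => x _; congr f; rewrite /ustat; congr (_ * _).
apply: eq_bigr => k _; apply: eq_bigr => l _; rewrite !tnth_mktuple /raw /cm /corr_map/= /kern rho.
have -> : Num.sqrt (1 - sin psi ^+ 2) = cos psi.
  by rewrite -cos2sin2 sqrtr_sqr ger0_norm.
have si : 0 < Num.sqrt (Sigma i i) by rewrite sqrtr_gt0.
have sj : 0 < Num.sqrt (Sigma j j) by rewrite sqrtr_gt0.
move: (tnth x k) (tnth x l) => [u v] [u' v'] /=.
have E1 (m s a b : R) : m + s * a - (m + s * b) = s * (a - b) by ring.
have E2 (m s a b c d a' b' : R) : m + s * (a * c + b * d) - (m + s * (a * a' + b * b')) =
  s * (a * (c - a') + b * (d - b')) by ring.
by rewrite E1 E2 !sgrM (gtr0_sg si) (gtr0_sg sj) !mul1r.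
Qed.

End kendall.

(** * Concentration of Kendall's tau *)

Section block_embedding.
Variables (n N b : nat).
Hypothesis Nbn : (N * b <= n)%N.

Lemma block_subproof (j : 'I_N) (l : 'I_b) : (j * b + l < n)%N.
Proof.
apply: leq_trans Nbn; apply: leq_trans (_ : j.+1 * b <= _)%N.
  by rewrite mulSn addnC ltn_add2r.
by rewrite leq_mul2r ltn_ord orbT.
Qed.

Definition block_emb (j : 'I_N) (l : 'I_b) : 'I_n := Ordinal (block_subproof j l).

Lemma block_emb_div j l : (block_emb j l %/ b)%N = j.
Proof.
have b0 : (0 < b)%N by case: b l => // -[].
by rewrite /= divnMDl// divn_small// addn0.
Qed.

Lemma block_emb_disj j j' l l' : block_emb j l = block_emb j' l' -> j = j'.
Proof.
by move=> E; apply: val_inj => /=; rewrite -(block_emb_div j l) E block_emb_div.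
Qed.

Lemma block_emb_inj j : injective (block_emb j).
Proof. by move=> l l' [/eqP]; rewrite eqn_add2l => /eqP /val_inj. Qed.

End block_embedding.

Section ustat_bounds.
Context d (T : measurableType d) (R : realType) (h : T -> T -> R).
Hypothesis bh : bounded_measurable (fun z : T * T => h z.1 z.2).
Hypothesis h1 : forall t t', `|h t t'| <= 1.

(** Blocks of length two: each block statistic has variance at most 4, and
    there are at least [n / 3] blocks. *)
Lemma ustat_var_le (P : probability T R) n (Q : probability (n.-tuple T) R) :
  iid P Q -> (1 < n)%N ->
  \int[Q]_x (ustat h x - kernel_mean h P) ^+ 2 <= 12 / n%:R.
Proof.
move=> iQ n1.
have N0 : (0 < n./2)%N by rewrite half_gt0.
have Nbn : (n./2 * 2 <= n)%N by rewrite muln2 -{2}(odd_double_half n) leq_addl.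
apply: le_trans (_ : 4 / (n./2)%:R <= _).
  have H := @ustat_var _ _ _ _ bh _ _ _ iQ _ 2 _ N0 isT (@block_emb_inj _ _ _ Nbn)
    (@block_emb_disj _ _ _ Nbn).
  apply: H => j.
  rewrite -(Rint_cst Q 4); apply: Rint_le.
  - apply: bmfX; apply: bmfB; last exact: bmf_cst.
    by apply: (bmf_comp (@measurable_sel _ _ _ _ _) (bmf_ustat bh 2)).
  - exact: bmf_cst.
  move=> x; rewrite -real_normK ?num_real//.
  rewrite (_ : 4 = 2 ^+ 2 :> R); last by ring.
  rewrite lerXn2r ?nnegrE//; apply: le_trans (ler_normB _ _) _.
  have u1 : `|ustat h (sel (block_emb Nbn j) x)| <= 1 by exact: ustat_norm_le1.
  apply: le_trans (lerD u1 (kernel_mean_norm_le1 bh h1 iQ n1)) _.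
  by lra.
have H : n%:R <= 3 * (n./2)%:R :> R.
  rewrite -natrM ler_nat mulSn -{1}(odd_double_half n) -mul2n leq_add2r.
  by apply: leq_trans N0; case: (odd n).
rewrite ler_pdivrMr ?ltr0n// mulrAC ler_pdivlMr ?ltr0n; last exact: ltnW.
by move: H; lra.
Qed.

End ustat_bounds.

Section kendall_bounds.
Variable R : realType.
Local Notation RT := (measurableTypeR R).
Local Notation RR := (RT * RT)%type.
Local Notation N2 := (gauss2 R).

Section sample.
Variables (n : nat) (Q : probability (n.-tuple RR) R) (psi : R).
Hypotheses (iQ : iid N2 Q) (psi2 : `|psi| <= pi / 2).

Local Notation Y := (fun x : n.-tuple RR => ustat (kern psi) x - 2 * psi / pi).

Lemma bmf_kdev : bounded_measurable Y.
Proof. by apply: bmfB; [exact: (bmf_ustat (bmf_kern _))|exact: bmf_cst]. Qed.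

Lemma kendall_var : (1 < n)%N -> \int[Q]_x Y x ^+ 2 <= 12 / n%:R.
Proof.
move=> n1; rewrite -(kern_mean psi2).
by apply: (ustat_var_le (bmf_kern psi)) => //; exact: kern_norm_le1.
Qed.

Lemma kendall_mgf N b t : (0 < N)%N -> (1 < b)%N -> (N * b <= n)%N ->
  \int[Q]_x expR (t * Y x) <=
  expR (t ^+ 2 / 2 * expR (2 * `|t| / N%:R) *
    (4 / (9 * b%:R) + 2 / (b * b.-1)%N%:R + 4 * `|psi| / pi) / N%:R).
Proof.
move=> N0 b1 Nbn; rewrite -(kern_mean psi2).
apply: (ustat_mgf (bmf_kern psi) (@kern_norm_le1 _ psi) iQ N0 b1
  (@block_emb_inj _ _ _ Nbn) (@block_emb_disj _ _ _ Nbn)) => j.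
rewrite (kern_mean psi2).
rewrite (Rint_sel (Q' := power_prob N2 b) (f := fun y => (ustat (kern psi) y - 2 * psi / pi) ^+ 2) iQ).
- by apply: ustat_kern_var => //; exact: iid_power.
- exact: iid_power.
- exact: block_emb_inj.
- by apply: bmfX; apply: bmfB; [exact: (bmf_ustat (bmf_kern _))|exact: bmf_cst].
Qed.

End sample.

(** Hoeffding's decomposition with blocks of a fixed length [b]: for large [b]
    and small [psi] a block has variance close to [4 / (9 b)], and the second
    order remainder is negligible once [t / n] is small. *)
Lemma kendall_mgf_asymp (v : R) : 4 / 9 < v ->
  exists2 D : R, 0 < D & exists n0 : nat, forall n (Q : probability (n.-tuple RR) R) psi t,
    iid N2 Q -> (n0 <= n)%N -> `|psi| <= pi / 2 -> `|psi| <= D -> `|t| <= D * n%:R ->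
    \int[Q]_x expR (t * (ustat (kern psi) x - 2 * psi / pi)) <=
    expR (v * t ^+ 2 / (2 * n%:R)).
Proof.
move=> v49; pose g := v - 4 / 9; have g0 : 0 < g by rewrite subr_gt0.
(* [w] bounds the block variance times [b]; the factor [s] is spent twice, on
   the remainder of the exponential and on the incomplete last block. *)
pose w := 4 / 9 + g / 4.
have w0 : 0 < w by rewrite /w; lra.
have [s s1 sw] : exists2 s : R, 1 < s & w * s * s <= v.
  pose e := Num.min 1 (g / (4 * w)).
  have e0 : 0 < e by rewrite lt_min ltr01 divr_gt0// mulr_gt0.
  exists (1 + e); first by rewrite ltrDl.
  have e1 : e <= 1 by rewrite ge_min lexx.
  have ew : e * (4 * w) <= g by rewrite -ler_pdivlMr ?mulr_gt0// ge_min lexx orbT.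
  have : e * e <= e by rewrite ler_piMr// ltW.
  rewrite -mulrA; have -> : (1 + e) * (1 + e) = 1 + 2 * e + e * e by ring.
  move=> e2; have := ler_wpM2l (ltW w0) e2; move: ew.
  have wv : v = w + 3 * (g / 4) by rewrite /w /g; field.
  rewrite wv; move: (w) (g) => W G.
  have -> : W * (1 + 2 * e + e * e) = W + 2 * (W * e) + W * (e * e) by ring.
  have -> : e * (4 * W) = 4 * (W * e) by ring.
  move: (W * e) (W * (e * e)) => *; lra.
(* [b] is large enough for the lower order term of the block variance. *)
pose B := 16 / g; have B0 : 0 < B by rewrite divr_gt0.
have [b b1 bB] : exists2 b, (1 < b)%N & B <= b.-1%:R.
  by exists (Num.truncn B).+2 => //=; apply/ltW; exact: truncnS_gt.
have b0 : 0 < b%:R :> R by rewrite ltr0n; exact: ltnW.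
have pi0 : (0 : R) < pi := pi_gt0 R.
have ls0 : 0 < ln s by rewrite ln_gt0.
pose D := Num.min (ln s / (4 * b%:R)) (g * pi / (32 * b%:R)).
have D0 : 0 < D by rewrite lt_min !divr_gt0// ?mulr_gt0.
exists D => //.
pose n0 := maxn (2 * b) (Num.truncn (b%:R * s / (s - 1))).+1.
exists n0 => n Q psi t iQ n0n psi2 psiD tD.
pose N := (n %/ b)%N.
have nb : (2 * b <= n)%N by apply: leq_trans n0n; rewrite leq_maxl.
have nS : b%:R * s <= (s - 1) * n%:R.
  rewrite mulrC -[X in _ <= X]mulrC -ler_pdivrMr ?subr_gt0// [s * _]mulrC.
  apply/ltW/(lt_le_trans (truncnS_gt _)); rewrite ler_nat.
  by apply: leq_trans n0n; rewrite leq_maxr.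
have N0 : (0 < N)%N.
  by rewrite divn_gt0 ?(ltnW b1)//; apply: leq_trans nb; rewrite leq_pmull.
have Nbn : (N * b <= n)%N by exact: leq_divM.
apply: le_trans (kendall_mgf iQ psi2 t N0 b1 Nbn) _; rewrite ler_expR.
have y0 : 0 < N%:R :> R by rewrite ltr0n.
have x0 : 0 < n%:R :> R by rewrite ltr0n; apply: leq_trans nb; rewrite muln_gt0/= ltnW.
have nN : n%:R <= N%:R * b%:R + b%:R :> R.
  rewrite -natrM -natrD ler_nat addnC -mulSn; apply/ltnW/ltn_ceil; exact: ltnW.
have nb' : 2 * b%:R <= n%:R :> R by rewrite -natrM ler_nat.
have xy : n%:R <= s * (N%:R * b%:R).
  have := ler_wpM2l (ltW (lt_trans ltr01 s1)) nN; rewrite mulrDr [s * b%:R]mulrC.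
  move: nS; rewrite mulrBl mul1r; move: (s * (N%:R * b%:R)) (s * n%:R) (b%:R * s) => A B' C.
  by move: (n%:R : R) => X; lra.
have xy2 : n%:R <= 2 * (N%:R * b%:R) :> R.
  have gen (X A C : R) : X <= A + C -> 2 * C <= X -> X <= 2 * A by lra.
  exact: gen nN nb'.
have Es : expR (2 * `|t| / N%:R) <= s.
  rewrite -[leRHS](lnK (_ : s \is Num.pos)); last by rewrite posrE (lt_trans ltr01).
  rewrite ler_expR ler_pdivrMr//.
  apply: le_trans (_ : 2 * (D * (2 * (N%:R * b%:R))) <= _).
    by rewrite ler_pM2l//; apply: le_trans tD _; rewrite ler_pM2l.
  have : D * (4 * b%:R) <= ln s by rewrite -ler_pdivlMr ?mulr_gt0// ge_min lexx.
  move=> /(ler_wpM2l (ltW y0)); rewrite [_ * ln s]mulrC.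
  by apply: le_trans; rewrite le_eqVlt; apply/orP; left; apply/eqP; ring.
have Sw : b%:R * (4 / (9 * b%:R) + 2 / (b * b.-1)%N%:R + 4 * `|psi| / pi) <= w.
  have b10 : 0 < b.-1%:R :> R by rewrite ltr0n; move: b1; case: (b) => [|[]].
  have -> : b%:R * (4 / (9 * b%:R) + 2 / (b * b.-1)%N%:R + 4 * `|psi| / pi) =
    4 / 9 + 2 / b.-1%:R + 4 * b%:R * `|psi| / pi.
    rewrite natrM; move: (b.-1%:R : R) (gt_eqF b10) (b%:R : R) (gt_eqF b0) (pi : R) (gt_eqF pi0).
    by move=> c c0 a a0 P P0; field; rewrite c0 a0 P0.
  have h1 : 2 / b.-1%:R <= g / 8.
    rewrite ler_pdivrMr//; have := ler_wpM2l (ltW g0) bB; rewrite /B mulrC divfK ?gt_eqF//; lra.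
  have h2 : 4 * b%:R * `|psi| / pi <= g / 8.
    rewrite ler_pdivrMr//.
    have : `|psi| * (32 * b%:R) <= g * pi.
      by rewrite -ler_pdivlMr ?mulr_gt0//; apply: le_trans psiD _; rewrite ge_min lexx orbT.
    by move: (`|psi|) (g * pi) (pi : R) => *; lra.
  rewrite /w; move: h1 h2; move: (2 / _) (_ / pi) => h1 h2; lra.
set E := expR _ in Es *; set S := (_ + _ + _) in Sw *.
have S0 : 0 <= S by rewrite /S !addr_ge0// !mulr_ge0// ?invr_ge0// ?mulr_ge0// ltW.
have E0 : 0 <= E by rewrite expR_ge0.
have key : E * S * n%:R <= v * N%:R.
  apply: le_trans (_ : s * S * (s * (N%:R * b%:R)) <= _).
    apply: ler_pM => //; [exact: mulr_ge0|].
    by rewrite ler_wpM2r.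
  have -> : s * S * (s * (N%:R * b%:R)) = N%:R * (s * s * (b%:R * S)) by ring.
  rewrite mulrC ler_wpM2r ?(ltW y0)//.
  apply: le_trans sw; have -> : w * s * s = s * s * w by ring.
  by apply: ler_wpM2l => //; rewrite -expr2 sqr_ge0.
have -> : t ^+ 2 / 2 * E * S / N%:R = t ^+ 2 / 2 * (E * S / N%:R) by ring.
have -> : v * t ^+ 2 / (2 * n%:R) = t ^+ 2 / 2 * (v / n%:R) by rewrite invfM; ring.
apply: ler_wpM2l; first by rewrite divr_ge0 ?sqr_ge0.
by rewrite ler_pdivrMr// mulrAC ler_pdivlMr.
Qed.

(** Chernoff's bound at the optimal [t = x n / v]. The square is absorbed into
    the exponential: [u <= exp (u - 1)] bounds [Y ^ 2] by
    [x ^ 2 exp (t (|Y| - x))] as soon as [2 v <= x ^ 2 n]. *)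
Lemma kendall_tail (v : R) : 4 / 9 < v ->
  exists2 D : R, 0 < D & exists n0 : nat, forall n (Q : probability (n.-tuple RR) R) psi x,
    iid N2 Q -> (n0 <= n)%N -> `|psi| <= pi / 2 -> `|psi| <= D ->
    0 < x -> x <= D -> 2 * v <= x ^+ 2 * n%:R ->
    \int[Q]_y ((ustat (kern psi) y - 2 * psi / pi) ^+ 2 *
       (x <= `|ustat (kern psi) y - 2 * psi / pi|)%R%:R) <=
    2 * x ^+ 2 * expR (- (x ^+ 2 * n%:R / (2 * v))).
Proof.
move=> v49; have [D D0 [n0 H]] := kendall_mgf_asymp v49.
have v0 : 0 < v by apply: lt_trans v49; rewrite divr_gt0.
exists (Num.min D (D * v)); first by rewrite lt_min D0 mulr_gt0.
exists n0 => n Q psi x iQ n0n psi2; rewrite !le_min => /andP[psiD _] x0 /andP[xD xDv] xv.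
have n00 : 0 < n%:R :> R.
  rewrite lt_neqAle ler0n andbT eq_sym; apply/eqP => n0'.
  by move: xv; rewrite n0' mulr0; lra.
pose t := x * n%:R / v.
have t0 : 0 < t by rewrite divr_gt0// mulr_gt0.
have tD : `|t| <= D * n%:R.
  by rewrite gtr0_norm// ler_pdivrMr// mulrAC ler_pM2r.
have tD' : `|- t| <= D * n%:R by rewrite normrN.
have := H _ _ _ _ iQ n0n psi2 psiD tD; have := H _ _ _ _ iQ n0n psi2 psiD tD'.
pose Y (y : n.-tuple RR) := ustat (kern psi) y - 2 * psi / pi.
have bY : bounded_measurable Y := bmf_kdev _ _.
have bE s : bounded_measurable (fun y => expR (s * Y y)) by apply: bmf_expR; exact: bmfZ.
rewrite sqrrN -/(Y _) => H1 H2.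
apply: le_trans (_ : \int[Q]_y (x ^+ 2 * expR (- (t * x)) * (expR (t * Y y) + expR (- t * Y y))) <= _).
  apply: Rint_le.
  - apply: bmfM; first exact: bmfX.
    by apply: bmf_bool; apply: measurable_fun_ler => //; case: (bmf_norm bY).
  - by apply: bmfZ; exact: bmfD.
  move=> y; rewrite -/(Y y); case: (leP x `|Y y|) => [xY|_]; last first.
    by rewrite mulr0 mulr_ge0// ?addr_ge0 ?expR_ge0// mulr_ge0 ?sqr_ge0 ?expR_ge0.
  rewrite mulr1.
  have Y2 : Y y ^+ 2 <= x ^+ 2 * expR (t * (`|Y y| - x)).
    have Yx : `|Y y| <= x * expR (`|Y y| / x - 1).
      rewrite mulrC -ler_pdivrMr//; apply: le_trans (expR_ge1Dx _).
      by rewrite addrCA subrr addr0.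
    rewrite -real_normK ?num_real//.
    apply: le_trans (_ : (x * expR (`|Y y| / x - 1)) ^+ 2 <= _).
      by rewrite lerXn2r ?nnegrE// mulr_ge0 ?expR_ge0// ltW.
    rewrite exprMn ler_wpM2l ?sqr_ge0// -expRM_natl ler_expR.
    rewrite -[X in _ / x - X](divff (lt0r_neq0 x0)) -mulrBl mulrA mulrAC.
    rewrite ler_wpM2r ?subr_ge0//.
    rewrite ler_pdivrMr// /t mulrAC ler_pdivlMr//.
    by rewrite (_ : x * n%:R * x = x ^+ 2 * n%:R)//; ring.
  apply: le_trans Y2 _; rewrite -mulrA ler_wpM2l ?sqr_ge0//.
  rewrite [leRHS]mulrDr -!expRD mulrBr.
  case: (ger0P (Y y)) => _.
    by rewrite [t * Y y - _]addrC lerDl expR_ge0.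
  by rewrite mulrN -mulNr [- t * Y y - _]addrC lerDr expR_ge0.
rewrite RintZ; last exact: bmfD.
rewrite RintD//.
have x2 : 0 <= x ^+ 2 * expR (- (t * x)) by rewrite mulr_ge0 ?sqr_ge0 ?expR_ge0.
apply: le_trans (ler_wpM2l x2 (lerD H2 H1)) _.
set e := expR (v * _ / _).
have -> : x ^+ 2 * expR (- (t * x)) * (e + e) = 2 * x ^+ 2 * (expR (- (t * x)) * e) by ring.
apply: ler_wpM2l; first by rewrite mulr_ge0 ?sqr_ge0.
rewrite -expRD ler_expR le_eqVlt; apply/orP; left; apply/eqP.
rewrite /t; field; rewrite gt_eqF//= gt_eqF//.
Qed.

End kendall_bounds.

(** * Inequalities for the sine *)

Section trigonometry.
Variable R : realType.
Implicit Types x y : R.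

Lemma sin_lipschitz x y : `|sin x - sin y| <= `|x - y|.
Proof.
wlog xy : x y / x <= y => [H|].
  by case: (leP x y) => [/H //|/ltW /H]; rewrite distrC [X in _ <= X]distrC.
have h1 : x - sin x <= y - sin y.
  apply: (@le_of_deriv _ (fun t => t - sin t) (fun t => 1 - cos t))  => //.
have h2 : x + sin x <= y + sin y.
  apply: (@le_of_deriv _ (fun t => t + sin t) (fun t => 1 + cos t))  => //.
by rewrite [X in _ <= X]ler0_norm ?subr_le0// ler_norml; apply/andP; split; lra.
Qed.

(** [y cos y <= sin y] at [y = x / 2], then the formulas for the double
    angle. *)
Lemma half_le_sin x : 0 <= x <= pi / 2 -> x / 2 <= sin x.
Proof.
move=> /andP[x0 x2].
have pi2 : pi / 2 < 2 :> R := pihalf_lt2 R.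
have key : x / 2 * cos (x / 2) <= sin (x / 2).
  rewrite -subr_ge0; have -> : 0 = sin 0 - 0 * cos 0 :> R by rewrite sin0 mul0r subr0.
  apply: (@le_of_deriv _ (fun t => sin t - t * cos t) (fun t => t * sin t)).
  - by rewrite divr_ge0.
  - move=> t _; apply: is_derive_eq; rewrite /GRing.scale/=; ring.
  - move=> t /andP[t0 tx]; rewrite mulr_ge0// sin_ge0_pi// t0/=.
    by have := pi_gt0 R; lra.
have c0 : 0 <= cos (x / 2) by apply: cos_ge0_pihalf; have := pi_gt0 R; lra.
have cx : 0 <= cos x by apply: cos_ge0_pihalf; have := pi_gt0 R; lra.
have xE : x = x / 2 + x / 2 by lra.
have E1 : sin x = 2 * (sin (x / 2) * cos (x / 2)).
  by rewrite [in LHS]xE sinD; ring.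
have E2 : cos x = 2 * cos (x / 2) ^+ 2 - 1.
  rewrite [in LHS]xE cosD -!expr2 sin2cos2; ring.
have : x / 2 * cos (x / 2) ^+ 2 <= sin (x / 2) * cos (x / 2).
  by rewrite expr2 mulrA ler_wpM2r.
have : 0 <= x / 2 * cos x by rewrite mulr_ge0 ?divr_ge0.
rewrite E1 E2; lra.
Qed.

Lemma half_le_norm_sin x : `|x| <= pi / 2 -> `|x| / 2 <= `|sin x|.
Proof.
move=> x2; apply: le_trans (half_le_sin _) _; first by rewrite normr_ge0.
case: (ger0P x) => _; first exact: ler_norm.
by rewrite sinN -normrN ler_norm.
Qed.

Lemma ln2_ge : 2^-1 <= ln 2 :> R.
Proof.
have h : ln 2^-1 <= - 2^-1 :> R.
  rewrite [X in ln X](_ : _ = 1 + - 2^-1); last by lra.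
  by apply: le_ln1Dx; lra.
by move: h; rewrite lnV ?posrE//; lra.
Qed.

End trigonometry.

(** * Truncated sums over weak balls *)

Section weak_balls.
Variable R : realType.
Implicit Types (q c s l : R).

Lemma sorted_count_gt (S : seq R) s k : sorted >=%R S -> S`_k <= s -> 0 <= s ->
  (count (fun y => (s < y)%R) S <= k)%N.
Proof.
move=> srt Sk s0; rewrite -[S](cat_take_drop k) count_cat.
have -> : count (fun y => s < y) (drop k S) = 0%N.
  apply/eqP; rewrite -leqn0 leqNgt -has_count; apply/negP => /hasP[y].
  move=> /(nthP 0)[i]; rewrite size_drop nth_drop => ik <-; rewrite ltNge => /negP; apply.
  apply: le_trans Sk; have [->|i0] := eqVneq i 0%N; first by rewrite addn0.
  apply: (sorted_leq_nth (leT := >=%R)) => //.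
  - by move=> a b c' /= h1 h2; exact: le_trans h2 h1.
  - by move=> a /=.
  - by rewrite inE /=; move: ik; rewrite ltn_subRL; apply: leq_ltn_trans; rewrite leq_addr.
  - by rewrite inE /= -ltn_subRL.
  - by rewrite leq_addr.
by rewrite addn0; apply: leq_trans (count_size _ _) _; rewrite size_take; case: ltnP.
Qed.

Lemma count_ordered_abs d (x : 'rV[R]_d) s :
  count (fun y => s < y) (ordered_abs x) = #|[set j | s < `|x 0 j|]%SET|.
Proof.
rewrite /ordered_abs count_sort count_map -sum1_count -sum1_card big_enum_cond/=.
by apply: eq_bigl => j; rewrite inE.
Qed.

Lemma ordered_abs_sorted d (x : 'rV[R]_d) : sorted >=%R (ordered_abs x).
Proof. by apply: sort_sorted => a b; exact: le_total. Qed.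

Lemma size_ordered_abs d (x : 'rV[R]_d) : size (ordered_abs x) = d.
Proof. by rewrite /ordered_abs size_sort size_map size_enum_ord. Qed.

Lemma weak_ball_count d q c (x : 'rV[R]_d) s : 0 <= q -> 0 < c -> 0 < s ->
  weak_ball q c x -> #|[set j | s < `|x 0 j|]%SET|%:R * s `^ q <= c.
Proof.
move=> q0 c0 s0 wx; rewrite -count_ordered_abs.
case E : (count _ _) => [|k]; first by rewrite mul0r ltW.
have kd : (k < d)%N by rewrite -(size_ordered_abs x) -E count_size.
have xk : s < (ordered_abs x)`_k.
  rewrite ltNge; apply/negP => h.
  have := sorted_count_gt (ordered_abs_sorted x) h (ltW s0).
  by rewrite E ltnn.
have := wx k kd; rewrite /pow00 gt_eqF ?(lt_trans s0)// => h.
rewrite mulrC -ler_pdivlMr ?ltr0n//; apply: le_trans h.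
apply: ge0_ler_powR (ltW xk) => //; rewrite nnegrE; apply: ltW => //.
exact: lt_trans xk.
Qed.

(** Four times the square of the largest level [l / 2 ^ (k + 1)] below [y]
    bounds the left-hand side, unless [y] lies below all levels. *)
Lemma min_sqr_dyadic l y L : 0 < l -> 0 <= y ->
  Num.min (y ^+ 2) (l ^+ 2) <= l ^+ 2 * 4^-1 ^+ L +
    \sum_(k < L) l ^+ 2 * 4^-1 ^+ k * (l * 2^-1 ^+ k.+1 < y)%R%:R.
Proof.
move=> l0 y0; elim: L => [|L IH].
  by rewrite big_ord0 addr0 expr0 mulr1 ge_min lexx orbT.
rewrite big_ord_recr/=; case: ltP => h; last first.
  apply: le_trans (_ : l ^+ 2 * 4^-1 ^+ L.+1 <= _).
    rewrite ge_min; apply/orP; left.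
    have -> : l ^+ 2 * 4^-1 ^+ L.+1 = (l * 2^-1 ^+ L.+1) ^+ 2.
      rewrite exprMn exprAC; congr (_ * _ ^+ _); by field.
    by rewrite lerXn2r ?nnegrE// mulr_ge0 ?exprn_ge0 ?(ltW l0).
  rewrite lerDl addr_ge0//; last by rewrite mulr0.
  apply: sumr_ge0 => k _; apply: mulr_ge0 => //; apply: mulr_ge0; rewrite exprn_ge0//.
  exact: ltW.
apply: le_trans IH _; rewrite mulr1 [X in _ <= _ + X]addrC addrA; apply: lerD => //.
by rewrite lerDr mulr_ge0 ?exprn_ge0// ltW.
Qed.

(** Entries are sorted by size into dyadic levels; at most [c / s ^ q] entries
    exceed [s], and the resulting series is geometric because [q <= 1]. *)
Lemma weak_ball_sum d q c (x : 'rV[R]_d) l : 0 <= q <= 1 -> 0 < c -> 0 < l ->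
  weak_ball q c x ->
  \sum_j Num.min (x 0 j ^+ 2) (l ^+ 2) <= 4 * c * (l ^+ 2 / l `^ q) + l ^+ 2.
Proof.
move=> /andP[q0 q1] c0 l0 wx.
have lq0 : 0 < l `^ q by rewrite powR_gt0.
have l20 : 0 < l ^+ 2 by rewrite exprn_gt0.
apply: le_trans (_ : \sum_(j < d) (l ^+ 2 * 4^-1 ^+ d +
    \sum_(k < d) l ^+ 2 * 4^-1 ^+ k * (l * 2^-1 ^+ k.+1 < `|x 0 j|)%R%:R) <= _).
  by apply: ler_sum => j _; rewrite -real_normK ?num_real//; exact: min_sqr_dyadic.
rewrite big_split/= addrC; apply: lerD; last first.
  rewrite sumr_const card_ord -[_ *+ d]mulr_natr -mulrA ler_piMr ?(ltW l20)//.
  rewrite exprVn mulrC ler_pdivrMr ?exprn_gt0// mul1r -natrX ler_nat.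
  by apply/ltnW/ltn_expl.
rewrite exchange_big/=.
apply: le_trans (_ : \sum_(k < d) (2 * c * (l ^+ 2 / l `^ q)) * 2^-1 ^+ k <= _).
  apply: ler_sum => k _.
  rewrite -mulr_sumr -natr_sum.
  have -> : (\sum_(j < d) (l * 2^-1 ^+ k.+1 < `|x 0 j|)%R)%N = #|[set j | l * 2^-1 ^+ k.+1 < `|x 0 j|]%SET|.
    by rewrite -sum1_card [RHS]big_mkcond/=; apply: eq_bigr => j _; rewrite inE; case: ltP.
  have s0 : 0 < l * 2^-1 ^+ k.+1 by rewrite mulr_gt0// exprn_gt0.
  have := weak_ball_count q0 c0 s0 wx; set m := #|_|%:R => hm.
  have hh : 2^-1 ^+ k.+1 <= (2^-1 ^+ k.+1) `^ q :> R.
    apply: ger1_powR => //; rewrite exprn_gt0//= exprn_ile1//.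
    by rewrite invf_le1// ler1n.
  have hm2 : m * (l `^ q * 2^-1 ^+ k.+1) <= c.
    apply: le_trans hm; rewrite ler_wpM2l//.
    by rewrite powRM ?exprn_ge0 ?(ltW l0)// ler_wpM2l// ltW.
  have P2 : 0 < 2^-1 ^+ k.+1 :> R by rewrite exprn_gt0.
  have hm3 : m <= c / (l `^ q * 2^-1 ^+ k.+1) by rewrite ler_pdivlMr ?mulr_gt0.
  apply: le_trans (ler_wpM2l _ hm3) _; first by rewrite mulr_ge0 ?exprn_ge0 ?ltW.
  rewrite le_eqVlt; apply/orP; left; apply/eqP.
  have -> : 4^-1 ^+ k = 2^-1 ^+ k * 2^-1 ^+ k :> R by rewrite -exprMn; congr (_ ^+ _); field.
  have P3 : 0 < 2^-1 ^+ k :> R by rewrite exprn_gt0.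
  rewrite [2^-1 ^+ k.+1]exprS; move: (2^-1 ^+ k) P3 => P P3.
  by move: (l `^ q) lq0 => A A0; field; rewrite !gt_eqF.
rewrite -mulr_sumr; apply: le_trans (_ : 2 * c * (l ^+ 2 / l `^ q) * 2 <= _).
  apply: ler_wpM2l; first by rewrite !mulr_ge0 ?invr_ge0 ?ltW.
  have : (1 - 2^-1) * \sum_(i < d) 2^-1 ^+ i <= 1 :> R.
    have := subrX1 (2^-1 : R) d; have : 0 <= 2^-1 ^+ d :> R by rewrite exprn_ge0.
    move: (2^-1 ^+ d) (\sum_(i < d) _) => *; lra.
  lra.
by rewrite le_eqVlt; apply/orP; left; apply/eqP; ring.
Qed.

End weak_balls.

(** * The risk of one thresholded entry *)

Section growth.
Variable R : realType.

Lemma ln_div_small (eta e : R) : 0 < eta -> 0 < e ->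
  exists n1 : nat, forall n p : nat, (n1 <= n)%N -> (0 < n)%N -> (0 < p)%N ->
    p%:R <= n%:R `^ eta -> ln p%:R / n%:R <= e.
Proof.
move=> eta0 e0; exists (Num.truncn ((2 * eta / e) ^+ 2)).+1 => n p n1 n0 p0 pn.
have x0 : 0 < n%:R :> R by rewrite ltr0n.
rewrite ler_pdivrMr//.
apply: le_trans (_ : eta * ln n%:R <= _).
  by rewrite -ln_powR ler_ln// posrE ?ltr0n// powR_gt0.
have s0 : 0 < Num.sqrt n%:R :> R by rewrite sqrtr_gt0.
have nE : n%:R = Num.sqrt n%:R ^+ 2 :> R by rewrite sqr_sqrtr.
have ln_s : ln n%:R <= 2 * Num.sqrt n%:R :> R.
  rewrite [X in ln X]nE lnXn// -[_ *+ 2]mulr_natl ler_pM2l//.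
  exact/ltW/ln_sublinear.
apply: le_trans (_ : eta * (2 * Num.sqrt n%:R) <= _); first by rewrite ler_pM2l.
have h : 2 * eta / e <= Num.sqrt n%:R.
  rewrite -(ler_pXn2r (isT : (0 < 2)%N)) ?nnegrE ?(ltW s0)//; last first.
    by rewrite divr_ge0 ?mulr_ge0// ltW.
  by rewrite -nE; apply/ltW/(lt_le_trans (truncnS_gt _)); rewrite ler_nat.
rewrite [X in e * X]nE expr2 !mulrA ler_pM2r//.
by rewrite [eta * 2]mulrC [e * _]mulrC -ler_pdivrMr.
Qed.

End growth.

Section entry_risk.
Variable R : realType.
Local Notation RT := (measurableTypeR R).
Local Notation RR := (RT * RT)%type.
Local Notation N2 := (gauss2 R).

Definition sin_threshold (a T : R) : R := sin (pi / 2 * T) * (a < `|T|)%R%:R.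

Lemma bmf_sin_threshold a r : bounded_measurable (fun T => (sin_threshold a T - r) ^+ 2).
Proof.
apply: bmfX; apply: bmfB; last exact: bmf_cst.
apply: bmfM.
  have [mX _] : measurable_fun setT (fun T : R => pi / 2 * T) /\ True.
    by split=> //; exact: mulrl_measurable.
  apply: bmf_sin mX.
by apply: bmf_bool; apply: measurable_fun_ltr => //; exact: normr_measurable.
Qed.

Section sample.
Variables (n : nat) (G : probability (n.-tuple RR) R) (psi : R).
Hypotheses (iG : iid N2 G) (psi2 : `|psi| <= pi / 2).
Local Notation T := (fun x : n.-tuple RR => ustat (kern psi) x).
Local Notation tau := (2 * psi / pi).

Lemma sin_tau (t : R) : `|sin (pi / 2 * t) - sin psi| <= 2 * `|t - tau|.
Proof.
have p0 : 0 < pi :> R := pi_gt0 R.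
apply: le_trans (sin_lipschitz _ _) _.
rewrite [X in `|X|](_ : _ = pi / 2 * (t - tau)).
  rewrite normrM ger0_norm ?divr_ge0 ?(ltW p0)//.
  by rewrite ler_wpM2r// ltW// pihalf_lt2.
by move: (pi : R) (gt_eqF p0) => P P0; field; rewrite P0.
Qed.

Lemma tau_le_sin : `|tau| <= 2 * `|sin psi|.
Proof.
have p2 := pi_ge2 R; have p0 : 0 < pi :> R := pi_gt0 R.
have h := half_le_norm_sin psi2.
apply: le_trans (_ : `|psi| <= _); last by move: h; lra.
rewrite !normrM normfV (gtr0_norm p0) ger0_norm// ler_pdivrMr// mulrC.
by rewrite ler_wpM2l.
Qed.

Lemma sin_le_tau : `|sin psi| <= 2 * `|tau|.
Proof.
by have := sin_tau 0; rewrite mulr0 sin0 !sub0r !normrN.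
Qed.

(** Thresholding changes the estimate by at most [2 a], and the untruncated
    estimate is Lipschitz in Kendall's tau. *)
Lemma entry_risk_large a : 0 <= a -> (1 < n)%N ->
  \int[G]_x (sin_threshold a (T x) - sin psi) ^+ 2 <= 8 * a ^+ 2 + 96 / n%:R.
Proof.
move=> a0 n1.
have bT : bounded_measurable T by exact: (bmf_ustat (bmf_kern psi)).
have bY := bmf_kdev n psi.
apply: le_trans (_ : \int[G]_x (8 * a ^+ 2 + 8 * (T x - tau) ^+ 2) <= _).
  apply: Rint_le.
  - by apply: (bmf_comp _ (bmf_sin_threshold a (sin psi))); case: bT.
  - by apply: bmfD; [exact: bmf_cst|apply: bmfZ; exact: bmfX].
  move=> x; set t := T x.
  have h1 : `|sin_threshold a t - sin (pi / 2 * t)| <= 2 * a.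
    rewrite /sin_threshold; case: (ltP a `|t|) => h.
      by rewrite mulr1 subrr normr0 mulr_ge0.
    rewrite mulr0 sub0r normrN.
    have := sin_lipschitz (pi / 2 * t) 0; rewrite sin0 !subr0 => /le_trans; apply.
    rewrite normrM ger0_norm ?divr_ge0 ?pi_ge0//.
    by apply: ler_pM => //; [rewrite divr_ge0 ?pi_ge0|rewrite ltW// pihalf_lt2].
  have h2 := sin_tau t.
  have h3 : `|sin_threshold a t - sin psi| <= 2 * a + 2 * `|t - tau|.
    rewrite -[X in `|X|](subrKA (sin (pi / 2 * t))).
    by apply: le_trans (ler_normD _ _) _; exact: lerD.
  rewrite -real_normK ?num_real// -[X in _ + 8 * X]real_normK ?num_real//.
  apply: le_trans (_ : (2 * a + 2 * `|t - tau|) ^+ 2 <= _).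
    by rewrite lerXn2r ?nnegrE// addr_ge0// mulr_ge0.
  rewrite -subr_ge0; set y := `|t - tau|.
  have E (u w : R) : 8 * u ^+ 2 + 8 * w ^+ 2 - (2 * u + 2 * w) ^+ 2 = 4 * (u - w) ^+ 2 by ring.
  by rewrite E mulr_ge0 ?sqr_ge0.
rewrite RintD; [|exact: bmf_cst|by apply: bmfZ; exact: bmfX].
rewrite Rint_cst RintZ; last exact: bmfX.
have := kendall_var iG psi2 n1; rewrite lerD2l => h.
apply: le_trans (ler_wpM2l _ h) _ => //.
by rewrite mulrA -natrM.
Qed.

(** If an estimate survives the threshold although [|tau| <= a - b], then the
    statistic has deviated by at least [b]; otherwise the error is exactly the
    true correlation. *)
Lemma entry_risk_small a b e : `|tau| <= a - b ->
  \int[G]_x ((T x - tau) ^+ 2 * (b <= `|T x - tau|)%R%:R) <= e ->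
  \int[G]_x (sin_threshold a (T x) - sin psi) ^+ 2 <= sin psi ^+ 2 + 4 * e.
Proof.
move=> tab he.
have bT : bounded_measurable T by exact: (bmf_ustat (bmf_kern psi)).
have bY := bmf_kdev n psi.
have bI : bounded_measurable (fun x => (T x - tau) ^+ 2 * (b <= `|T x - tau|)%R%:R).
  apply: bmfM; first exact: bmfX.
  by apply: bmf_bool; apply: measurable_fun_ler => //; case: (bmf_norm bY).
apply: le_trans (_ : \int[G]_x (sin psi ^+ 2 + 4 * ((T x - tau) ^+ 2 * (b <= `|T x - tau|)%R%:R)) <= _).
  apply: Rint_le.
  - by apply: (bmf_comp _ (bmf_sin_threshold a (sin psi))); case: bT.
  - by apply: bmfD; [exact: bmf_cst|exact: bmfZ].
  move=> x; set t := T x; rewrite /sin_threshold; case: (ltP a `|t|) => h; last first.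
    by rewrite mulr0 sub0r sqrrN lerDl; do 2?apply: mulr_ge0 => //; exact: sqr_ge0.
  rewrite mulr1; have -> : b <= `|t - tau|.
    have := lerB_dist t tau; move: tab (ltW h); lra.
  rewrite mulr1 -[X in X <= _]add0r lerD ?sqr_ge0//.
  have -> : 4 * (t - tau) ^+ 2 = (2 * `|t - tau|) ^+ 2.
    by rewrite exprMn real_normK ?num_real//; ring.
  by rewrite -real_normK ?num_real// lerXn2r ?nnegrE// ?mulr_ge0// sin_tau.
rewrite RintD; [|exact: bmf_cst|exact: bmfZ].
by rewrite Rint_cst RintZ// lerD2l ler_wpM2l.
Qed.

Lemma entry_risk_le4 a :
  \int[G]_x (sin_threshold a (T x) - sin psi) ^+ 2 <= 4.
Proof.
have bT : bounded_measurable T by exact: (bmf_ustat (bmf_kern psi)).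
rewrite -(Rint_cst G 4); apply: Rint_le; [|exact: bmf_cst|].
  by apply: (bmf_comp _ (bmf_sin_threshold a (sin psi))); case: bT.
move=> x; rewrite -real_normK ?num_real// (_ : 4 = 2 ^+ 2 :> R); last by ring.
rewrite lerXn2r ?nnegrE//; apply: le_trans (ler_normB _ _) _.
have s1 y : `|sin y| <= 1 :> R by rewrite ler_norml sin_geN1 sin_le1.
suff : `|sin_threshold a (T x)| <= 1 by have := s1 psi; lra.
  rewrite /sin_threshold; case: (_ < _) => /=; rewrite ?mulr1// mulr0 normr0 ler01//.
Qed.

End sample.

(** Take [b] strictly between the critical constant and [alpha]. The variance
    constant [v = b ^ 2 / 2] then exceeds 4/9, so that squared deviations
    beyond [b l] contribute at most of the order of [l ^ 2 / p]. If [tau] is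
    below [(alpha - b) l], these are the only source of nonzero estimates;
    otherwise the correlation is at least of order [l], and an error of that
    order is allowed. The finitely many [n] for which the asymptotic bound is
    not yet valid go into the constant. *)
Lemma entry_risk (alpha eta : R) : 2 * Num.sqrt 2 / 3 < alpha -> 0 < eta ->
  exists2 C : R, 0 < C & forall (n p : nat) (G : probability (n.-tuple RR) R) (psi l : R),
    iid N2 G -> `|psi| <= pi / 2 -> (1 < n)%N -> (n < p)%N -> p%:R <= n%:R `^ eta ->
    l = Num.sqrt (ln p%:R / n%:R) ->
    \int[G]_x (sin_threshold (alpha * l) (ustat (kern psi) x) - sin psi) ^+ 2 <=
    C * (Num.min (sin psi ^+ 2) (l ^+ 2) + l ^+ 2 / p%:R).
Proof.
move=> al eta0.
have s2 : 0 < Num.sqrt 2 :> R by rewrite sqrtr_gt0.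
have s22 : Num.sqrt 2 ^+ 2 = 2 :> R by rewrite sqr_sqrtr.
set a0 := 2 * Num.sqrt 2 / 3 in al *.
have a00 : 0 < a0 by rewrite /a0 divr_gt0 ?mulr_gt0.
pose b := (alpha + a0) / 2; pose g := alpha - b.
have ab : a0 < b by rewrite /b; lra.
have g0 : 0 < g by rewrite /g /b; lra.
have b0 : 0 < b by exact: lt_trans ab.
(* With this [v] the exponent of the tail bound at [x = b l] is [ln p]. *)
pose v := b ^+ 2 / 2.
have v49 : 4 / 9 < v.
  rewrite /v ltr_pdivlMr//; apply: le_lt_trans (_ : a0 ^+ 2 < _).
    by rewrite /a0 !exprMn s22 exprVn; lra.
  by rewrite ltrXn2r// ltW.
have v0 : 0 < v by apply: lt_trans v49; lra.
have [D D0 [n0 tail]] := kendall_tail v49.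
pose e := Num.min (D / b) (D / (2 * g)).
have e0 : 0 < e by rewrite lt_min divr_gt0//= divr_gt0// mulr_gt0.
have [n1 small] := @ln_div_small R eta (e ^+ 2) eta0 (exprn_gt0 2 e0).
pose n2 := maxn (maxn n0 n1) (Num.truncn (expR 1 : R)).+1.
pose A := 1 + 4 * g ^+ 2; pose B := (8 * alpha ^+ 2 + 96) * (1 + 4 / g ^+ 2).
pose E := 8 * (n2%:R * n2%:R `^ eta) : R.
have n20 : 0 < n2%:R :> R by rewrite ltr0n /n2 leq_max orbT.
have E0 : 0 < E by rewrite /E !mulr_gt0// powR_gt0.
have A0 : 0 < A by rewrite /A addr_gt0// mulr_gt0// exprn_gt0.
have B0 : 0 < B by rewrite /B mulr_gt0// addr_gt0 ?divr_gt0 ?mulr_gt0 ?exprn_gt0//; exact: lt_trans al.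
pose C := A + 8 * b ^+ 2 + B + E.
have C0 : 0 < C by rewrite /C !addr_gt0// mulr_gt0// exprn_gt0.
exists C => // n p G psi l iG psi2 n_1 np peta lsq.
have x0 : 0 < n%:R :> R by rewrite ltr0n; exact: ltnW.
have p0 : 0 < p%:R :> R by rewrite ltr0n; exact: leq_ltn_trans np.
have p3 : 2 <= p%:R :> R by rewrite ler_nat ltnW// (leq_ltn_trans n_1).
have lp : 2^-1 <= ln p%:R :> R by apply: le_trans (ln2_ge R) _; rewrite ler_ln// posrE.
have lp0 : 0 < ln p%:R :> R by exact: lt_le_trans lp.
have l20 : 0 < ln p%:R / n%:R :> R by rewrite divr_gt0.
have l0 : 0 < l by rewrite lsq sqrtr_gt0.
have lE : l ^+ 2 = ln p%:R / n%:R by rewrite lsq sqr_sqrtr// ltW.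
set m := Num.min _ _; set s := \int[G]_x _.
have m0 : 0 <= m by rewrite le_min !sqr_ge0.
have q0 : 0 <= l ^+ 2 / p%:R by rewrite divr_ge0 ?sqr_ge0 ?ltW.
have weaken c d : 0 <= c <= C -> 0 <= d <= C -> s <= c * m + d * (l ^+ 2 / p%:R) ->
    s <= C * (m + l ^+ 2 / p%:R).
  move=> /andP[c0 cC] /andP[d0 dC] h; apply: le_trans h _; rewrite mulrDr.
  by apply: lerD; rewrite ler_wpM2r.
have b20 : 0 < b ^+ 2 by rewrite exprn_gt0.
case: (ltnP n n2) => [nn2|n2n].
  apply: (weaken 0 E); [by rewrite lexx ltW| |].
    by rewrite (ltW E0)/= /C; lra.
  rewrite mul0r add0r; apply: le_trans (entry_risk_le4 _ _ _) _.
  rewrite mulrA ler_pdivlMr// lE mulrA ler_pdivlMr//.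
  apply: le_trans (_ : E * 2^-1 <= _); last by rewrite ler_pM2l.
  rewrite /E; have -> : 8 * (n2%:R * n2%:R `^ eta) * 2^-1 = 4 * (n2%:R `^ eta) * n2%:R :> R by field.
  have nn : n%:R <= n2%:R :> R by rewrite ler_nat ltnW.
  apply: ler_pM => //.
  rewrite ler_pM2l//; apply: le_trans peta _.
  by apply: ge0_ler_powR => //; rewrite ?nnegrE// ltW.
move: n2n; rewrite !geq_max -andbA => /and3P[n0n n1n n3n].
have lp1 : 1 <= ln p%:R :> R.
  rewrite -[X in X <= _]expRK ler_ln ?posrE ?expR_gt0//.
  apply/ltW/(lt_le_trans (truncnS_gt _)); rewrite ler_nat; exact: ltnW (leq_ltn_trans n3n np).
have le_e : l <= e.
  have -> : e = Num.sqrt (e ^+ 2) by rewrite sqrtr_sqr gtr0_norm.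
  rewrite lsq ler_wsqrtr//; apply: small => //; first exact: ltnW.
  exact: leq_ltn_trans np.
case: (leP `|2 * psi / pi| (alpha * l - b * l)) => h; last first.
  apply: (weaken B 0); [| by rewrite lexx ltW |].
    by rewrite (ltW B0)/= /C; lra.
  rewrite mul0r addr0; apply: le_trans (entry_risk_large iG psi2 _ _) _ => //.
    by rewrite mulr_ge0// ltW// ?(lt_trans a00).
  have h1 : 96 / n%:R <= 96 * l ^+ 2.
    by rewrite lE ler_pM2l// ler_pMl ?invr_gt0// .
  apply: le_trans (_ : (8 * alpha ^+ 2 + 96) * l ^+ 2 <= _).
    by rewrite exprMn; lra.
  rewrite /B -mulrA; apply: ler_wpM2l; first by rewrite addr_ge0// mulr_ge0 ?sqr_ge0.
  have gl : g * l < 2 * `|sin psi|.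
    by apply: lt_le_trans (tau_le_sin psi2); rewrite /g mulrBl.
  have k4 : 0 <= 4 / g ^+ 2 by rewrite divr_ge0// sqr_ge0.
  rewrite /m; case: (leP (sin psi ^+ 2) (l ^+ 2)) => _; last first.
    by rewrite mulrDl mul1r lerDl mulr_ge0// sqr_ge0.
  apply: le_trans (_ : 4 / g ^+ 2 * sin psi ^+ 2 <= _); last first.
    by rewrite [leRHS]mulrDl mul1r lerDr sqr_ge0.
  rewrite mulrAC ler_pdivlMr ?exprn_gt0// -exprMn.
  have -> : 4 * sin psi ^+ 2 = (2 * `|sin psi|) ^+ 2.
    by rewrite exprMn real_normK ?num_real//; ring.
  by rewrite lerXn2r ?nnegrE ?mulr_ge0 ?(ltW l0) ?(ltW g0)// mulrC ltW.
apply: (weaken A (8 * b ^+ 2)).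
- by rewrite (ltW A0)/= /C; lra.
- by rewrite mulr_ge0 ?(ltW b20)//= /C; lra.
have psiD : `|psi| <= D.
  have pi0 : 0 < pi :> R := pi_gt0 R; have pi4 := pihalf_lt2 R.
  have : `|psi| <= 2 * `|2 * psi / pi|.
    rewrite !normrM normfV (gtr0_norm pi0) ger0_norm//.
    rewrite !mulrA ler_pdivlMr// mulrC ler_wpM2r//; lra.
  move/le_trans; apply; apply: le_trans (_ : 2 * (g * l) <= _).
    by rewrite ler_pM2l// /g mulrBl.
  by rewrite mulrA mulrC -ler_pdivlMr ?mulr_gt0//; apply: le_trans le_e _; rewrite ge_min lexx orbT.
have blD : b * l <= D.
  by rewrite mulrC -ler_pdivlMr//; apply: le_trans le_e _; rewrite ge_min lexx.
have bl2 : (b * l) ^+ 2 * n%:R = b ^+ 2 * ln p%:R.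
  by rewrite exprMn lE -mulrA divfK ?gt_eqF.
have vb : 2 * v = b ^+ 2 by rewrite /v mulrC divfK.
have := tail n G psi (b * l) iG n0n psi2 psiD (mulr_gt0 b0 l0) blD _.
rewrite bl2 vb => /(_ _) H; have {}H := H (ler_peMr (ltW b20) lp1).
apply: le_trans (entry_risk_small h H) _.
rewrite [b ^+ 2 * _]mulrC mulfK ?gt_eqF// expRN lnK ?posrE//.
apply: lerD; last by rewrite exprMn le_eqVlt; apply/orP; left; apply/eqP; field; rewrite gt_eqF.
have sl : sin psi ^+ 2 <= 4 * g ^+ 2 * l ^+ 2.
  have -> : 4 * g ^+ 2 * l ^+ 2 = (2 * (g * l)) ^+ 2 by ring.
  rewrite -real_normK ?num_real// lerXn2r ?nnegrE// ?mulr_ge0 ?(ltW g0) ?(ltW l0)//.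
  apply: le_trans (sin_le_tau psi) _; rewrite ler_pM2l//.
  by apply: le_trans h _; rewrite /g mulrBl.
rewrite /m /A; case: (leP (sin psi ^+ 2) (l ^+ 2)) => _; rewrite mulrDl mul1r.
  by rewrite lerDl mulr_ge0 ?sqr_ge0// mulr_ge0 ?sqr_ge0.
by apply: le_trans sl _; rewrite lerDr sqr_ge0.
Qed.

End entry_risk.

(** * The upper bound above the critical threshold *)

Section threshold.
Variable R : realType.
Local Notation N2 := (gauss2 R).

Lemma sin_param (r : R) : r ^+ 2 <= 1 ->
  exists psi, [/\ r = sin psi, 0 <= cos psi & `|psi| <= pi / 2].
Proof.
rewrite -real_normK ?num_real// expr_le1// ler_norml => r1.
exists (asin r); split; first by rewrite asinK// in_itv.
  by rewrite cos_asin// sqrtr_ge0.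
by rewrite ler_norml asin_geNpi2// asin_lepi2.
Qed.

Lemma bmf_kendall n p (i j : 'I_p) :
  bounded_measurable (fun x : sample R n p => kendall_tau x i j).
Proof.
apply: bmfZ; apply: bmf_sum => k _; apply: bmf_sum => l _.
apply: bmfM; apply: bmf_sg; apply: measurable_funB;
  exact: (measurableT_comp (measurable_tnth _) (measurable_tnth _)).
Qed.

Lemma threshold_offdiag a n p (x : sample R n p) i j : i != j ->
  threshold_estimator a x i j =
  sin_threshold (a * Num.sqrt (ln p%:R / n%:R)) (kendall_tau x i j).
Proof. by move=> ij; rewrite mxE (negPf ij). Qed.

Lemma bmf_threshold a n p r i j :
  bounded_measurable (fun x : sample R n p => (threshold_estimator a x i j - r) ^+ 2).
Proof.
have [->|ij] := eqVneq i j.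
  by under eq_fun do rewrite mxE eqxx; exact: bmf_cst.
under eq_fun do rewrite threshold_offdiag//.
by apply: (bmf_comp _ (bmf_sin_threshold _ _)); case: (bmf_kendall n i j).
Qed.

Lemma measurable_threshold a n p : measurable_estimator (@threshold_estimator R a n p).
Proof.
move=> i j; have [->|ij] := eqVneq i j.
  by under eq_fun do rewrite mxE eqxx; exact: measurable_cst.
under eq_fun do rewrite threshold_offdiag//.
have mk : measurable_fun setT (fun x : sample R n p => kendall_tau x i j).
  by case: (bmf_kendall n i j).
rewrite /sin_threshold; apply: measurable_funM.
  apply: measurableT_comp; first exact: continuous_measurable_fun (@continuous_sin R).
  by apply: measurable_funM.
have [] // : bounded_measurable (fun x : sample R n p =>
  ((a * Num.sqrt (ln p%:R / n%:R) < `|kendall_tau x i j|)%R%:R : R)).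
apply: bmf_bool; apply: measurable_fun_ltr => //; exact: measurableT_comp.
Qed.

Lemma risk_finite n p (Q : probability (sample R n p) R) (rho : 'M[R]_p) (f : estimator R n p) :
  (forall i j, bounded_measurable (fun x => (f x i j - rho i j) ^+ 2)) ->
  risk Q rho f = (p%:R^-1 * \sum_i \sum_j \int[Q]_x (f x i j - rho i j) ^+ 2)%:E.
Proof.
move=> bf; rewrite /risk unlock /frobenius2 EFinM; congr (_ * _)%E.
have E x : \sum_i \sum_j (f x - rho) i j ^+ 2 = \sum_i \sum_j (f x i j - rho i j) ^+ 2.
  by apply: eq_bigr => i _; apply: eq_bigr => j _; rewrite !mxE.
under eq_integral do rewrite E.
have bs i : bounded_measurable (fun x => \sum_j (f x i j - rho i j) ^+ 2).
  by apply: bmf_sum => j _.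
rewrite EFin_Rint; last by apply: bmf_sum => i _.
rewrite Rint_sum//; congr EFin; apply: eq_bigr => i _.
by rewrite Rint_sum.
Qed.

(** The term [l ^ 2 / p] of each entry sums to at most [l ^ 2] along a row, and
    the truncated squares sum up over the weak ball. *)
Lemma threshold_risk_row (alpha eta : R) : 2 * Num.sqrt 2 / 3 < alpha -> 0 < eta ->
  exists2 C : R, 0 < C & forall (n p : nat) (q c l : R) mu (Sigma : 'M[R]_p)
      (Q : probability (sample R n p) R) i,
    gaussian_sample mu Sigma Q -> (forall i, 0 < Sigma i i) ->
    (1 < n)%N -> (n < p)%N -> p%:R <= n%:R `^ eta ->
    0 <= q <= 1 -> 0 < c -> weak_ball q c (row i (col' i (corrmx Sigma))) ->
    l = Num.sqrt (ln p%:R / n%:R) ->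
    \sum_j \int[Q]_x (threshold_estimator alpha x i j - corrmx Sigma i j) ^+ 2 <=
    C * (4 * c * (l ^+ 2 / l `^ q) + 2 * l ^+ 2).
Proof.
move=> al eta0; have [C C0 entry] := entry_risk al eta0.
exists C => // n p q c l mu Sigma Q i gS S0 n1 np peta q01 c0 wb lE.
have p0 : 0 < p%:R :> R by rewrite ltr0n; exact: leq_ltn_trans np.
have l0 : 0 < l.
  rewrite lE sqrtr_gt0 divr_gt0 ?ltr0n ?(ltnW n1)// ln_gt0// ltr1n.
  exact: ltn_trans np.
have e1 j : i != j -> \int[Q]_x (threshold_estimator alpha x i j - corrmx Sigma i j) ^+ 2 <=
    C * (Num.min (corrmx Sigma i j ^+ 2) (l ^+ 2) + l ^+ 2 / p%:R).
  move=> ij.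
  have r1 : corrmx Sigma i j ^+ 2 <= 1 by case: (gS) => P [mP _]; exact: (corr_sqr_le1 mP S0).
  have [psi [rE cpsi psi2]] := sin_param r1.
  under eq_Rintegral do rewrite threshold_offdiag// -lE.
  rewrite (kendall_law (f := fun t => (sin_threshold (alpha * l) t - corrmx Sigma i j) ^+ 2)
    gS S0 (@iid_power _ _ _ N2 n) rE cpsi (bmf_sin_threshold _ _)).
  by rewrite rE; apply: entry => //; exact: iid_power.
rewrite (bigD1_ord i)//=.
have -> : \int[Q]_x (threshold_estimator alpha x i i - corrmx Sigma i i) ^+ 2 = 0.
  transitivity (\int[Q]_x (0 : R)); last by rewrite Rint_cst.
  apply: eq_Rintegral => x _; rewrite !mxE eqxx -expr2 sqr_sqrtr ?(ltW (S0 i))//.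
  by rewrite divff ?gt_eqF// subrr expr0n.
rewrite add0r.
apply: le_trans (_ : \sum_(j < p.-1) C * (Num.min (corrmx Sigma i (lift i j) ^+ 2) (l ^+ 2)
    + l ^+ 2 / p%:R) <= _).
  by apply: ler_sum => j _; apply: e1; rewrite neq_lift.
rewrite -mulr_sumr ler_pM2l// big_split/= sumr_const card_ord.
rewrite [2 * _]mulr_natl mulr2n addrA; apply: lerD.
  have := weak_ball_sum q01 c0 l0 wb; apply: le_trans.
  by rewrite le_eqVlt; apply/orP; left; apply/eqP; apply: eq_bigr => j _; rewrite !mxE.
rewrite -[_ *+ _]mulr_natl mulrCA ler_piMr ?sqr_ge0// ler_pdivrMr// mul1r ler_nat.
exact: leq_pred.
Qed.

(** The lower bound on the sparsity in a permissible set makes the additional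
    [l ^ 2] per row comparable with the rate. *)
Lemma threshold_upper q alpha : 0 <= q < 1 -> 2 * Num.sqrt 2 / 3 < alpha ->
  forall M m eta_l eta_u : R,
  exists2 C : R, 0 < C &
    forall (p : nat -> nat) (c : nat -> R),
    permissible_with q M m eta_l eta_u p c ->
    forall n : nat, (2 <= n)%N ->
    (max_risk q (c n) (@threshold_estimator R alpha n (p n))
       <= (C * c n * (ln (p n)%:R / n%:R) `^ (1 - q / 2))%:E)%E.
Proof.
move=> /andP[q0 q1] al M m eta_l eta_u.
have [m0|m0] := ltP 0 m; last first.
  by exists 1 => // p c [_ m0']; rewrite ltNge m0 in m0'.
have [e0|e0] := ltP 1 eta_u; last first.
  by exists 1 => // p c [_ _ _ e0']; rewrite ltNge e0 in e0'.
have [C C0 row_le] := threshold_risk_row al (lt_trans ltr01 e0).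
exists (C * (4 + 2 / m)); first by rewrite mulr_gt0// addr_gt0// divr_gt0.
move=> p c [_ _ el1 _ H] n n2; have [[c0 _] clow _ pl pu] := H n n2.
have n0 : 0 < n%:R :> R by rewrite ltr0n ltnW.
have np : (n < p n)%N.
  rewrite -(ltr_nat R); apply: le_lt_trans pl; rewrite -[X in X <= _]powRr1 ?(ltW n0)//.
  by apply: ler_powR; [rewrite ler1n ltnW|exact: ltW].
set L := ln (p n)%:R / n%:R in clow *.
have p0 : 0 < (p n)%:R :> R by rewrite ltr0n; exact: leq_ltn_trans np.
have L0 : 0 < L.
  rewrite divr_gt0// ln_gt0// ltr1n; exact: ltn_trans np.
have lsq : Num.sqrt L ^+ 2 = L by rewrite sqr_sqrtr// ltW.
have lpow : Num.sqrt L `^ q = L `^ (q / 2).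
  by rewrite -powR12_sqrt ?(ltW L0)// -powRrM [2^-1 * _]mulrC.
have Lq : L / L `^ (q / 2) = L `^ (1 - q / 2).
  by rewrite powRB ?(gt_eqF L0) ?implybT// powRr1// ltW.
have LL : L <= c n / m * L `^ (1 - q / 2).
  rewrite -Lq mulrCA mulrC ler_pMl// ler_pdivlMr ?powR_gt0// mul1r.
  by rewrite ler_pdivlMr// mulrC.
apply: ge_ereal_sup => _ [mu [Sigma [Q [gS S0 [_ _ wb] ->]]]].
rewrite risk_finite; last by move=> i j; exact: bmf_threshold.
rewrite lee_fin mulrC ler_pdivrMr//.
apply: le_trans (_ : \sum_(i < p n) C * ((4 + 2 / m) * (c n * L `^ (1 - q / 2))) <= _); last first.
  rewrite sumr_const card_ord -[_ *+ _]mulr_natr.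
  by rewrite !mulrA.
apply: ler_sum => i _.
apply: le_trans (row_le n (p n) q (c n) _ mu Sigma Q i gS S0 n2 np (ltW pu) _ c0 (wb i) erefl) _.
  by rewrite q0 ltW.
rewrite -/L lsq lpow Lq ler_pM2l//.
move: LL; rewrite mulrAC; move: (L `^ _) => P LL.
have -> : (4 + 2 / m) * (c n * P) = 4 * c n * P + 2 * (c n * P / m) by ring.
by rewrite lerD2l ler_pM2l.
Qed.

End threshold.

(** * Change of measure for samples *)

Section power.
Context d (T : measurableType d) (R : realType).

Lemma Rint_power_cons n (P : probability T R) (F : n.+1.-tuple T -> R) :
  bounded_measurable F ->
  \int[power_prob P n.+1]_x F x = \int[P]_t \int[power_prob P n]_x F (cons_pair (t, x)).
Proof.
move=> bF.
have bFc : bounded_measurable (fun z : T * n.-tuple T => F (cons_pair z)).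
  exact: bmf_comp (@measurable_cons_pair _ T n) bF.
rewrite -(Rint_fubini1 P (power_prob P n) bFc).
by apply: Rint_push bF; first exact: measurable_cons_pair.
Qed.

End power.

Section change_of_measure.
Context d (T : measurableType d) d' (U : measurableType d') (R : realType).
Variables (P : probability T R) (P' : probability U R) (phi : T -> U) (g : T -> R).
Hypotheses (mphi : measurable_fun setT phi) (bg : bounded_measurable g).
Hypothesis g0 : forall t, 0 <= g t.
Hypothesis Hle : forall h : U -> R, bounded_measurable h -> (forall u, 0 <= h u) ->
  \int[P]_t (h (phi t) * g t) <= \int[P']_u h u.

Lemma bmf_lik n : bounded_measurable (fun x : n.-tuple T => \prod_k g (tnth x k)).
Proof. by apply: bmf_prod => k _; apply: (bmf_comp (measurable_tnth k) bg). Qed.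

(** [g] stands for a likelihood ratio that may have been truncated, so that it
    only bounds the law [P'] from below; Fubini passes such a bound from one
    observation to a sample. *)
Lemma power_change n (F : n.-tuple U -> R) : bounded_measurable F -> (forall y, 0 <= F y) ->
  \int[power_prob P n]_x (F [tuple phi (tnth x k) | k < n] * \prod_k g (tnth x k)) <=
  \int[power_prob P' n]_y F y.
Proof.
elim: n F => [|n IH] F bF F0.
  rewrite le_eqVlt; apply/orP; left; apply/eqP.
  transitivity (F [tuple]).
    rewrite -[RHS](Rint_cst (power_prob P 0)); apply: eq_Rintegral => x _.
    by rewrite big_ord0 mulr1; congr F; apply: eq_from_tnth => -[].
  rewrite -[LHS](Rint_cst (power_prob P' 0)); apply: eq_Rintegral => x _;
    by congr F; apply: eq_from_tnth => -[].
have bF1 : bounded_measurable (fun z : U * n.-tuple U => F (cons_pair z)).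
  exact: bmf_comp (@measurable_cons_pair _ U n) bF.
rewrite Rint_power_cons; last first.
  apply: bmfM; last exact: bmf_lik.
  exact: bmf_comp (@measurable_map_tnth _ _ _ _ n.+1 _ mphi) bF.
rewrite Rint_power_cons//.
pose h u := \int[power_prob P' n]_y F (cons_pair (u, y)).
have bh : bounded_measurable h := bmf_fubini1 P' (power_prob P' n) bF1.
apply: le_trans (Hle bh _); last by move=> u; apply: Rint_ge0.
have bin : bounded_measurable (fun z : T * n.-tuple T =>
    F (cons_pair (phi z.1, [tuple phi (tnth z.2 k) | k < n])) *
    (g z.1 * \prod_k g (tnth z.2 k))).
  apply: bmfM.
    apply: (bmf_comp _ bF1); apply/measurable_fun_pairP; split.
      exact: (measurableT_comp mphi measurable_fst).
    exact: (measurableT_comp (@measurable_map_tnth _ _ _ _ n _ mphi) measurable_snd).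
  by apply: bmfM; [apply: (bmf_comp _ bg)|apply: (bmf_comp _ (bmf_lik n))].
have E t (x : n.-tuple T) :
    F [tuple phi (tnth (cons_pair (t, x)) k) | k < n.+1] * \prod_k g (tnth (cons_pair (t, x)) k)
    = F (cons_pair (phi t, [tuple phi (tnth x k) | k < n])) * (g t * \prod_k g (tnth x k)).
  congr (F _ * _).
    apply: eq_from_tnth => k; rewrite tnth_mktuple.
    by case: (unliftP ord0 k) => [j|] ->//; rewrite /cons_pair !tnthS tnth_mktuple.
  by rewrite big_ord_recl; congr (_ * _); apply: eq_bigr => k _; rewrite /cons_pair tnthS.
apply: Rint_le.
- have := bmf_fubini1 P (power_prob P n) bin; congr bounded_measurable.
  by apply/funext => t; apply: eq_Rintegral => x _; rewrite E.
- by apply: bmfM => //; exact: bmf_comp mphi bh.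
move=> t; rewrite mulrC.
have bFt : bounded_measurable (fun y : n.-tuple U => F (cons_pair (phi t, y))).
  exact: (bmf_pairl bF1).
have := IH _ bFt (fun y => F0 _) => /(ler_wpM2l (g0 t)); apply: le_trans.
rewrite le_eqVlt; apply/orP; left; apply/eqP.
rewrite -RintZ; last first.
  by apply: bmfM; [exact: (bmf_comp (@measurable_map_tnth _ _ _ _ n _ mphi) bFt)|exact: bmf_lik].
by apply: eq_Rintegral => x _; rewrite E mulrCA.
Qed.

End change_of_measure.

Section tilting.
Context d (T : measurableType d) (R : realType) (P : probability T R) (w : T -> R).
Hypotheses (bw : bounded_measurable w) (w0 : forall t, 0 <= w t).
Hypothesis w1 : \int[P]_t w t = 1.

Definition tilt (A : set T) : \bar R := (\int[P]_(t in A) (w t)%:E)%E.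

Let tilt0 : tilt set0 = 0%E. Proof. by rewrite /tilt integral_set0. Qed.

Let tilt_ge0 A : (0 <= tilt A)%E.
Proof. by apply: integral_ge0 => t _; rewrite lee_fin. Qed.

Let tilt_sigma_additive : semi_sigma_additive tilt.
Proof.
apply: semi_sigma_additive_nng_induced => //; first by apply/measurable_EFinP; case: bw.
Qed.

HB.instance Definition _ := isMeasure.Build _ _ _ tilt tilt0 tilt_ge0 tilt_sigma_additive.

Let tilt_setT : tilt setT = 1%E.
Proof. by rewrite /tilt EFin_Rint// w1. Qed.

HB.instance Definition _ := @Measure_isProbability.Build _ _ R tilt tilt_setT.

Definition tilted : probability T R := tilt.

Lemma Rint_tilted h : bounded_measurable h -> \int[tilted]_t h t = \int[P]_t (h t * w t).
Proof.
have nn k : bounded_measurable k -> (forall t, 0 <= k t) ->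
    \int[tilted]_t k t = \int[P]_t (k t * w t).
  move=> bk k0; rewrite /Rintegral; congr fine.
  rewrite (@ge0_integral_density _ _ _ P tilted w)//; first by case: bw.
  by apply/measurable_EFinP; case: bk.
move=> bh; have [mh [M hM]] := bh.
have bM : bounded_measurable (fun t => h t + M) by apply: bmfD bh (bmf_cst _ _).
have := nn _ bM; rewrite RintD//; last exact: bmf_cst.
rewrite Rint_cst (_ : \int[P]_t ((h t + M) * w t) = \int[P]_t (h t * w t) + M).
  by move=> /(_ _)/addIr; apply=> t; have := hM t; rewrite ler_norml; lra.
under eq_Rintegral do rewrite mulrDl.
by rewrite RintD ?RintZ ?w1 ?mulr1//; [exact: bmfM|exact: bmfZ].
Qed.

End tilting.

(** * A lower bound for the tail of Kendall's tau *)

Section tilted_sample.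
Variable R : realType.
Local Notation RT := (measurableTypeR R).
Local Notation RR := (RT * RT)%type.
Local Notation N2 := (gauss2 R).

Definition Hprod (z : RR) : R := Hproj z.1 * Hproj z.2.

Lemma Hprod_norm_le1 z : `|Hprod z| <= 1.
Proof. by rewrite normrM mulr_ile1// Hproj_norm_le1. Qed.

Section theta.
Variable th : R.
Hypotheses (th0 : 0 <= th) (th1 : th <= 2^-1).

(** The density of the Farlie-Gumbel-Morgenstern copula, since [Hproj] is
    [2 F - 1]. It tilts the independent law along the first projection of the
    sign kernel, the direction in which the mean of Kendall's tau grows at the
    least cost in relative entropy to leading order. *)
Definition fgm (z : RR) : R := 1 + th * Hprod z.

Let thH z : `|th * Hprod z| <= th.
Proof. by rewrite normrM ger0_norm// ler_piMr// Hprod_norm_le1. Qed.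

Lemma fgm_ge z : 2^-1 <= fgm z.
Proof. by have := th1; have := thH z; rewrite /fgm ler_norml; move: (th * _) => y /andP[ya yb] ?; lra. Qed.

Lemma fgm_gt0 z : 0 < fgm z.
Proof. by apply: lt_le_trans (fgm_ge z); rewrite invr_gt0. Qed.

Lemma bmf_fgm : bounded_measurable fgm.
Proof. by apply: bmfD; [exact: bmf_cst|apply: bmfZ; exact: bmf_Hprod]. Qed.

Lemma fgm_int : \int[N2]_z fgm z = 1.
Proof.
rewrite RintD; [|exact: bmf_cst|by apply: bmfZ; exact: bmf_Hprod].
by rewrite Rint_cst RintZ ?Hprod_mean ?mulr0 ?addr0//; exact: bmf_Hprod.
Qed.

Lemma bmf_ln_fgm : bounded_measurable (fun z => ln (fgm z)).
Proof.
split.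
  by apply: (measurableT_comp (@measurable_ln R)); case: bmf_fgm.
exists 1 => z; have h := fgm_ge z; have h0 := fgm_gt0 z.
have h1 : ln (fgm z) <= th * Hprod z.
  apply: le_ln1Dx; move: h; rewrite /fgm; lra.
have h2 : - ln (fgm z) <= (fgm z)^-1 - 1.
  rewrite -lnV// -[X in ln X](addrNK 1) addrC; apply: le_ln1Dx.
  by rewrite ltrBrDr addrC subrr invr_gt0.
have h3 : (fgm z)^-1 <= 2 by rewrite -[leRHS]invrK lef_pV2 ?posrE ?invr_gt0.
move: (thH z) h1 h2; rewrite !ler_norml; move: (th * _) (ln _) => y k /andP[ya yb] h1 h2.
by move: (fgm z)^-1 h2 h3 => I h2 h3; have t1 := th1; apply/andP; split; lra.
Qed.

(** [(1 + y) ln (1 + y)] is [y + y ^ 2 / 2] up to third order, where [y] has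
    mean 0 and variance [th ^ 2 / 9]. *)
Lemma fgm_entropy : \int[N2]_z (ln (fgm z) * fgm z) <= th ^+ 2 / 18 + th ^+ 3.
Proof.
have bH : bounded_measurable Hprod := bmf_Hprod R.
apply: le_trans (_ : \int[N2]_z (th * Hprod z + th ^+ 2 / 2 * Hprod z ^+ 2 + th ^+ 3) <= _).
  apply: Rint_le.
  - by apply: bmfM; [exact: bmf_ln_fgm|exact: bmf_fgm].
  - apply: bmfD; last exact: bmf_cst.
    by apply: bmfD; [exact: bmfZ|apply: bmfZ; exact: bmfX].
  move=> z; have := thH z; rewrite /fgm.
  have E (a b : R) : a ^+ 2 / 2 * b ^+ 2 = (a * b) ^+ 2 / 2 by field.
  rewrite E; set y := th * Hprod z => yth.
  have y1 : -1 < y by move: yth; rewrite ler_norml => /andP[? ?]; have t1 := th1; lra.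
  have y10 : 0 <= 1 + y by lra.
  apply: le_trans (ler_wpM2r y10 (ln1p_le_cubic y1)) _.
  have y3 : `|y| ^+ 3 <= th ^+ 3 by rewrite lerXn2r ?nnegrE.
  have : - y ^+ 3 / 6 + y ^+ 4 / 3 <= `|y| ^+ 3.
    have -> : y ^+ 4 = `|y| * `|y| ^+ 3.
      by rewrite -exprS -normrX ger0_norm// -(mul1n 4%N) exprM // exprn_even_ge0.
    have : - y ^+ 3 <= `|y| ^+ 3 by rewrite -normrX -normrN ler_norm.
    have : `|y| * `|y| ^+ 3 <= 1 * `|y| ^+ 3.
      by rewrite ler_wpM2r ?exprn_ge0//; have t1 := th1; lra.
    have : 0 <= `|y| ^+ 3 by rewrite exprn_ge0.
    move: (`|y| ^+ 3) (`|y| * _) (y ^+ 3) => A B' C; lra.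
  have -> : (y - y ^+ 2 / 2 + y ^+ 3 / 3) * (1 + y) =
     y + y ^+ 2 / 2 + (- y ^+ 3 / 6 + y ^+ 4 / 3) by field.
  by lra.
rewrite RintD; [|by apply: bmfD; [exact: bmfZ|apply: bmfZ; exact: bmfX]|exact: bmf_cst].
rewrite RintD; [|exact: bmfZ|by apply: bmfZ; exact: bmfX].
rewrite RintZ// Hprod_mean RintZ; last exact: bmfX.
rewrite Hprod_var Rint_cst; lra.
Qed.

Definition fgm_law : probability RR R := tilted bmf_fgm (fun z => ltW (fgm_gt0 z)) fgm_int.

Lemma Rint_fgm h : bounded_measurable h -> \int[fgm_law]_z h z = \int[N2]_z (h z * fgm z).
Proof. exact: Rint_tilted. Qed.

(** The tilt acts on both arguments of the kernel and gains [th / 9] through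
    each of them; the term with both tilts is at least [- th ^ 2]. *)
Lemma fgm_mean : 2 * th / 9 - th ^+ 2 <= kernel_mean (kern 0) fgm_law.
Proof.
have bH : bounded_measurable Hprod := bmf_Hprod R.
have bK : bounded_measurable (fun w : RR * RR => kern 0 w.1 w.2) := bmf_kern 0.
pose A z := \int[N2]_z' (kern 0 z z' * Hprod z').
have bKH : bounded_measurable (fun w : RR * RR => kern 0 w.1 w.2 * Hprod w.2).
  by apply: bmfM => //; apply: (bmf_comp _ bH).
have bA : bounded_measurable A := bmf_fubini1 N2 N2 bKH.
have bKz z : bounded_measurable (fun z' => kern 0 z z') := bmf_pairl bK z.
have A1 z : `|A z| <= 1.
  apply: le_trans (Rint_norm_le _ (bmf_pairl bKH z)) _.
  rewrite -(Rint_cst N2 1); apply: Rint_le; [exact: (bmf_norm (bmf_pairl bKH z))|exact: bmf_cst|].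
  by move=> z' /=; rewrite normrM mulr_ile1// ?kern_norm_le1 ?Hprod_norm_le1.
have AE : \int[N2]_z A z = 9^-1.
  rewrite /A -(Rint_fubini1 N2 N2 bKH) (Rint_fubini2 N2 N2 bKH) -Hprod_var.
  apply: eq_Rintegral => z _ /=; rewrite RintZr; last by under eq_fun do rewrite -kern_sym.
  under eq_Rintegral do rewrite -kern_sym.
  by rewrite kern0_proj expr2.
have in1 z : \int[fgm_law]_z' kern 0 z z' = Hprod z + th * A z.
  rewrite Rint_fgm//.
  transitivity (\int[N2]_z' (kern 0 z z' + th * (kern 0 z z' * Hprod z'))).
    by apply: eq_Rintegral => z' _; rewrite /fgm; ring.
  have bz : bounded_measurable (fun z' => kern 0 z z' * Hprod z') := bmf_pairl bKH z.
  by rewrite RintD ?RintZ ?kern0_proj//; exact: bmfZ.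
rewrite /kernel_mean; under eq_Rintegral do rewrite in1.
have bI : bounded_measurable (fun z => Hprod z + th * A z) by apply: bmfD => //; exact: bmfZ.
rewrite Rint_fgm//.
apply: le_trans (_ : \int[N2]_z (Hprod z + (th * Hprod z ^+ 2 + (th * A z - th ^+ 2))) <= _).
  have bH2 : bounded_measurable (fun z => th * Hprod z ^+ 2) by apply: bmfZ; exact: bmfX.
  have bAt : bounded_measurable (fun z => th * A z - th ^+ 2).
    by apply: bmfB; [exact: bmfZ|exact: bmf_cst].
  rewrite RintD//; last exact: bmfD.
  rewrite RintD// RintZ; last exact: bmfX.
  rewrite RintB; [|exact: bmfZ|exact: bmf_cst].
  by rewrite RintZ// Rint_cst AE Hprod_mean Hprod_var; lra.
apply: Rint_le.
- apply: bmfD => //; apply: bmfD; first by apply: bmfZ; exact: bmfX.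
  by apply: bmfB; [exact: bmfZ|exact: bmf_cst].
- by apply: bmfM => //; exact: bmf_fgm.
move=> z; rewrite /fgm.
have : - 1 <= A z * Hprod z.
  have : `|A z * Hprod z| <= 1 by rewrite normrM mulr_ile1// Hprod_norm_le1.
  by rewrite ler_norml => /andP[].
have t2 : 0 <= th ^+ 2 by rewrite sqr_ge0.
move=> /(ler_wpM2l t2); set a := A z; set h := Hprod z => h1.
have -> : (h + th * a) * (1 + th * h) = h + (th * h ^+ 2 + (th * a + th ^+ 2 * (a * h))) by ring.
by rewrite !lerD2l; lra.
Qed.

Section size.
Variable n : nat.
Local Notation Q := (power_prob N2 n).
Local Notation W := (power_prob fgm_law n).
Local Notation L := (fun x : n.-tuple RR => \prod_k fgm (tnth x k)).

Lemma bmf_L : bounded_measurable L.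
Proof. exact: (bmf_lik bmf_fgm). Qed.

Lemma L_gt0 x : 0 < L x. Proof. by apply: prodr_gt0 => k _; exact: fgm_gt0. Qed.

(** The inequality of [power_change] for [F] and for [1 - F]. *)
Lemma Rint_W F : bounded_measurable F -> (forall x, 0 <= F x <= 1) ->
  \int[W]_x F x = \int[Q]_x (F x * L x).
Proof.
have le F' : bounded_measurable F' -> (forall x, 0 <= F' x) ->
    \int[Q]_x (F' x * L x) <= \int[W]_x F' x.
  move=> bF F0.
  have Hle h : bounded_measurable h -> (forall u, 0 <= h u) ->
      \int[N2]_z (h z * fgm z) <= \int[fgm_law]_z h z by move=> bh _; rewrite Rint_fgm.
  apply: le_trans (@power_change _ RR _ RR R N2 fgm_law id fgm (@measurable_id _ _ _) bmf_fgm
    (fun z => ltW (fgm_gt0 z)) Hle n F' bF F0).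
  rewrite le_eqVlt; apply/orP; left; apply/eqP; apply: eq_Rintegral => x _.
  by congr (F' _ * _); apply: eq_from_tnth => k; rewrite tnth_mktuple.
move=> bF F01; apply/eqP; rewrite eq_le; apply/andP; split; last first.
  by apply: le => // x; case/andP: (F01 x).
have b1F : bounded_measurable (fun x => 1 - F x) by apply: bmfB => //; exact: bmf_cst.
have := le _ b1F (fun x => _); rewrite RintB//; last exact: bmf_cst.
rewrite Rint_cst.
have -> : \int[Q]_x ((1 - F x) * L x) = 1 - \int[Q]_x (F x * L x).
  transitivity (\int[Q]_x (L x - F x * L x)).
    by apply: eq_Rintegral => x _; rewrite mulrBl mul1r.
  rewrite RintB; [|exact: bmf_L|by apply: bmfM => //; exact: bmf_L].
  congr (_ - _); rewrite (@Rint_prod_coord _ _ _ n N2 _ (fun=> fgm) (@iid_power _ _ _ N2 n))//.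
    by rewrite big1// => k _; exact: fgm_int.
  by move=> k; exact: bmf_fgm.
move=> /(_ _); rewrite lerD2l lerN2; apply => x.
by rewrite subr_ge0; case/andP: (F01 x).
Qed.

Lemma ln_L x : ln (L x) = \sum_k ln (fgm (tnth x k)).
Proof.
suff : forall r : seq 'I_n, ln (\prod_(k <- r) fgm (tnth x k)) = \sum_(k <- r) ln (fgm (tnth x k)).
  by apply.
elim=> [|k r IH]; first by rewrite !big_nil ln1.
rewrite !big_cons lnM ?posrE ?fgm_gt0// ?IH//.
by apply: prodr_gt0 => l _; exact: fgm_gt0.
Qed.

Lemma bmf_ln_L : bounded_measurable (fun x => ln (L x)).
Proof.
under eq_fun do rewrite ln_L.
by apply: bmf_sum => k _; apply: (bmf_comp (measurable_tnth k) bmf_ln_fgm).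
Qed.

Lemma L_entropy : \int[Q]_x (ln (L x) * L x) <= n%:R * (th ^+ 2 / 18 + th ^+ 3).
Proof.
have bl k : bounded_measurable (fun x : n.-tuple RR => ln (fgm (tnth x k)) * L x).
  apply: bmfM; last exact: bmf_L.
  by apply: (bmf_comp (measurable_tnth k) bmf_ln_fgm).
under eq_Rintegral do rewrite ln_L mulr_suml.
rewrite Rint_sum// mulr_natl -[X in _ *+ X]card_ord -sumr_const; apply: ler_sum => k _.
pose F j z := (if j == k then ln (fgm z) else 1) * fgm z.
have bF j : bounded_measurable (F j).
  apply: bmfM; last exact: bmf_fgm.
  by case: (j == k); [exact: bmf_ln_fgm|exact: bmf_cst].
have -> : \int[Q]_x (ln (fgm (tnth x k)) * L x) = \int[Q]_x \prod_j F j (tnth x j).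
  apply: eq_Rintegral => x _; rewrite /F big_split/=; congr (_ * _).
  by rewrite (bigD1 k)//= eqxx big1 ?mulr1// => j /negPf ->.
rewrite (Rint_prod_coord (@iid_power _ _ _ N2 n))// (bigD1 k)//= big1 ?mulr1; last first.
  move=> j /negPf jk; rewrite /F jk; under eq_Rintegral do rewrite mul1r.
  exact: fgm_int.
by rewrite /F eqxx; exact: fgm_entropy.
Qed.

(** With [L] the likelihood ratio, [exp u >= 1 + u] gives
    [L (1 + c - ln L) <= exp c] everywhere and [- L ln L <= 1]. The first bound
    is used on the event, the second off it. *)
Lemma entropy_bound (A : pred (n.-tuple RR)) c : measurable_fun setT A ->
  expR (- c) * ((1 + c) * \int[W]_x (A x)%:R - n%:R * (th ^+ 2 / 18 + th ^+ 3) - 1) <=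
  \int[Q]_x (A x)%:R.
Proof.
move=> mA; have bA : bounded_measurable (fun x => (A x)%:R : R) by exact: bmf_bool.
have bL := bmf_L; have blL := bmf_ln_L.
have bAL : bounded_measurable (fun x => (A x)%:R * L x) by exact: bmfM.
have blLL : bounded_measurable (fun x => ln (L x) * L x) by exact: bmfM.
rewrite Rint_W//; last by move=> x; case: (A x); rewrite ?lexx ?ler01.
apply: le_trans (_ : expR (- c) * \int[Q]_x ((1 + c) * ((A x)%:R * L x) - ln (L x) * L x - 1) <= _).
  apply: ler_wpM2l; first exact: expR_ge0.
  rewrite RintB; [|by apply: bmfB => //; exact: bmfZ|exact: bmf_cst].
  rewrite RintB//; last exact: bmfZ.
  rewrite RintZ// Rint_cst !lerD2r lerD2l lerN2; exact: L_entropy.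
rewrite -RintZ; last by apply: bmfB; [apply: bmfB => //; exact: bmfZ|exact: bmf_cst].
apply: Rint_le => //.
  apply: bmfZ; apply: bmfB; [apply: bmfB => //; exact: bmfZ|exact: bmf_cst].
move=> x; have l0 := L_gt0 x; set l := L x in l0 *.
rewrite -ler_pdivlMl ?expR_gt0// expRN invrK.
case: (A x) => /=; rewrite ?mulr1 ?mulr0 ?mul0r ?mul1r.
  have := ler_wpM2l (ltW l0) (expR_ge1Dx (c - ln l)).
  rewrite expRB lnK ?posrE// mulrCA divff ?gt_eqF// mulr1.
  rewrite (_ : l * (1 + (c - ln l)) = (1 + c) * l - ln l * l); last by ring.
  by move=> h; lra.
have := ler_wpM2l (ltW l0) (le_ln1Dx (_ : -1 < l^-1 - 1)).
rewrite [1 + _]addrC addrNK lnV ?posrE// mulrBr divff ?gt_eqF// => /(_ _) h.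
have : l * - ln l <= 1 - l * 1.
  by apply: h; rewrite ltrBrDr addrC subrr invr_gt0.
lra.
Qed.

(** Chebyshev's inequality. *)
Lemma tilted_tail x : (1 < n)%N -> x < 2 * th / 9 - th ^+ 2 ->
  1 - 12 / n%:R / (2 * th / 9 - th ^+ 2 - x) ^+ 2 <=
  \int[W]_y (x < ustat (kern 0) y)%R%:R.
Proof.
move=> n1 xth; set D := _ - x; have D0 : 0 < D by rewrite subr_gt0.
have bK := bmf_kern (0 : R).
have bU : bounded_measurable (fun y : n.-tuple RR => ustat (kern 0) y) := bmf_ustat bK n.
set m := kernel_mean (kern 0) fgm_law.
have Dm : D <= m - x by rewrite lerD2r; exact: fgm_mean.
have V : \int[W]_y (ustat (kern 0) y - m) ^+ 2 <= 12 / n%:R.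
  by apply: (ustat_var_le bK) => //; [exact: kern_norm_le1|exact: iid_power].
have bI : bounded_measurable (fun y : n.-tuple RR => (x < ustat (kern 0) y)%R%:R : R).
  by apply: bmf_bool; apply: measurable_fun_ltr => //; case: bU.
have bV : bounded_measurable (fun y : n.-tuple RR => (ustat (kern 0) y - m) ^+ 2).
  by apply: bmfX; apply: bmfB => //; exact: bmf_cst.
apply: le_trans (_ : \int[W]_y (1 - (D ^+ 2)^-1 * (ustat (kern 0) y - m) ^+ 2) <= _).
  rewrite RintB; [|exact: bmf_cst|exact: bmfZ].
  rewrite Rint_cst RintZ// lerD2l lerN2 mulrC ler_wpM2r// invr_ge0 sqr_ge0//.
apply: Rint_le => //; first by apply: bmfB; [exact: bmf_cst|exact: bmfZ].
move=> y; case: ltP => xy.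
  by rewrite gerBl mulr_ge0 ?invr_ge0 ?sqr_ge0.
rewrite subr_le0 mulrC ler_pdivlMr ?exprn_gt0// mul1r -[leRHS]real_normK ?num_real//.
rewrite lerXn2r ?nnegrE ?(ltW D0)//.
apply: le_trans Dm _; rewrite -normrN; apply: le_trans _ (ler_norm _); lra.
Qed.

End size.
End theta.

(** Tilting by [th] close to [9 x / 2] moves the mean of the statistic just
    above [x = a l], at an entropy cost of about
    [n th ^ 2 / 18 = (9 a ^ 2 / 8) ln p]. Hence the exponent of the upper tail
    bound cannot be improved. *)
Lemma kendall_lower_tail (a kappa eta : R) : 0 < a -> 9 * a ^+ 2 / 8 < kappa -> 0 < eta ->
  exists n0 : nat, forall n p : nat, (n0 <= n)%N -> (1 < n)%N -> (n < p)%N ->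
    p%:R <= n%:R `^ eta ->
    expR (- (kappa * ln p%:R)) <=
    \int[power_prob N2 n]_y (a * Num.sqrt (ln p%:R / n%:R) < ustat (kern 0) y)%R%:R.
Proof.
move=> a0; set S := _ / 8 => Sk eta0.
have S0 : 0 < S by rewrite /S divr_gt0// mulr_gt0// exprn_gt0.
(* [z] is the slack between [S] and [kappa]: the mean is moved to [x (1 + z)],
   and all errors together are at most [z (15 S + 3) ln p]. *)
pose z := Num.min 1 ((kappa - S) / (15 * S + 3)).
have z0 : 0 < z by rewrite lt_min ltr01 divr_gt0 ?subr_gt0// addr_gt0// mulr_gt0.
have z1 : z <= 1 by rewrite ge_min lexx.
have zk : z * (15 * S + 3) <= kappa - S.
  by rewrite -ler_pdivlMr ?ge_min ?lexx ?orbT// addr_gt0// mulr_gt0.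
pose e := z / (162 * (1 + a)).
have e0 : 0 < e by rewrite divr_gt0// mulr_gt0// addr_gt0.
have [n1 small] := @ln_div_small R eta (e ^+ 2) eta0 (exprn_gt0 2 e0).
pose B := 1 / z + 96 / (a ^+ 2 * z ^+ 3).
exists (maxn n1 (Num.truncn (expR B)).+1) => n p; rewrite geq_max => /andP[n1n Bn] n_1 np peta.
have x0 : 0 < n%:R :> R by rewrite ltr0n; exact: ltnW.
have p0 : 0 < p%:R :> R by rewrite ltr0n; exact: leq_ltn_trans np.
set lp := ln p%:R; have lpB : B <= lp.
  rewrite -[B]expRK ler_ln ?posrE ?expR_gt0//.
  by apply/ltW/(lt_le_trans (truncnS_gt _)); rewrite ler_nat; exact: ltnW (leq_ltn_trans Bn np).
have B1 : 1 / z <= lp by apply: le_trans lpB; rewrite lerDl divr_ge0// mulr_ge0 ?sqr_ge0// exprn_ge0// ltW.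
have B2 : 96 / (a ^+ 2 * z ^+ 3) <= lp by apply: le_trans lpB; rewrite lerDr divr_ge0// ltW.
have lp0 : 0 < lp by apply: lt_le_trans B1; rewrite divr_gt0.
set l := Num.sqrt _.
have l2 : l ^+ 2 = lp / n%:R by rewrite sqr_sqrtr// divr_ge0// ltW.
have l0 : 0 < l by rewrite sqrtr_gt0 divr_gt0.
have le : l <= e.
  have -> : e = Num.sqrt (e ^+ 2) by rewrite sqrtr_sqr gtr0_norm.
  by rewrite ler_wsqrtr//; apply: small => //; [exact: ltnW|exact: leq_ltn_trans np].
set x := a * l.
have xx0 : 0 < x by rewrite mulr_gt0.
have xz : 162 * x <= z.
  have a10 : 0 < 162 * (1 + a) by rewrite mulr_gt0// addr_gt0.
  have : l * (162 * (1 + a)) <= z by rewrite -ler_pdivlMr.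
  by rewrite /x; move: l0; move: (l) => l'; nra.
have nx : n%:R * x ^+ 2 = a ^+ 2 * lp by rewrite exprMn l2; field; rewrite gt_eqF.
pose th := 9 * x * (1 + z) / 2.
have th0 : 0 < th by rewrite /th divr_gt0// !mulr_gt0// addr_gt0.
have th9 : th <= 9 * x by rewrite /th ler_pdivrMr// ler_wpM2l ?mulr_ge0 ?(ltW xx0)//; lra.
have th18 : 18 * th <= z by lra.
have th1 : th <= 2^-1 by lra.
have th2 : th ^+ 2 <= x * z / 2.
  rewrite expr2; apply: le_trans (_ : 9 * x * th <= _); first by rewrite ler_pM2r.
  have : x * (18 * th) <= x * z by rewrite ler_pM2l.
  by move: (x * z) => xz'; lra.
have mE : 2 * th / 9 = x + x * z by rewrite /th; field.
set D := 2 * th / 9 - th ^+ 2 - x.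
have xz0 : 0 < x * z by rewrite mulr_gt0.
have Dxz : x * z / 2 <= D by rewrite /D mE; move: th2; move: (x * z) => *; lra.
have xlt : x < 2 * th / 9 - th ^+ 2.
  by rewrite -subr_gt0 -/D; apply: lt_le_trans Dxz; rewrite divr_gt0.
have := tilted_tail (ltW th0) th1 n_1 xlt.
have := entropy_bound (ltW th0) th1 (A := fun y : n.-tuple RR => x < ustat (kern 0) y).
set WA := \int[_]_y _; set PA := \int[_]_y _ => ent tail.
have WAge : 1 - z / 2 <= WA.
  apply: le_trans tail; rewrite lerD2l lerN2 -/D.
  apply: le_trans (_ : 12 / n%:R / (x * z / 2) ^+ 2 <= _).
    rewrite ler_wpM2l ?divr_ge0// lef_pV2 ?posrE ?exprn_gt0 ?divr_gt0//; last first.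
      by apply: lt_le_trans Dxz; rewrite divr_gt0.
    by rewrite lerXn2r ?nnegrE ?divr_ge0 ?(ltW xz0)//; apply: le_trans Dxz; rewrite divr_ge0// ltW.
  have -> : 12 / n%:R / (x * z / 2) ^+ 2 = 48 / (a ^+ 2 * lp * z ^+ 2).
    by rewrite -nx; field; rewrite !gt_eqF.
  move: B2; rewrite !ler_pdivrMr ?mulr_gt0 ?exprn_gt0// => B2.
  have -> : z / 2 * (a ^+ 2 * lp * z ^+ 2) = lp * (a ^+ 2 * z ^+ 3) / 2 by field.
  by move: B2; move: (lp * _) => u; lra.
set KL := n%:R * (th ^+ 2 / 18 + th ^+ 3) in ent.
have KLle : KL <= S * lp * (1 + z) ^+ 3.
  have E : n%:R * (th ^+ 2 / 18) = S * lp * (1 + z) ^+ 2.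
    have -> : n%:R * (th ^+ 2 / 18) = 9 / 8 * (n%:R * x ^+ 2) * (1 + z) ^+ 2 by rewrite /th; field.
    by rewrite nx /S; field.
  have -> : KL = n%:R * (th ^+ 2 / 18) * (1 + 18 * th) by rewrite /KL; field.
  rewrite E (exprSr _ 2) [leRHS]mulrA; apply: ler_wpM2l; last by rewrite lerD2l.
  by rewrite mulr_ge0 ?sqr_ge0// mulr_ge0// ltW.
set X := S * lp * (1 + z) ^+ 3 in KLle.
have z10 : 0 <= 1 + z by rewrite addr_ge0// ltW.
have X0 : 0 <= X by rewrite /X mulr_ge0 ?exprn_ge0// mulr_ge0// ltW.
pose c := (X + 1) * (1 + z).
have c0 : 0 <= c by rewrite /c mulr_ge0 ?addr_ge0// ltW.
have main : 2^-1 <= (1 + c) * WA - KL - 1.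
  have h1 : (1 + c) * (1 - z / 2) <= (1 + c) * WA by rewrite ler_wpM2l// addr_ge0.
  have h2 : X + 1 <= c * (1 - z / 2).
    rewrite /c -mulrA ler_peMr ?addr_ge0//.
    have -> : (1 + z) * (1 - z / 2) = 1 + z * (1 - z) / 2 by field.
    by rewrite lerDl divr_ge0// mulr_ge0 ?subr_ge0// ltW.
  have h3 : (1 + c) * (1 - z / 2) = 1 - z / 2 + c * (1 - z / 2) by ring.
  by move: h1; rewrite h3; move: h2; move: (c * _) ((1 + c) * _) => u v; lra.
apply: le_trans (ent c _); last first.
  by apply: measurable_fun_ltr => //; case: (bmf_ustat (bmf_kern (0 : R)) n).
apply: le_trans (_ : expR (- c) * 2^-1 <= _); last by rewrite ler_wpM2l ?expR_ge0.
apply: le_trans (_ : expR (- c) * expR (- 1) <= _); last first.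
  rewrite ler_wpM2l ?expR_ge0// expRN lef_pV2 ?posrE ?expR_gt0//.
  by have := expR_ge1Dx (1 : R); lra.
rewrite -expRD ler_expR -opprD lerN2.
have lpz : 1 <= z * lp by move: B1; rewrite ler_pdivrMr// mulrC.
have z4 : (1 + z) ^+ 4 <= 1 + 15 * z.
  have z20 : z ^+ 2 <= z by rewrite expr2 ler_piMr// ltW.
  have z30 : z ^+ 3 <= z by rewrite exprS ler_piMr ?(ltW z0)// exprn_ile1// ltW.
  have z40 : z ^+ 4 <= z by rewrite exprS ler_piMr ?(ltW z0)// exprn_ile1// ltW.
  have -> : (1 + z) ^+ 4 = 1 + 4 * z + 6 * z ^+ 2 + 4 * z ^+ 3 + z ^+ 4 by ring.
  lra.
have Sl0 : 0 <= S * lp by rewrite mulr_ge0 ?ltW.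
have -> : c + 1 = S * lp * (1 + z) ^+ 4 + (2 + z) by rewrite /c /X; ring.
have h4 := ler_wpM2l Sl0 z4.
have h5 := ler_wpM2r (ltW lp0) zk.
have -> : kappa * lp = (kappa - S) * lp + S * lp by ring.
move: h4 h5; have -> : S * lp * (1 + 15 * z) = S * lp + 15 * (z * S * lp) by ring.
have -> : z * (15 * S + 3) * lp = 15 * (z * S * lp) + 3 * (z * lp) by ring.
move: lpz z1; move: (z * lp) (z * S * lp) ((kappa - S) * lp) (S * lp) (_ * _ ^+ 4) => *; lra.
Qed.

End tilted_sample.

(** * Gaussian samples with a given covariance *)

Section linear_gaussian.
Variable R : realType.
Local Notation RT := (measurableTypeR R).
Variables (m p : nat) (B : 'M[R]_(p, m)).

Definition linmap (w : m.-tuple RT) : p.-tuple RT :=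
  [tuple \sum_l B i l * tnth w l | i < p].

Lemma measurable_linmap : measurable_fun setT linmap.
Proof.
apply/measurable_fun_tnthP => i.
rewrite (_ : _ \o _ = fun w : m.-tuple RT => \sum_l B i l * tnth w l); last first.
  by apply/funext => w /=; rewrite tnth_mktuple.
by apply: measurable_sum => l; apply: measurable_funM => //; exact: measurable_tnth.
Qed.

HB.instance Definition _ := isMeasurableFun.Build _ _ _ _ linmap measurable_linmap.

Definition gauss_image : probability (p.-tuple RT) R :=
  distribution (power_prob (gauss R) m) (linmap : {mfun _ >-> _}).

Lemma Rint_gauss_image F : bounded_measurable F ->
  \int[gauss_image]_x F x = \int[power_prob (gauss R) m]_w F (linmap w).
Proof. by move=> bF; apply: Rint_push bF => //; exact: measurable_linmap. Qed.

Lemma multinormal_gauss_image : multinormal 0 (B *m B^T) gauss_image.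
Proof.
have quad (t : 'rV[R]_p) : (t *m (B *m B^T) *m t^T) 0 0 = \sum_l (t *m B) 0 l ^+ 2.
  rewrite mulmxA -mulmxA -trmx_mul mxE; apply: eq_bigr => l _.
  by rewrite [X in _ * X]mxE expr2.
split.
- by rewrite trmx_mul trmxK.
- by move=> t; rewrite quad; apply: sumr_ge0 => l _; exact: sqr_ge0.
move=> t A mA; rewrite mulmx0 [X in normal_law X]mxE.
have ms : measurable_fun setT (fun x : p.-tuple RT => \sum_i t 0 i * tnth x i : RT).
  by apply: measurable_sum => i; apply: measurable_funM => //; exact: measurable_tnth.
have mpre : measurable [set x : p.-tuple RT | A (\sum_i t 0 i * tnth x i)].
  by have := ms measurableT A mA; rewrite setTI.
rewrite normal_lawE//; last by rewrite quad; apply: sumr_ge0 => l _; exact: sqr_ge0.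
rewrite quad.
have mpre2 : measurable [set w : RT | A (0 + Num.sqrt (\sum_l (t *m B) 0 l ^+ 2) * w)].
  by have := measurable_affine 0 (Num.sqrt (\sum_l (t *m B) 0 l ^+ 2)) measurableT mA; rewrite setTI.
rewrite -(Rint_indic gauss_image mpre) -(Rint_indic (gauss R) mpre2); congr EFin.
rewrite Rint_gauss_image; last exact: bmf_indic.
have := @Rint_linform R m (power_prob (gauss R) m) (fun l => (t *m B) 0 l) 0 (fun x => \1_A x : R)
  (@iid_power _ _ _ (gauss R) m) (bmf_indic _ mA).
move=> H; transitivity (\int[gauss R]_w (\1_A (0 + Num.sqrt (\sum_l (t *m B) 0 l ^+ 2) * w) : R)); last first.
  by apply: eq_Rintegral => w _; rewrite !indicE; congr (_%:R); apply/idP/idP; rewrite !inE.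
rewrite -H; apply: eq_Rintegral => w _; rewrite !indicE; congr (_%:R).
have -> : \sum_l (t *m B) 0 l * tnth w l = \sum_i t 0 i * tnth (linmap w) i :> R.
  transitivity (\sum_l \sum_i t 0 i * B i l * tnth w l).
    by apply: eq_bigr => l _; rewrite mxE mulr_suml.
  rewrite exchange_big; apply: eq_bigr => i _; rewrite tnth_mktuple mulr_sumr.
  by apply: eq_bigr => l _; rewrite mulrA.
by rewrite add0r; congr nat_of_bool; apply/idP/idP => h; move: h; rewrite !inE.
Qed.

Lemma gaussian_sample_image n : gaussian_sample 0 (B *m B^T) (power_prob gauss_image n).
Proof.
exists gauss_image; split; first exact: multinormal_gauss_image.
by move=> C mC; apply: (@iid_power _ _ _ gauss_image n C mC).
Qed.

End linear_gaussian.

(** * Two-valued vectors in weak balls *)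

Section sparse.
Variable R : realType.

Lemma sorted_lt_count (S : seq R) (s : R) k : sorted >=%R S -> (k < size S)%N -> s < S`_k ->
  (k < count (fun y => (s < y)%R) S)%N.
Proof.
move=> srt kS sk; rewrite -[S](cat_take_drop k.+1) count_cat.
apply: leq_trans (leq_addr _ _).
have -> : count (fun y => s < y) (take k.+1 S) = size (take k.+1 S).
  apply/eqP; rewrite -all_count; apply/(all_nthP 0) => i; rewrite size_takel// => ik.
  rewrite nth_take//; apply: lt_le_trans sk _.
  apply: (sorted_leq_nth (leT := >=%R)) => //.
  - by move=> a b c' /= h1 h2; exact: le_trans h2 h1.
  - by move=> a /=.
  - by rewrite inE; exact: leq_ltn_trans kS.
by rewrite size_takel.
Qed.

Lemma weak_ball_two_valued dim q c (x : 'rV[R]_dim) (d : R) K :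
  0 < c -> 0 < d -> (forall j, x 0 j = 0 \/ x 0 j = d) ->
  (#|[set j | x 0%R j != 0%R]%SET| <= K)%N -> d `^ q * K%:R <= c -> weak_ball q c x.
Proof.
move=> c0 d0 x0d xK dK i ip.
have isz : (i < size (ordered_abs x))%N by rewrite size_ordered_abs.
set y := _`_i; have : y \in ordered_abs x by exact: mem_nth.
rewrite mem_sort => /mapP[j _ yj].
have [y0|y0] := eqVneq y 0.
  by rewrite /pow00 y0 eqxx mulr_ge0 ?invr_ge0// ltW.
have yd : y = d.
  rewrite yj; case: (x0d j) => E; first by move: y0; rewrite yj E normr0 eqxx.
  by rewrite E gtr0_norm.
have := @sorted_lt_count (ordered_abs x) 0 i (ordered_abs_sorted x) isz.
rewrite -/y yd => /(_ d0); rewrite count_ordered_abs => ic.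
have iK : (i.+1 <= K)%N.
  apply: leq_trans ic _; apply: leq_trans xK; apply: subset_leq_card.
  by apply/fintype.subsetP => k; rewrite !inE normr_gt0.
rewrite /pow00 gt_eqF// ler_pdivlMr ?ltr0n//; apply: le_trans dK.
by rewrite ler_wpM2l ?powR_ge0// ler_nat.
Qed.

End sparse.

(** * The risk of thresholding at the identity matrix *)

Section identity_risk.
Variable R : realType.
Local Notation RT := (measurableTypeR R).
Local Notation RR := (RT * RT)%type.
Local Notation N2 := (gauss2 R).

(** All true correlations vanish, so each pair that exceeds the threshold costs
    at least [(alpha l / 2) ^ 2]. *)
Lemma max_risk_ge_identity (q c alpha : R) n p : 0 < c -> 0 <= alpha -> (1 < n)%N -> (0 < p)%N ->
  let L := ln p%:R / n%:R in
  (((p.-1)%:R * (alpha ^+ 2 * L / 4 * \int[power_prob N2 n]_y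
     (alpha * Num.sqrt L < ustat (kern 0) y)%R%:R))%:E <=
  max_risk q c (@threshold_estimator R alpha n p))%E.
Proof.
move=> c0 al0 n1 p0 /=; set L := ln _ / _; set PA := \int[_]_y _.
have PA0 : 0 <= PA by apply: Rint_ge0.
pose Q := power_prob (gauss_image (1%:M : 'M[R]_p)) n.
have gS : gaussian_sample 0 (1%:M : 'M[R]_p) Q.
  by have := gaussian_sample_image (1%:M : 'M[R]_p) n; rewrite trmx1 mulmx1.
have cE i j : corrmx (1%:M : 'M[R]_p) i j = (i == j)%:R.
  by rewrite !mxE !eqxx !mulr1n sqrtr1 mulr1 divr1.
have S0 i : 0 < (1%:M : 'M[R]_p) i i by rewrite mxE eqxx.
apply: le_trans (_ : risk Q (corrmx (1%:M : 'M[R]_p)) (@threshold_estimator R alpha n p) <= _)%E;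
  last first.
  apply: ereal_sup_ubound; exists 0, 1%:M, Q; split => //; split.
  - by apply/matrixP => i j; rewrite mxE !cE eq_sym.
  - by move=> j; rewrite cE eqxx.
  - move=> i; apply: (@weak_ball_two_valued _ _ _ _ _ 1 0) => //.
    + by move=> j; left; rewrite [LHS]mxE [LHS]mxE cE (negPf (neq_lift i j)).
    + rewrite leqn0 cards_eq0; apply/eqP/setP => j; rewrite !inE [X in X != 0]mxE [X in X != 0]mxE cE.
      by rewrite (negPf (neq_lift i j)) eqxx.
    + by rewrite mulr0 ltW.
rewrite risk_finite; last by move=> i j; exact: bmf_threshold.
rewrite lee_fin ler_pdivlMl ?ltr0n//.
have L0 : 0 <= L by rewrite divr_ge0// ln_ge0// ler1n.
set a := alpha * Num.sqrt L.
have a0 : 0 <= a by rewrite mulr_ge0// sqrtr_ge0.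
have a2 : a ^+ 2 = alpha ^+ 2 * L by rewrite exprMn sqr_sqrtr.
apply: le_trans (_ : \sum_(i < p) ((p.-1)%:R * (a ^+ 2 / 4 * PA)) <= _).
  by rewrite sumr_const card_ord a2 -[leRHS]mulr_natl.
apply: ler_sum => i _; rewrite (bigD1_ord i)//=.
rewrite -[leLHS]add0r; apply: lerD; first by apply: Rint_ge0 => x; exact: sqr_ge0.
apply: le_trans (_ : \sum_(j < p.-1) (a ^+ 2 / 4 * PA) <= _).
  by rewrite sumr_const card_ord -[leRHS]mulr_natl.
apply: ler_sum => j _; rewrite cE (negPf (neq_lift _ _)).
under eq_Rintegral do rewrite threshold_offdiag ?neq_lift//.
have rE : corrmx (1%:M : 'M[R]_p) i (lift i j) = sin 0 by rewrite cE (negPf (neq_lift _ _)) sin0.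
have c00 : 0 <= cos 0 :> R by rewrite cos0.
rewrite (kendall_law (f := fun t => (sin_threshold a t - 0) ^+ 2)
    gS S0 (@iid_power _ _ _ N2 n) rE c00 (bmf_sin_threshold _ _)).
have bU : bounded_measurable (fun y : n.-tuple RR => ustat (kern 0) y) := bmf_ustat (bmf_kern 0) n.
have bI : bounded_measurable (fun y : n.-tuple RR => (a < ustat (kern 0) y)%R%:R : R).
  by apply: bmf_bool; apply: measurable_fun_ltr => //; case: bU.
rewrite -RintZ//; apply: Rint_le; first exact: bmfZ.
  by apply: (bmf_comp _ (bmf_sin_threshold _ _)); case: bU.
move=> y; rewrite subr0; set t := ustat _ _.
case: (ltP a t) => at_; last by rewrite mulr0 sqr_ge0.
have t0 : 0 <= t by apply: le_trans (ltW at_).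
have t1 : t <= 1 by apply: le_trans (ler_norm _) _; apply: ustat_norm_le1 => z z'; exact: kern_norm_le1.
have p2 := pihalf_ge1 R.
rewrite mulr1 /sin_threshold ger0_norm// at_ mulr1.
have -> : a ^+ 2 / 4 = (a / 2) ^+ 2 by rewrite expr_div_n -natrX.
have st : a / 2 <= sin (pi / 2 * t).
  apply: le_trans (half_le_sin _); last first.
    by rewrite mulr_ge0 ?(le_trans ler01 p2)//= ler_piMr// (le_trans ler01 p2).
  rewrite ler_pM2r//; apply: le_trans (ltW at_) _.
  by rewrite -[X in X <= _]mul1r ler_wpM2r.
rewrite lerXn2r ?nnegrE ?divr_ge0//; apply: le_trans st; exact: divr_ge0.
Qed.

End identity_risk.

Section suboptimal.
Variable R : realType.

Lemma powR_unbounded (b X : R) : 0 < b -> exists n1 : nat, forall n, (n1 <= n)%N -> X < n%:R `^ b.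
Proof.
move=> b0; pose Y := Num.max X 1.
have Y0 : 0 < Y by rewrite lt_max ltr01 orbT.
exists (Num.truncn (Y `^ b^-1)).+1 => n hn.
apply: le_lt_trans (_ : Y < _); first by rewrite le_max lexx.
have -> : Y = (Y `^ b^-1) `^ b by rewrite -powRrM mulVf ?gt_eqF// powRr1// ltW.
apply: gt0_ltr_powR => //; rewrite ?nnegrE ?powR_ge0//.
by apply: (lt_le_trans (truncnS_gt _)); rewrite ler_nat.
Qed.

(** The threshold constant 2 already shows that the minimax risk is at most of
    the order of the rate. A rate optimal estimator then has a small risk at
    the identity matrix, where entries exceed the threshold with probability at
    least [p ^ (- kappa)]. *)
Lemma attains_bound (q alpha kappa M m eta_l eta_u : R) p c : 0 <= q < 1 -> 0 < alpha ->
  9 * alpha ^+ 2 / 8 < kappa -> permissible_with q M m eta_l eta_u p c ->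
  attains_minimax_rate q c (fun n => @threshold_estimator R alpha n (p n)) ->
  exists2 C : R, 0 < C & exists n0 : nat, forall n, (n0 <= n)%N ->
    (p n)%:R `^ (1 - kappa) <= C * (c n * (ln (p n)%:R / n%:R) `^ (- (q / 2))).
Proof.
move=> q01 al0 ak perm [K K0 att].
have s2 : 2 * Num.sqrt 2 / 3 < 2 :> R.
  have : Num.sqrt 2 < Num.sqrt (2 ^+ 2) :> R by rewrite ltr_sqrt ?exprn_gt0//; lra.
  by rewrite sqrtr_sqr ger0_norm//; lra.
have [C C0 up] := threshold_upper q01 s2 M m eta_l eta_u.
have [_ _ l1 u1 H] := perm.
have [n0 low] := kendall_lower_tail al0 ak (lt_trans ltr01 u1).
exists (8 * K * C / alpha ^+ 2); first by rewrite divr_gt0 ?exprn_gt0// !mulr_gt0.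
exists (maxn n0 2) => n; rewrite geq_max => /andP[n0n n1].
have [[c0 _] _ _ pl pu] := H n n1.
have x0 : 0 < n%:R :> R by rewrite ltr0n ltnW.
have np : (n < p n)%N.
  rewrite -(ltr_nat R); apply: le_lt_trans pl; rewrite -[X in X <= _]powRr1 ?(ltW x0)//.
  by apply: ler_powR; [rewrite ler1n ltnW|exact: ltW].
have p0 : (0 < p n)%N by exact: leq_ltn_trans np.
have pp0 : 0 < (p n)%:R :> R by rewrite ltr0n.
set L := ln _ / _.
have L0 : 0 < L by rewrite divr_gt0// ln_gt0// ltr1n; exact: ltn_trans np.
have lo := max_risk_ge_identity q c0 (ltW al0) n1 p0.
have := le_trans lo (att n n1).
have mm : (minimax_risk n (p n) q (c n) <= (C * c n * L `^ (1 - q / 2))%:E)%E.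
  apply: le_trans (up p c perm n n1); apply: ereal_inf_lbound.
  by exists (@threshold_estimator R 2 n (p n)) => //; exact: measurable_threshold.
have K0' : (0 <= K%:E)%E by rewrite lee_fin ltW.
move=> /le_trans/(_ (lee_wpmul2l K0' mm)); rewrite -EFinM lee_fin -/L => bnd.
have tail := low n (p n) n0n n1 np (ltW pu).
have {}bnd : (p n).-1%:R * (alpha ^+ 2 * L / 4 * expR (- (kappa * ln (p n)%:R))) <=
    K * (C * c n * L `^ (1 - q / 2)).
  apply: le_trans bnd; rewrite ler_wpM2l// ler_wpM2l//.
  by rewrite divr_ge0// mulr_ge0 ?sqr_ge0// ltW.
have pE : expR (- (kappa * ln (p n)%:R)) = (p n)%:R `^ (- kappa).
  by rewrite /powR gt_eqF// mulNr.
have half : (p n)%:R / 2 <= (p n).-1%:R :> R.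
  rewrite ler_pdivrMr// -natrM ler_nat; case: (p n) np => // -[|k _ /=].
    by move=> h; move: n1; rewrite ltnNge ltnW.
  by rewrite muln2 -addnn addnS ltnS leq_addr.
have LE : L `^ (1 - q / 2) = L * L `^ (- (q / 2)).
  by rewrite powRD ?powRr1 ?(ltW L0)// (gt_eqF L0) implybT.
have PE : (p n)%:R `^ (1 - kappa) = (p n)%:R * (p n)%:R `^ (- kappa).
  by rewrite powRD ?powRr1// (gt_eqF pp0) implybT.
rewrite pE LE in bnd; rewrite PE.
set P := (p n)%:R `^ _ in bnd *; set LQ := L `^ _ in bnd *.
have P0 : 0 <= P by exact: powR_ge0.
have a20 : 0 < alpha ^+ 2 by rewrite exprn_gt0.
rewrite -[leLHS](mulKf (lt0r_neq0 a20)) mulrC.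
have : (p n)%:R / 2 * (alpha ^+ 2 * L / 4 * P) <= K * (C * c n * (L * LQ)).
  by apply: le_trans bnd; rewrite ler_wpM2r// mulr_ge0// divr_ge0// mulr_ge0 ?sqr_ge0// ltW.
rewrite (_ : _ / 2 * _ = L * (alpha ^+ 2 * ((p n)%:R * P)) / 8); last by field.
rewrite (_ : K * _ = L * (K * C * (c n * LQ))); last by ring.
rewrite -mulrA ler_pM2l// => h.
rewrite [leRHS]mulrAC ler_pM2r ?invr_gt0//; move: h.
rewrite ler_pdivrMr// => /le_trans; apply.
by rewrite le_eqVlt; apply/orP; left; apply/eqP; ring.
Qed.

End suboptimal.

(** * Failure below the critical threshold *)

Section suboptimality.
Variable R : realType.
Implicit Types (q alpha : R).

Lemma powR_gt1_mono (x a b : R) : 1 < x -> a < b -> x `^ a < x `^ b.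
Proof.
move=> x1 ab; have x0 : 0 < x by exact: lt_trans x1.
by rewrite /powR gt_eqF// ltr_expR ltr_pM2r// ln_gt0.
Qed.

Section permissible_facts.
Variables (q M m el eu : R) (p : nat -> nat) (c : nat -> R).
Hypotheses (perm : permissible_with q M m el eu p c).
Variable n : nat.
Hypothesis n2 : (2 <= n)%N.

Lemma permissible_dim : (n < p n)%N.
Proof.
have [_ _ el1 _ H] := perm; have [_ _ _ pl _] := H n n2.
have x1 : 1 < n%:R :> R by rewrite ltr1n.
rewrite -(ltr_nat R); apply: lt_trans pl.
by rewrite -[X in X < _]powRr1 ?(ltW (lt_trans ltr01 x1))//; exact: powR_gt1_mono.
Qed.

Lemma permissible_log : 2^-1 <= ln (p n)%:R :> R.
Proof.
apply: le_trans (ln2_ge R) _; rewrite ler_ln ?posrE ?ltr0n//.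
  by rewrite ler_nat (leq_trans n2)// ltnW// permissible_dim.
by apply: leq_ltn_trans permissible_dim.
Qed.

Lemma permissible_sparsity :
  c n * (ln (p n)%:R / n%:R) `^ (- (q / 2)) <= M * (n%:R `^ 2^-1 * 2 `^ (3 / 2)).
Proof.
have [M0 m0 el1 eu1 H] := perm; have [[c0 _] _ cu pl _] := H n n2.
have x1 : 1 < n%:R :> R by rewrite ltr1n.
have x0 : 0 < n%:R :> R by exact: lt_trans x1.
have lp := permissible_log; have lp0 : 0 < ln (p n)%:R :> R by exact: lt_le_trans lp.
set lg := ln _ in lp lp0 cu *.
apply: le_trans (_ : M * n%:R `^ ((1 - q) / 2) * lg `^ (- ((3 - q) / 2)) *
    (lg / n%:R) `^ (- (q / 2)) <= _); first by rewrite ler_wpM2r ?powR_ge0.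
rewrite powRM ?invr_ge0 ?(ltW lp0) ?(ltW x0)//.
have -> : n%:R^-1 `^ (- (q / 2)) = n%:R `^ (q / 2) :> R.
  by rewrite -powR_inv1 ?(ltW x0)// -powRrM mulN1r opprK.
have E1 : n%:R `^ ((1 - q) / 2) * n%:R `^ (q / 2) = n%:R `^ 2^-1 :> R.
  by rewrite -powRD ?(gt_eqF x0) ?implybT//; congr (_ `^ _); field.
have E2 : lg `^ (- ((3 - q) / 2)) * lg `^ (- (q / 2)) = lg `^ (- (3 / 2)).
  by rewrite -powRD ?(gt_eqF lp0) ?implybT//; congr (_ `^ _); field.
have -> : M * n%:R `^ ((1 - q) / 2) * lg `^ (- ((3 - q) / 2)) *
    (lg `^ (- (q / 2)) * n%:R `^ (q / 2)) =
  M * ((n%:R `^ ((1 - q) / 2) * n%:R `^ (q / 2)) * (lg `^ (- ((3 - q) / 2)) * lg `^ (- (q / 2)))).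
  by ring.
rewrite E1 E2 ler_pM2l// ler_pM2l ?powR_gt0//.
rewrite powRN -[leRHS]invrK lef_pV2 ?posrE ?invr_gt0 ?powR_gt0//.
rewrite -powRN -[X in X `^ _](invrK 2) -powR_inv1 ?invr_ge0// -powRrM mulN1r opprK.
by apply: ge0_ler_powR => //; rewrite ?nnegrE// ltW.
Qed.

End permissible_facts.

(** For [alpha < 2 / 3] the exponent [kappa] can be taken below 1/2, and then
    [p ^ (1 - kappa)] outgrows [sqrt n], whereas [c L ^ (- q / 2)] is at most
    of order [sqrt n] in every permissible set. *)
Lemma suboptimal_lt23 q alpha : 0 <= q < 1 -> 0 < alpha -> alpha < 2 / 3 ->
  ~ exists (p : nat -> nat) (c : nat -> R), permissible q p c /\
    attains_minimax_rate q c (fun n => @threshold_estimator R alpha n (p n)).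
Proof.
move=> q01 al0 a23 [p [c [[M [m [el [eu perm]]]] att]]].
have a49 : 9 * alpha ^+ 2 / 8 < 2^-1.
  have : alpha ^+ 2 < (2 / 3) ^+ 2 by rewrite ltrXn2r// ?nnegrE ltW.
  by rewrite expr_div_n; lra.
pose k := (9 * alpha ^+ 2 / 8 + 2^-1) / 2.
have k1 : 9 * alpha ^+ 2 / 8 < k by rewrite /k; lra.
have k2 : k < 2^-1 by rewrite /k; lra.
have [C C0 [n0 bnd]] := attains_bound q01 al0 k1 perm att.
have k3 : 0 < 2^-1 - k by rewrite subr_gt0.
have [M0 m0 el1 eu1 H] := perm.
have [n1 big] := @powR_unbounded R (2^-1 - k) (C * M * 2 `^ (3 / 2)) k3.
pose n := maxn (maxn n0 n1) 2.
have n0n : (n0 <= n)%N by rewrite /n !leq_max leqnn.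
have n1n : (n1 <= n)%N by rewrite /n !leq_max leqnn orbT.
have n2 : (2 <= n)%N by rewrite /n !leq_max orbT.
have := bnd n n0n; have [[c0 _] _ cu pl _] := H n n2.
have := big n n1n => {}big.
have x1 : 1 < n%:R :> R by rewrite ltr1n.
have x0 : 0 < n%:R :> R by exact: lt_trans x1.
have np : n%:R < (p n)%:R :> R by rewrite ltr_nat; exact (permissible_dim perm n2).
have p0 : 0 < (p n)%:R :> R by exact: lt_trans np.
apply/negP; rewrite -ltNge.
have cL := permissible_sparsity perm n2.
apply: le_lt_trans (ler_wpM2l (ltW C0) cL) _.
apply: le_lt_trans (_ : n%:R `^ 2^-1 * (C * M * 2 `^ (3 / 2)) < _).
  by rewrite le_eqVlt; apply/orP; left; apply/eqP; ring.
apply: lt_trans (_ : n%:R `^ 2^-1 * n%:R `^ (2^-1 - k) < _).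
  by rewrite ltr_pM2l ?powR_gt0.
rewrite -powRD ?(gt_eqF x0) ?implybT// (_ : 2^-1 + (2^-1 - k) = 1 - k); last by field.
by apply: gt0_ltr_powR => //; rewrite ?nnegrE ?(ltW x0) ?(ltW p0)//; lra.
Qed.

(** A permissible set with the smallest sparsity allowed: the rate reduces to
    [ln p / n], and exceedances at the identity matrix dominate the risk as
    soon as their expected number per row grows like a power of [p]. *)
Definition square_dim (n : nat) := (n ^ 2)%N.
Definition square_c q (n : nat) : R := (ln (n ^ 2)%N%:R / n%:R) `^ (q / 2).

Lemma square_permissible q : 0 <= q < 1 ->
  permissible_with q (6 `^ (3 / 2)) 1 (3 / 2) 3 square_dim (square_c q).
Proof.
move=> /andP[q0 q1]; split; rewrite ?powR_gt0//; [lra|lra|].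
move=> n n2.
have x1 : 1 < n%:R :> R by rewrite ltr1n.
have x0 : 0 < n%:R :> R by exact: lt_trans x1.
have pE : (square_dim n)%:R = n%:R `^ 2 :> R by rewrite powR_mulrn ?(ltW x0)// natrX.
have lE : ln (square_dim n)%:R = 2 * ln n%:R :> R by rewrite pE ln_powR.
have ln0 : 0 < ln n%:R :> R by rewrite ln_gt0.
set lg := ln (square_dim n)%:R : R.
have lg0 : 0 < lg by rewrite /lg lE mulr_gt0.
have L0 : 0 < lg / n%:R by rewrite divr_gt0.
split.
- split; first by rewrite powR_gt0.
  by move=> ->; exists 1%N; rewrite /square_c mul0r powRr0.
- by rewrite mul1r.
(* The constant 6 comes from [ln x < x] at [x = n ^ (1/3)]. *)
- have lg6 : lg <= 6 * n%:R `^ 3^-1.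
    rewrite /lg lE; have : ln (n%:R `^ 3^-1) < n%:R `^ 3^-1 :> R by rewrite ln_sublinear// powR_gt0.
    by rewrite ln_powR; lra.
  rewrite /square_c -/lg powRM ?invr_ge0 ?(ltW lg0) ?(ltW x0)//.
  rewrite -[n%:R^-1]powR_inv1 ?(ltW x0)// -powRrM mulN1r.
  have E1 : lg `^ (q / 2) = lg `^ (3 / 2) * lg `^ (- ((3 - q) / 2)).
    by rewrite -powRD ?(gt_eqF lg0) ?implybT//; congr (_ `^ _); field.
  have E2 : n%:R `^ ((1 - q) / 2) = n%:R `^ 2^-1 * n%:R `^ (- (q / 2)) :> R.
    by rewrite -powRD ?(gt_eqF x0) ?implybT//; congr (_ `^ _); field.
  rewrite E1 E2 -[leLHS]mulrA.
  have -> : 6 `^ (3 / 2) * (n%:R `^ 2^-1 * n%:R `^ (- (q / 2))) * lg `^ (- ((3 - q) / 2)) =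
    6 `^ (3 / 2) * n%:R `^ 2^-1 * (lg `^ (- ((3 - q) / 2)) * n%:R `^ (- (q / 2))) by ring.
  rewrite ler_pM2r; last by rewrite mulr_gt0// powR_gt0.
  apply: le_trans (_ : (6 * n%:R `^ 3^-1) `^ (3 / 2) <= _).
    by apply: ge0_ler_powR => //; rewrite ?nnegrE ?mulr_ge0 ?powR_ge0// ltW.
  rewrite powRM ?powR_ge0// -powRrM (_ : 3^-1 * (3 / 2) = 2^-1 :> R)//; by field.
- by rewrite pE; apply: powR_gt1_mono => //; lra.
- by rewrite pE; apply: powR_gt1_mono => //; lra.
Qed.

(** Below the critical constant [kappa] can be taken below 1, so that
    [p ^ (1 - kappa)] is unbounded. *)
Lemma suboptimal_subcritical q alpha : 0 <= q < 1 -> 0 < alpha -> alpha < 2 * Num.sqrt 2 / 3 ->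
  ~ attains_minimax_rate q (square_c q) (fun n => @threshold_estimator R alpha n (square_dim n)).
Proof.
move=> q01 al0 a23 att.
have s22 : Num.sqrt 2 ^+ 2 = 2 :> R by rewrite sqr_sqrtr.
have a1 : 9 * alpha ^+ 2 / 8 < 1.
  have : alpha ^+ 2 < (2 * Num.sqrt 2 / 3) ^+ 2.
    by rewrite ltrXn2r// ?nnegrE ?(ltW al0)// ltW// (lt_trans al0).
  by rewrite expr_div_n exprMn s22; lra.
pose k := (9 * alpha ^+ 2 / 8 + 1) / 2.
have k1 : 9 * alpha ^+ 2 / 8 < k by rewrite /k; lra.
have k2 : 0 < 1 - k by rewrite /k; lra.
have [C C0 [n0 bnd]] := attains_bound q01 al0 k1 (square_permissible q01) att.
have [n1 big] := @powR_unbounded R (1 - k) C k2.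
pose n := maxn (maxn n0 n1) 2.
have n0n : (n0 <= n)%N by rewrite /n !leq_max leqnn.
have n1n : (n1 <= n)%N by rewrite /n !leq_max leqnn orbT.
have n2 : (2 <= n)%N by rewrite /n !leq_max orbT.
have := bnd n n0n; have := big n n1n => {}big.
have x1 : 1 < n%:R :> R by rewrite ltr1n.
have x0 : 0 < n%:R :> R by exact: lt_trans x1.
have pl : n%:R <= (square_dim n)%:R :> R.
  by rewrite ler_nat /square_dim -[X in (X <= _)%N]expn1 leq_exp2l.
have L0 : 0 < ln (square_dim n)%:R / n%:R :> R.
  by rewrite divr_gt0// ln_gt0//; exact: lt_le_trans pl.
rewrite /square_c -/(square_dim n) -powRD ?(gt_eqF L0) ?implybT// subrr powRr0 mulr1.
apply/negP; rewrite -ltNge; apply: lt_le_trans big _.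
apply: ge0_ler_powR => //; [exact: ltW|exact: ltW|].
by rewrite nnegrE (le_trans (ltW x0)).
Qed.

End suboptimality.

(** * The likelihood ratio between a correlated and an independent pair *)

Section likelihood.
Variable R : realType.
Local Notation RT := (measurableTypeR R).
Local Notation RR := (RT * RT)%type.
Local Notation N := (gauss R).
Local Notation N2 := (gauss2 R).
Notation leb := (@lebesgue_measure R).
Variables (r s : R).
Hypotheses (s0 : 0 < s) (rs : r ^+ 2 + s ^+ 2 = 1).

Let c0 : R := (Num.sqrt (pi *+ 2))^-1.

Lemma normal_pdf_pos (m t x : R) : 0 < t ->
  normal_pdf m t x = c0 / t * expR (- (x - m) ^+ 2 / (2 * t ^+ 2)).
Proof.
move=> t0; rewrite normal_pdfE ?gt_eqF// /normal_peak /normal_fun.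
congr (_ * expR (_ / _)); last by rewrite mulr_natl.
rewrite -mulrnAr sqrtrM ?sqr_ge0// sqrtr_sqr gtr0_norm// invfM mulrC.
by [].
Qed.

Let expMM (a b c d : R) : a * expR b * (c * expR d) = a * c * expR (b + d).
Proof. by rewrite mulrACA -expRD. Qed.

(** The density of the normal law with mean [r z.1] and variance [s ^ 2]
    relative to the standard normal law, at [z.2]. *)
Definition lik (z : RR) : R :=
  s^-1 * expR (z.2 ^+ 2 / 2 - (z.2 - r * z.1) ^+ 2 / (2 * s ^+ 2)).

Lemma lik_gt0 z : 0 < lik z.
Proof. by rewrite mulr_gt0 ?invr_gt0// expR_gt0. Qed.

Lemma lik_pdf (u v : R) : lik (u, v) * normal_pdf 0 1 v = normal_pdf (r * u) s v.
Proof.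
rewrite !normal_pdf_pos// /lik/= expMM; congr (_ * expR _); last by field; rewrite gt_eqF.
by rewrite divr1 mulrC.
Qed.

Lemma measurable_lik : measurable_fun setT lik.
Proof.
apply: measurable_funM => //; apply: measurableT_comp => //.
apply: measurable_funB.
  by apply: measurable_funM => //; apply: measurable_funX.
apply: measurable_funM => //; apply: measurable_funX; apply: measurable_funB => //.
by apply: measurable_funM.
Qed.

(** Truncated, in order to remain among bounded functions. *)
Definition likM (M : R) z := Num.min (lik z) M.

Variable M : R.
Hypothesis M0 : 0 < M.

Lemma likM_ge0 z : 0 <= likM M z.
Proof. by rewrite le_min !ltW// lik_gt0. Qed.

Lemma bmf_likM : bounded_measurable (likM M).
Proof.
split; first by apply: measurable_minr => //; exact: measurable_lik.
by exists M => z; rewrite ger0_norm ?likM_ge0// ge_min lexx orbT.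
Qed.

Lemma likM_le (f : RR -> R) : bounded_measurable f -> (forall z, 0 <= f z) ->
  \int[N2]_z (f z * likM M z) <= \int[N2]_z f (z.1, r * z.1 + s * z.2).
Proof.
move=> bf f0.
have mrs : measurable_fun setT (fun z : RR => (z.1, r * z.1 + s * z.2) : RR).
  apply/measurable_fun_pairP; split; first exact: measurable_fst.
  by apply: measurable_funD; apply: measurable_funM.
have bf1 : bounded_measurable (fun z : RR => f (z.1, r * z.1 + s * z.2)) by exact: bmf_comp mrs bf.
have bf2 : bounded_measurable (fun z => f z * likM M z) by apply: bmfM => //; exact: bmf_likM.
rewrite (Rint_fubini1 N N bf1) (Rint_fubini1 N N bf2).
apply: Rint_le; [exact: (bmf_fubini1 N N bf2)|exact: (bmf_fubini1 N N bf1)|].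
move=> u; rewrite -lee_fin -!EFin_Rint; last 2 first.
- exact: (bmf_pairl bf1).
- exact: (bmf_pairl bf2).
have mfu : measurable_fun setT (fun v : RT => (f (u, v))%:E).
  by apply/measurable_EFinP; case: (bmf_pairl bf u).
have := @normal_affine R (r * u) s (fun v : RT => (f (u, v))%:E) (lt0r_neq0 s0) mfu
  (fun v => f0 _).
rewrite [X in _ -> (_ <= X)%E](_ : _ = (\int[N]_x (f (u, affine (r * u) s x))%:E)%E)//.
move=> <-; rewrite normal_integral//; last by move=> v; rewrite lee_fin.
rewrite gaussE normal_integral; last 2 first.
- by apply/measurable_EFinP; case: (bmf_pairl bf2 u).
- by move=> v; rewrite lee_fin mulr_ge0// likM_ge0.
apply: ge0_le_integral => //.
- by move=> v _; rewrite mule_ge0// lee_fin ?normal_pdf_ge0// mulr_ge0// likM_ge0.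
- apply: emeasurable_funM; apply/measurable_EFinP; last exact: measurable_normal_pdf.
  by case: (bmf_pairl bf2 u).
- by apply: emeasurable_funM => //; apply/measurable_EFinP; exact: measurable_normal_pdf.
move=> v _; rewrite -!EFinM lee_fin -mulrA ler_wpM2l// -lik_pdf.
by rewrite ler_wpM2r ?normal_pdf_ge0// ge_min lexx.
Qed.

Let EN2 (k : RR -> R) : measurable_fun setT k -> (forall z, 0 <= k z) ->
  (\int[N2]_z (k z)%:E = \int[N]_u \int[leb]_v (k (u, v) * normal_pdf 0 1 v)%:E)%E.
Proof.
move=> mk k0.
have mk' : measurable_fun setT (fun z => (k z)%:E) by exact/measurable_EFinP.
rewrite (@fubini_tonelli1 _ _ _ _ _ N N _ mk')//.
apply: eq_integral => u _; rewrite /fubini_F gaussE normal_integral.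
- by apply: eq_integral => v _; rewrite EFinM.
- exact: measurableT_comp mk' (pair1_measurable u).
- by move=> v; rewrite lee_fin.
Qed.

Let lik_mean : (\int[N2]_z (lik z)%:E = 1)%E.
Proof.
rewrite EN2//; [|exact: measurable_lik|by move=> z; exact: ltW (lik_gt0 z)].
transitivity (\int[N]_u (cst 1%E u))%E; last first.
  by rewrite integral_cst// mul1e; exact: probability_setT.
apply: eq_integral => u _; under eq_integral do rewrite lik_pdf.
exact: integral_normal_pdf.
Qed.

Let y : R := Num.sqrt (1 + r ^+ 2).
Let y2 : y ^+ 2 = 1 + r ^+ 2.
Proof. by rewrite sqr_sqrtr// addr_ge0 ?sqr_ge0. Qed.
Let y0 : 0 < y.
Proof. by rewrite sqrtr_gt0 ltr_pwDl ?sqr_ge0. Qed.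

Let kappa (u : R) : R := (s * y)^-1 * expR (r ^+ 2 * u ^+ 2 / y ^+ 2).

(** Completing the square in [v]. *)
Let lik_sqr_pdf (u v : R) : lik (u, v) ^+ 2 * normal_pdf 0 1 v =
  kappa u * normal_pdf (2 * r * u / y ^+ 2) (s / y) v.
Proof.
have sy : 0 < s / y by rewrite divr_gt0.
rewrite !normal_pdf_pos// /lik/= /kappa subr0 exprMn -expRM_natl.
rewrite !expMM; congr (_ * expR _).
  by move: (c0) => c; field; rewrite !gt_eqF.
have s2 : s ^+ 2 = 1 - r ^+ 2 by have := rs; lra.
have s20 : 1 - r ^+ 2 != 0 by rewrite -s2 gt_eqF// exprn_gt0.
have y20 : 1 + r ^+ 2 != 0 by rewrite -y2 gt_eqF// exprn_gt0.
rewrite expr_div_n s2 y2; field.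
by rewrite s20 y20.
Qed.

(** Completing the square in [u]; this leaves the constant [1 / (1 - r ^ 2)]
    as the second moment of the likelihood ratio. *)
Let kappa_pdf (u : R) : kappa u * normal_pdf 0 1 u = (s ^+ 2)^-1 * normal_pdf 0 (y / s) u.
Proof.
have ys : 0 < y / s by rewrite divr_gt0.
rewrite !normal_pdf_pos// /kappa subr0.
rewrite expMM [RHS]mulrA; congr (_ * expR _).
  by move: (c0) => c; field; rewrite !gt_eqF.
have s2 : s ^+ 2 = 1 - r ^+ 2 by have := rs; lra.
have s20 : 1 - r ^+ 2 != 0 by rewrite -s2 gt_eqF// exprn_gt0.
have y20 : 1 + r ^+ 2 != 0 by rewrite -y2 gt_eqF// exprn_gt0.
rewrite expr_div_n s2 y2; field.
by rewrite s20 y20.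
Qed.

Let lik_sqr : (\int[N2]_z (lik z ^+ 2)%:E = ((s ^+ 2)^-1)%:E)%E.
Proof.
rewrite EN2; last 2 first.
- by apply: measurable_funX; exact: measurable_lik.
- by move=> z; exact: sqr_ge0.
have k0 u : 0 <= kappa u by rewrite mulr_ge0 ?expR_ge0// invr_ge0 mulr_ge0 ?ltW.
transitivity (\int[N]_u (kappa u)%:E)%E.
  apply: eq_integral => u _; under eq_integral do rewrite lik_sqr_pdf EFinM.
  rewrite ge0_integralZl//; last 3 first.
  - by apply/measurable_EFinP; exact: measurable_normal_pdf.
  - by move=> v _; rewrite lee_fin normal_pdf_ge0.
  - by rewrite lee_fin.
  by rewrite integral_normal_pdf mule1.
have mk : measurable_fun setT (kappa : RT -> R).
  apply: measurable_funM => //; apply: measurableT_comp => //.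
  by apply: measurable_funM => //; apply: measurable_funM => //; exact: measurable_funX.
rewrite gaussE normal_integral; last 2 first.
- exact/measurable_EFinP.
- by move=> u; rewrite lee_fin.
under eq_integral do rewrite -EFinM kappa_pdf EFinM.
rewrite ge0_integralZl//.
- by rewrite integral_normal_pdf mule1.
- by apply/measurable_EFinP; exact: measurable_normal_pdf.
- by move=> v _; rewrite lee_fin normal_pdf_ge0.
- by rewrite lee_fin invr_ge0 sqr_ge0.
Qed.

Lemma likM_sqr : \int[N2]_z likM M z ^+ 2 <= (s ^+ 2)^-1.
Proof.
have b2 : bounded_measurable (fun z => likM M z ^+ 2) by apply: bmfX; exact: bmf_likM.
rewrite -lee_fin -EFin_Rint// -lik_sqr; apply: ge0_le_integral => //.
- by move=> z _; rewrite lee_fin sqr_ge0.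
- by apply/measurable_EFinP; case: b2.
- by apply/measurable_EFinP; apply: measurable_funX; exact: measurable_lik.
move=> z _; rewrite lee_fin lerXn2r ?nnegrE ?likM_ge0 ?(ltW (lik_gt0 z))//.
by rewrite ge_min lexx.
Qed.

(** Where the ratio exceeds [M], it exceeds [M] by at most its square over
    [M]. *)
Lemma likM_mean : 1 - (s ^+ 2)^-1 / M <= \int[N2]_z likM M z.
Proof.
rewrite lerBlDr -lee_fin EFinD -EFin_Rint; last exact: bmf_likM.
rewrite mulrC EFinM -lik_sqr -ge0_integralZl//; last 3 first.
- by apply/measurable_EFinP; apply: measurable_funX; exact: measurable_lik.
- by move=> z _; rewrite lee_fin sqr_ge0.
- by rewrite lee_fin invr_ge0 ltW.
rewrite -ge0_integralD//; last 4 first.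
- by move=> z _; rewrite lee_fin likM_ge0.
- by apply/measurable_EFinP; case: bmf_likM.
- by move=> z _; rewrite -EFinM lee_fin mulr_ge0 ?sqr_ge0// invr_ge0 ltW.
- apply/measurable_EFinP; apply: measurable_funM => //.
  by apply: measurable_funX; exact: measurable_lik.
rewrite -lik_mean; apply: ge0_le_integral => //.
- by move=> z _; rewrite lee_fin ltW// lik_gt0.
- by apply/measurable_EFinP; exact: measurable_lik.
- apply/measurable_EFinP; apply: measurable_funD; first by case: bmf_likM.
  by apply: measurable_funM => //; apply: measurable_funX; exact: measurable_lik.
move=> z _; rewrite lee_fin /likM; have l0 := lik_gt0 z.
case: (leP (lik z) M) => h; first by rewrite lerDl mulr_ge0 ?sqr_ge0// invr_ge0 ltW.
have -> : M + M^-1 * lik z ^+ 2 = lik z + ((lik z - M) ^+ 2 + lik z * M) / M.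
  by move: (lik z) => l; field; rewrite gt_eqF.
by rewrite lerDl divr_ge0 ?(ltW M0)// addr_ge0 ?sqr_ge0// mulr_ge0 ?(ltW M0)// ltW.
Qed.

End likelihood.

(** * Gaussian vectors attached to graphs *)

Section three_gaussians.
Variable R : realType.
Local Notation RT := (measurableTypeR R).
Local Notation RR := (RT * RT)%type.
Local Notation N := (gauss R).
Local Notation N2 := (gauss2 R).

(** Both sides are Gaussian with variances [a + d], [b + d] and covariance
    [d]. *)
Lemma Rint_common_factor (a b d : R) (H : RR -> R) : 0 < a -> 0 < b -> 0 < d ->
  bounded_measurable H ->
  let r := d / (Num.sqrt (a + d) * Num.sqrt (b + d)) in
  \int[N]_t \int[N]_t' \int[N]_v
     H (Num.sqrt a * t + Num.sqrt d * v, Num.sqrt b * t' + Num.sqrt d * v) =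
  \int[N2]_z H (Num.sqrt (a + d) * z.1,
     Num.sqrt (b + d) * (r * z.1 + Num.sqrt (1 - r ^+ 2) * z.2)).
Proof.
move=> a0 b0 d0 bH r.
(* Rows: the two variables; columns: their private noises and the common
   factor. *)
pose coef (i : 'I_2) (l : 'I_3) : R :=
  if l == 2%N :> nat then Num.sqrt d else if i == l :> nat then
     (if i == 0%N :> nat then Num.sqrt a else Num.sqrt b) else 0.
pose B : 'M[R]_(2, 3) := \matrix_(i, l) coef i l.
have mS := multinormal_gauss_image B.
have sq x : 0 < x -> Num.sqrt x * Num.sqrt x = x :> R by move=> x0; rewrite -expr2 sqr_sqrtr// ltW.
have S00 : (B *m B^T) ord0 ord0 = a + d.
  by rewrite mxE !big_ord_recl big_ord0 !mxE /coef/= mul0r add0r addr0 !sq.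
have S11 : (B *m B^T) ord_max ord_max = b + d.
  by rewrite mxE !big_ord_recl big_ord0 !mxE /coef/= mul0r add0r addr0 !sq.
have S01 : (B *m B^T) ord0 ord_max = d.
  by rewrite mxE !big_ord_recl big_ord0 !mxE /coef/= mul0r mulr0 !add0r addr0 !sq.
have Spos i : 0 < (B *m B^T) i i.
  have [->|->] : i = ord0 \/ i = ord_max.
    by case: i => -[|[|//]] ?; [left|right]; apply: val_inj.
  - by rewrite S00 addr_gt0.
  - by rewrite S11 addr_gt0.
have pl := pair_law mS Spos ord0 ord_max.
set cm := corr_map _ _ _ _ _ in pl.
have mcm : measurable_fun setT cm := measurable_corr_map _ _ _ _ _.
pose phi (x : 2.-tuple RT) : RR := (tnth x ord0, tnth x ord_max).
have mphi : measurable_fun setT phi by apply/measurable_fun_pairP; split; exact: measurable_tnth.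
pose cmM : {mfun RR >-> RR} := HB.pack cm (isMeasurableFun.Build _ _ _ _ _ mcm).
have E1 : \int[distribution N2 cmM]_z H z = \int[gauss_image B]_x H (phi x).
  by apply: Rint_push bH => // A mA; rewrite /= -pl.
have E2 : \int[distribution N2 cmM]_z H z = \int[N2]_z H (cm z).
  by apply: Rint_push bH.
transitivity (\int[gauss_image B]_x H (phi x)); last first.
  rewrite -E1 E2; apply: eq_Rintegral => z _; congr H; rewrite /cm /corr_map.
  have rE : corrmx (B *m B^T) ord0 ord_max = r by rewrite mxE S00 S11 S01.
  have z0 i : (0 : 'cV[R]_2) i 0 = 0 by rewrite mxE.
  by rewrite rE S00 S11 !z0 !add0r.
have bHp : bounded_measurable (fun x => H (phi x)) by exact: bmf_comp mphi bH.
rewrite (Rint_gauss_image B bHp).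
have bHl : bounded_measurable (fun w : 3.-tuple RT => H (phi (linmap B w))).
  exact: bmf_comp (measurable_linmap B) bHp.
rewrite (Rint_power_cons N bHl); apply: eq_Rintegral => t _.
have b1 := bmf_comp (pair1_measurable t) (bmf_comp (@measurable_cons_pair _ _ _) bHl).
rewrite (Rint_power_cons N b1); apply: eq_Rintegral => t' _.
have b2 := bmf_comp (pair1_measurable t') (bmf_comp (@measurable_cons_pair _ _ _) b1).
rewrite (Rint_power_cons N b2); apply: eq_Rintegral => v _.
rewrite -[LHS](Rint_cst (power_prob N 0)); apply: eq_Rintegral => x _; congr H.
rewrite /phi !tnth_mktuple !big_ord_recl !big_ord0 !mxE /coef/= !mul0r !add0r !addr0.
by [].
Qed.

End three_gaussians.

Section graph_law.
Variables (R : realType) (p : nat).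
Local Notation RT := (measurableTypeR R).
Local Notation RR := (RT * RT)%type.
Local Notation N := (gauss R).
Local Notation N2 := (gauss2 R).
Local Notation E := ('I_p * 'I_p)%type.
Implicit Types (A : {set E}) (e : E) (i j l : 'I_p).

Definition touches e i := (e.1 == i) || (e.2 == i).
Definition edges : {set E} := [set e : E | (e.1 < e.2)%N]%SET.
Definition deg A i := #|[set e in A | touches e i]%SET|.
Definition bounded_degree K : {set {set E}} :=
  [set A : {set E} | (A \subset edges) && [forall i, (deg A i <= K)%N]]%SET.

Variables (d : R) (K : nat).
Hypotheses (d0 : 0 < d) (Kd : K%:R * d <= 2^-1).

Local Notation m := (p + #|{: E}|)%N.

(** A factor model: every edge carries a Gaussian variable that enters both of
    its end points with variance [d], and private noise at each vertex
    completes the variance to 1. The covariance is the identity plus [d] times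
    the adjacency matrix; no positivity has to be checked by other means. *)
Definition load A : 'M[R]_(p, m) :=
  row_mx (diag_mx (\row_i Num.sqrt (1 - (deg A i)%:R * d)))
    (\matrix_(i, k) (Num.sqrt d * ((enum_val k \in A) && touches (enum_val k) i)%:R)).

Lemma deg_le A i : A \in bounded_degree K -> (deg A i)%:R * d <= 2^-1.
Proof.
rewrite inE => /andP[_ /forallP /(_ i) h].
by apply: le_trans Kd; rewrite ler_pM2r// ler_nat.
Qed.

Lemma load_cov A i j : A \in bounded_degree K ->
  (load A *m (load A)^T) i j =
  if i == j then 1 else d * (((i, j) \in A) || ((j, i) \in A))%:R.
Proof.
move=> Aa; have AE : A \subset edges by move: Aa; rewrite inE => /andP[].
rewrite /load tr_row_mx mul_row_col mxE tr_diag_mx mulmx_diag !mxE.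
have -> : \sum_k (\matrix_(i, k) (Num.sqrt d * ((enum_val k \in A) && touches (enum_val k) i)%:R) : 'M[R]_(p, #|{: E}|)) i k *
   ((\matrix_(i, k) (Num.sqrt d * ((enum_val k \in A) && touches (enum_val k) i)%:R))^T : 'M[R]_(#|{: E}|, p)) k j =
   d * (\sum_(e in A) (touches e i && touches e j))%N%:R.
  rewrite natr_sum mulr_sumr [RHS]big_mkcond /= [RHS](reindex _ (onW_bij _ (@enum_val_bij E)))/=.
  apply: eq_bigr => k _; rewrite !mxE; case: (enum_val k \in A) => /=; last by rewrite mulr0 mul0r.
  rewrite mulrACA -expr2 sqr_sqrtr ?(ltW d0)//; congr (_ * _).
  by case: touches; case: touches; rewrite /= ?mulr0 ?mul0r ?mulr1.
have [<-|ij] := eqVneq i j.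
  rewrite mulr1n -expr2 sqr_sqrtr; last by have := deg_le i Aa; lra.
  rewrite (_ : (\sum_(e in A) _)%N = deg A i); first by rewrite [d * _]mulrC subrK.
  rewrite /deg -sum1_card [RHS]big_mkcond [LHS]big_mkcond/=; apply: eq_bigr => e _.
  by rewrite inE andbb; case: (e \in A) => //=; case: touches.
rewrite mulr0n add0r; congr (_ * _%:R).
have key e : e \in A -> (touches e i && touches e j : nat) = ((e == (i, j)) + (e == (j, i)))%N.
  move=> eA; case: e eA => x y eA; rewrite /touches/= !xpair_eqE.
  have xy : x != y.
    by move/fintype.subsetP: AE => /(_ _ eA); rewrite inE/= => h; apply: contraTneq h => ->; rewrite ltnn.
  have [xi|xi] := eqVneq x i; have [yi|yi] := eqVneq y i; have [xj|xj] := eqVneq x j; have [yj|yj] := eqVneq y j => //=;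
  by exfalso; move: xy ij; rewrite ?xi ?yi ?xj ?yj -?xi -?yi -?xj -?yj ?eqxx.
rewrite (eq_bigr _ key) big_split/=.
have one e : (\sum_(f in A) (f == e) = (e \in A))%N.
  rewrite big_mkcond/= (bigD1 e)//= eqxx big1 ?addn0; first by case: (e \in A).
  by move=> f /negPf ->; case: ifP.
rewrite !one; case ijA : ((i, j) \in A); case jiA : ((j, i) \in A) => //.
move/fintype.subsetP: AE => AE; have := AE _ ijA; have := AE _ jiA; rewrite !inE/= => h1 h2.
by have := ltn_trans h1 h2; rewrite ltnn.
Qed.

Lemma load_linmap A (w : m.-tuple RT) i :
  tnth (linmap (load A) w) i = Num.sqrt (1 - (deg A i)%:R * d) * tnth w (lshift _ i) +
    Num.sqrt d * \sum_(k | (enum_val k \in A) && touches (enum_val k) i) tnth w (rshift p k) :> R.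
Proof.
rewrite tnth_mktuple big_split_ord/=; congr (_ + _).
  rewrite (bigD1 i)//= row_mxEl !mxE eqxx mulr1n big1 ?addr0// => j ji.
  by rewrite row_mxEl !mxE eq_sym (negPf ji) mulr0n mul0r.
rewrite mulr_sumr [RHS]big_mkcond/=; apply: eq_bigr => k _.
by rewrite row_mxEr mxE; case: (_ && _); rewrite /= ?mulr1// mulr0 mul0r.
Qed.

Section edge_removal.
Variables (A : {set E}) (e : E).
Hypotheses (Aa : A \in bounded_degree K) (eA : e \in A).
Local Notation A0 := (A :\ e).
Local Notation W := (power_prob N m).

Lemma edge_neq : e.1 != e.2.
Proof.
move: Aa; rewrite inE => /andP[/fintype.subsetP /(_ _ eA) + _]; rewrite inE => h.
by apply: contraTneq h => ->; rewrite ltnn.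
Qed.

Lemma deg_del i : deg A i = (deg A0 i + touches e i)%N.
Proof.
rewrite /deg (cardsD1 e) inE eA /= addnC; congr (_ + _)%N.
by apply: eq_card => f; rewrite !inE andbA.
Qed.

Lemma bounded_degree_del : A0 \in bounded_degree K.
Proof.
move: Aa; rewrite !inE => /andP[AE /forallP h]; apply/andP; split.
  by apply: fintype.subset_trans AE; exact: subD1set.
by apply/forallP => i; apply: leq_trans (h i); rewrite deg_del leq_addr.
Qed.

Let noise i (w : m.-tuple RT) : R :=
  Num.sqrt d * \sum_(k | (enum_val k \in A0) && touches (enum_val k) i) tnth w (rshift p k).

(** The models with and without the edge [e] as one function of the factors of
    the other edges and of a pair of variables located at the end points of
    [e]: the pair is correlated in one model and independent in the other. *)
Definition resample (z : m.-tuple RT * RR) : p.-tuple RT :=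
  [tuple if l == e.1 then noise l z.1 + z.2.1 else if l == e.2 then noise l z.1 + z.2.2
         else tnth (linmap (load A0) z.1) l | l < p].

Let mnoise i : measurable_fun setT (noise i : m.-tuple RT -> RT).
Proof.
apply: measurable_funM => //; under eq_fun do rewrite big_mkcond.
apply: measurable_sum => k; case: (_ && _) => //; exact: measurable_tnth.
Qed.

Lemma tnth_resample z l : tnth (resample z) l = if l == e.1 then noise l z.1 + z.2.1
  else if l == e.2 then noise l z.1 + z.2.2 else tnth (linmap (load A0) z.1) l.
Proof. by rewrite tnth_mktuple. Qed.

Lemma measurable_resample : measurable_fun setT resample.
Proof.
apply/measurable_fun_tnthP => l.
rewrite (_ : _ \o _ = fun z : m.-tuple RT * RR => if l == e.1 then noise l z.1 + z.2.1
  else if l == e.2 then noise l z.1 + z.2.2 else tnth (linmap (load A0) z.1) l); last first.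
  by apply/funext => z /=; rewrite tnth_resample.
case: (l == e.1); [|case: (l == e.2)].
- apply: measurable_funD; first exact: (measurableT_comp (mnoise l) measurable_fst).
  exact: (measurableT_comp measurable_fst measurable_snd).
- apply: measurable_funD; first exact: (measurableT_comp (mnoise l) measurable_fst).
  exact: (measurableT_comp measurable_snd measurable_snd).
- have := measurableT_comp (measurable_tnth l) (measurableT_comp (measurable_linmap (load A0)) measurable_fst).
  exact.
Qed.

Let a : R := 1 - (deg A e.1)%:R * d.
Let b : R := 1 - (deg A e.2)%:R * d.

Let a_ge : 2^-1 <= a. Proof. by have := deg_le e.1 Aa; rewrite /a; lra. Qed.
Let b_ge : 2^-1 <= b. Proof. by have := deg_le e.2 Aa; rewrite /b; lra. Qed.

Let adE : 1 - (deg A0 e.1)%:R * d = a + d.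
Proof. by rewrite /a deg_del /touches eqxx/= natrD; ring. Qed.
Let bdE : 1 - (deg A0 e.2)%:R * d = b + d.
Proof. by rewrite /b deg_del /touches eqxx orbT/= natrD; ring. Qed.

Let li := lshift #|{: E}| e.1.
Let lj := lshift #|{: E}| e.2.
Let rk : 'I_m := rshift p (enum_rank e).

Lemma resample_del (w : m.-tuple RT) t t' :
  linmap (load A0) (set_coord (set_coord w li t) lj t') =
  resample (w, (Num.sqrt (a + d) * t, Num.sqrt (b + d) * t')).
Proof.
apply: eq_from_tnth => l; rewrite load_linmap tnth_resample /=.
have -> : \sum_(k | (enum_val k \in A0) && touches (enum_val k) l)
    tnth (set_coord (set_coord w li t) lj t') (rshift p k) =
  \sum_(k | (enum_val k \in A0) && touches (enum_val k) l) tnth w (rshift p k) :> R.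
  by apply: eq_bigr => k _; rewrite !tnth_set_coord !eq_rlshift.
rewrite !tnth_set_coord !eq_lshift.
have [->|l1] := eqVneq l e.1.
  by rewrite (negPf edge_neq) adE addrC.
have [->|l2] := eqVneq l e.2; first by rewrite bdE addrC.
by rewrite load_linmap.
Qed.

Lemma resample_add (w : m.-tuple RT) t t' v :
  linmap (load A) (set_coord (set_coord (set_coord w li t) lj t') rk v) =
  resample (w, (Num.sqrt a * t + Num.sqrt d * v, Num.sqrt b * t' + Num.sqrt d * v)).
Proof.
apply: eq_from_tnth => l; rewrite load_linmap tnth_resample /=.
have -> : \sum_(k | (enum_val k \in A) && touches (enum_val k) l)
    tnth (set_coord (set_coord (set_coord w li t) lj t') rk v) (rshift p k) =
  (touches e l)%:R * v +
  \sum_(k | (enum_val k \in A0) && touches (enum_val k) l) tnth w (rshift p k) :> R.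
  rewrite big_mkcond/= (bigD1 (enum_rank e))//= enum_rankK eA/=; congr (_ + _).
    rewrite tnth_set_coord eqxx; case: touches; rewrite ?mul1r ?mul0r//.
  rewrite [RHS]big_mkcond [RHS](bigD1 (enum_rank e))//= enum_rankK !inE eqxx/= add0r.
  apply: eq_bigr => k ke; rewrite !inE -(can_eq (@enum_valK E)) enum_rankK in ke *.
  rewrite ke/=; case: ifP => // _; rewrite !tnth_set_coord !eq_rlshift eq_rshift.
  by rewrite -(can_eq (@enum_valK E)) enum_rankK (negPf ke).
rewrite !tnth_set_coord !eq_lrshift !eq_lshift mulrDr /noise.
have [->|l1] := eqVneq l e.1.
  by rewrite (negPf edge_neq) /touches eqxx/= mul1r; ring.
have [->|l2] := eqVneq l e.2.
  by rewrite /touches eqxx orbT/= mul1r; ring.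
have tl : touches e l = false by rewrite /touches eq_sym (negPf l1) eq_sym (negPf l2).
by rewrite load_linmap tl mul0r mulr0 add0r deg_del tl addn0.
Qed.

Let iW : iid N W. Proof. exact: iid_power. Qed.

Let bset k (f : m.-tuple RT -> R) : bounded_measurable f ->
  bounded_measurable (fun w => \int[N]_t f (set_coord w k t)).
Proof.
move=> bf; have bz : bounded_measurable (fun z : m.-tuple RT * RT => f (set_coord z.1 k z.2)).
  exact: bmf_comp (measurable_set_coord k) bf.
exact: (bmf_fubini1 W N bz).
Qed.

(** The correlation that the edge [e] gives to the noise at its end points. *)
Definition edge_corr : R := d / (Num.sqrt (a + d) * Num.sqrt (b + d)).
Local Notation r := edge_corr.

Definition scaled_resample (z : m.-tuple RT * RR) : p.-tuple RT :=
  resample (z.1, (Num.sqrt (a + d) * z.2.1, Num.sqrt (b + d) * z.2.2)).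

Lemma measurable_scaled_resample : measurable_fun setT scaled_resample.
Proof.
apply: (measurableT_comp measurable_resample); apply/measurable_fun_pairP; split; first exact: measurable_fst.
apply/measurable_fun_pairP; split; apply: measurable_funM => //.
- exact: (measurableT_comp measurable_fst measurable_snd).
- exact: (measurableT_comp measurable_snd measurable_snd).
Qed.

Local Notation mu := ((W \x N2)%E : probability (m.-tuple RT * RR)%type R).

Lemma law_del h : bounded_measurable h ->
  \int[gauss_image (load A0)]_x h x = \int[mu]_z h (scaled_resample z).
Proof.
move=> bh; have bhl := bmf_comp (measurable_linmap (load A0)) bh.
have bhs := bmf_comp measurable_scaled_resample bh.
rewrite (Rint_gauss_image _ bh) (Rint_fubini1 W N2 bhs).
rewrite (Rint_set_coord iW lj bhl) (Rint_set_coord iW li (bset lj bhl)).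
apply: eq_Rintegral => w _; have bw := bmf_pairl bhs w.
rewrite (Rint_fubini1 N N bw).
by apply: eq_Rintegral => t _; apply: eq_Rintegral => t' _; rewrite resample_del.
Qed.

Lemma edge_corr_bounds : 0 <= r ^+ 2 <= 4 * d ^+ 2.
Proof.
have h1 : 2^-1 <= a + d by have := a_ge; have := d0; lra.
have h2 : 2^-1 <= b + d by have := b_ge; have := d0; lra.
have h10 : 0 < a + d by lra.
have h20 : 0 < b + d by lra.
rewrite sqr_ge0/= /r expr_div_n exprMn !sqr_sqrtr ?(ltW h10) ?(ltW h20)//.
rewrite ler_pdivrMr ?mulr_gt0//.
rewrite mulrAC ler_peMl ?sqr_ge0//.
have : 2^-1 * 2^-1 <= (a + d) * (b + d) by apply: ler_pM.
lra.
Qed.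

(** Conditionally on the other factors, the pair at the end points of [e] has
    correlation [r], so its density is at least the truncated likelihood
    ratio. *)
Lemma law_add h (M : R) : bounded_measurable h -> (forall x, 0 <= h x) -> 0 < M -> r ^+ 2 < 1 ->
  \int[mu]_z (h (scaled_resample z) * likM r (Num.sqrt (1 - r ^+ 2)) M z.2) <=
  \int[gauss_image (load A)]_x h x.
Proof.
move=> bh h0 M0 r1; have bhl := bmf_comp (measurable_linmap (load A)) bh.
set s := Num.sqrt _.
have s0 : 0 < s by rewrite sqrtr_gt0 subr_gt0.
have rs : r ^+ 2 + s ^+ 2 = 1 by rewrite sqr_sqrtr ?subr_ge0 ?(ltW r1)// addrC subrK.
have bhs := bmf_comp measurable_scaled_resample bh.
have bl := bmf_likM r s0 M0.
have bI : bounded_measurable (fun z : m.-tuple RT * RR =>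
    h (scaled_resample z) * likM r s M z.2).
  by apply: bmfM => //; exact: (bmf_comp measurable_snd bl).
rewrite (Rint_gauss_image _ bh) (Rint_fubini1 W N2 bI).
have b1 := bset rk bhl; have b2 := bset lj b1; have b3 := bset li b2.
rewrite (Rint_set_coord iW rk bhl) (Rint_set_coord iW lj b1) (Rint_set_coord iW li b2).
apply: Rint_le => //; first exact: (bmf_fubini1 W N2 bI).
move=> w.
pose H (z : RR) := h (resample (w, z)).
have bH : bounded_measurable H.
  apply: (bmf_comp _ bh); exact: (measurableT_comp measurable_resample (pair1_measurable w)).
have ap : 0 < a by have := a_ge; lra.
have bp : 0 < b by have := b_ge; lra.
apply: le_trans (_ : \int[N]_t \int[N]_t' \int[N]_v
     H (Num.sqrt a * t + Num.sqrt d * v, Num.sqrt b * t' + Num.sqrt d * v) <= _); last first.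
  rewrite le_eqVlt; apply/orP; left; apply/eqP.
  apply: eq_Rintegral => t _; apply: eq_Rintegral => t' _; apply: eq_Rintegral => v _.
  by rewrite resample_add.
rewrite (Rint_common_factor ap bp d0 bH) -/r -/s.
have bS : bounded_measurable (fun z : RR => H (Num.sqrt (a + d) * z.1, Num.sqrt (b + d) * z.2)).
  apply: (bmf_comp _ bH); apply/measurable_fun_pairP; split; apply: measurable_funM => //.
have := likM_le r s0 M0 bS (fun z => h0 _).
by [].
Qed.

End edge_removal.

End graph_law.

(** * Testing for the presence of one edge *)

Section two_points.
Variables (R : realType) (p : nat).
Local Notation RT := (measurableTypeR R).
Local Notation RR := (RT * RT)%type.
Local Notation N := (gauss R).
Local Notation N2 := (gauss2 R).
Local Notation E := ('I_p * 'I_p)%type.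

Let quarter (u v : R) : 2^-1 <= u -> v <= 4^-1 -> 4^-1 <= u - v.
Proof. lra. Qed.

Let pos_of_8 (u : R) : 0 <= u -> 8 * u <= 1 -> 0 < 1 - 4 * u.
Proof. lra. Qed.

Let half_of_half : 1 - 2^-1 = 2^-1 :> R.
Proof. lra. Qed.

Variables (d : R) (K : nat) (A : {set E}) (e : E).
Hypotheses (d0 : 0 < d) (Kd : K%:R * d <= 2^-1) (d8 : 8 * d ^+ 2 <= 1).
Hypotheses (Aa : A \in bounded_degree p K) (eA : e \in A).

(** A Bayes estimate with weight 1 on the absence of [e] and [z] on its
    presence. For a likelihood ratio [k], completing the square gives
    [y ^ 2 + z k (y - d) ^ 2 >= z d ^ 2 (k - z k ^ 2)]. The mean of the ratio
    of the sample is about 1 and its second moment is at most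
    [(1 - 4 d ^ 2) ^ (- n)], so the presence of an edge cannot be decided while
    [z] times this second moment is small. *)
Lemma two_point_risk n (z : R) (x : n.-tuple (p.-tuple RT) -> R) :
  (0 < n)%N -> 0 < z -> z * (1 - 4 * d ^+ 2)^-1 ^+ n <= 4^-1 ->
  bounded_measurable x ->
  z * d ^+ 2 / 4 <= \int[power_prob (gauss_image (load d (A :\ e)%SET)) n]_y x y ^+ 2 +
    z * \int[power_prob (gauss_image (load d A)) n]_y (x y - d) ^+ 2.
Proof.
move=> n0 z0 zD bx.
set r := edge_corr d A e; pose s := Num.sqrt (1 - r ^+ 2).
have /andP[r0 r4] : 0 <= r ^+ 2 <= 4 * d ^+ 2 := edge_corr_bounds d0 Kd e Aa.
have r1 : r ^+ 2 < 1 by move: r4 d8; move: (r ^+ 2) (d ^+ 2) => *; lra.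
have s2 : s ^+ 2 = 1 - r ^+ 2 by rewrite sqr_sqrtr// subr_ge0 ltW.
have s0 : 0 < s by rewrite sqrtr_gt0 subr_gt0.
have rs : r ^+ 2 + s ^+ 2 = 1 by rewrite s2 addrC subrK.
have s20 : 0 < s ^+ 2 by rewrite exprn_gt0.
have nn0 : 0 < n%:R :> R by rewrite ltr0n.
(* Truncation at [M] costs each factor at most [1 / (2 n)] of its mean. *)
pose M : R := 2 * n%:R * s ^- 2.
have M0 : 0 < M by rewrite !mulr_gt0// invr_gt0.
pose lk (w : RR) := likM r s M w.
have bl : bounded_measurable lk := bmf_likM r s0 M0.
set mu := ((power_prob N (p + #|{: E}|) \x N2)%E : probability _ R).
pose phi := scaled_resample d A e.
have mphi : measurable_fun setT phi := measurable_scaled_resample d A e.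
pose g (w : (p + #|{: E}|).-tuple RT * RR) := lk w.2.
have bg : bounded_measurable g by exact: (bmf_comp measurable_snd bl).
have g0 w : 0 <= g w by exact: likM_ge0.
pose V (w : n.-tuple ((p + #|{: E}|).-tuple RT * RR)) := [tuple phi (tnth w k) | k < n].
have mV : measurable_fun setT V := @measurable_map_tnth _ _ _ _ n _ mphi.
pose Y w := x (V w); pose G (w : n.-tuple ((p + #|{: E}|).-tuple RT * RR)) := \prod_k g (tnth w k).
have bY : bounded_measurable Y by exact: bmf_comp mV bx.
have bG : bounded_measurable G := bmf_lik bg n.
have b1 : bounded_measurable (fun y => x y ^+ 2) by exact: bmfX.
have b2 : bounded_measurable (fun y => (x y - d) ^+ 2).
  by apply: bmfX; apply: bmfB => //; exact: bmf_cst.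
have L1 : \int[power_prob mu n]_w (Y w ^+ 2) <=
    \int[power_prob (gauss_image (load d (A :\ e)%SET)) n]_y x y ^+ 2.
  have H h : bounded_measurable h -> (forall u, 0 <= h u) ->
     \int[mu]_t (h (phi t) * (1 : R)) <= \int[gauss_image (load d (A :\ e)%SET)]_u h u.
    move=> bh _; rewrite (law_del d Aa eA bh) le_eqVlt; apply/orP; left; apply/eqP.
    by apply: eq_Rintegral => t _; rewrite mulr1.
  have := power_change mphi (bmf_cst _ 1) (fun=> ler01) H b1 (fun y => sqr_ge0 _).
  apply: le_trans; rewrite le_eqVlt; apply/orP; left; apply/eqP.
  by apply: eq_Rintegral => w _; rewrite big1 ?mulr1.
have L2 : \int[power_prob mu n]_w ((Y w - d) ^+ 2 * G w) <=
    \int[power_prob (gauss_image (load d A)) n]_y (x y - d) ^+ 2.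
  apply: (power_change mphi bg g0 _ b2 (fun y => sqr_ge0 _)) => h bh h0.
  exact: (law_add d0 Kd Aa eA bh h0 M0 r1).
have Eg (f : RR -> R) : bounded_measurable f -> \int[mu]_w f w.2 = \int[N2]_y f y.
  move=> bf; have bf2 : bounded_measurable (fun w : (p + #|{: E}|).-tuple RT * RR => f w.2) by exact: (bmf_comp measurable_snd bf).
  rewrite (Rint_fubini1 (power_prob N (p + #|{: E}|)) N2 bf2).
  by rewrite -[RHS](Rint_cst (power_prob N (p + #|{: E}|))).
have EG : \int[power_prob mu n]_w G w = (\int[N2]_y lk y) ^+ n.
  rewrite (@Rint_prod_coord _ _ _ n mu _ (fun=> g) (@iid_power _ _ _ mu n))//.
  by rewrite prodr_const card_ord (Eg lk bl).
have bl2 : bounded_measurable (fun y => lk y ^+ 2) by exact: bmfX.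
have EG2 : \int[power_prob mu n]_w (G w ^+ 2) = (\int[N2]_y lk y ^+ 2) ^+ n.
  have -> : \int[power_prob mu n]_w (G w ^+ 2) = \int[power_prob mu n]_w \prod_k (g (tnth w k) ^+ 2).
    by apply: eq_Rintegral => w _; rewrite prodrXl.
  rewrite (@Rint_prod_coord _ _ _ n mu _ (fun _ w => g w ^+ 2) (@iid_power _ _ _ mu n))//; last first.
    by move=> _; exact: bmfX.
  by rewrite prodr_const card_ord (Eg _ bl2).
have EGge : 2^-1 <= \int[power_prob mu n]_w G w.
  rewrite EG; have := likM_mean s0 rs M0; rewrite -/lk.
  have -> : s ^- 2 / M = (2 * n%:R)^-1 by rewrite /M; field; rewrite !gt_eqF.
  set q := (2 * n%:R)^-1 => h.
  have q0 : 0 <= q by rewrite invr_ge0 mulr_ge0.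
  have q1 : q <= 1.
    by rewrite invf_le1 ?mulr_gt0// -natrM ler1n muln_gt0.
  apply: le_trans (_ : (1 - q) ^+ n <= _).
    apply: le_trans (bernoulli_ge n _); last by rewrite q0 q1.
    rewrite (_ : n%:R * q = 2^-1); first by rewrite half_of_half.
    by rewrite /q; field; rewrite gt_eqF.
  by rewrite lerXn2r ?nnegrE ?subr_ge0//; apply: Rint_ge0 => y; exact: likM_ge0.
have EG2le : z * \int[power_prob mu n]_w (G w ^+ 2) <= 4^-1.
  apply: le_trans zD; rewrite ler_pM2l// EG2.
  have D0 : 0 < 1 - 4 * d ^+ 2 by apply: pos_of_8 => //; exact: sqr_ge0.
  rewrite lerXn2r ?nnegrE ?invr_ge0 ?(ltW D0)//; first by apply: Rint_ge0 => y; exact: sqr_ge0.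
  apply: le_trans (likM_sqr s0 rs M0) _.
  by rewrite lef_pV2 ?posrE// s2 lerD2l lerN2.
apply: le_trans (lerD L1 (ler_wpM2l (ltW z0) L2)).
have bYG : bounded_measurable (fun w => (Y w - d) ^+ 2 * G w).
  by apply: bmfM => //; apply: bmfX; apply: bmfB => //; exact: bmf_cst.
have bY2 : bounded_measurable (fun w => Y w ^+ 2) by exact: bmfX.
have bG2 : bounded_measurable (fun w => G w ^+ 2) by exact: bmfX.
rewrite -(RintZ _ _ bYG) -RintD//; last exact: bmfZ.
apply: le_trans (_ : \int[power_prob mu n]_w (z * d ^+ 2 * G w - z * d ^+ 2 * z * G w ^+ 2) <= _).
  rewrite RintB; [|exact: bmfZ|exact: bmfZ].
  rewrite !RintZ//; move: EGge EG2le; set I1 := \int[_]_w G w; set I2 := \int[_]_w (G w ^+ 2).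
  move=> h1 h2; have -> : z * d ^+ 2 * I1 - z * d ^+ 2 * z * I2 = z * d ^+ 2 * (I1 - z * I2) by ring.
  have zd : 0 <= z * d ^+ 2 by rewrite mulr_ge0 ?sqr_ge0// ltW.
  by apply: ler_wpM2l => //; exact: quarter.
apply: Rint_le.
- by apply: bmfB; exact: bmfZ.
- by apply: bmfD => //; exact: bmfZ.
move=> w; have G0 : 0 <= G w by apply: prodr_ge0 => k _.
move: (Y w) (G w) G0 => y k k0; rewrite -subr_ge0.
have -> : y ^+ 2 + z * ((y - d) ^+ 2 * k) - (z * d ^+ 2 * k - z * d ^+ 2 * z * k ^+ 2) =
  (y - z * k * d) ^+ 2 + z * k * y ^+ 2 by ring.
by rewrite addr_ge0 ?sqr_ge0// mulr_ge0 ?sqr_ge0// mulr_ge0// ltW.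
Qed.

End two_points.

(** * A random graph with many edges *)

Section edge_counting.
Variables (R : realFieldType) (p K : nat).
Local Notation E := ('I_p * 'I_p)%type.
Local Notation U := (edges p).
Local Notation GG := (bounded_degree p K).
Implicit Types (A : {set E}) (e : E).

(** Edges that can be added without exceeding the degree bound. Only edges that
    meet a vertex of full degree are excluded, and a graph with few edges has
    few such vertices. *)
Definition extensions A : {set E} := [set e : E | (e \notin A) && (e |: A \in GG)]%SET.
Definition saturated A : {set 'I_p} := [set i | deg A i == K]%SET.

Lemma deg_set1U e A i : e \notin A -> deg (e |: A) i = (deg A i + touches e i)%N.
Proof.
move=> eA; rewrite /deg (cardsD1 e) !inE eqxx /= addnC; congr (_ + _)%N.
apply: eq_card => f; rewrite !inE; have [->|fe] := eqVneq f e; last by rewrite orFb.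
by rewrite (negPf eA).
Qed.

Lemma sum_deg A : (\sum_i deg A i <= 2 * #|A|)%N.
Proof.
rewrite (eq_bigr (fun i => \sum_(e in A) touches e i)%N); last first.
  move=> i _; rewrite /deg -sum1_card big_mkcond [RHS]big_mkcond; apply: eq_bigr => e _.
  by rewrite inE; case: (e \in A) => //=; case: touches.
rewrite exchange_big mulnC -sum_nat_const; apply: leq_sum => e _.
apply: leq_trans (_ : \sum_i ((e.1 == i) + (e.2 == i)) <= _)%N.
  by apply: leq_sum => i _; rewrite /touches; case: (e.1 == i); case: (e.2 == i).
rewrite big_split/= (bigD1 e.1)//= eqxx big1 ?addn0; last by move=> i /negPf; rewrite eq_sym => ->.
by rewrite (bigD1 e.2)//= eqxx big1 ?addn0// => i /negPf; rewrite eq_sym => ->.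
Qed.

Lemma extensions_count A : A \in GG ->
  (#|U| <= #|A| + #|extensions A| + 2 * (p * #|saturated A|))%N.
Proof.
move=> AG.
have c1 : #|[set e : E | e.1 \in saturated A]%SET| = (p * #|saturated A|)%N.
  transitivity #|finset.setX (saturated A) [set: 'I_p]%SET|; last by rewrite cardsX cardsT card_ord mulnC.
  by apply: eq_card => e; rewrite !inE andbT.
have c2 : #|[set e : E | e.2 \in saturated A]%SET| = (p * #|saturated A|)%N.
  transitivity #|finset.setX [set: 'I_p]%SET (saturated A)|; last by rewrite cardsX cardsT card_ord.
  by apply: eq_card => e; rewrite !inE.
have sub : U \subset A :|: extensions A :|: ([set e : E | e.1 \in saturated A]%SET
    :|: [set e : E | e.2 \in saturated A]%SET).
  apply/fintype.subsetP => e eU; rewrite !inE; have [//|eA/=] := boolP (e \in A).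
  have [s1|s1] := boolP (deg A e.1 == K); first by rewrite orbT.
  have [s2|s2] := boolP (deg A e.2 == K); first by rewrite !orbT.
  move: AG; rewrite inE => /andP[AU /forallP dA].
  rewrite !orbF finset.subUset finset.sub1set eU AU /=; apply/forallP => i.
  rewrite deg_set1U//; case t : (touches e i); last by rewrite addn0.
  rewrite addn1 ltn_neqAle dA andbT.
  by move: t; rewrite /touches => /orP[/eqP <-|/eqP <-].
apply: leq_trans (subset_leq_card sub) _.
apply: leq_trans (leq_card_setU _ _) _; apply: leq_add; first exact: leq_card_setU.
by rewrite mul2n -addnn -{1}c1 -c2; exact: leq_card_setU.
Qed.

Lemma saturated_count A : (K * #|saturated A| <= 2 * #|A|)%N.
Proof.
apply: leq_trans (sum_deg A).
rewrite mulnC -sum_nat_const big_mkcond; apply: leq_sum => i _.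
by rewrite inE; case: eqP => // ->.
Qed.

Variable z : R.
Hypotheses (z0 : 0 < z) (z1 : z <= 1) (K0 : (0 < K)%N) (zK : z * (4 * p%:R / K%:R) <= 1).
Let w A : R := z ^+ #|A|.

Lemma bounded_degree_sub A e : A \in GG -> (A :\ e)%SET \in GG.
Proof.
move=> AG; have [eA|eA] := boolP (e \in A); first exact: bounded_degree_del.
by have -> : (A :\ e)%SET = A by apply/setP => f; rewrite !inE; case: eqP => //= ->; rewrite (negPf eA).
Qed.

Lemma sum_containing e (F : {set E} -> R) :
  \sum_(A in GG | e \in A) F A = \sum_(A in GG | e \in extensions A) F (e |: A)%SET.
Proof.
rewrite (reindex_onto (fun A => e |: A)%SET (fun A => A :\ e)%SET)/=; last first.
  by move=> A /andP[_ eA]; rewrite finset.setD1K.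
apply: eq_bigl => A.
have -> : (e \in extensions A) = (e \notin A) && (e |: A \in GG)%SET by rewrite inE.
rewrite setU11 andbT; have [eA|eA] := boolP (e \in A).
  have -> : ((e |: A) :\ e == A)%SET = false.
    by apply/negbTE/eqP => h; move: eA; rewrite -h !inE eqxx.
  by rewrite !andbF.
rewrite finset.setU1K// eqxx andbT /=.
have [h|] := boolP (_ \in _); last by rewrite andbF.
by rewrite andbT; have := bounded_degree_sub e h; rewrite finset.setU1K.
Qed.

Lemma weight_setU1 A e : e \notin A -> w (e |: A)%SET = z * w A.
Proof. by move=> eA; rewrite /w cardsU1 eA add1n exprS. Qed.

(** Graphs [A] are weighted by [z ^ #|A|]. Removing an edge matches the edges of
    graphs with the possible extensions of smaller graphs, so the mean number
    of edges is [z] times the mean number of extensions; the latter number is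
    almost [#|U|] unless [A] itself already has many edges. *)
Lemma mean_edges :
  z * #|U|%:R / 3 * \sum_(A in GG) w A <= \sum_(A in GG) w A * #|A|%:R.
Proof.
set W := \sum_(A in GG) w A; set Ed := \sum_(A in GG) _.
have w0 A : 0 < w A by rewrite exprn_gt0.
have E1 : Ed = z * \sum_(A in GG) w A * #|extensions A|%:R.
  transitivity (\sum_(A in GG) \sum_(e in A) w A).
    by apply: eq_bigr => A _; rewrite sumr_const mulr_natr.
  rewrite (exchange_big_dep predT)//=.
  transitivity (\sum_e \sum_(A in GG | e \in extensions A) z * w A).
    apply: eq_bigr => e _; rewrite sum_containing; apply: eq_bigr => A /andP[_].
    by rewrite inE => /andP[eA _]; rewrite weight_setU1.
  rewrite mulr_sumr (exchange_big_dep (fun A => A \in GG))/=; last by move=> ? ? _ /andP[].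
  apply: eq_bigr => A AG; rewrite (eq_bigl (fun e => e \in extensions A)); last by move=> e; rewrite AG.
  by rewrite sumr_const -[LHS]mulr_natr mulrA.
have ext A : A \in GG -> #|U|%:R - (1 + 4 * p%:R / K%:R) * #|A|%:R <= #|extensions A|%:R :> R.
  move=> AG; have := extensions_count AG; have := saturated_count A.
  rewrite -!(ler_nat R) !natrM !natrD !natrM.
  have KK : 0 < K%:R :> R by rewrite ltr0n.
  have -> : (1 + 4 * p%:R / K%:R) * #|A|%:R = #|A|%:R + 2 * (p%:R * (2 * #|A|%:R / K%:R)) :> R by ring.
  move=> h1 h2.
  have h3 : #|saturated A|%:R <= 2 * #|A|%:R / K%:R :> R by rewrite ler_pdivlMr// mulrC.
  have := ler_wpM2l (ler0n R p) h3.
  by move: h2; move: (p%:R * #|saturated A|%:R : R) (p%:R * (2 * #|A|%:R / K%:R) : R) => u v; lra.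
have lower : z * (#|U|%:R * W - (1 + 4 * p%:R / K%:R) * Ed) <= Ed.
  rewrite [leRHS]E1 ler_pM2l// /W /Ed !mulr_sumr -sumrB; apply: ler_sum => A AG.
  have := ler_wpM2l (ltW (w0 A)) (ext A AG); apply: le_trans.
  by rewrite le_eqVlt; apply/orP; left; apply/eqP; ring.
have Ed0 : 0 <= Ed by apply: sumr_ge0 => A _; rewrite mulr_ge0// ltW.
have h1 : z * Ed <= Ed by rewrite ler_piMl.
have h2 : z * (4 * p%:R / K%:R) * Ed <= Ed by rewrite ler_piMl.
move: lower.
have -> : z * (#|U|%:R * W - (1 + 4 * p%:R / K%:R) * Ed) =
  z * #|U|%:R * W - z * Ed - z * (4 * p%:R / K%:R) * Ed by ring.
have -> : z * #|U|%:R / 3 * W = z * #|U|%:R * W / 3 by ring.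
move: (z * Ed) (_ * Ed) (_ * W) h1 h2 => *; lra.
Qed.

(** Averaging the costs over the weighted graphs and pairing [A] with [A :\ e]
    for every edge: the hypothesis bounds the two costs from below at every
    edge of [A], and the mean number of edges is large. *)
Lemma hard_graph (a : {set E} -> E -> R) (b : R) :
  (forall A e, 0 <= a A e) -> 0 <= b ->
  (forall A e, A \in GG -> e \in A -> z * b <= a (A :\ e)%SET e + z * a A e) ->
  exists2 A, A \in GG & b * (z * #|U|%:R / 3) <= \sum_(e in U) a A e.
Proof.
move=> a0 b0 H.
have w0 A : 0 < w A by rewrite exprn_gt0.
have G0 : (finset.set0 : {set E}) \in GG.
  rewrite inE finset.sub0set; apply/forallP => i; rewrite /deg.
  by rewrite (_ : [set e in (finset.set0 : {set E}) | touches e i]%SET = finset.set0) ?cards0//; apply/setP => e; rewrite !inE.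
case: (pselect (exists2 A, A \in GG & b * (z * #|U|%:R / 3) <= \sum_(e in U) a A e)) => // none.
exfalso; set t := b * _ in none.
have lt A : A \in GG -> \sum_(e in U) a A e < t.
  by move=> AG; rewrite ltNge; apply/negP => h; apply: none; exists A.
have up : \sum_(A in GG) w A * \sum_(e in U) a A e < \sum_(A in GG) w A * t.
  rewrite (bigD1 (finset.set0 : {set E}))//= [ltRHS](bigD1 (finset.set0 : {set E}))//=; apply: ltr_leD.
    by rewrite ltr_pM2l// lt.
  by apply: ler_sum => A /andP[AG _]; rewrite ler_pM2l// ltW// lt.
have low : b * \sum_(A in GG) w A * #|A|%:R <= \sum_(A in GG) w A * \sum_(e in U) a A e.
  have -> : \sum_(A in GG) w A * #|A|%:R = \sum_(e in U) \sum_(A in GG | e \in A) w A.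
    rewrite (exchange_big_dep (fun A => A \in GG))/=; last by move=> ? ? _ /andP[].
    apply: eq_bigr => A AG; rewrite mulr_natr -sumr_const; apply: eq_bigl => e.
    rewrite AG/=; have [eA|] := boolP (e \in A); last by rewrite andbF.
    by move: AG; rewrite inE => /andP[/fintype.subsetP /(_ _ eA) ->].
  under [leRHS]eq_bigr do rewrite mulr_sumr.
  rewrite exchange_big mulr_sumr; apply: ler_sum => e eU.
  rewrite [leRHS](bigID (fun A : {set E} => e \in A))/=.
  apply: le_trans (_ : \sum_(A in GG | e \in A) (w A * a A e + w (A :\ e)%SET * a (A :\ e)%SET e) <= _).
    rewrite mulr_sumr; apply: ler_sum => A /andP[AG eA].
    have E1 : w A = z * w (A :\ e)%SET
      by have := @weight_setU1 (A :\ e)%SET e; rewrite finset.setD1K//; apply; rewrite !inE eqxx.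
    have := ler_wpM2l (ltW (w0 (A :\ e)%SET)) (H A e AG eA); rewrite E1.
    rewrite mulrDr => h.
    have -> : b * (z * w (A :\ e)%SET) = w (A :\ e)%SET * (z * b) by ring.
    apply: le_trans h _; rewrite le_eqVlt; apply/orP; left; apply/eqP; ring.
  rewrite big_split/=; apply: lerD => //.
  rewrite (sum_containing e (fun A => w (A :\ e)%SET * a (A :\ e)%SET e)).
  rewrite [leRHS](bigID (fun A : {set E} => e \in extensions A))/=.
  rewrite -[leLHS]addr0; apply: lerD; last first.
    by apply: sumr_ge0 => A _; rewrite mulr_ge0// ltW.
  rewrite le_eqVlt; apply/orP; left; apply/eqP; apply: eq_big => A.
    have -> : (e \in extensions A) = (e \notin A) && (e |: A \in GG)%SET by rewrite inE.
    by case: (e \in A); rewrite /= ?andbF ?andbT.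
  by move=> /andP[_]; rewrite inE => /andP[eA _]; rewrite finset.setU1K.
have := le_trans (ler_wpM2l b0 mean_edges) low.
move=> /le_lt_trans /(_ up); rewrite -mulr_suml /t.
move: (\sum_(A in GG) w A) (z * _ / 3) => W x.
by rewrite (_ : b * (x * W) = W * (b * x)) ?ltxx//; ring.
Qed.

End edge_counting.

(** * The maximal risk over graph models *)

Section lower_bound.
Variable R : realType.

(** Clipping brings an estimate closer to both candidate values 0 and [d], and
    makes the loss bounded whatever the estimator is. *)
Definition clip (d y : R) : R := Num.max 0 (Num.min y d).

Lemma clip_bounds d y : 0 <= d -> 0 <= clip d y <= d.
Proof. by move=> d0; rewrite /clip le_max lexx/= ge_max d0 ge_min lexx orbT. Qed.

Lemma clip_sqr d y t : 0 <= d -> t = 0 \/ t = d -> (clip d y - t) ^+ 2 <= (y - t) ^+ 2.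
Proof.
move=> d0 t0d; rewrite -[leLHS]real_normK ?num_real// -[leRHS]real_normK ?num_real//.
rewrite lerXn2r ?nnegrE// /clip minElt maxElt.
case: t0d => ->; rewrite ?subr0.
  by case: (ltP y d) => yd; case: ltP => h; rewrite ?normr0 ?normr_ge0// !ger0_norm//; lra.
case: (ltP y d) => yd; case: ltP => h //.
- by rewrite sub0r normrN ltr0_norm ?subr_lt0// ger0_norm//; lra.
- by rewrite subrr normr0.
- have -> : d = 0 by apply/eqP; rewrite eq_le h.
  by rewrite subr0 normr0.
Qed.

Lemma bmf_clip dd (T : measurableType dd) (d : R) (f : T -> R) : 0 <= d ->
  measurable_fun setT f -> bounded_measurable (fun x => clip d (f x)).
Proof.
move=> d0 mf; split.
  by apply: measurable_maxr => //; apply: measurable_minr.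
by exists d => x; have /andP[h1 h2] := clip_bounds (f x) d0; rewrite ger0_norm.
Qed.

Section graph_class.
Variables (p : nat) (d : R) (K : nat) (q c : R).
Hypotheses (d0 : 0 < d) (Kd : K%:R * d <= 2^-1) (c0 : 0 < c) (dK : d `^ q * K%:R <= c).
Variable A : {set 'I_p * 'I_p}.
Hypothesis Aa : A \in bounded_degree p K.
Local Notation S := (load d A *m (load d A)^T).

Lemma corrmx_graph i j :
  corrmx S i j = if i == j then 1 else d * (((i, j) \in A) || ((j, i) \in A))%:R.
Proof.
by rewrite mxE !(load_cov d0 Kd)// !eqxx sqrtr1 mulr1 divr1.
Qed.

(** A row has at most [K] nonzero entries off the diagonal, all equal to
    [d]. *)
Lemma graph_sparse : sparse_class q c (corrmx S).
Proof.
split.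
- by apply/matrixP => i j; rewrite mxE !corrmx_graph eq_sym orbC.
- by move=> j; rewrite corrmx_graph eqxx.
move=> i; have E j : row i (col' i (corrmx S)) 0 j =
    d * (((i, lift i j) \in A) || ((lift i j, i) \in A))%:R.
  by rewrite [LHS]mxE [LHS]mxE corrmx_graph (negPf (neq_lift i j)).
apply: (@weak_ball_two_valued _ _ _ _ _ d K) => //.
  by move=> j; rewrite E; case: (_ || _); rewrite ?mulr0 ?mulr1; [right|left].
pose e j : 'I_p * 'I_p := if (i, lift i j) \in A then (i, lift i j) else (lift i j, i).
have ei : injective e.
  move=> j j'; rewrite /e; case: ifP => _; case: ifP => _ h.
  - exact: lift_inj (congr1 snd h).
  - by have /= h2 := congr1 fst h; have := neq_lift i j'; rewrite -h2 eqxx.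
  - by have /= h2 := congr1 fst h; have := neq_lift i j; rewrite h2 eqxx.
  - exact: lift_inj (congr1 fst h).
rewrite -(card_imset _ ei).
have : (deg A i <= K)%N by move: Aa; rewrite inE => /andP[_ /forallP].
apply: leq_trans; apply: subset_leq_card; apply/fintype.subsetP => x /imsetP[j].
rewrite inE E => h ->; rewrite inE /e /touches.
case: ifP => [->|h2]/=; rewrite ?eqxx ?orbT// andbT.
by move: h; rewrite h2 /=; case: (_ \in A) => //=; rewrite mulr0 eqxx.
Qed.

Lemma max_risk_clip n (f : estimator R n p) : measurable_estimator f ->
  ((p%:R^-1 * \sum_(e in edges p) \int[power_prob (gauss_image (load d A)) n]_x
      (clip d (f x e.1 e.2) - d * (e \in A)%:R) ^+ 2)%:E <= max_risk q c f)%E.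
Proof.
move=> mf; set Q := power_prob _ n.
apply: le_trans (_ : risk Q (corrmx S) f <= _)%E; last first.
  apply: ereal_sup_ubound; exists 0, S, Q; split; last by [].
  - exact: gaussian_sample_image.
  - by move=> i; rewrite (load_cov d0 Kd)// eqxx.
  - exact: graph_sparse.
have bc e : bounded_measurable (fun x : sample R n p => (clip d (f x e.1 e.2) - d * (e \in A)%:R) ^+ 2).
  by apply: bmfX; apply: bmfB (bmf_cst _ _); apply: bmf_clip (ltW d0) (mf _ _).
rewrite /risk EFinM; apply: lee_wpmul2l; first by rewrite lee_fin invr_ge0.
rewrite -Rint_sum; last by move=> e _; exact: bc.
have -> (g : sample R n p -> R) : ('E_Q[g] = \int[Q]_x (g x)%:E)%E by rewrite unlock.
rewrite -EFin_Rint; last by apply: bmf_sum => e _; exact: bc.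
apply: ge0_le_integral => //.
- by move=> x _; rewrite lee_fin; apply: sumr_ge0 => e _; exact: sqr_ge0.
- by apply/measurable_EFinP; apply: (proj1 (@bmf_sum _ _ _ _ _ _ _ (fun e _ => bc e))).
- apply/measurable_EFinP; apply: measurable_sum => i; apply: measurable_sum => j.
  under eq_fun do rewrite !mxE.
  by apply: measurable_funX; apply: measurable_funB; [exact: mf|exact: measurable_cst].
move=> x _; rewrite lee_fin /frobenius2 pair_bigA/=.
rewrite [leRHS](bigID (fun e : 'I_p * 'I_p => e \in edges p))/=.
rewrite -[leLHS]addr0; apply: lerD; last by apply: sumr_ge0 => e _; exact: sqr_ge0.
apply: ler_sum => e eU; rewrite [in leRHS]mxE [X in f x _ _ + X]mxE corrmx_graph.
have lt12 : (e.1 < e.2)%N by move: eU; rewrite inE.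
have -> : (e.1 == e.2) = false by apply/negP => /eqP h; move: lt12; rewrite h ltnn.
have -> : (e.2, e.1) \in A = false.
  apply/negP => h; have : (e.2, e.1) \in edges p.
    by move: Aa; rewrite inE => /andP[/fintype.subsetP /(_ _ h)].
  by rewrite inE/= ltnNge ltnW.
rewrite orbF -surjective_pairing; apply: clip_sqr (ltW d0) _.
by case: (e \in A); rewrite ?mulr0 ?mulr1; [right|left].
Qed.

End graph_class.

Lemma card_edges p : (2 * #|edges p| + p = p ^ 2)%N.
Proof.
pose sw (e : 'I_p * 'I_p) := (e.2, e.1).
have swi : injective sw by move=> [a b] [a' b'] [-> ->].
pose D := [set e : 'I_p * 'I_p | e.1 == e.2]%SET.
have cD : #|D| = p.
  rewrite -[RHS]card_ord -(card_imset _ (f := fun i : 'I_p => (i, i))); last by move=> ? ? [].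
  apply: eq_card => -[a b]; rewrite inE/=; apply/eqP/imsetP => [->|[i _ [-> ->]]//]; by exists b.
have cS : #|sw @: edges p|%SET = #|edges p| by rewrite card_imset.
have -> : (p ^ 2 = #|{: 'I_p * 'I_p}|)%N by rewrite card_prod !card_ord.
rewrite -cardsT.
have -> : [set: 'I_p * 'I_p]%SET = (edges p :|: (sw @: edges p :|: D))%SET.
  apply/setP => -[a b]; rewrite !inE/=.
  have -> : ((a, b) \in sw @: edges p)%SET = (b < a)%N.
    by apply/imsetP/idP => [[[x y]]|h]; [rewrite inE/= => h [-> ->]|exists (b, a); rewrite ?inE].
  by rewrite -val_eqE/=; case: ltngtP.
rewrite cardsU cardsU cS cD.
have -> : (sw @: edges p :&: D)%SET = finset.set0.
  apply/setP => -[a b]; rewrite !inE/=; apply/negP => /andP[/imsetP[[x y]]].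
  by rewrite inE/= => h [-> ->] /eqP h2; move: h; rewrite h2 ltnn.
have -> : (edges p :&: (sw @: edges p :|: D))%SET = finset.set0.
  apply/setP => -[a b]; rewrite !inE/=; apply/negP => /andP[h /orP[/imsetP[[x y]]|/eqP h2]].
    by rewrite inE/= => h' [ea eb]; move: h h'; rewrite ea eb => h h'; have := ltn_trans h h'; rewrite ltnn.
  by move: h; rewrite h2 ltnn.
by rewrite !cards0 !subn0 mul2n -addnn addnA.
Qed.

Lemma edges_ge p : (2 <= p)%N -> p%:R ^+ 2 / 4 <= #|edges p|%:R :> R.
Proof.
move=> p2; have h : (p ^ 2 <= 4 * #|edges p|)%N.
  have := card_edges p; have : (2 * p <= p ^ 2)%N by rewrite -mulnn leq_mul.
  rewrite -mulnn; move: #|edges p| (p * p)%N => u v h E.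
  rewrite -(leq_add2r (2 * p)) (_ : (4 * u + 2 * p = v + v)%N) ?leq_add2l//.
  by rewrite -E; ring.
by rewrite ler_pdivrMr// -natrX -natrM ler_nat mulnC.
Qed.

Lemma max_risk_lower (p n K : nat) (d q c z : R) (f : estimator R n p) :
  (0 < n)%N -> (2 <= p)%N -> (0 < K)%N -> 0 < d -> K%:R * d <= 2^-1 -> 8 * d ^+ 2 <= 1 ->
  0 < c -> d `^ q * K%:R <= c ->
  0 < z -> z <= 1 -> z * (4 * p%:R / K%:R) <= 1 ->
  z * (1 - 4 * d ^+ 2)^-1 ^+ n <= 4^-1 ->
  measurable_estimator f ->
  ((d ^+ 2 * (z * p%:R) / 48)%:E <= max_risk q c f)%E.
Proof.
move=> n0 p2 K0 d0 Kd d8 c0 dK z0 z1 zK zD mf.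
pose a (A : {set 'I_p * 'I_p}) e := \int[power_prob (gauss_image (load d A)) n]_x
   (clip d (f x e.1 e.2) - d * (e \in A)%:R) ^+ 2.
have a0 A e : 0 <= a A e by apply: Rint_ge0 => x; exact: sqr_ge0.
have b0 : 0 <= d ^+ 2 / 4 by rewrite divr_ge0// sqr_ge0.
have H A e : A \in bounded_degree p K -> e \in A ->
    z * (d ^+ 2 / 4) <= a (A :\ e)%SET e + z * a A e.
  move=> AG eA; rewrite /a !inE eqxx eA/= mulr0 mulr1 mulrA.
  under eq_Rintegral do rewrite subr0.
  apply: (two_point_risk d0 Kd d8 AG eA n0 z0 zD (x := fun y => clip d (f y e.1 e.2))).
  exact: bmf_clip (ltW d0) (mf _ _).
have [A AG lo] := hard_graph z0 z1 K0 zK a0 b0 H.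
apply: le_trans (max_risk_clip d0 Kd c0 dK AG mf).
rewrite lee_fin ler_pdivlMl ?ltr0n ?(ltnW p2)//; apply: le_trans lo.
have E := edges_ge p2.
have -> : p%:R * (d ^+ 2 * (z * p%:R) / 48) = (d ^+ 2 / 4 * (z / 3)) * (p%:R ^+ 2 / 4) by field.
have -> : d ^+ 2 / 4 * (z * #|edges p|%:R / 3) = (d ^+ 2 / 4 * (z / 3)) * #|edges p|%:R by ring.
by apply: ler_wpM2l E; rewrite mulr_ge0// divr_ge0// ltW.
Qed.

End lower_bound.

(** * The minimax rate *)

Section minimax.
Variable R : realType.

Lemma inv_one_sub (u : R) : 0 <= u <= 2^-1 -> (1 - u)^-1 <= 1 + 2 * u.
Proof.
move=> /andP[u0 u2]; rewrite -[leLHS]mul1r ler_pdivrMr; last by lra.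
have : 0 <= u * (1 - 2 * u) by rewrite mulr_ge0//; lra.
have -> : (1 + 2 * u) * (1 - u) = 1 + u * (1 - 2 * u) by ring.
by rewrite lerDl.
Qed.

Lemma lik_ratio_power (d : R) (n p : nat) : (0 < p)%N -> 16 * (n%:R * d ^+ 2) <= ln p%:R ->
  4 * d ^+ 2 <= 2^-1 -> (1 - 4 * d ^+ 2)^-1 ^+ n <= Num.sqrt p%:R.
Proof.
move=> p0 h16 d4; set u := 4 * d ^+ 2 in d4 *.
have u0 : 0 <= u by rewrite mulr_ge0// sqr_ge0.
have le_exp : (1 - u)^-1 <= expR (2 * u).
  by apply: le_trans (expR_ge1Dx _); apply: inv_one_sub; rewrite u0.
have i0 : 0 <= (1 - u)^-1 by rewrite invr_ge0; lra.
apply: le_trans (_ : expR (2 * u) ^+ n <= _).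
  by rewrite lerXn2r ?nnegrE ?expR_ge0.
have pp : 0 < p%:R :> R by rewrite ltr0n.
rewrite -expRM_natl -powR12_sqrt ?(ltW pp)// /powR gt_eqF// ler_expR /u.
by rewrite (_ : n%:R * (2 * (4 * d ^+ 2)) = 8 * (n%:R * d ^+ 2)); [lra|ring].
Qed.

(** The degree bound [K] is as large as the sparsity [c = v d ^ q] allows. The
    weight [z] of an edge is proportional to [K / p], which gives typical
    degrees of order [K]; it is of order at most [1 / sqrt p], whereas the
    second moment of the likelihood ratio is at most [sqrt p]. *)
Lemma max_risk_rate (p n : nat) (d q c v c0 M' : R) (f : estimator R n p) :
  (0 < n)%N -> (2 <= p)%N -> (n <= p)%N -> 0 < d -> 0 < c -> v = c * d `^ (- q) -> 1 <= v ->
  v * d <= 4^-1 -> v <= M' * Num.sqrt n%:R -> 16 * (n%:R * d ^+ 2) <= ln p%:R ->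
  0 < c0 -> 4 * c0 <= 1 -> 4 * c0 * M' <= 1 -> measurable_estimator f ->
  ((d ^+ 2 * (c0 * v) / 96)%:E <= max_risk q c f)%E.
Proof.
move=> n0 p2 np d0 c_gt0 vE v1 vd vM h16 c00 c04 c0M mf.
pose K := Num.truncn v.
have K0 : (0 < K)%N by rewrite truncn_gt0.
have k0 : 0 < K%:R :> R by rewrite ltr0n.
have Kv : K%:R <= v by rewrite -truncn_ge_nat// (le_trans ler01).
have vK : v <= 2 * K%:R.
  have : v < K.+1%:R by rewrite -truncn_lt_nat ?(le_trans ler01).
  have : 1 <= K%:R :> R by rewrite ler1n.
  by rewrite -natr1; lra.
have p0 : 0 < p%:R :> R by rewrite ltr0n (ltnW p2).
have d4 : d <= 4^-1 by apply: le_trans vd; rewrite ler_peMl// ltW.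
have d16 : d ^+ 2 <= 16^-1.
  have -> : 16^-1 = 4^-1 ^+ 2 :> R by rewrite exprVn -natrX.
  by rewrite lerXn2r ?nnegrE// ltW.
have s_np : Num.sqrt n%:R <= Num.sqrt p%:R :> R by rewrite ler_sqrt ?ler_nat// ltW.
have sp2 : Num.sqrt p%:R ^+ 2 = p%:R :> R by rewrite sqr_sqrtr// ltW.
have sp0 : 0 < Num.sqrt p%:R :> R by rewrite sqrtr_gt0.
have sp1 : Num.sqrt p%:R <= p%:R :> R.
  rewrite -[leRHS]sp2 expr2 ler_peMl ?(ltW sp0)//.
  by rewrite -[leLHS]sqrtr1 ler_sqrt ?ler1n ?(ltnW p2)// ltW.
have cK : c0 * K%:R <= 4^-1 * Num.sqrt p%:R.
  apply: le_trans (_ : c0 * v <= _); first by rewrite ler_pM2l.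
  apply: le_trans (_ : c0 * (M' * Num.sqrt n%:R) <= _); first by rewrite ler_pM2l.
  rewrite mulrA; apply: le_trans (_ : 4^-1 * Num.sqrt n%:R <= _); last by rewrite ler_pM2l.
  by apply: ler_wpM2r; rewrite ?sqrtr_ge0//; move: c0M; rewrite -mulrA; lra.
pose z := c0 * K%:R / p%:R.
have z0 : 0 < z by rewrite divr_gt0// mulr_gt0.
have zp : z * p%:R = c0 * K%:R by rewrite divfK// gt_eqF.
have z1 : z <= 1.
  by rewrite ler_pdivrMr// mul1r; apply: le_trans cK _; lra.
have zK : z * (4 * p%:R / K%:R) <= 1.
  have swap (t u w : R) : t * (4 * u / w) = 4 * (t * u) / w by ring.
  by rewrite swap zp mulrA mulfK ?gt_eqF.
have zD : z * (1 - 4 * d ^+ 2)^-1 ^+ n <= 4^-1.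
  apply: le_trans (_ : z * Num.sqrt p%:R <= _).
    rewrite ler_pM2l//; apply: lik_ratio_power => //; first exact: ltnW.
    by move: d16; lra.
  rewrite /z -{1}sp2 expr2 invfM mulrA -[X in X <= _]mulrA mulVf ?gt_eqF// mulr1.
  by rewrite ler_pdivrMr.
have dK : d `^ q * K%:R <= c.
  apply: le_trans (_ : d `^ q * v <= _); first by rewrite ler_pM2l ?powR_gt0.
  by rewrite vE powRN mulrCA mulfV ?mulr1// gt_eqF// powR_gt0.
have Kd : K%:R * d <= 2^-1.
  by apply: le_trans (_ : v * d <= _); [rewrite ler_pM2r|move: vd; lra].
have d8 : 8 * d ^+ 2 <= 1 by move: d16; lra.
apply: le_trans (max_risk_lower n0 p2 K0 d0 Kd d8 c_gt0 dK z0 z1 zK zD mf).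
rewrite lee_fin zp (_ : _ / 48 = d ^+ 2 * (c0 * (2 * K%:R)) / 96); last by field.
by rewrite ler_pM2r ?invr_gt0// !ler_pM2l ?exprn_gt0.
Qed.

Lemma small_scale (q M m : R) : 0 <= q < 1 -> 0 < M -> 0 < m -> exists eps : R,
  [/\ 0 < eps, eps <= 4^-1, eps `^ (1 - q) <= (8 * M)^-1 & q != 0 -> eps `^ q <= m].
Proof.
move=> /andP[q0 q1] M0 m0.
have M8 : 0 < (8 * M)^-1 by rewrite invr_gt0 mulr_gt0.
have q1' : 0 < 1 - q by rewrite subr_gt0.
have root (x a b : R) : 0 < a -> 0 < b -> 0 <= x -> x <= b `^ a^-1 -> x `^ a <= b.
  move=> a0 b0 x0 xb; apply: le_trans (_ : (b `^ a^-1) `^ a <= _).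
    by apply: ge0_ler_powR => //; rewrite ?nnegrE ?powR_ge0// ltW.
  by rewrite -powRrM mulVf ?gt_eqF// powRr1// ltW.
exists (Num.min 4^-1 (Num.min ((8 * M)^-1 `^ (1 - q)^-1) (m `^ q^-1))).
set e := Num.min _ _; have e0 : 0 < e by rewrite /e !lt_min !powR_gt0// invr_gt0 ltr0n.
split => //; first by rewrite ge_min lexx.
  by apply: root; rewrite ?(ltW e0)// !ge_min lexx orbT.
move=> qn; have {}q0 : 0 < q by rewrite lt_neqAle eq_sym qn.
by apply: root; rewrite ?(ltW e0)// !ge_min lexx !orbT.
Qed.

(** The correlation [d] is a small multiple of [sqrt (ln p / n)]. The three
    requirements on the multiple are: the graphs are permitted
    ([v >= 1], from the lower bound on the sparsity), their covariances exist
    ([v d <= 1 / 4], from the upper bound), and an edge is hard to detect. *)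
Lemma minimax_lower (q M m eta_l eta_u : R) p c : 0 <= q < 1 ->
  permissible_with q M m eta_l eta_u p c ->
  exists2 k : R, 0 < k & forall n, (2 <= n)%N ->
    ((k * c n * (ln (p n)%:R / n%:R) `^ (1 - q / 2))%:E <= minimax_risk n (p n) q (c n))%E.
Proof.
move=> q01 perm; have [M0 m0 _ _ H] := perm; have /andP[q0 q1] := q01.
have [eps [e0 e4 eM em]] := small_scale q01 M0 m0.
pose M' := M * 2 `^ (3 / 2) * eps `^ (- q).
have M'0 : 0 < M' by rewrite !mulr_gt0 ?powR_gt0.
pose c0 : R := Num.min 4^-1 (4 * M')^-1.
have c00 : 0 < c0 by rewrite lt_min !invr_gt0 mulr_gt0// ltr0n.
have c04 : 4 * c0 <= 1.
  have : c0 <= 4^-1 by rewrite ge_min lexx.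
  by lra.
have c0M : 4 * c0 * M' <= 1.
  have : c0 <= (4 * M')^-1 by rewrite ge_min lexx orbT.
  rewrite -[X in _ <= X -> _]mul1r ler_pdivlMr; last exact: mulr_gt0.
  move=> h.
  by apply: le_trans h; rewrite le_eqVlt; apply/orP; left; apply/eqP; ring.
exists (c0 * eps ^+ 2 * eps `^ (- q) / 96).
  by rewrite divr_gt0// !mulr_gt0 ?exprn_gt0 ?powR_gt0.
move=> n n2; have [[cn0 cnat] cl cu _ _] := H n n2.
have np := permissible_dim perm n2; have lg2 := permissible_log perm n2.
have cM := permissible_sparsity perm n2.
set lg := ln _ in cl cu lg2 cM *.
have lg0 : 0 < lg by apply: lt_le_trans lg2.
have n0 : (0 < n)%N by exact: ltnW.
have x0 : 0 < n%:R :> R by rewrite ltr0n.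
set L := lg / n%:R in cM cl *; have L0 : 0 < L by rewrite divr_gt0.
pose d := eps * Num.sqrt L.
have d0 : 0 < d by rewrite mulr_gt0// sqrtr_gt0.
have d2 : d ^+ 2 = eps ^+ 2 * L by rewrite exprMn sqr_sqrtr// ltW.
have dq a : d `^ a = eps `^ a * L `^ (a / 2).
  by rewrite powRM ?sqrtr_ge0 ?(ltW e0)// -powR12_sqrt ?(ltW L0)// -powRrM (mulrC 2^-1).
pose v := c n * d `^ (- q).
have vE : v = c n * L `^ (- (q / 2)) * eps `^ (- q) by rewrite /v dq mulNr; ring.
have v1 : 1 <= v.
  have [qz|qn] := eqVneq q 0.
    rewrite /v qz oppr0 powRr0 mulr1; have [k E] := cnat qz.
    by rewrite E ler1n -(ltr0n R) -E.
  rewrite vE !powRN -mulrA -invfM ler_pdivlMr ?mulr_gt0 ?powR_gt0// mul1r.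
  by apply: le_trans cl; rewrite mulrC ler_wpM2r ?powR_ge0// em.
have vd : v * d <= 4^-1.
  have -> : v * d = c n * (L `^ ((1 - q) / 2) * eps `^ (1 - q)).
    have dd : d `^ (- q) * d = d `^ (1 - q).
      by rewrite [1 - q]addrC powRD ?(gt_eqF d0) ?implybT// powRr1 ?(ltW d0).
    by rewrite /v -mulrA dd dq [X in _ * X]mulrC.
  have h1 : c n * L `^ ((1 - q) / 2) <= M * lg^-1.
    apply: le_trans (ler_wpM2r (powR_ge0 _ _) cu) _.
    rewrite powRM ?invr_ge0 ?(ltW lg0) ?(ltW x0)//.
    have -> : n%:R^-1 `^ ((1 - q) / 2) = (n%:R `^ ((1 - q) / 2))^-1 :> R.
      by rewrite -powR_inv1 ?(ltW x0)// -powRrM mulN1r powRN.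
    have E2 : lg `^ (- ((3 - q) / 2)) * lg `^ ((1 - q) / 2) = lg^-1.
      by rewrite -powRD ?(gt_eqF lg0) ?implybT// -[RHS]powR_inv1 ?(ltW lg0)//; congr (_ `^ _); field.
    have nq : n%:R `^ ((1 - q) / 2) != 0 :> R by rewrite gt_eqF// powR_gt0.
    rewrite -E2 le_eqVlt; apply/orP; left; apply/eqP.
    by rewrite -!mulrA; congr (_ * _); rewrite mulrCA; congr (_ * _); rewrite mulrCA mulfV// mulr1.
  rewrite mulrA; apply: le_trans (ler_pM _ (powR_ge0 _ _) h1 eM) _.
    by rewrite mulr_ge0 ?powR_ge0// ltW.
  have cancel (t y : R) : t != 0 -> y != 0 -> t / y * (8 * t)^-1 = y^-1 / 8.
    by move=> t0 y0; field; rewrite t0 y0.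
  rewrite cancel ?gt_eqF//.
  have : lg^-1 <= 2 by rewrite -[leRHS]invrK lef_pV2 ?posrE ?invr_gt0.
  by lra.
have vM : v <= M' * Num.sqrt n%:R.
  rewrite vE -powR12_sqrt ?(ltW x0)//; apply: le_trans (ler_wpM2r (powR_ge0 _ _) cM) _.
  by rewrite le_eqVlt; apply/orP; left; apply/eqP; rewrite /M'; ring.
have h16 : 16 * (n%:R * d ^+ 2) <= lg.
  rewrite d2 (_ : 16 * _ = 16 * eps ^+ 2 * (L * n%:R)); last by ring.
  rewrite divfK ?gt_eqF// -[leRHS]mul1r ler_pM2r//.
  have : eps ^+ 2 <= 4^-1 ^+ 2 by rewrite lerXn2r ?nnegrE// ltW.
  by rewrite exprVn -natrX; lra.
have p2 : (2 <= p n)%N by exact: leq_trans n2 (ltnW np).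
apply: le_ereal_inf_tmp => _ [f mf <-].
apply: le_trans (max_risk_rate n0 p2 (ltnW np) d0 cn0 erefl v1 vd vM h16 c00 c04 c0M mf).
rewrite lee_fin -/v vE d2 powRD ?(gt_eqF L0) ?implybT//.
rewrite powRr1 ?(ltW L0)// le_eqVlt; apply/orP; left; apply/eqP.
by clear; ring.
Qed.

End minimax.

Theorem theorem4p1 (R : realType) (q : R) (hq : 0 <= q < 1)
    (alpha : R) (halpha : 0 < alpha)
    (hne : alpha <> 2 * Num.sqrt 2 / 3) :
  [/\ (forall (p : nat -> nat) (c : nat -> R), permissible q p c ->
         attains_minimax_rate q c
           (fun n => @threshold_estimator R alpha n (p n)))
      <-> 2 * Num.sqrt 2 / 3 < alpha,
      2 * Num.sqrt 2 / 3 < alpha ->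
      forall M m eta_l eta_u : R,
      exists2 C : R, 0 < C &
        forall (p : nat -> nat) (c : nat -> R),
        permissible_with q M m eta_l eta_u p c ->
        forall n : nat, (2 <= n)%N ->
        (max_risk q (c n) (@threshold_estimator R alpha n (p n))
           <= (C * c n * (ln (p n)%:R / n%:R) `^ (1 - q / 2))%:E)%E
    & alpha < 2 / 3 ->
      ~ exists (p : nat -> nat) (c : nat -> R),
          permissible q p c /\
          attains_minimax_rate q c
            (fun n => @threshold_estimator R alpha n (p n))].
Proof.
split; last 2 first.
- exact: threshold_upper.
- exact: suboptimal_lt23.
split=> [opt|large p c [M [m [eta_l [eta_u perm]]]]].
  have /orP[//|small] : (2 * Num.sqrt 2 / 3 < alpha) || (alpha < 2 * Num.sqrt 2 / 3).
    by rewrite orbC -neq_lt; exact/eqP.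
  case: (suboptimal_subcritical hq halpha small); apply: opt.
  by exists (6 `^ (3 / 2)), 1, (3 / 2), 3; exact: square_permissible.
have [C C0 upper] := threshold_upper hq large M m eta_l eta_u.
have [k k0 lower] := minimax_lower hq perm.
exists (C / k); first exact: divr_gt0.
move=> n n2; apply: le_trans (upper p c perm n n2) _.
apply: le_trans (lee_wpmul2l _ (lower n n2)); last by rewrite lee_fin divr_ge0 ?ltW.
by rewrite -EFinM !mulrA divfK// gt_eqF.
Qed.
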